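(* There is an absolute constant $c>0$ such that the following holds. Let $\alpha\in(0,1)$ and $a\in\mathbb{R}$ with $|a\alpha|<c$. Then there exist a function $W(\cdot;a)\in C^\alpha(\mathbb{R})$ and a number $\lambda(a)\in\mathbb{R}$ such that \[ w(x,t)=\frac{1}{1-t}\,W\!\left(\frac{x}{(1-t)^{1+\lambda(a)}};a\right) \] is a (self-similar) solution, for $t<1$, of the generalized De Gregorio equation \[ w_t+a\,u\,w_x=u_x\,w,\qquad u_x=Hw . \] Moreover, $W(\cdot;a)$ and $\lambda(a)$ depend analytically on $a$.
   Context: $H$ denotes the Hilbert transform on $\mathbb{R}$, $Hf(x)=\frac{1}{\pi}\,\mathrm{p.v.}\int_{-\infty}^{\infty}\frac{f(y)}{x-y}\,dy$. The velocity $u$ is determined from $w$ through $u_x=Hw$. $C^\alpha$ denotes the space of $\alpha$-Hölder continuous functions. *)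

(* Defs.v *)
From Stdlib Require Import Reals Lra.
From Coquelicot Require Import Coquelicot.
Open Scope R_scope.

Definition hilbert_pv (f : R -> R) (x v : R) : Prop :=
  (forall e Rr, 0 < e -> e < Rr ->
     ex_RInt (fun y => f y / (x - y)) (x - Rr) (x - e) /\
     ex_RInt (fun y => f y / (x - y)) (x + e) (x + Rr)) /\
  (forall d, 0 < d -> exists e0 R0, 0 < e0 /\
     forall e Rr, 0 < e -> e < e0 -> R0 < Rr -> e < Rr ->
       Rabs (/ PI * (RInt (fun y => f y / (x - y)) (x - Rr) (x - e)
                   + RInt (fun y => f y / (x - y)) (x + e) (x + Rr)) - v) < d).

Definition Calpha (alpha : R) (f : R -> R) : Prop :=
  (exists M, forall x, Rabs (f x) <= M) /\
  (exists C, forall x y, x <> y ->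
     Rabs (f x - f y) <= C * Rpower (Rabs (x - y)) alpha).

Definition real_analytic_on (P : R -> Prop) (g : R -> R) : Prop :=
  forall a0, P a0 -> exists r, 0 < r /\ exists cn : nat -> R,
    forall a, Rabs (a - a0) < r -> is_series (fun n => cn n * (a - a0) ^ n) (g a).

Definition calpha_analytic_on (alpha : R) (P : R -> Prop) (W : R -> R -> R) : Prop :=
  forall a0, P a0 -> exists r, 0 < r /\ exists Wn : nat -> R -> R,
    (forall n, Calpha alpha (Wn n)) /\
    forall a, Rabs (a - a0) < r -> forall eps, 0 < eps -> exists N0 : nat,
      forall N : nat, (N0 <= N)%nat ->
        let Rm := fun x => W a x - sum_n (fun n => Wn n x * (a - a0) ^ n) N in
        (forall x, Rabs (Rm x) <= eps) /\
        (forall x y, x <> y -> Rabs (Rm x - Rm y) <= eps * Rpower (Rabs (x - y)) alpha).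

Definition ss_w (W : R -> R) (lam : R) (t x : R) : R :=
  / (1 - t) * W (x / Rpower (1 - t) (1 + lam)).

(* w (continuous, argument order t x) is a solution on (-oo,1) x R of
     w_t + a u w_x = u_x w,   u_x = H w,   u(t,0) = 0,
   in the distributional sense (equivalently
     w_t + a (u w)_x = (1 + a) (H w) w), tested against C^1 functions
   compactly supported in (-oo,1) x R. *)
Definition dg_solution (a : R) (w : R -> R -> R) : Prop :=
  exists Hw : R -> R -> R,
    (forall t x, t < 1 -> hilbert_pv (w t) x (Hw t x)) /\
    (forall t x, t < 1 -> continuous (fun p : R * R => Hw (fst p) (snd p)) (t, x)) /\
    let u := fun t x => RInt (fun y => Hw t y) 0 x in
    forall (phi phit phix : R -> R -> R) (T0 T1 X : R),
      T1 < 1 ->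
      (forall t x, (t < T0 \/ T1 < t \/ X < Rabs x) -> phi t x = 0) ->
      (forall t x, is_derive (fun s => phi s x) t (phit t x)) ->
      (forall t x, is_derive (fun y => phi t y) x (phix t x)) ->
      (forall t x,
         continuous (fun p : R * R => phi (fst p) (snd p)) (t, x) /\
         continuous (fun p : R * R => phit (fst p) (snd p)) (t, x) /\
         continuous (fun p : R * R => phix (fst p) (snd p)) (t, x)) ->
      RInt (fun t => RInt (fun x =>
              w t x * phit t x
              + a * u t x * w t x * phix t x
              + (1 + a) * Hw t x * w t x * phi t x) (- X) X) T0 T1 = 0.

(* Main.v *)
(* Let F = H W - i W on the half line (W odd). The profile equation reads
   Im (F + D F - F ^ 2 / 2) + e v (Im D F) = 0 with D = (1 / be) x d/dx, v the average of Re F over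
   [0, x] and e = a be, where 1 + lam = 1 / be. For e = 0 it is solved by F = 2 y,
   y = 1 / (1 + p ^ be), p = - i x, which satisfies D y = - y + y ^ 2. All functions are superpositions
   of the exponentials exp (i k x), k > 0, and are measured by a weighted Wiener norm with weight
   k ^ s + k ^ (- s / 3), which is an algebra norm and controls the Hoelder norm of exponent s. For
   such superpositions the Hilbert transform is read off from the real part. The linearization
   f + D f - 2 y f = g is inverted by combining, with coefficients polynomial in y, the solutions of the
   constant-coefficient equations D b = - b + g, D c = c - g and D T = g(0) e^(ix) - g, with bounds
   that are uniform in alpha for s = alpha, be = 4 alpha / 3 (alpha small) or s = 1, be = 3 / 2. Hence
   F is a power series in e with uniform radius, lam being kept constant. *)
Require Import Defs.
From Stdlib Require Import Reals Lra Lia Arith List ClassicalEpsilon FunctionalExtensionality.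
From Coquelicot Require Import Coquelicot.
From mathcomp Require filter.
Open Scope R_scope.

(** * Weighted Wiener balls *)

(** All coefficients are real, so real parts extend evenly and imaginary parts oddly to the line;
    [Re F] is then the Hilbert transform of [W] by construction, and only the imaginary part of the
    profile equation has to be solved. The advection term is no product of holomorphic functions,
    yet it is the imaginary part of some superposition with positive frequencies. As it contains
    [D F], the linear inverse bounds [f] and [D f] together, and no derivative is lost.

    With P = p^be one has D P = P, and y (1 - y) solves the homogeneous linearized equation.
    Variation of constants divides the data by it, and 1 / (y (1 - y)) = P + 2 + 1 / P; the three
    terms give the equations of b, T and c.

    The obstacle is uniformity as alpha tends to 0: integrating dk / k against the weight costs 1 /
    s. The factor 1 / be in D repays this, since be / s stays bounded. The exponents are tuned to
    one another: with t = k^(-s/3) and be = 4 s / 3, the weight is t^(-3) + t and k^(-be) = t^4, so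
    that estimates become polynomial inequalities. *)

Definition ek (k x : R) : C := (cos (k * x), sin (k * x)).

Fixpoint ev (l : list (R * R)) (x : R) : C :=
  match l with
  | nil => RtoC 0
  | (c, k) :: t => (RtoC c * ek k x + ev t x)%C
  end.

Fixpoint cost (w : R -> R) (l : list (R * R)) : R :=
  match l with
  | nil => 0
  | (c, k) :: t => Rabs c * w k + cost w t
  end.

Definition posl (l : list (R * R)) : Prop := List.Forall (fun p => 0 < snd p) l.

(* The closed hull, for uniform convergence on bounded subsets of the half line, of the
   combinations of exponentials of weighted cost at most [M]. *)
Definition wball (w : R -> R) (M : R) (f : R -> C) : Prop :=
  forall X eta, 0 < eta -> exists l, posl l /\ cost w l <= M /\
    forall x, 0 <= x <= X -> Cmod (f x - ev l x) <= eta.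

(** The lower bound 1 makes the cost of a combination dominate its sup norm. *)
Definition weight (w : R -> R) : Prop := forall k, 0 < k -> 1 <= w k.

Lemma Cmod_le_sum (z : C) : Cmod z <= Rabs (fst z) + Rabs (snd z).
Proof.
  destruct z as [a b]; simpl.
  replace (a, b) with (RtoC a + (Ci * RtoC b))%C.
  - eapply Rle_trans; [apply Cmod_triangle|].
    rewrite Cmod_mult, !Cmod_R.
    replace (Cmod Ci) with 1; [lra|].
    unfold Cmod, Ci; simpl. replace (0 * (0 * 1) + 1 * (1 * 1)) with 1 by ring.
    symmetry; apply sqrt_1.
  - unfold RtoC, Ci, Cplus, Cmult; simpl; f_equal; ring.
Qed.

Lemma Rabs_fst_Cmod (z : C) : Rabs (fst z) <= Cmod z.
Proof. eapply Rle_trans; [apply Rmax_l | apply Rmax_Cmod]. Qed.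

Lemma Rabs_snd_Cmod (z : C) : Rabs (snd z) <= Cmod z.
Proof. eapply Rle_trans; [apply Rmax_r | apply Rmax_Cmod]. Qed.

Lemma Cmod_minus_sym (a b : C) : Cmod (a - b) = Cmod (b - a).
Proof. rewrite <- Cmod_opp. f_equal. ring. Qed.

Lemma Cmod_dist_triangle (a b c : C) : Cmod (a - c) <= Cmod (a - b) + Cmod (b - c).
Proof. replace (a - c)%C with ((a - b) + (b - c))%C by ring. apply Cmod_triangle. Qed.

Lemma Cmod_ek (k x : R) : Cmod (ek k x) = 1.
Proof.
  unfold Cmod, ek; simpl fst; simpl snd.
  rewrite Rplus_comm, <- !Rsqr_pow2, sin2_cos2. apply sqrt_1.
Qed.

Lemma ek_mult (k l x : R) : (ek k x * ek l x)%C = ek (k + l) x.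
Proof.
  unfold ek, Cmult; simpl. rewrite Rmult_plus_distr_r, cos_plus, sin_plus.
  f_equal; ring.
Qed.

Lemma ek_0 (k : R) : ek k 0 = RtoC 1.
Proof. unfold ek. rewrite Rmult_0_r, cos_0, sin_0. reflexivity. Qed.

Lemma sin_abs_le (x : R) : Rabs (sin x) <= Rabs x.
Proof.
  destruct (MVT_gen sin 0 x cos) as [c [_ Hc]].
  - intros t _. auto_derive; [trivial | ring].
  - intros t _. apply continuity_sin.
  - rewrite sin_0, !Rminus_0_r in Hc. rewrite Hc, Rabs_mult.
    pose proof (COS_bound c). pose proof (Rabs_pos x).
    assert (Rabs (cos c) <= 1) by (apply Rabs_le; lra). nra.
Qed.

(** A chord of the unit circle has length twice the sine of half the angle. *)
Lemma Cmod_ek_diff (k x y : R) : Cmod (ek k x - ek k y) <= Rabs (k * (x - y)).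
Proof.
  set (h := k * (x - y) / 2).
  assert (E : Cmod (ek k x - ek k y) = 2 * Rabs (sin h)).
  { change (Cmod (ek k x - ek k y))
      with (sqrt ((cos (k * x) - cos (k * y)) ^ 2 + (sin (k * x) - sin (k * y)) ^ 2)).
    replace (2 * Rabs (sin h)) with (Rabs (2 * sin h))
      by (rewrite Rabs_mult, (Rabs_pos_eq 2) by lra; reflexivity).
    rewrite <- sqrt_Rsqr_abs. f_equal. unfold Rsqr. rewrite form2, form4.
    replace ((k * x - k * y) / 2) with h by (unfold h; field).
    set (s := (k * x + k * y) / 2).
    pose proof (sin2_cos2 s) as H. unfold Rsqr in H.
    transitivity (4 * sin h ^ 2 * (sin s * sin s + cos s * cos s)); [ring | rewrite H; ring]. }
  rewrite E. replace (k * (x - y)) with (2 * h) by (unfold h; field).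
  rewrite Rabs_mult, (Rabs_pos_eq 2) by lra. pose proof (sin_abs_le h). lra.
Qed.

Lemma Cmod_ek_diff_2 (k x y : R) : Cmod (ek k x - ek k y) <= 2.
Proof.
  eapply Rle_trans; [apply Cmod_triangle |]. rewrite Cmod_opp, !Cmod_ek. lra.
Qed.

Lemma ev_app (l1 l2 : list (R * R)) (x : R) : ev (l1 ++ l2) x = (ev l1 x + ev l2 x)%C.
Proof.
  induction l1 as [|[c k] t IH]; simpl; [|rewrite IH]; ring.
Qed.

Lemma cost_app (w : R -> R) (l1 l2 : list (R * R)) : cost w (l1 ++ l2) = cost w l1 + cost w l2.
Proof. induction l1 as [|[c k] t IH]; simpl; [|rewrite IH]; ring. Qed.

Lemma posl_app (l1 l2 : list (R * R)) : posl l1 -> posl l2 -> posl (l1 ++ l2).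
Proof. intros H1 H2. apply Forall_app; split; assumption. Qed.

(** One map covers scaling ([r = 1], [k0 = 0]), modulation by [ek k0] ([r = 1]) and dilation
    ([a = 1], [k0 = 0]), so that a single cost estimate serves all three. *)
Definition lscal (a r k0 : R) (l : list (R * R)) : list (R * R) :=
  map (fun p => (a * fst p, r * snd p + k0)) l.

Lemma ev_lscal (a k0 : R) (l : list (R * R)) (x : R) :
  ev (lscal a 1 k0 l) x = (RtoC a * ek k0 x * ev l x)%C.
Proof.
  induction l as [|[c k] t IH]; simpl; [ring|].
  rewrite IH. rewrite Rmult_1_l, <- (ek_mult k k0), RtoC_mult. ring.
Qed.

Lemma ev_ldil (r : R) (l : list (R * R)) (x : R) : ev (lscal 1 r 0 l) x = ev l (r * x).
Proof.
  induction l as [|[c k] t IH]; simpl; [reflexivity|].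
  rewrite IH. unfold ek. rewrite Rmult_1_l. do 3 f_equal; f_equal; ring.
Qed.

Lemma posl_lscal (a r k0 : R) (l : list (R * R)) : 0 < r -> 0 <= k0 -> posl l -> posl (lscal a r k0 l).
Proof.
  intros Hr Hk H. induction H as [|[c k] t H1 H2 IH]; simpl; constructor; auto.
  simpl in *. nra.
Qed.

Lemma cost_lscal (w w' : R -> R) (a r k0 K : R) (l : list (R * R)) :
  posl l -> (forall k, 0 < k -> w' (r * k + k0) <= K * w k) ->
  cost w' (lscal a r k0 l) <= Rabs a * K * cost w l.
Proof.
  intros H Hw. induction H as [|[c k] t H1 H2 IH]; simpl; [lra|].
  simpl in H1. rewrite Rabs_mult. specialize (Hw k H1).
  pose proof (Rabs_pos a). pose proof (Rabs_pos c).
  assert (Rabs a * Rabs c * w' (r * k + k0) <= Rabs a * Rabs c * (K * w k)).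
  { apply Rmult_le_compat_l; [apply Rmult_le_pos|]; assumption. }
  lra.
Qed.

Fixpoint lprod (l1 l2 : list (R * R)) : list (R * R) :=
  match l1 with
  | nil => nil
  | (c, k) :: t => lscal c 1 k l2 ++ lprod t l2
  end.

Lemma ev_lprod (l1 l2 : list (R * R)) (x : R) : ev (lprod l1 l2) x = (ev l1 x * ev l2 x)%C.
Proof.
  induction l1 as [|[c k] t IH]; simpl; [ring|].
  rewrite ev_app, ev_lscal, IH. ring.
Qed.

Lemma posl_lprod (l1 l2 : list (R * R)) : posl l1 -> posl l2 -> posl (lprod l1 l2).
Proof.
  intros H1 H2. induction H1 as [|[c k] t H H' IH]; simpl; [constructor|].
  simpl in H. apply posl_app; auto. apply posl_lscal; auto; lra.
Qed.

Lemma cost_nonneg (w : R -> R) (l : list (R * R)) :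
  (forall k, 0 < k -> 0 <= w k) -> posl l -> 0 <= cost w l.
Proof.
  intros Hw H. induction H as [|[c k] t H1 H2 IH]; simpl; [lra|].
  simpl in H1. specialize (Hw k H1). pose proof (Rabs_pos c). nra.
Qed.

Lemma weight_nonneg (w : R -> R) : weight w -> forall k, 0 < k -> 0 <= w k.
Proof. intros H k Hk. specialize (H k Hk). lra. Qed.

(** Multiplication adds frequencies. Three different weights are allowed because the resolvent
    estimates measure the factors in weights other than that of the product. *)
Lemma cost_lprod (w1 w2 w3 : R -> R) (K : R) (l1 l2 : list (R * R)) :
  (forall k, 0 < k -> 0 <= w1 k) -> (forall k, 0 < k -> 0 <= w2 k) ->
  (forall k l, 0 < k -> 0 < l -> w3 (k + l) <= K * w1 k * w2 l) ->
  posl l1 -> posl l2 -> cost w3 (lprod l1 l2) <= K * cost w1 l1 * cost w2 l2.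
Proof.
  intros Hw1 Hw2 Hw H1 H2. induction H1 as [|[c k] t H H' IH]; simpl; [lra|].
  simpl in H. rewrite cost_app.
  assert (cost w3 (lscal c 1 k l2) <= Rabs c * (K * w1 k) * cost w2 l2).
  { apply cost_lscal; auto. intros l Hl. rewrite Rmult_1_l, Rplus_comm. auto. }
  lra.
Qed.

Lemma Cmod_ev (w : R -> R) (l : list (R * R)) (x : R) :
  weight w -> posl l -> Cmod (ev l x) <= cost w l.
Proof.
  intros Hw H. induction H as [|[c k] t H1 H2 IH]; simpl.
  - rewrite Cmod_0. lra.
  - eapply Rle_trans; [apply Cmod_triangle|].
    rewrite Cmod_mult, Cmod_R, Cmod_ek. simpl in H1. specialize (Hw k H1).
    pose proof (Rabs_pos c). nra.
Qed.

(** * Closure properties of the balls *)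

Section Ball.
Variable w : R -> R.
Hypothesis Hw : weight w.

Lemma wball_mono (M M' : R) (f : R -> C) : M <= M' -> wball w M f -> wball w M' f.
Proof.
  intros HM H X eta He. destruct (H X eta He) as [l [H1 [H2 H3]]].
  exists l; repeat split; auto. lra.
Qed.

Lemma wball_ext (M : R) (f g : R -> C) :
  (forall x, 0 <= x -> f x = g x) -> wball w M f -> wball w M g.
Proof.
  intros E H X eta He. destruct (H X eta He) as [l [H1 [H2 H3]]].
  exists l; repeat split; auto. intros x Hx. rewrite <- E by lra. auto.
Qed.

Lemma wball_closed (M : R) (f : R -> C) :
  (forall X eta, 0 < eta -> exists g, wball w M g /\
     forall x, 0 <= x <= X -> Cmod (f x - g x) <= eta) -> wball w M f.
Proof.
  intros H X eta He.
  destruct (H X (eta / 2)) as [g [Hg Hfg]]; [lra|].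
  destruct (Hg X (eta / 2)) as [l [H1 [H2 H3]]]; [lra|].
  exists l; repeat split; auto. intros x Hx.
  specialize (Hfg x Hx). specialize (H3 x Hx).
  pose proof (Cmod_dist_triangle (f x) (g x) (ev l x)). lra.
Qed.

Lemma wball_bound (M : R) (f : R -> C) : wball w M f -> forall x, 0 <= x -> Cmod (f x) <= M.
Proof.
  intros H x Hx. apply Rle_plus_epsilon. intros eta He.
  destruct (H x eta He) as [l [H1 [H2 H3]]].
  specialize (H3 x (conj Hx (Rle_refl x))).
  pose proof (Cmod_ev w l x Hw H1).
  replace (f x) with ((f x - ev l x) + ev l x)%C by ring.
  eapply Rle_trans; [apply Cmod_triangle|]. lra.
Qed.

Lemma wball_nonneg (M : R) (f : R -> C) : wball w M f -> 0 <= M.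
Proof.
  intros H. eapply Rle_trans; [apply Cmod_ge_0 | apply (wball_bound M f H 0); lra].
Qed.

Lemma wball_ev (l : list (R * R)) : posl l -> wball w (cost w l) (ev l).
Proof.
  intros H X eta He. exists l; repeat split; auto; [lra|].
  intros x _. replace (ev l x - ev l x)%C with (RtoC 0) by ring. rewrite Cmod_0. lra.
Qed.

Lemma wball_ek (k : R) : 0 < k -> wball w (w k) (ek k).
Proof.
  intros Hk. apply wball_ext with (f := ev ((1, k) :: nil)).
  - intros x _. simpl. ring.
  - apply wball_mono with (cost w ((1, k) :: nil)).
    + simpl. rewrite Rabs_R1. lra.
    + apply wball_ev. constructor; [exact Hk | constructor].
Qed.

Lemma wball_0 : wball w 0 (fun _ => RtoC 0).
Proof. apply (wball_ev nil). constructor. Qed.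

Lemma wball_add (M1 M2 : R) (f g : R -> C) :
  wball w M1 f -> wball w M2 g -> wball w (M1 + M2) (fun x => f x + g x)%C.
Proof.
  intros Hf Hg X eta He.
  destruct (Hf X (eta / 2)) as [l [H1 [H2 H3]]]; [lra|].
  destruct (Hg X (eta / 2)) as [l' [H1' [H2' H3']]]; [lra|].
  exists (l ++ l'); repeat split.
  - apply posl_app; auto.
  - rewrite cost_app. lra.
  - intros x Hx. rewrite ev_app. specialize (H3 x Hx). specialize (H3' x Hx).
    replace (f x + g x - (ev l x + ev l' x))%C with ((f x - ev l x) + (g x - ev l' x))%C by ring.
    eapply Rle_trans; [apply Cmod_triangle|]. lra.
Qed.

Lemma wball_scal (a M : R) (f : R -> C) :
  wball w M f -> wball w (Rabs a * M) (fun x => RtoC a * f x)%C.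
Proof.
  intros Hf X eta He.
  pose proof (Rabs_pos a) as Ha.
  destruct (Hf X (eta / (Rabs a + 1))) as [l [H1 [H2 H3]]].
  { apply Rdiv_lt_0_compat; lra. }
  exists (lscal a 1 0 l); repeat split.
  - apply posl_lscal; auto; lra.
  - eapply Rle_trans; [apply (cost_lscal w w a 1 0 1)|]; auto.
    + intros k Hk. rewrite Rmult_1_l, Rplus_0_r. lra.
    + nra.
  - intros x Hx. specialize (H3 x Hx). rewrite ev_lscal.
    replace (ek 0 x) with (RtoC 1) by (unfold ek; rewrite Rmult_0_l, cos_0, sin_0; reflexivity).
    replace (a * f x - a * 1 * ev l x)%C with (a * (f x - ev l x))%C by ring.
    rewrite Cmod_mult, Cmod_R.
    apply Rle_trans with (Rabs a * (eta / (Rabs a + 1))).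
    + apply Rmult_le_compat_l; auto.
    + unfold Rdiv. rewrite <- Rmult_assoc. apply Rle_div_l; [lra|]. nra.
Qed.

Lemma wball_opp (M : R) (f : R -> C) : wball w M f -> wball w M (fun x => - f x)%C.
Proof.
  intros H. apply wball_ext with (fun x => RtoC (-1) * f x)%C.
  - intros x _. apply injective_projections; simpl; ring.
  - replace M with (Rabs (-1) * M) by (rewrite Rabs_left by lra; ring).
    apply wball_scal; auto.
Qed.

Lemma wball_minus (M1 M2 : R) (f g : R -> C) :
  wball w M1 f -> wball w M2 g -> wball w (M1 + M2) (fun x => f x - g x)%C.
Proof. intros Hf Hg. apply wball_add; auto. apply wball_opp; auto. Qed.

(** Shrinking by the factor M / (M + eta) carries a member of the larger ball into the smaller one
    and moves it by at most [eta]. This serves constants, whose approximants cost slightly more than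
    the limit. *)
Lemma wball_slack (M : R) (f : R -> C) :
  0 <= M -> (forall eta, 0 < eta -> wball w (M + eta) f) -> wball w M f.
Proof.
  intros HM H. apply wball_closed. intros X eta He.
  set (r := M / (M + eta)).
  exists (fun x => RtoC r * f x)%C. split.
  - replace M with (Rabs r * (M + eta)).
    + apply wball_scal. apply H; auto.
    + rewrite Rabs_pos_eq; unfold r; [field; lra|]. apply Rdiv_le_0_compat; lra.
  - intros x Hx. replace (f x - r * f x)%C with (RtoC (1 - r) * f x)%C
      by (rewrite RtoC_minus; ring).
    rewrite Cmod_mult, Cmod_R.
    pose proof (wball_bound _ _ (H eta He) x ltac:(lra)).
    replace (1 - r) with (eta / (M + eta)) by (unfold r; field; lra).
    rewrite Rabs_pos_eq by (apply Rdiv_le_0_compat; lra).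
    apply Rle_trans with (eta / (M + eta) * (M + eta)).
    + apply Rmult_le_compat_l; auto. apply Rdiv_le_0_compat; lra.
    + right. field. lra.
Qed.

Lemma wball_dil (r K M : R) (f : R -> C) :
  0 < r -> 0 <= K -> (forall k, 0 < k -> w (r * k) <= K * w k) -> wball w M f ->
  wball w (K * M) (fun x => f (r * x)).
Proof.
  intros Hr HK HrK Hf X eta He.
  destruct (Hf (r * X) eta He) as [l [H1 [H2 H3]]].
  exists (lscal 1 r 0 l); repeat split.
  - apply posl_lscal; auto; lra.
  - eapply Rle_trans; [apply (cost_lscal w w 1 r 0 K)|]; auto.
    + intros k Hk. rewrite Rplus_0_r; auto.
    + rewrite Rabs_R1. nra.
  - intros x Hx. rewrite ev_ldil. apply H3. nra.
Qed.

Lemma wball_sum (m : nat -> R) (f : nat -> R -> C) (n : nat) :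
  (forall i, (i <= n)%nat -> wball w (m i) (f i)) ->
  wball w (sum_n m n) (fun x => sum_n (fun i => f i x) n).
Proof.
  induction n as [|n IH]; intros H.
  - apply wball_ext with (f 0%nat); [intros x _; rewrite sum_O; reflexivity|].
    rewrite sum_O. auto.
  - apply wball_ext with (fun x => sum_n (fun i => f i x) n + f (S n) x)%C.
    + intros x _. rewrite sum_Sn. reflexivity.
    + rewrite sum_Sn. apply (wball_add (sum_n m n) (m (S n))); auto.
Qed.

Lemma wball_series (m : nat -> R) (M : R) (f : nat -> R -> C) (F : R -> C) :
  (forall i, wball w (m i) (f i)) ->
  is_series m M ->
  (forall x n, 0 <= x -> Cmod (F x - sum_n (fun i => f i x) n) <= M - sum_n m n) ->
  wball w M F.
Proof.
  intros Hf Hm HF. apply wball_closed. intros X eta He.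
  assert (Hm0 : forall i, 0 <= m i) by (intros i; eapply wball_nonneg; apply Hf).
  change (is_lim_seq (sum_n m) M) in Hm.
  apply is_lim_seq_spec in Hm. destruct (Hm (mkposreal _ He)) as [N HN].
  specialize (HN N (Nat.le_refl N)). simpl in HN.
  exists (fun x => sum_n (fun i => f i x) N). split.
  - apply wball_mono with (sum_n m N); [|apply wball_sum; auto].
    pose proof (HF 0 N (Rle_refl 0)) as H.
    pose proof (Cmod_ge_0 (F 0 - sum_n (fun i => f i 0) N)%C). lra.
  - intros x Hx. eapply Rle_trans; [apply HF; lra|].
    apply Rabs_lt_between in HN. lra.
Qed.

End Ball.

Lemma wball_mult (w1 w2 w3 : R -> R) (K M1 M2 : R) (f g : R -> C) :
  weight w1 -> weight w2 -> 0 <= K ->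
  (forall k l, 0 < k -> 0 < l -> w3 (k + l) <= K * w1 k * w2 l) ->
  wball w1 M1 f -> wball w2 M2 g -> wball w3 (K * M1 * M2) (fun x => f x * g x)%C.
Proof.
  intros Hw1 Hw2 HK Hw Hf Hg X eta He.
  pose proof (wball_nonneg w1 Hw1 _ _ Hf) as HM1. pose proof (wball_nonneg w2 Hw2 _ _ Hg) as HM2.
  (* With this tolerance the two errors in f g - l l' = f (g - l') + (f - l) l' add up to at most
     [eta]. *)
  set (e := eta / (M1 + M2 + 1)).
  assert (He' : 0 < e) by (apply Rdiv_lt_0_compat; lra).
  destruct (Hf X e) as [l [H1 [H2 H3]]]; auto.
  destruct (Hg X e) as [l' [H1' [H2' H3']]]; auto.
  exists (lprod l l'); repeat split.
  - apply posl_lprod; auto.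
  - eapply Rle_trans; [apply (cost_lprod w1 w2 w3 K)|]; auto using weight_nonneg.
    pose proof (cost_nonneg w1 l (weight_nonneg w1 Hw1) H1).
    pose proof (cost_nonneg w2 l' (weight_nonneg w2 Hw2) H1').
    rewrite !Rmult_assoc. apply Rmult_le_compat_l; auto.
    apply Rmult_le_compat; auto.
  - intros x Hx. rewrite ev_lprod.
    replace (f x * g x - ev l x * ev l' x)%C
      with (f x * (g x - ev l' x) + (f x - ev l x) * ev l' x)%C by ring.
    eapply Rle_trans; [apply Cmod_triangle|]. rewrite !Cmod_mult.
    pose proof (wball_bound w1 Hw1 M1 f Hf x ltac:(lra)).
    pose proof (Cmod_ev w2 l' x Hw2 H1').
    specialize (H3 x Hx). specialize (H3' x Hx).
    apply Rle_trans with (M1 * e + e * M2).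
    + apply Rplus_le_compat; apply Rmult_le_compat; auto using Cmod_ge_0; lra.
    + assert (e * (M1 + M2 + 1) = eta) by (unfold e; field; lra). nra.
Qed.

Lemma wball_weight (w1 w2 : R -> R) (K M : R) (f : R -> C) :
  0 <= K -> (forall k, 0 < k -> w2 k <= K * w1 k) -> wball w1 M f -> wball w2 (K * M) f.
Proof.
  intros HK Hw H X eta He. destruct (H X eta He) as [l [H1 [H2 H3]]].
  exists l; repeat split; auto.
  apply Rle_trans with (K * cost w1 l); [|nra].
  clear - Hw H1. induction H1 as [|[c k] t H H' IH]; simpl; [lra|].
  simpl in H. specialize (Hw k H). pose proof (Rabs_pos c). nra.
Qed.

(** * Hölder bounds and compactness *)

(** A limit along one ultrafilter exists at all points of the half line simultaneously, which takes
    the place of a diagonal extraction of subsequences. The ultrafilter is an extension of the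
    filter of tails. *)
Lemma free_ultrafilter : exists U : (nat -> Prop) -> Prop,
  (forall P Q : nat -> Prop, (forall n, P n -> Q n) -> U P -> U Q) /\
  (forall P Q, U P -> U Q -> U (fun n => P n /\ Q n)) /\
  (~ U (fun _ => False)) /\
  (forall P, U P \/ U (fun n => ~ P n)) /\
  (forall N, U (fun n => (N <= n)%nat)).
Proof.
  set (F := fun P : nat -> Prop => exists N, forall n, (N <= n)%nat -> P n).
  assert (PF : filter.ProperFilter F).
  { constructor.
    - intros [N HN]. exact (HN N (Nat.le_refl N)).
    - constructor.
      + exists 0%nat. intros n _. exact I.
      + intros P Q [N HN] [N' HN']. exists (Nat.max N N'). intros n Hn.
        split; [apply HN | apply HN']; lia.
      + intros P Q PQ [N HN]. exists N. intros n Hn. apply PQ, HN, Hn. }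
  destruct (filter.ultraFilterLemma PF) as [U [[[Hne [HT HI HS]] Hmax] HFU]].
  exists U.
  assert (Hmono : forall P Q : nat -> Prop, (forall n, P n -> Q n) -> U P -> U Q)
    by (intros P Q PQ; apply HS; exact PQ).
  assert (Hand : forall P Q, U P -> U Q -> U (fun n => P n /\ Q n))
    by (intros P Q HP HQ; exact (HI P Q HP HQ)).
  repeat split; auto.
  - intros P. destruct (classic (U P)) as [HP|HP]; [left; auto | right].
    (* If [P] is not in [U], the filter generated by [U] and the complement of [P] is proper; by
       maximality it equals [U]. *)
    set (G := fun Q : nat -> Prop => exists A, U A /\ forall n, A n -> ~ P n -> Q n).
    assert (PG : filter.ProperFilter G).
    { constructor.
      - intros [A [HA HAP]]. apply HP. apply (Hmono A P); [|exact HA].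
        intros n Hn. apply NNPP. intros Hn'. exact (HAP n Hn Hn').
      - constructor.
        + exists (fun _ => True). split; [exact HT|]. intros; exact I.
        + intros Q Q' [A [HA HQ]] [A' [HA' HQ']]. exists (fun n => A n /\ A' n).
          split; auto. intros n [Hn Hn'] Hp. split; [apply HQ | apply HQ']; auto.
        + intros Q Q' QQ' [A [HA HQ]]. exists A. split; [exact HA|].
          intros n Hn Hp. apply QQ'. apply HQ; auto. }
    rewrite <- (Hmax G PG).
    + exists (fun _ => True). split; [exact HT|]. intros n _ H; exact H.
    + intros A HA. exists A. split; auto.
  - intros N. apply HFU. exists N. auto.
Qed.

(** The limit is the supremum of the levels that [u] reaches on a set of the ultrafilter. *)
Lemma ultra_limit (U : (nat -> Prop) -> Prop) (u : nat -> R) (M : R) :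
  (forall P Q : nat -> Prop, (forall n, P n -> Q n) -> U P -> U Q) ->
  (forall P Q, U P -> U Q -> U (fun n => P n /\ Q n)) ->
  (~ U (fun _ => False)) ->
  (forall P, U P \/ U (fun n => ~ P n)) ->
  U (fun _ => True) ->
  (forall n, Rabs (u n) <= M) ->
  exists l, forall eta, 0 < eta -> U (fun n => Rabs (u n - l) < eta).
Proof.
  intros HS HI HN HC HT HM.
  destruct (completeness (fun r => U (fun n => r <= u n))) as [l [Hl1 Hl2]].
  - exists M. intros r Hr. apply Rnot_lt_le. intros Hlt. apply HN.
    apply (HS (fun n => r <= u n)); auto.
    intros n Hn. specialize (HM n). apply Rabs_le_between in HM. lra.
  - exists (- M). apply (HS (fun _ => True)); auto.
    intros n _. specialize (HM n). apply Rabs_le_between in HM. lra.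
  - exists l. intros eta He.
    assert (H1 : U (fun n => u n < l + eta)).
    { destruct (HC (fun n => l + eta <= u n)) as [H|H].
      - apply Hl1 in H. lra.
      - apply (HS _ _ (fun n Hn => Rnot_le_lt _ _ Hn) H). }
    assert (H2 : exists r, U (fun n => r <= u n) /\ l - eta < r).
    { apply NNPP. intros Hn. assert (l <= l - eta); [|lra].
      apply Hl2. intros r Hr. apply Rnot_lt_le. intros Hlt. apply Hn. exists r; auto. }
    destruct H2 as [r [Hr Hr']].
    apply (HS _ _) with (2 := HI _ _ H1 Hr).
    intros n [Ha Hb]. apply Rabs_def1; lra.
Qed.

Definition holder_weight (w : R -> R) (s : R) : Prop :=
  0 < s <= 1 /\ forall k, 0 < k -> Rpower k s <= w k.

Lemma Rpower_pos (x y : R) : 0 < Rpower x y.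
Proof. apply exp_pos. Qed.

Lemma Rpower_1_l (s : R) : Rpower 1 s = 1.
Proof. unfold Rpower. rewrite ln_1, Rmult_0_r. apply exp_0. Qed.

Lemma Rpower_ge_1 (x s : R) : 1 <= x -> 0 <= s -> 1 <= Rpower x s.
Proof. intros Hx Hs. rewrite <- (Rpower_1_l s). apply Rle_Rpower_l; lra. Qed.

Lemma Rpower_le_1 (x s : R) : 0 < x <= 1 -> 0 <= s -> Rpower x s <= 1.
Proof. intros Hx Hs. rewrite <- (Rpower_1_l s). apply Rle_Rpower_l; lra. Qed.

(** Geometric interpolation between 1 and [h]. It turns the pair of bounds 2 and k |x - y| for a
    difference of exponentials into a Hölder bound. *)
Lemma min_le_Rpower (h s : R) : 0 < h -> 0 < s <= 1 -> Rmin 1 h <= Rpower h s.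
Proof.
  intros Hh Hs. destruct (Rle_dec 1 h) as [H|H].
  - rewrite Rmin_left by lra. apply Rpower_ge_1; lra.
  - rewrite Rmin_right by lra.
    rewrite <- (Rpower_1 h) at 1 by lra. unfold Rpower.
    assert (ln h < 0) by (rewrite <- ln_1; apply ln_increasing; lra).
    destruct (Req_dec s 1) as [->|Hs1]; [lra|].
    left. apply exp_increasing. nra.
Qed.

Lemma ek_holder (k x y s : R) : 0 < k -> x <> y -> 0 < s <= 1 ->
  Cmod (ek k x - ek k y) <= 2 * Rpower (Rabs (x - y)) s * Rpower k s.
Proof.
  intros Hk Hxy Hs.
  assert (Hd : 0 < Rabs (x - y)) by (apply Rabs_pos_lt; lra).
  pose proof (min_le_Rpower (Rabs (x - y) * k) s ltac:(nra) Hs) as H.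
  rewrite <- Rpower_mult_distr in H by lra.
  pose proof (Cmod_ek_diff k x y) as H1. pose proof (Cmod_ek_diff_2 k x y) as H2.
  rewrite Rabs_mult, (Rabs_pos_eq k) in H1 by lra.
  unfold Rmin in H. destruct (Rle_dec 1 (Rabs (x - y) * k)); nra.
Qed.

Lemma ev_holder (w : R -> R) (s : R) (l : list (R * R)) (x y : R) :
  holder_weight w s -> posl l -> x <> y ->
  Cmod (ev l x - ev l y) <= 2 * Rpower (Rabs (x - y)) s * cost w l.
Proof.
  intros [Hs Hw] H Hxy. induction H as [|[c k] t H1 H2 IH]; simpl.
  - replace (0 - 0)%C with (RtoC 0) by ring. rewrite Cmod_0. lra.
  - replace (c * ek k x + ev t x - (c * ek k y + ev t y))%C
      with (c * (ek k x - ek k y) + (ev t x - ev t y))%C by ring.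
    eapply Rle_trans; [apply Cmod_triangle|]. rewrite Cmod_mult, Cmod_R.
    simpl in H1. pose proof (ek_holder k x y s H1 Hxy Hs). specialize (Hw k H1).
    pose proof (Rabs_pos c). pose proof (Rpower_pos (Rabs (x - y)) s).
    assert (Rabs c * Cmod (ek k x - ek k y) <= Rabs c * (2 * Rpower (Rabs (x - y)) s * w k)).
    { apply Rmult_le_compat_l; auto. eapply Rle_trans; [apply H|].
      apply Rmult_le_compat_l; nra. }
    lra.
Qed.

Lemma wball_holder (w : R -> R) (s M : R) (f : R -> C) (x y : R) :
  holder_weight w s -> wball w M f -> 0 <= x -> 0 <= y -> x <> y ->
  Cmod (f x - f y) <= 2 * Rpower (Rabs (x - y)) s * M.
Proof.
  intros Hs Hf Hx Hy Hxy. apply Rle_plus_epsilon. intros eta He.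
  destruct (Hf (Rmax x y) (eta / 2)) as [l [H1 [H2 H3]]]; [lra|].
  pose proof (H3 x (conj Hx (Rmax_l x y))) as Hfx.
  pose proof (H3 y (conj Hy (Rmax_r x y))) as Hfy.
  rewrite Cmod_minus_sym in Hfy.
  pose proof (ev_holder w s l x y Hs H1 Hxy).
  pose proof (Cmod_dist_triangle (f x) (ev l x) (f y)).
  pose proof (Cmod_dist_triangle (ev l x) (ev l y) (f y)).
  pose proof (Rpower_pos (Rabs (x - y)) s). nra.
Qed.

Lemma Rpower_small (s eta : R) : 0 < s -> 0 < eta ->
  exists d, 0 < d /\ forall h, 0 < h <= d -> Rpower h s <= eta.
Proof.
  intros Hs He. exists (Rpower eta (/ s)). split; [apply Rpower_pos|].
  intros h Hh. apply Rle_trans with (Rpower (Rpower eta (/ s)) s).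
  - apply Rle_Rpower_l; lra.
  - rewrite Rpower_mult, Rinv_l, Rpower_1; lra.
Qed.

Lemma nat_above (x : R) : exists n : nat, x <= INR n.
Proof.
  destruct (Rle_dec 0 x) as [H|H].
  - destruct (nfloor_ex x H) as [n Hn]. exists (S n). rewrite S_INR. lra.
  - exists 0%nat. simpl. lra.
Qed.

Lemma grid (d x : R) (K : nat) : 0 < d -> 0 <= x <= INR K * d ->
  exists i, (i <= K)%nat /\ Rabs (x - INR i * d) <= d.
Proof.
  intros Hd Hx.
  assert (Hxd : 0 <= x / d) by (apply Rdiv_le_0_compat; lra).
  destruct (nfloor_ex (x / d) Hxd) as [i Hi].
  assert (E : x = x / d * d) by (field; lra).
  exists i. split.
  - apply INR_le. apply Rnot_lt_le. intros H.
    assert (INR K < x / d) by lra.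
    assert (INR K * d < x / d * d) by (apply Rmult_lt_compat_r; auto). lra.
  - rewrite E at 1. rewrite <- Rmult_minus_distr_r, Rabs_mult, (Rabs_pos_eq d) by lra.
    rewrite Rabs_pos_eq by lra. nra.
Qed.

(** Arzela-Ascoli: membership in the ball gives a common Hölder modulus, so the pointwise limit
    along a free ultrafilter is locally uniform. The conclusion speaks of arbitrarily late indices,
    which suffices to pass to the limit in equations. *)
Theorem wball_cluster (w : R -> R) (s M : R) (fn : nat -> R -> C) :
  weight w -> holder_weight w s -> (forall n, wball w M (fn n)) ->
  exists f, wball w M f /\ forall X eta N, 0 < eta ->
    exists n, (N <= n)%nat /\ forall x, 0 <= x <= X -> Cmod (f x - fn n x) <= eta.
Proof.
  intros Hw Hs Hfn.
  destruct free_ultrafilter as [U [HS [HI [HN [HC HE]]]]].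
  assert (HT : U (fun _ => True)) by (apply (HS _ _ (fun n _ => I) (HE 0%nat))).
  assert (Hlim : forall x, exists z : C, 0 <= x -> forall eta, 0 < eta ->
            U (fun n => Cmod (fn n x - z) < eta)).
  { intros x. destruct (Rle_dec 0 x) as [Hx|Hx]; [|exists (RtoC 0); lra].
    pose proof (fun n => wball_bound w Hw M (fn n) (Hfn n) x Hx) as HB.
    destruct (ultra_limit U (fun n => fst (fn n x)) M) as [a Ha]; auto.
    { intros n. eapply Rle_trans; [apply Rabs_fst_Cmod | apply HB]. }
    destruct (ultra_limit U (fun n => snd (fn n x)) M) as [b Hb]; auto.
    { intros n. eapply Rle_trans; [apply Rabs_snd_Cmod | apply HB]. }
    exists (a, b). intros _ eta He.
    apply (HS _ _) with (2 := HI _ _ (Ha (eta / 2) ltac:(lra)) (Hb (eta / 2) ltac:(lra))).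
    intros n [H1 H2]. eapply Rle_lt_trans; [apply Cmod_le_sum|].
    change (Rabs (fst (fn n x) - a) + Rabs (snd (fn n x) - b) < eta). lra. }
  set (f := fun x => proj1_sig (constructive_indefinite_description _ (Hlim x))).
  assert (Hf : forall x, 0 <= x -> forall eta, 0 < eta -> U (fun n => Cmod (fn n x - f x) < eta))
    by (intros x; unfold f; destruct (constructive_indefinite_description _ (Hlim x)); auto).
  assert (Hne : forall P, U P -> exists n, P n).
  { intros P HP. apply NNPP. intros H. apply HN. apply (HS P); auto.
    intros n Hn. apply H. exists n; auto. }
  pose proof (wball_nonneg w Hw M (fn 0%nat) (Hfn 0%nat)) as HM.
  assert (Hhol : forall x y, 0 <= x -> 0 <= y -> x <> y ->
            Cmod (f x - f y) <= 2 * Rpower (Rabs (x - y)) s * M).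
  { intros x y Hx Hy Hxy. apply Rle_plus_epsilon. intros eta He.
    destruct (Hne _ (HI _ _ (Hf x Hx (eta / 2) ltac:(lra)) (Hf y Hy (eta / 2) ltac:(lra))))
      as [n [H1 H2]].
    pose proof (wball_holder w s M (fn n) x y Hs (Hfn n) Hx Hy Hxy).
    pose proof (Cmod_dist_triangle (f x) (fn n x) (f y)).
    pose proof (Cmod_dist_triangle (fn n x) (fn n y) (f y)).
    rewrite Cmod_minus_sym in H1. lra. }
  assert (Hunif : forall X eta, 0 < eta ->
     U (fun n => forall x, 0 <= x <= X -> Cmod (f x - fn n x) <= eta)).
  { intros X eta He.
    (* Up to distance [d] the Hölder bound 2 M h^s is at most eta / 4; this is spent once for [f]
       and once for [fn n], and a further eta / 4 at the grid point. *)
    destruct (Rpower_small s (eta / (8 * (M + 1)))) as [d [Hd Hd']].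
    { apply Hs. } { apply Rdiv_lt_0_compat; lra. }
    destruct (nat_above (X / d)) as [K HK].
    assert (HXK : X <= INR K * d).
    { apply Rmult_le_compat_r with (r := d) in HK; [|lra].
      unfold Rdiv in HK. rewrite Rmult_assoc, Rinv_l, Rmult_1_r in HK; lra. }
    (* An ultrafilter is closed under finite intersections, hence the finite grid. *)
    assert (HG : forall J, U (fun n => forall i, (i <= J)%nat ->
              Cmod (fn n (INR i * d) - f (INR i * d)) < eta / 4)).
    { assert (Hpt : forall i, U (fun n => Cmod (fn n (INR i * d) - f (INR i * d)) < eta / 4)).
      { intros i. apply Hf; [|lra]. apply Rmult_le_pos; [apply pos_INR | lra]. }
      induction J as [|J IH].
      - apply (HS _ _) with (2 := Hpt 0%nat). intros n Hn i Hi.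
        replace i with 0%nat by lia. exact Hn.
      - apply (HS _ _) with (2 := HI _ _ IH (Hpt (S J))). intros n [Hn Hn'] i Hi.
        destruct (Nat.eq_dec i (S J)) as [->|Hne']; [exact Hn' | apply Hn; lia]. }
    apply (HS _ _) with (2 := HG K). intros n Hn x Hx.
    destruct (grid d x K Hd) as [i [Hi Hxi]]; [lra|]. specialize (Hn i Hi).
    set (p := INR i * d) in *.
    assert (Hp : 0 <= p) by (apply Rmult_le_pos; [apply pos_INR | lra]).
    rewrite Cmod_minus_sym in Hn.
    destruct (Req_dec x p) as [->|Hxp]; [lra|].
    assert (Hsm : 2 * Rpower (Rabs (x - p)) s * M <= eta / 4).
    { assert (Rpower (Rabs (x - p)) s <= eta / (8 * (M + 1))).
      { apply Hd'. split; [apply Rabs_pos_lt; lra | exact Hxi]. }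
      apply Rle_trans with (2 * (eta / (8 * (M + 1))) * (M + 1)); [|right; field; lra].
      pose proof (Rpower_pos (Rabs (x - p)) s).
      apply Rmult_le_compat; lra. }
    pose proof (wball_holder w s M (fn n) x p Hs (Hfn n) (proj1 Hx) Hp Hxp) as Ha.
    pose proof (Hhol x p (proj1 Hx) Hp Hxp) as Hb.
    rewrite Cmod_minus_sym in Ha.
    pose proof (Cmod_dist_triangle (f x) (f p) (fn n x)).
    pose proof (Cmod_dist_triangle (f p) (fn n p) (fn n x)). lra. }
  assert (Hc : forall X eta N, 0 < eta ->
    exists n, (N <= n)%nat /\ forall x, 0 <= x <= X -> Cmod (f x - fn n x) <= eta).
  { intros X eta N He. apply Hne. apply HI; auto. }
  exists f. split; auto.
  apply wball_closed. intros X eta He. destruct (Hc X eta 0%nat He) as [n [_ Hn]].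
  exists (fn n). auto.
Qed.

(** * Superpositions of exponentials *)

Ltac real_eq := match goal with |- @eq _ ?a ?b => change (@eq R a b) end.

Definition CRInt (F : R -> C) (a b : R) : C :=
  (RInt (fun u => fst (F u)) a b, RInt (fun u => snd (F u)) a b).

Lemma RInt_near_const (f : R -> R) (a b v e : R) :
  a <= b -> ex_RInt f a b -> (forall u, a <= u <= b -> Rabs (f u - v) <= e) ->
  Rabs (RInt f a b - (b - a) * v) <= (b - a) * e.
Proof.
  intros Hab Hf H.
  replace (RInt f a b - (b - a) * v) with (RInt (fun u => minus (f u) v) a b).
  - apply abs_RInt_le_const; auto.
    apply (ex_RInt_minus (V := R_NormedModule)); auto. apply ex_RInt_const.
  - rewrite (RInt_minus f (fun _ => v)); auto.
    + rewrite RInt_const. reflexivity.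
    + apply ex_RInt_const.
Qed.

(** Riemann sums: on each short piece the integral is replaced by one value of [F], and an
    approximant of that value is scaled by the length of the piece. *)
Lemma wball_int (w : R -> R) (a b : R) (F : R -> R -> C) (m : R -> R) :
  weight w -> a <= b ->
  (forall u, a <= u <= b -> continuous m u) ->
  (forall u, a <= u <= b -> wball w (m u) (F u)) ->
  (forall x, 0 <= x -> ex_RInt (fun u => fst (F u x)) a b) ->
  (forall x, 0 <= x -> ex_RInt (fun u => snd (F u x)) a b) ->
  (forall X eta, 0 < eta -> exists d, 0 < d /\ forall u u' x,
     a <= u <= b -> a <= u' <= b -> Rabs (u - u') <= d -> 0 <= x <= X ->
     Cmod (F u x - F u' x) <= eta) ->
  wball w (RInt m a b) (fun x => CRInt (fun u => F u x) a b).
Proof.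
  intros Hw Hab Hm HF Hf1 Hf2 Heq X eta He.
  set (e := eta / (b - a + 1)).
  assert (Hep : 0 < e) by (apply Rdiv_lt_0_compat; lra).
  destruct (Heq X (e / 4)) as [d [Hd Hd']]; [lra|].
  assert (Hexm : forall c c', a <= c <= c' -> c' <= b -> ex_RInt m c c').
  { intros c c' Hc Hc'. apply (ex_RInt_continuous (V := R_CompleteNormedModule)).
    intros z. rewrite Rmin_left, Rmax_right by lra. intros Hz. apply Hm; lra. }
  assert (Hex : forall f c c', ex_RInt f a b -> a <= c <= c' -> c' <= b -> ex_RInt (V := R_NormedModule) f c c').
  { intros f c c' H Hc Hc'. apply (ex_RInt_Chasles_1 (V := R_CompleteNormedModule)) with b; [lra|].
    apply (ex_RInt_Chasles_2 (V := R_CompleteNormedModule)) with a; [lra | exact H]. }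
  assert (Hone : forall c c', a <= c <= c' -> c' <= b -> c' - c <= d ->
    exists l, posl l /\ cost w l <= RInt m c c' /\ forall x, 0 <= x <= X ->
      Cmod (CRInt (fun u => F u x) c c' - ev l x) <= e * (c' - c)).
  { intros c c' Hc Hc' Hcd.
    (* Sampling where [m] is least keeps the cost of the piece below the integral of [m] over it, so
       the bound [RInt m a b] is reached without loss. *)
    destruct (continuity_ab_min m c c') as [u [Hmin Hu]]; [lra| |].
    { intros z Hz. apply continuity_pt_filterlim. apply Hm; lra. }
    destruct (HF u ltac:(lra) X (e / 4)) as [l [Hl1 [Hl2 Hl3]]]; [lra|].
    exists (lscal (c' - c) 1 0 l). split; [apply posl_lscal; auto; lra|]. split.
    - eapply Rle_trans; [apply (cost_lscal w w (c' - c) 1 0 1)|]; auto.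
      { intros k Hk. rewrite Rmult_1_l, Rplus_0_r. lra. }
      rewrite Rabs_pos_eq by lra.
      apply Rle_trans with (RInt (fun _ => m u) c c').
      + rewrite RInt_const. change (scal (c' - c) (m u)) with ((c' - c) * m u). nra.
      + apply RInt_le; [lra | apply ex_RInt_const | apply Hexm; lra |].
        intros z Hz. apply Hmin; lra.
    - intros x Hx. rewrite ev_lscal.
      replace (ek 0 x) with (RtoC 1) by (unfold ek; rewrite Rmult_0_l, cos_0, sin_0; reflexivity).
      rewrite Cmult_1_r.
      assert (Hn : forall v, c <= v <= c' -> Cmod (F v x - F u x) <= e / 4).
      { intros v Hv. apply Hd'; auto; try lra. apply Rabs_le. lra. }
      pose proof (RInt_near_const (fun v => fst (F v x)) c c' (fst (F u x)) (e / 4)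
        ltac:(lra) (Hex _ c c' (Hf1 x ltac:(lra)) Hc Hc')
        (fun v Hv => Rle_trans _ _ _ (Rabs_fst_Cmod (F v x - F u x)) (Hn v Hv))) as A1.
      pose proof (RInt_near_const (fun v => snd (F v x)) c c' (snd (F u x)) (e / 4)
        ltac:(lra) (Hex _ c c' (Hf2 x ltac:(lra)) Hc Hc')
        (fun v Hv => Rle_trans _ _ _ (Rabs_snd_Cmod (F v x - F u x)) (Hn v Hv))) as A2.
      eapply Rle_trans; [apply (Cmod_dist_triangle _ (RtoC (c' - c) * F u x)%C)|].
      assert (B1 : Cmod (CRInt (fun v => F v x) c c' - RtoC (c' - c) * F u x)
                   <= (c' - c) * (e / 4) + (c' - c) * (e / 4)).
      { eapply Rle_trans; [apply Cmod_le_sum|].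
        assert (E : (RtoC (c' - c) * F u x)%C
                    = ((c' - c) * fst (F u x), (c' - c) * snd (F u x))).
        { apply injective_projections; simpl; ring. }
        rewrite E. apply Rplus_le_compat; [exact A1 | exact A2]. }
      assert (B2 : Cmod (RtoC (c' - c) * F u x - RtoC (c' - c) * ev l x) <= (c' - c) * (e / 4)).
      { replace (RtoC (c' - c) * F u x - RtoC (c' - c) * ev l x)%C
          with (RtoC (c' - c) * (F u x - ev l x))%C by ring.
        rewrite Cmod_mult, Cmod_R, Rabs_pos_eq by lra.
        apply Rmult_le_compat_l; [lra|]. apply Hl3; auto. }
      nra. }
  assert (Hall : forall n c c', a <= c <= c' -> c' <= b -> c' - c <= INR n * d ->
    exists l, posl l /\ cost w l <= RInt m c c' /\ forall x, 0 <= x <= X ->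
      Cmod (CRInt (fun u => F u x) c c' - ev l x) <= e * (c' - c)).
  { induction n as [|n IH]; intros c c' Hc Hc' Hn.
    - simpl in Hn. apply Hone; auto; lra.
    - destruct (Rle_dec (c' - c) d) as [Hs|Hs]; [apply Hone; auto|].
      rewrite S_INR in Hn.
      destruct (Hone c (c + d)) as [l [A1 [A2 A3]]]; try lra.
      destruct (IH (c + d) c') as [l' [B1 [B2 B3]]]; try lra.
      exists (l ++ l'). split; [apply posl_app; auto|]. split.
      + rewrite cost_app. rewrite <- (RInt_Chasles m c (c + d) c'); try (apply Hexm; lra).
        change (plus (RInt m c (c + d)) (RInt m (c + d) c'))
          with (RInt m c (c + d) + RInt m (c + d) c'). lra.
      + intros x Hx. rewrite ev_app. specialize (A3 x Hx). specialize (B3 x Hx).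
        assert (E : CRInt (fun u => F u x) c c'
          = (CRInt (fun u => F u x) c (c + d) + CRInt (fun u => F u x) (c + d) c')%C).
        { unfold CRInt. apply injective_projections; simpl; symmetry.
          - apply (RInt_Chasles (fun u => fst (F u x))); (apply Hex; [apply Hf1; lra| lra|lra]).
          - apply (RInt_Chasles (fun u => snd (F u x))); (apply Hex; [apply Hf2; lra| lra|lra]). }
        rewrite E.
        replace (CRInt (fun u => F u x) c (c + d) + CRInt (fun u => F u x) (c + d) c'
                 - (ev l x + ev l' x))%C
          with ((CRInt (fun u => F u x) c (c + d) - ev l x)
                + (CRInt (fun u => F u x) (c + d) c' - ev l' x))%C by ring.
        eapply Rle_trans; [apply Cmod_triangle|]. lra. }
  destruct (nat_above ((b - a) / d)) as [n Hn].
  destruct (Hall n a b) as [l [A1 [A2 A3]]]; try lra.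
  { apply Rmult_le_compat_r with (r := d) in Hn; [|lra].
    unfold Rdiv in Hn. rewrite Rmult_assoc, Rinv_l, Rmult_1_r in Hn; lra. }
  exists l. repeat split; auto. intros x Hx. eapply Rle_trans; [apply A3; auto|].
  apply Rle_trans with (e * (b - a + 1)); [nra|]. right. unfold e. field. lra.
Qed.

(** * Integrals of powers against exponentials *)

Lemma is_derive_Rpower (s x : R) : 0 < x ->
  is_derive (fun u => Rpower u s) x (s * Rpower x (s - 1)).
Proof. intros Hx. apply is_derive_Reals, derivable_pt_lim_power, Hx. Qed.

Lemma continuous_Rpower (s x : R) : 0 < x -> continuous (fun u => Rpower u s) x.
Proof.
  intros Hx. apply (ex_derive_continuous (K := R_AbsRing) (V := R_NormedModule)).
  eexists. apply is_derive_Rpower, Hx.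
Qed.

Lemma continuous_cos (x : R) : continuous cos x.
Proof. apply continuity_pt_filterlim, continuity_cos. Qed.

Lemma continuous_sin (x : R) : continuous sin x.
Proof. apply continuity_pt_filterlim, continuity_sin. Qed.

Lemma continuous_scale_arg (g : R -> R) (x u : R) :
  (forall t, continuous g t) -> continuous (fun m => g (m * x)) u.
Proof.
  intros Hg. apply (continuous_comp (fun m : R => m * x) g); [|apply Hg].
  apply (continuous_mult (K := R_AbsRing) (fun m : R => m) (fun _ => x)).
  - apply continuous_id.
  - apply continuous_const.
Qed.

Lemma ex_RInt_pos (f : R -> R) (a b : R) : 0 < a -> 0 < b ->
  (forall u, 0 < u -> continuous f u) -> ex_RInt f a b.
Proof.
  intros Ha Hb Hf. apply (ex_RInt_continuous (V := R_CompleteNormedModule)).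
  intros z Hz. apply Hf. pose proof (Rmin_pos a b Ha Hb). lra.
Qed.

Lemma is_RInt_Rpower (a b th : R) : 0 < a -> 0 < b -> th <> 0 ->
  is_RInt (fun u => Rpower u (th - 1)) a b ((Rpower b th - Rpower a th) / th).
Proof.
  intros Ha Hb Hth.
  replace ((Rpower b th - Rpower a th) / th)
    with (minus (Rpower b th / th) (Rpower a th / th)) by (unfold minus, plus, opp; simpl; field; auto).
  apply (is_RInt_derive (V := R_CompleteNormedModule) (fun u => Rpower u th / th)).
  - intros x Hx. pose proof (Rmin_pos a b Ha Hb).
    replace (Rpower x (th - 1)) with (scal (/ th) (th * Rpower x (th - 1))).
    + apply (is_derive_ext (fun u => scal (/ th) (Rpower u th))).
      * intros t. unfold scal; simpl; unfold mult; simpl. field; auto.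
      * apply (is_derive_scal (fun u => Rpower u th)). apply is_derive_Rpower. lra.
    + unfold scal; simpl; unfold mult; simpl. field; auto.
  - intros x Hx. pose proof (Rmin_pos a b Ha Hb). apply continuous_Rpower. lra.
Qed.

(** Scaling the variable moves [y] out of the integrand: the integral equals y^(-th) times the
    integral of m^(th - 1) g(m) from a y to b y. The product rule and the derivative with respect to
    moving bounds then apply to a [g] that is merely continuous. *)
Lemma power_int_derive (g : R -> R) (th a b x : R) :
  (forall t, continuous g t) -> 0 < a -> 0 < b -> 0 < x ->
  is_derive (fun y => RInt (fun m => Rpower m (th - 1) * g (m * y)) a b) x
    ((Rpower b th * g (b * x) - Rpower a th * g (a * x)
      - th * RInt (fun m => Rpower m (th - 1) * g (m * x)) a b) / x).
Proof.
  intros Hg Ha Hb Hx.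
  set (f := fun m => Rpower m (th - 1) * g m).
  assert (Hfc : forall u, 0 < u -> continuous f u).
  { intros u Hu. apply (continuous_mult (K := R_AbsRing)).
    - apply continuous_Rpower, Hu.
    - apply Hg. }
  set (J := fun y => RInt f (a * y) (b * y)).
  assert (E : forall y, 0 < y ->
    RInt (fun m => Rpower m (th - 1) * g (m * y)) a b = Rpower y (- th) * J y).
  { intros y Hy. unfold J.
    assert (E1 : RInt f (a * y) (b * y)
                 = RInt (fun m => scal (Rpower y th) (Rpower m (th - 1) * g (m * y))) a b).
    { replace (a * y) with (y * a + 0) by ring. replace (b * y) with (y * b + 0) by ring.
      rewrite <- RInt_comp_lin.
      - apply RInt_ext. intros m Hm. pose proof (Rmin_pos a b Ha Hb).
        unfold f. rewrite Rplus_0_r. unfold scal; simpl; unfold mult; simpl.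
        rewrite <- Rpower_mult_distr by lra.
        replace (Rpower y th) with (y * Rpower y (th - 1)).
        + real_eq. rewrite (Rmult_comm m y). ring.
        + real_eq. rewrite <- (Rpower_1 y) at 1 by lra. rewrite <- Rpower_plus. f_equal. ring.
      - apply ex_RInt_pos; auto; nra. }
    rewrite E1, (RInt_scal (V := R_CompleteNormedModule)).
    - unfold scal; simpl; unfold mult; simpl. rewrite <- Rmult_assoc, <- Rpower_plus.
      replace (- th + th) with 0 by ring. rewrite Rpower_O by lra. symmetry. apply Rmult_1_l.
    - apply ex_RInt_pos; auto. intros u Hu. apply (continuous_mult (K := R_AbsRing)).
      + apply continuous_Rpower, Hu.
      + apply continuous_scale_arg, Hg. }
  assert (HJ : is_derive J x (b * f (b * x) - a * f (a * x))).
  { assert (Hloc : locally (a * x, b * x) (fun u : R * R => is_RInt f (fst u) (snd u) (RInt f (fst u) (snd u)))).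
    { assert (Hax : 0 < a * x) by nra. assert (Hbx : 0 < b * x) by nra.
      exists (mkposreal _ (Rmin_pos _ _ Hax Hbx)). intros [u v] [H1 H2]. simpl in *.
      apply (RInt_correct (V := R_CompleteNormedModule)).
      unfold ball in H1, H2; simpl in H1, H2. unfold AbsRing_ball, abs, minus, plus, opp in H1, H2; simpl in H1, H2.
      apply Rabs_def2 in H1. apply Rabs_def2 in H2.
      pose proof (Rmin_l (a * x) (b * x)). pose proof (Rmin_r (a * x) (b * x)).
      apply ex_RInt_pos; auto; lra. }
    pose proof (is_derive_RInt_bound_comp f (RInt f) (fun y => a * y) (fun y => b * y) a b x Hloc) as H.
    apply H.
    - apply Hfc; nra.
    - apply Hfc; nra.
    - auto_derive; [trivial | ring].
    - auto_derive; [trivial | ring]. }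
  apply (is_derive_ext_loc (fun y => Rpower y (- th) * J y)).
  { exists (mkposreal x Hx). intros y Hy. symmetry. apply E.
    unfold ball in Hy; simpl in Hy. unfold AbsRing_ball, abs, minus, plus, opp in Hy; simpl in Hy.
    apply Rabs_def2 in Hy. lra. }
  rewrite E by auto.
  replace ((Rpower b th * g (b * x) - Rpower a th * g (a * x) - th * (Rpower x (- th) * J x)) / x)
    with (plus (mult (- th * Rpower x (- th - 1)) (J x))
               (mult (Rpower x (- th)) (b * f (b * x) - a * f (a * x)))).
  { apply (is_derive_mult (fun y => Rpower y (- th)) J); auto.
    - apply is_derive_Rpower, Hx.
    - intros; apply Rmult_comm. }
  unfold plus, mult, f; simpl.
  assert (P1 : Rpower x (- th - 1) = Rpower x (- th) / x).
  { unfold Rminus. rewrite Rpower_plus, (Rpower_Ropp x 1), Rpower_1; auto. }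
  assert (P2 : forall c, 0 < c -> Rpower x (- th) * (c * (Rpower (c * x) (th - 1) * g (c * x)))
                = Rpower c th * g (c * x) / x).
  { intros c Hc. rewrite <- Rpower_mult_distr by auto.
    replace (Rpower c th) with (c * Rpower c (th - 1)).
    - replace (Rpower x (th - 1)) with (Rpower x th / x).
      + rewrite Rpower_Ropp. pose proof (Rpower_pos x th). field. lra.
      + unfold Rminus. rewrite Rpower_plus, Rpower_Ropp, Rpower_1; auto.
    - rewrite <- (Rpower_1 c) at 1 by lra. rewrite <- Rpower_plus. f_equal. ring. }
  rewrite Rmult_minus_distr_l, !P2 by auto. rewrite P1. field. lra.
Qed.

Definition pint (th a b x : R) : C := CRInt (fun m => RtoC (Rpower m (th - 1)) * ek m x)%C a b.

Lemma pint_fst (th a b x : R) : fst (pint th a b x) = RInt (fun m => Rpower m (th - 1) * cos (m * x)) a b.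
Proof. unfold pint, CRInt; simpl. apply RInt_ext. intros; real_eq; ring. Qed.

Lemma pint_snd (th a b x : R) : snd (pint th a b x) = RInt (fun m => Rpower m (th - 1) * sin (m * x)) a b.
Proof. unfold pint, CRInt; simpl. apply RInt_ext. intros; real_eq; ring. Qed.

Definition cderive (f : R -> C) (x : R) (d : C) : Prop :=
  is_derive (fun y => fst (f y)) x (fst d) /\ is_derive (fun y => snd (f y)) x (snd d).

(** By homogeneity, x d/dx acts on such integrals as the factor - th up to end terms, which are
    exponentials. This is why power densities solve constant-coefficient equations in D with
    exponentials as data. *)
Lemma pint_derive (th a b x : R) : 0 < a -> 0 < b -> 0 < x ->
  cderive (pint th a b) x
    ((RtoC (Rpower b th) * ek b x - RtoC (Rpower a th) * ek a x - RtoC th * pint th a b x) / RtoC x)%C.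
Proof.
  intros Ha Hb Hx.
  assert (E : forall z : C, (z / RtoC x)%C = (fst z / x, snd z / x)).
  { intros [p q]. unfold Cdiv, Cinv, Cmult, RtoC; simpl. f_equal; field; lra. }
  rewrite E. split; unfold Cminus, Cplus, Copp, Cmult, RtoC, ek; cbn [fst snd];
    rewrite ?pint_fst, ?pint_snd.
  - eapply is_derive_ext; [intros t; symmetry; apply pint_fst|].
    evar_last; [apply power_int_derive; auto using continuous_cos|].
    field. lra.
  - eapply is_derive_ext; [intros t; symmetry; apply pint_snd|].
    evar_last; [apply power_int_derive; auto using continuous_sin|].
    field. lra.
Qed.

Lemma continuous_Cek (psi : R -> R) (x u : R) : continuous psi u ->
  continuous (fun m => fst (RtoC (psi m) * ek m x)%C) u /\
  continuous (fun m => snd (RtoC (psi m) * ek m x)%C) u.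
Proof.
  intros H. split.
  - apply continuous_ext with (fun m => psi m * cos (m * x)); [intros; simpl; real_eq; ring|].
    apply (continuous_mult (K := R_AbsRing)); auto. apply continuous_scale_arg, continuous_cos.
  - apply continuous_ext with (fun m => psi m * sin (m * x)); [intros; simpl; real_eq; ring|].
    apply (continuous_mult (K := R_AbsRing)); auto. apply continuous_scale_arg, continuous_sin.
Qed.

Lemma ek_swap (k x : R) : ek k x = ek x k.
Proof. unfold ek. rewrite Rmult_comm. reflexivity. Qed.

(** The cost of a continuous superposition is the integral of |psi| w. A majorant [m] stands in for
    it so that one with an explicit primitive can be chosen. *)
Lemma wball_density (w : R -> R) (a b : R) (psi m : R -> R) :
  weight w -> 0 < a <= b ->
  (forall u, a <= u <= b -> continuous psi u) ->
  (forall u, a <= u <= b -> continuous m u) ->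
  (forall u, a <= u <= b -> Rabs (psi u) * w u <= m u) ->
  wball w (RInt m a b) (fun x => CRInt (fun u => RtoC (psi u) * ek u x)%C a b).
Proof.
  intros Hw Hab Hpsi Hm Hb.
  apply (wball_int w a b (fun u x => RtoC (psi u) * ek u x)%C m); auto; try lra.
  - intros u Hu. apply wball_mono with (Rabs (psi u) * w u); auto.
    apply wball_scal. apply wball_ek; auto. lra.
  - intros x Hx. apply (ex_RInt_continuous (V := R_CompleteNormedModule)). intros z.
    rewrite Rmin_left, Rmax_right by lra. intros Hz. exact (proj1 (continuous_Cek psi x z (Hpsi z Hz))).
  - intros x Hx. apply (ex_RInt_continuous (V := R_CompleteNormedModule)). intros z.
    rewrite Rmin_left, Rmax_right by lra. intros Hz. exact (proj2 (continuous_Cek psi x z (Hpsi z Hz))).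
  - intros X eta He.
    destruct (bounded_continuity psi a b Hpsi) as [K HK].
    assert (HK0 : 0 < K).
    { eapply Rle_lt_trans; [apply (norm_ge_0 (psi a)) | apply HK; lra]. }
    destruct (unifcont_normed_1d psi a b Hpsi (mkposreal (eta / 2) ltac:(lra))) as [d1 Hd1].
    set (d2 := eta / (2 * (K * (Rabs X + 1)))).
    assert (Hx1 : 0 < K * (Rabs X + 1)) by (pose proof (Rabs_pos X); nra).
    assert (Hd2 : 0 < d2) by (apply Rdiv_lt_0_compat; lra).
    exists (Rmin (d1 / 2) d2). split; [apply Rmin_pos; auto; destruct d1; simpl; lra|].
    intros u u' x Hu Hu' Huu Hx.
    assert (H1 : Rabs (psi u - psi u') < eta / 2).
    { specialize (Hd1 u' u Hu' Hu). apply Hd1.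
      change (Rabs (u - u') < d1). pose proof (Rmin_l (d1 / 2) d2). pose proof (cond_pos d1). lra. }
    assert (H2 : Cmod (ek u x - ek u' x) <= Rabs X * d2).
    { rewrite (ek_swap u), (ek_swap u'). eapply Rle_trans; [apply Cmod_ek_diff|].
      rewrite Rabs_mult. pose proof (Rmin_r (d1 / 2) d2).
      apply Rmult_le_compat; try apply Rabs_pos; [|lra].
      rewrite (Rabs_pos_eq x) by lra. pose proof (Rle_abs X). lra. }
    replace (psi u * ek u x - psi u' * ek u' x)%C
      with (RtoC (psi u - psi u') * ek u x + RtoC (psi u') * (ek u x - ek u' x))%C
      by (rewrite RtoC_minus; ring).
    eapply Rle_trans; [apply Cmod_triangle|].
    rewrite !Cmod_mult, !Cmod_R, Cmod_ek, Rmult_1_r.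
    assert (H3 : Rabs (psi u') < K) by (apply HK; auto).
    assert (Rabs (psi u') * Cmod (ek u x - ek u' x) <= K * (Rabs X * d2)).
    { apply Rmult_le_compat; auto using Rabs_pos, Cmod_ge_0; lra. }
    assert (K * (Rabs X * d2) <= eta / 2).
    { apply Rle_trans with (K * (Rabs X + 1) * d2); [|unfold d2; right; field; pose proof (Rabs_pos X); lra].
      pose proof (Rabs_pos X). nra. }
    lra.
Qed.

(** * The scaled derivative *)

Lemma is_derive_continuity_pt (f : R -> R) (x l : R) : is_derive f x l -> continuity_pt f x.
Proof.
  intros H. apply derivable_continuous_pt. exists l. apply is_derive_Reals, H.
Qed.

(** By the mean value theorem the increment of g - RInt d is small with [eta]; in the limit f(x) =
    f(x0) + RInt d x0 x near [x0], and the right side has derivative [d]. *)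
Lemma derive_limit (f d : R -> R) :
  (forall x, 0 < x -> continuous d x) ->
  (forall x1 x2 eta, 0 < x1 < x2 -> 0 < eta -> exists g dg,
     (forall x, x1 <= x <= x2 -> is_derive g x (dg x)) /\
     (forall x, x1 <= x <= x2 -> Rabs (f x - g x) <= eta /\ Rabs (d x - dg x) <= eta)) ->
  forall x, 0 < x -> is_derive f x (d x).
Proof.
  intros Hd H x0 Hx0.
  assert (HI : forall x, 0 < x -> is_derive (fun y => RInt d x0 y) x (d x)).
  { intros x Hx. apply (is_derive_RInt d _ x0); auto.
    exists (mkposreal x Hx). intros y Hy. apply (RInt_correct (V := R_CompleteNormedModule)).
    change (Rabs (y - x) < x) in Hy. apply Rabs_def2 in Hy. apply ex_RInt_pos; auto; lra. }
  assert (E : forall x, x0 / 2 <= x <= 2 * x0 -> f x = f x0 + RInt d x0 x).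
  { intros x Hx. apply Rminus_diag_uniq. apply cond_eq. intros eps Heps.
    (* Two units pay for replacing [f] by [g] at x and x0, and x0 units for the mean value estimate,
       as |x - x0| <= x0. *)
    set (eta := eps / (2 * (2 + x0))).
    assert (He : 0 < eta) by (apply Rdiv_lt_0_compat; lra).
    destruct (H (x0 / 2) (2 * x0) eta) as [g [dg [Hg Hc]]]; [lra | auto |].
    destruct (MVT_gen (fun y => g y - RInt d x0 y) x0 x (fun y => dg y - d y)) as [c [Hc1 Hc2]].
    - intros y Hy. apply (is_derive_minus (K := R_AbsRing) (V := R_NormedModule) g (fun y => RInt d x0 y)).
      + apply Hg. revert Hy; unfold Rmin, Rmax; destruct (Rle_dec x0 x); lra.
      + apply HI. revert Hy; unfold Rmin, Rmax; destruct (Rle_dec x0 x); lra.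
    - intros y Hy. apply (is_derive_continuity_pt _ _ (dg y - d y)).
      apply (is_derive_minus (K := R_AbsRing) (V := R_NormedModule) g (fun y => RInt d x0 y)).
      + apply Hg. revert Hy; unfold Rmin, Rmax; destruct (Rle_dec x0 x); lra.
      + apply HI. revert Hy; unfold Rmin, Rmax; destruct (Rle_dec x0 x); lra.
    - rewrite RInt_point in Hc2. change (zero : R) with 0 in Hc2.
      assert (Hcr : x0 / 2 <= c <= 2 * x0)
        by (revert Hc1; unfold Rmin, Rmax; destruct (Rle_dec x0 x); lra).
      destruct (Hc c Hcr) as [_ H1].
      destruct (Hc x Hx) as [H2 _]. destruct (Hc x0 ltac:(lra)) as [H3 _].
      rewrite Rabs_minus_sym in H1.
      assert (Rabs ((dg c - d c) * (x - x0)) <= eta * x0).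
      { rewrite Rabs_mult. apply Rmult_le_compat; auto using Rabs_pos. apply Rabs_le; lra. }
      apply Rle_lt_trans with (eta * (2 + x0)); [|unfold eta].
      + rewrite <- Hc2 in H0. apply Rabs_le_between in H0, H2, H3. apply Rabs_le. lra.
      + replace (eps / (2 * (2 + x0)) * (2 + x0)) with (eps / 2) by (field; lra). lra. }
  apply (is_derive_ext_loc (fun x => plus (f x0) (RInt d x0 x))).
  - exists (mkposreal (x0 / 2) ltac:(lra)). intros y Hy. symmetry. apply E.
    change (Rabs (y - x0) < x0 / 2) in Hy. apply Rabs_def2 in Hy. lra.
  - evar_last.
    + apply (is_derive_plus (K := R_AbsRing) (V := R_NormedModule)); [apply is_derive_const | apply HI; auto].
    + apply Rplus_0_l.
Qed.

(** This is D f = e for D = (1 / be) x d/dx, restricted to x > 0 because members of the balls are in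
    general only Hölder at the origin. *)
Definition scder (be : R) (f e : R -> C) : Prop :=
  forall x, 0 < x -> cderive f x (RtoC (be / x) * e x)%C.

Definition Ccont (f : R -> C) (x : R) : Prop :=
  continuous (fun y => fst (f y)) x /\ continuous (fun y => snd (f y)) x.

Lemma RtoC_mult_pair (a : R) (z : C) : (RtoC a * z)%C = (a * fst z, a * snd z).
Proof. apply injective_projections; simpl; ring. Qed.

Lemma Ccont_mod (f : R -> C) (x : R) :
  (forall eta, 0 < eta -> exists d, 0 < d /\ forall y, Rabs (y - x) < d -> Cmod (f y - f x) <= eta) ->
  Ccont f x.
Proof.
  intros H. split; apply continuity_pt_filterlim; intros eta He;
    (destruct (H (eta / 2)) as [d [Hd Hd']]; [lra|]); exists d; (split; [exact Hd|]);
    intros y [_ Hy]; specialize (Hd' y Hy); simpl; unfold R_dist.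
  - pose proof (Rabs_fst_Cmod (f y - f x)) as Hf. change (fst (f y - f x)%C) with (fst (f y) - fst (f x)) in Hf. lra.
  - pose proof (Rabs_snd_Cmod (f y - f x)) as Hf. change (snd (f y - f x)%C) with (snd (f y) - snd (f x)) in Hf. lra.
Qed.

Lemma wball_modulus (w : R -> R) (s M : R) (f : R -> C) (x : R) :
  holder_weight w s -> weight w -> wball w M f -> 0 <= x ->
  forall eta, 0 < eta -> exists d, 0 < d /\ forall y, 0 <= y -> Rabs (y - x) < d -> Cmod (f y - f x) <= eta.
Proof.
  intros Hs Hw Hf Hx eta He.
  pose proof (wball_nonneg w Hw M f Hf) as HM.
  destruct (Rpower_small s (eta / (2 * (M + 1)))) as [d [Hd Hd']].
  { apply Hs. } { apply Rdiv_lt_0_compat; lra. }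
  exists d. split; auto. intros y Hy Hyx.
  destruct (Req_dec y x) as [->|Hne].
  - replace (f x - f x)%C with (RtoC 0) by ring. rewrite Cmod_0. lra.
  - eapply Rle_trans; [apply (wball_holder w s M f y x Hs Hf); auto|].
    assert (0 < Rabs (y - x)) by (apply Rabs_pos_lt; lra).
    specialize (Hd' (Rabs (y - x)) ltac:(lra)).
    apply Rle_trans with (2 * (eta / (2 * (M + 1))) * (M + 1)); [|right; field; lra].
    pose proof (Rpower_pos (Rabs (y - x)) s). apply Rmult_le_compat; lra.
Qed.

Lemma wball_Ccont (w : R -> R) (s M : R) (f : R -> C) (x : R) :
  holder_weight w s -> weight w -> wball w M f -> 0 < x -> Ccont f x.
Proof.
  intros Hs Hw Hf Hx. apply Ccont_mod. intros eta He.
  destruct (wball_modulus w s M f x Hs Hw Hf ltac:(lra) eta He) as [d [Hd Hd']].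
  exists (Rmin d x). split; [apply Rmin_pos; auto|]. intros y Hy.
  pose proof (Rmin_l d x). pose proof (Rmin_r d x).
  apply Hd'; [|lra]. apply Rabs_def2 in Hy. lra.
Qed.

Lemma Ccont_real (f : R -> C) (c : R -> R) (x : R) :
  continuous c x -> Ccont f x -> Ccont (fun y => RtoC (c y) * f y)%C x.
Proof.
  intros Hc [H1 H2]. split.
  - apply continuous_ext with (fun y => c y * fst (f y)); [intros; simpl; real_eq; ring|].
    apply (continuous_mult (K := R_AbsRing)); auto.
  - apply continuous_ext with (fun y => c y * snd (f y)); [intros; simpl; real_eq; ring|].
    apply (continuous_mult (K := R_AbsRing)); auto.
Qed.

Lemma continuous_div_x (be x : R) : 0 < x -> continuous (fun y => be / y) x.
Proof.
  intros Hx. apply (ex_derive_continuous (K := R_AbsRing) (V := R_NormedModule)).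
  auto_derive. lra.
Qed.

Lemma scder_limit (be : R) (f e : R -> C) :
  (forall x, 0 < x -> Ccont e x) ->
  (forall x1 x2 eta, 0 < x1 < x2 -> 0 < eta -> exists g eg, scder be g eg /\
     forall x, x1 <= x <= x2 -> Cmod (f x - g x) <= eta /\ Cmod (e x - eg x) <= eta) ->
  scder be f e.
Proof.
  intros He H.
  assert (Hlim : forall x1 x2 eta, 0 < x1 < x2 -> 0 < eta -> exists g eg, scder be g eg /\
     forall x, x1 <= x <= x2 -> Cmod (f x - g x) <= eta /\
       Cmod (RtoC (be / x) * e x - RtoC (be / x) * eg x) <= eta).
  { intros x1 x2 eta Hx Heta. pose proof (Rabs_pos be) as Hbe.
    set (eta' := Rmin eta (eta * x1 / (Rabs be + 1))).
    assert (He' : 0 < eta').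
    { apply Rmin_pos; auto. apply Rdiv_lt_0_compat; nra. }
    destruct (H x1 x2 eta' Hx He') as [g [eg [Hg Hc]]].
    exists g, eg. split; auto. intros x Hxx. destruct (Hc x Hxx) as [H1 H2]. split.
    - eapply Rle_trans; [exact H1 | apply Rmin_l].
    - replace (RtoC (be / x) * e x - RtoC (be / x) * eg x)%C
        with (RtoC (be / x) * (e x - eg x))%C by ring.
      rewrite Cmod_mult, Cmod_R. unfold Rdiv. rewrite Rabs_mult, (Rabs_pos_eq (/ x)).
      2: { left. apply Rinv_0_lt_compat. lra. }
      assert (Hx1 : / x <= / x1) by (apply Rinv_le_contravar; lra).
      assert (0 < / x) by (apply Rinv_0_lt_compat; lra).
      apply Rle_trans with ((Rabs be + 1) * / x1 * (eta * x1 / (Rabs be + 1))).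
      + apply Rmult_le_compat; auto using Cmod_ge_0.
        * nra.
        * apply Rmult_le_compat; lra.
        * eapply Rle_trans; [exact H2 | apply Rmin_r].
      + right. field. lra. }
  assert (Hcont : forall x, 0 < x -> Ccont (fun y => RtoC (be / y) * e y)%C x).
  { intros x Hx. apply Ccont_real; auto. apply continuous_div_x, Hx. }
  intros x Hx. split.
  - apply (derive_limit (fun y => fst (f y)) (fun y => fst (RtoC (be / y) * e y)%C)); auto.
    + intros y Hy. exact (proj1 (Hcont y Hy)).
    + intros x1 x2 eta Hx12 Heta. destruct (Hlim x1 x2 eta Hx12 Heta) as [g [eg [Hg Hc]]].
      exists (fun y => fst (g y)), (fun y => fst (RtoC (be / y) * eg y)%C). split.
      * intros y Hy. apply Hg. lra.
      * intros y Hy. destruct (Hc y Hy) as [H1 H2]. split.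
        -- eapply Rle_trans; [apply (Rabs_fst_Cmod (f y - g y)) | exact H1].
        -- eapply Rle_trans; [apply (Rabs_fst_Cmod (RtoC (be / y) * e y - RtoC (be / y) * eg y)) | exact H2].
  - apply (derive_limit (fun y => snd (f y)) (fun y => snd (RtoC (be / y) * e y)%C)); auto.
    + intros y Hy. exact (proj2 (Hcont y Hy)).
    + intros x1 x2 eta Hx12 Heta. destruct (Hlim x1 x2 eta Hx12 Heta) as [g [eg [Hg Hc]]].
      exists (fun y => snd (g y)), (fun y => snd (RtoC (be / y) * eg y)%C). split.
      * intros y Hy. apply Hg. lra.
      * intros y Hy. destruct (Hc y Hy) as [H1 H2]. split.
        -- eapply Rle_trans; [apply (Rabs_snd_Cmod (f y - g y)) | exact H1].
        -- eapply Rle_trans; [apply (Rabs_snd_Cmod (RtoC (be / y) * e y - RtoC (be / y) * eg y)) | exact H2].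
Qed.

Lemma scder_ext (be : R) (f g e e' : R -> C) :
  (forall x, 0 < x -> f x = g x) -> (forall x, 0 < x -> e x = e' x) ->
  scder be f e -> scder be g e'.
Proof.
  intros Ef Ee H x Hx. destruct (H x Hx) as [H1 H2]. rewrite <- Ee by auto.
  assert (L : forall P : R -> Prop, (forall y, 0 < y -> P y) -> locally x P).
  { intros P HP. exists (mkposreal x Hx). intros y Hy. apply HP.
    change (Rabs (y - x) < x) in Hy. apply Rabs_def2 in Hy. lra. }
  split; [apply (is_derive_ext_loc (fun y => fst (f y))) | apply (is_derive_ext_loc (fun y => snd (f y)))];
    auto; apply L; intros y Hy; rewrite Ef; auto.
Qed.

Lemma scder_plus (be : R) (f g ef eg : R -> C) :
  scder be f ef -> scder be g eg -> scder be (fun x => f x + g x)%C (fun x => ef x + eg x)%C.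
Proof.
  intros Hf Hg x Hx. destruct (Hf x Hx) as [F1 F2]. destruct (Hg x Hx) as [G1 G2].
  split; (evar_last; [apply (is_derive_plus (K := R_AbsRing) (V := R_NormedModule)); eassumption|]);
    unfold plus; simpl; ring.
Qed.

Lemma scder_mult (be : R) (f g ef eg : R -> C) :
  scder be f ef -> scder be g eg ->
  scder be (fun x => f x * g x)%C (fun x => ef x * g x + f x * eg x)%C.
Proof.
  intros Hf Hg x Hx. destruct (Hf x Hx) as [F1 F2]. destruct (Hg x Hx) as [G1 G2].
  assert (Hm : forall u v : R -> R, forall du dv, is_derive u x du -> is_derive v x dv ->
           is_derive (fun y => u y * v y) x (du * v x + u x * dv)).
  { intros u v du dv Hu Hv. evar_last.
    - apply (is_derive_mult u v x du dv Hu Hv). intros; apply Rmult_comm.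
    - reflexivity. }
  split; simpl.
  - evar_last; [apply (is_derive_minus (K := R_AbsRing) (V := R_NormedModule)); apply Hm; eassumption|].
    unfold minus, plus, opp; simpl. ring.
  - evar_last; [apply (is_derive_plus (K := R_AbsRing) (V := R_NormedModule)); apply Hm; eassumption|].
    unfold plus; simpl. ring.
Qed.

Lemma scder_const (be : R) (c : C) : scder be (fun _ => c) (fun _ => RtoC 0).
Proof.
  intros x Hx. split; (evar_last; [apply is_derive_const|]); simpl; unfold zero; simpl; ring.
Qed.

Lemma scder_scal (be : R) (c : C) (f e : R -> C) :
  scder be f e -> scder be (fun x => c * f x)%C (fun x => c * e x)%C.
Proof.
  intros H. eapply scder_ext; [| |apply (scder_mult be (fun _ => c) f (fun _ => RtoC 0) e)]; auto.
  - intros x _; simpl. ring.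
  - apply scder_const.
Qed.

Lemma scder_minus (be : R) (f g ef eg : R -> C) :
  scder be f ef -> scder be g eg -> scder be (fun x => f x - g x)%C (fun x => ef x - eg x)%C.
Proof.
  intros Hf Hg. pose proof (scder_plus _ _ _ _ _ Hf (scder_scal be (-1) g eg Hg)) as H.
  eapply scder_ext; [| |exact H]; intros x _; simpl; ring.
Qed.

(** The common device for solving equations: regularize, bound the approximate solutions in one
    ball, take a cluster point. Along it the right-hand sides Phi(f_n) + r_n converge locally
    uniformly on x > 0, as [Phi] is Lipschitz on the range of the ball, so the limit solves the
    equation. *)
Lemma cluster_ode (w : R -> R) (s M be L : R) (Phi : C -> C) (fn rn : nat -> R -> C) (r : R -> C) :
  weight w -> holder_weight w s ->
  (forall n, wball w M (fn n)) ->
  (forall z z', Cmod z <= M -> Cmod z' <= M -> Cmod (Phi z - Phi z') <= L * Cmod (z - z')) ->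
  (forall n, scder be (fn n) (fun x => Phi (fn n x) + rn n x)%C) ->
  (forall x, 0 < x -> Ccont r x) ->
  (forall x1 x2 eta, 0 < x1 < x2 -> 0 < eta -> exists N, forall n x, (N <= n)%nat ->
     x1 <= x <= x2 -> Cmod (r x - rn n x) <= eta) ->
  exists f, wball w M f /\ scder be f (fun x => Phi (f x) + r x)%C /\
    (forall X eta N, 0 < eta ->
      exists n, (N <= n)%nat /\ forall x, 0 <= x <= X -> Cmod (f x - fn n x) <= eta).
Proof.
  intros Hw Hs Hfn HPhi Hode Hr Hrn.
  destruct (wball_cluster w s M fn Hw Hs Hfn) as [f [Hf Hc]].
  exists f. split; auto. split; auto.
  pose proof (Rabs_pos L) as HL.
  assert (HPhi' : forall z z', Cmod z <= M -> Cmod z' <= M ->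
            Cmod (Phi z - Phi z') <= (Rabs L + 1) * Cmod (z - z')).
  { intros z z' Hz Hz'. eapply Rle_trans; [apply HPhi; auto|].
    pose proof (Rle_abs L). pose proof (Cmod_ge_0 (z - z')). nra. }
  apply scder_limit.
  - intros x Hx.
    assert (HA : Ccont (fun y => Phi (f y)) x).
    { apply Ccont_mod. intros eta He.
      destruct (wball_modulus w s M f x Hs Hw Hf ltac:(lra) (eta / (Rabs L + 1))) as [d [Hd Hd']].
      { apply Rdiv_lt_0_compat; lra. }
      exists (Rmin d x). split; [apply Rmin_pos; auto|]. intros y Hy.
      pose proof (Rmin_l d x). pose proof (Rmin_r d x).
      assert (Hy0 : 0 <= y) by (apply Rabs_def2 in Hy; lra).
      eapply Rle_trans; [apply HPhi'; apply (wball_bound w Hw M f Hf); lra|].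
      apply Rle_trans with ((Rabs L + 1) * (eta / (Rabs L + 1))); [|right; field; lra].
      apply Rmult_le_compat_l; [lra|]. apply Hd'; lra. }
    destruct HA as [A1 A2]. destruct (Hr x Hx) as [R1 R2].
    split; apply (continuous_plus (K := R_AbsRing) (V := R_NormedModule)); auto.
  - intros x1 x2 eta Hx He.
    destruct (Hrn x1 x2 (eta / 2) Hx ltac:(lra)) as [N HN].
    set (eta' := Rmin eta (eta / (2 * (Rabs L + 1)))).
    assert (He' : 0 < eta').
    { apply Rmin_pos; auto. apply Rdiv_lt_0_compat; lra. }
    destruct (Hc x2 eta' N He') as [n [Hn Hn']].
    exists (fn n), (fun x => Phi (fn n x) + rn n x)%C. split; auto.
    intros x Hxx. specialize (Hn' x ltac:(lra)). split.
    + eapply Rle_trans; [exact Hn' | apply Rmin_l].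
    + replace (Phi (f x) + r x - (Phi (fn n x) + rn n x))%C
        with ((Phi (f x) - Phi (fn n x)) + (r x - rn n x))%C by ring.
      eapply Rle_trans; [apply Cmod_triangle|].
      specialize (HN n x Hn Hxx).
      assert (Cmod (Phi (f x) - Phi (fn n x)) <= eta / 2); [|lra].
      eapply Rle_trans; [apply HPhi'|].
      * apply (wball_bound w Hw M f Hf); lra.
      * apply (wball_bound w Hw M (fn n) (Hfn n)); lra.
      * apply Rle_trans with ((Rabs L + 1) * (eta / (2 * (Rabs L + 1)))); [|right; field; lra].
        apply Rmult_le_compat_l; [lra|]. eapply Rle_trans; [exact Hn' | apply Rmin_r].
Qed.

(** * Inverting the linearized operator *)

(** The fraction q = a / (k + l) lies in (0, 1], hence q <= q^s; the cases a = k and a = l are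
    added. *)
Lemma Rpower_subadd (k l s : R) : 0 < k -> 0 < l -> 0 < s <= 1 ->
  Rpower (k + l) s <= Rpower k s + Rpower l s.
Proof.
  intros Hk Hl Hs.
  assert (H : forall a, 0 < a <= k + l -> a / (k + l) * Rpower (k + l) s <= Rpower a s).
  { intros a Ha.
    assert (Hq : 0 < a / (k + l)) by (apply Rdiv_lt_0_compat; lra).
    assert (Hq1 : a / (k + l) <= 1) by (apply Rle_div_l; lra).
    replace (Rpower a s) with (Rpower (a / (k + l)) s * Rpower (k + l) s).
    - apply Rmult_le_compat_r; [left; apply Rpower_pos|].
      eapply Rle_trans; [|apply (min_le_Rpower _ s Hq Hs)]. rewrite Rmin_right; lra.
    - rewrite Rpower_mult_distr by lra. f_equal. field. lra. }
  pose proof (H k ltac:(lra)). pose proof (H l ltac:(lra)).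
  replace (Rpower (k + l) s) with (k / (k + l) * Rpower (k + l) s + l / (k + l) * Rpower (k + l) s)
    by (field; lra). lra.
Qed.

(** The first power yields the Hölder bound and the convergence of principal values at the
    singularity; the second yields their convergence at infinity, where low frequencies matter. *)
Definition omega (s k : R) : R := Rpower k s + Rpower k (- (s / 3)).

Lemma Rpower_neg_ge_1 (k s : R) : 0 < k <= 1 -> 0 <= s -> 1 <= Rpower k (- s).
Proof.
  intros Hk Hs. rewrite Rpower_Ropp. rewrite <- Rinv_1.
  apply Rinv_le_contravar; [apply Rpower_pos | apply Rpower_le_1; auto].
Qed.

Lemma Rpower_neg_antimono (x y s : R) : 0 < x <= y -> 0 <= s -> Rpower y (- s) <= Rpower x (- s).
Proof.
  intros H Hs. rewrite !Rpower_Ropp. apply Rinv_le_contravar; [apply Rpower_pos|].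
  apply Rle_Rpower_l; lra.
Qed.

Lemma omega_weight (s : R) : 0 < s <= 1 -> weight (omega s).
Proof.
  intros Hs k Hk. unfold omega. pose proof (Rpower_pos k s). pose proof (Rpower_pos k (- (s / 3))).
  destruct (Rle_dec 1 k) as [Hk1|Hk1].
  - pose proof (Rpower_ge_1 k s ltac:(lra) ltac:(lra)). lra.
  - pose proof (Rpower_neg_ge_1 k (s / 3) ltac:(lra) ltac:(lra)). lra.
Qed.

Lemma omega_holder (s : R) : 0 < s <= 1 -> holder_weight (omega s) s.
Proof.
  intros Hs. split; auto. intros k Hk. unfold omega. pose proof (Rpower_pos k (- (s / 3))). lra.
Qed.

Lemma omega_add (s k l : R) : 0 < s <= 1 -> 0 < k -> 0 < l ->
  omega s (k + l) <= omega s k + omega s l.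
Proof.
  intros Hs Hk Hl. unfold omega.
  pose proof (Rpower_subadd k l s Hk Hl Hs).
  pose proof (Rpower_neg_antimono k (k + l) (s / 3) ltac:(lra) ltac:(lra)).
  pose proof (Rpower_pos l (- (s / 3))). lra.
Qed.

(** Subadditivity combined with x + y <= 2 x y, valid as both values of the weight are at least
    1. *)
Lemma omega_submult (s k l : R) : 0 < s <= 1 -> 0 < k -> 0 < l ->
  omega s (k + l) <= 2 * omega s k * omega s l.
Proof.
  intros Hs Hk Hl. pose proof (omega_add s k l Hs Hk Hl).
  pose proof (omega_weight s Hs k Hk). pose proof (omega_weight s Hs l Hl). nra.
Qed.

Lemma wball_omega_mult (s M1 M2 : R) (f g : R -> C) : 0 < s <= 1 ->
  wball (omega s) M1 f -> wball (omega s) M2 g ->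
  wball (omega s) (2 * M1 * M2) (fun x => f x * g x)%C.
Proof.
  intros Hs Hf Hg. apply (wball_mult (omega s) (omega s) (omega s)); auto using omega_weight; [lra|].
  intros k l Hk Hl. apply omega_submult; auto.
Qed.

Lemma Ccont_plus (f g : R -> C) (x : R) : Ccont f x -> Ccont g x -> Ccont (fun y => f y + g y)%C x.
Proof.
  intros [F1 F2] [G1 G2].
  split; apply (continuous_plus (K := R_AbsRing) (V := R_NormedModule)); auto.
Qed.

Lemma Ccont_scal (c : C) (f : R -> C) (x : R) : Ccont f x -> Ccont (fun y => c * f y)%C x.
Proof.
  intros [F1 F2]. split.
  - apply (continuous_minus (K := R_AbsRing) (V := R_NormedModule)
      (fun y => fst c * fst (f y)) (fun y => snd c * snd (f y)));
      apply (continuous_mult (K := R_AbsRing)); auto; apply continuous_const.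
  - apply (continuous_plus (K := R_AbsRing) (V := R_NormedModule)
      (fun y => fst c * snd (f y)) (fun y => snd c * fst (f y)));
      apply (continuous_mult (K := R_AbsRing)); auto; apply continuous_const.
Qed.

Lemma Ccont_ek (k x : R) : Ccont (ek k) x.
Proof.
  split; simpl.
  - apply continuous_ext with (fun y => cos (y * k)); [intros; f_equal; real_eq; ring|].
    apply continuous_scale_arg, continuous_cos.
  - apply continuous_ext with (fun y => sin (y * k)); [intros; f_equal; real_eq; ring|].
    apply continuous_scale_arg, continuous_sin.
Qed.

(** Linear extension of an operator known on the exponentials: [O k] is the image of [ek k]. *)
Fixpoint evO (O : R -> R -> C) (l : list (R * R)) (x : R) : C :=
  match l with
  | nil => RtoC 0
  | (c, k) :: t => (RtoC c * O k x + evO O t x)%C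
  end.

Lemma evO_wball (w : R -> R) (Cc : R) (O : R -> R -> C) (l : list (R * R)) :
  weight w -> posl l -> (forall k, 0 < k -> wball w (Cc * w k) (O k)) ->
  wball w (Cc * cost w l) (evO O l).
Proof.
  intros Hw Hl HO. induction Hl as [|[c k] t H H' IH]; simpl.
  - rewrite Rmult_0_r. apply wball_0; auto.
  - apply wball_mono with (Rabs c * (Cc * w k) + Cc * cost w t); [lra|].
    apply (wball_add w (Rabs c * (Cc * w k)) (Cc * cost w t) (fun x => RtoC c * O k x)%C (evO O t)); auto.
    apply wball_scal. apply HO, H.
Qed.

(** Range and tolerance are tied to the same n, so that a single sequence approximates on every
    bounded set. *)
Lemma lists_approx (w : R -> R) (M : R) (g : R -> C) : wball w M g ->
  exists ln : nat -> list (R * R), forall n, posl (ln n) /\ cost w (ln n) <= M /\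
    forall x, 0 <= x <= INR n -> Cmod (g x - ev (ln n) x) <= / (INR n + 1).
Proof.
  intros Hg.
  assert (H : forall n : nat, exists l, posl l /\ cost w l <= M /\
    forall x, 0 <= x <= INR n -> Cmod (g x - ev l x) <= / (INR n + 1)).
  { intros n. apply Hg. apply Rinv_0_lt_compat. pose proof (pos_INR n). lra. }
  exists (fun n => proj1_sig (constructive_indefinite_description _ (H n))).
  intros n. destruct (constructive_indefinite_description _ (H n)) as [l Hl]. exact Hl.
Qed.

Lemma inv_small (eta : R) : 0 < eta -> exists N : nat, forall n, (N <= n)%nat -> / (INR n + 1) <= eta.
Proof.
  intros He. destruct (nat_above (/ eta)) as [N HN]. exists N. intros n Hn.
  apply le_INR in Hn. rewrite <- (Rinv_inv eta).
  apply Rinv_le_contravar; [apply Rinv_0_lt_compat; auto | lra].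
Qed.

(** A solution operator given on exponentials extends to combinations by linearity and to balls by
    [cluster_ode]. The parameters [ka], [s0], [ta] cover the three model equations; [g 0] appears
    because every exponential is 1 at 0, so that the coefficient of [ek 1] extends linearly to
    [g 0]. *)
Lemma lift_operator (w : R -> R) (s be Cc ka s0 ta : R) :
  weight w -> holder_weight w s -> 0 <= Cc ->
  (forall k, 0 < k -> exists O, wball w (Cc * w k) O /\
     scder be O (fun x => RtoC ka * O x + RtoC s0 * (ek k x - RtoC ta * ek 1 x))%C) ->
  forall M g, wball w M g -> exists f, wball w (Cc * M) f /\
    scder be f (fun x => RtoC ka * f x + RtoC s0 * (g x - RtoC ta * g 0 * ek 1 x))%C.
Proof.
  intros Hw Hs HCc HO0 M g Hg.
  assert (HO1 : forall k, exists O, 0 < k -> wball w (Cc * w k) O /\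
     scder be O (fun x => RtoC ka * O x + RtoC s0 * (ek k x - RtoC ta * ek 1 x))%C).
  { intros k. destruct (Rlt_dec 0 k) as [Hk|Hk].
    - destruct (HO0 k Hk) as [O HO]. exists O; auto.
    - exists (fun _ => RtoC 0). intros; contradiction. }
  set (O := fun k => proj1_sig (constructive_indefinite_description _ (HO1 k))).
  assert (HO : forall k, 0 < k -> wball w (Cc * w k) (O k) /\
     scder be (O k) (fun x => RtoC ka * O k x + RtoC s0 * (ek k x - RtoC ta * ek 1 x))%C).
  { intros k. unfold O. destruct (constructive_indefinite_description _ (HO1 k)); auto. }
  clearbody O. clear HO0 HO1.
  destruct (lists_approx w M g Hg) as [ln Hln].
  assert (Hode : forall l, posl l -> scder be (evO O l)
     (fun x => RtoC ka * evO O l x + RtoC s0 * (ev l x - RtoC ta * ev l 0 * ek 1 x))%C).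
  { intros l Hl. induction Hl as [|[c k] t H H' IH]; simpl.
    - eapply scder_ext; [| |apply (scder_const be (RtoC 0))]; intros x _; simpl; ring.
    - simpl in H. destruct (HO k H) as [_ Hk].
      eapply scder_ext; [| |apply (scder_plus be _ _ _ _ (scder_scal be (RtoC c) _ _ Hk) IH)];
        intros x _; simpl; [reflexivity|]. rewrite ek_0. ring. }
  destruct (cluster_ode w s (Cc * M) be (Rabs ka) (fun z => RtoC ka * z)%C
     (fun n => evO O (ln n))
     (fun n x => RtoC s0 * (ev (ln n) x - RtoC ta * ev (ln n) 0 * ek 1 x))%C
     (fun x => RtoC s0 * (g x - RtoC ta * g 0 * ek 1 x))%C) as [f [Hf1 [Hf2 _]]]; auto.
  - intros n. destruct (Hln n) as [H1 [H2 _]].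
    apply wball_mono with (Cc * cost w (ln n)); [nra|].
    apply evO_wball; auto. intros k Hk. apply HO, Hk.
  - intros z z' _ _. replace (ka * z - ka * z')%C with (RtoC ka * (z - z'))%C by ring.
    rewrite Cmod_mult, Cmod_R. lra.
  - intros n. apply Hode. apply Hln.
  - intros x Hx. apply Ccont_scal. apply Ccont_plus.
    + apply (wball_Ccont w s M g x); auto.
    + pose proof (Ccont_scal (- (RtoC ta * g 0))%C (ek 1) x (Ccont_ek 1 x)) as [H1 H2].
      split; [apply (continuous_ext _ _ _) with (2 := H1) | apply (continuous_ext _ _ _) with (2 := H2)];
        intros y; simpl; real_eq; ring.
  - intros x1 x2 eta Hx He.
    set (K := Rabs s0 * (1 + Rabs ta)).
    assert (HK : 0 <= K) by (unfold K; pose proof (Rabs_pos s0); pose proof (Rabs_pos ta); nra).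
    destruct (inv_small (eta / (K + 1))) as [N HN]; [apply Rdiv_lt_0_compat; lra|].
    destruct (nat_above x2) as [N' HN'].
    exists (Nat.max N N'). intros n x Hn Hxx.
    destruct (Hln n) as [_ [_ H3]].
    assert (Hxn : x <= INR n).
    { apply Rle_trans with (INR N'); [lra|]. apply le_INR. lia. }
    pose proof (H3 x ltac:(lra)) as Ha. pose proof (H3 0 ltac:(lra)) as Hb.
    specialize (HN n ltac:(lia)).
    replace (s0 * (g x - ta * g 0 * ek 1 x) - s0 * (ev (ln n) x - ta * ev (ln n) 0 * ek 1 x))%C
      with (RtoC s0 * ((g x - ev (ln n) x) + - (RtoC ta * (g 0 - ev (ln n) 0) * ek 1 x)))%C by ring.
    rewrite Cmod_mult, Cmod_R.
    assert (Hc : Cmod ((g x - ev (ln n) x) + - (RtoC ta * (g 0 - ev (ln n) 0) * ek 1 x))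
            <= (1 + Rabs ta) * (eta / (K + 1))).
    { eapply Rle_trans; [apply Cmod_triangle|].
      rewrite Cmod_opp, !Cmod_mult, Cmod_R, Cmod_ek, Rmult_1_r. pose proof (Rabs_pos ta). nra. }
    apply Rle_trans with (K * (eta / (K + 1))).
    + unfold K at 1. rewrite Rmult_assoc. apply Rmult_le_compat_l; auto using Rabs_pos.
    + apply Rle_trans with ((K + 1) * (eta / (K + 1))); [|right; field; lra].
      apply Rmult_le_compat_r; [|lra]. apply Rdiv_le_0_compat; lra.
  - exists f. auto.
Qed.

(** * Model equations with one exponential as data *)

Section Atoms.
Variables s be : R.
Hypothesis Hs : 0 < s <= 1.
(** The lower bound gives be - s >= be / 4 and the upper one be / s <= 3 / 2; these ratios keep the
    constants 4 and 9 below uniform as [s] tends to 0. *)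
Hypothesis Hbe : 4 * s / 3 <= be <= 3 * s / 2.

Lemma pint_wball (th a b : R) : 0 < a <= b -> th + s <> 0 -> th - s / 3 <> 0 ->
  wball (omega s) ((Rpower b (th + s) - Rpower a (th + s)) / (th + s)
    + (Rpower b (th - s / 3) - Rpower a (th - s / 3)) / (th - s / 3)) (pint th a b).
Proof.
  intros Hab H1 H2.
  set (m := fun u => plus (Rpower u (th + s - 1)) (Rpower u (th - s / 3 - 1))).
  replace ((Rpower b (th + s) - Rpower a (th + s)) / (th + s)
    + (Rpower b (th - s / 3) - Rpower a (th - s / 3)) / (th - s / 3)) with (RInt m a b).
  - apply (wball_density (omega s) a b (fun u => Rpower u (th - 1)) m); auto using omega_weight.
    + intros u Hu. apply continuous_Rpower; lra.
    + intros u Hu. apply (continuous_plus (K := R_AbsRing) (V := R_NormedModule));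
        apply continuous_Rpower; lra.
    + intros u Hu. rewrite Rabs_pos_eq by (left; apply Rpower_pos).
      unfold omega, m, plus; simpl. rewrite Rmult_plus_distr_l, <- !Rpower_plus.
      right. f_equal; f_equal; ring.
  - apply is_RInt_unique.
    apply (is_RInt_plus (V := R_NormedModule)); apply is_RInt_Rpower; auto; lra.
Qed.

Lemma scder_pint (c th a b : R) : 0 < a -> 0 < b ->
  scder be (fun x => RtoC c * pint th a b x)%C
    (fun x => RtoC (c * Rpower b th / be) * ek b x - RtoC (c * Rpower a th / be) * ek a x
              - RtoC (c * th / be) * pint th a b x)%C.
Proof.
  intros Ha Hb.
  assert (Hb0 : RtoC be <> RtoC 0) by (intros E; apply RtoC_inj in E; lra).
  assert (H : scder be (pint th a b) (fun x => RtoC (/ be) *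
     (RtoC (Rpower b th) * ek b x - RtoC (Rpower a th) * ek a x - RtoC th * pint th a b x))%C).
  { intros x Hx. cbv beta.
    assert (Hx0 : RtoC x <> RtoC 0) by (intros E; apply RtoC_inj in E; lra).
    replace (RtoC (be / x) * (RtoC (/ be) *
     (RtoC (Rpower b th) * ek b x - RtoC (Rpower a th) * ek a x - RtoC th * pint th a b x)))%C
    with ((RtoC (Rpower b th) * ek b x - RtoC (Rpower a th) * ek a x - RtoC th * pint th a b x) / RtoC x)%C.
    - apply pint_derive; auto.
    - unfold Rdiv. rewrite RtoC_mult, !RtoC_inv by lra. field. auto. }
  eapply scder_ext; [intros; reflexivity| |apply (scder_scal be (RtoC c) _ _ H)].
  intros x _. cbv beta. unfold Rdiv. rewrite !RtoC_mult. ring.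
Qed.

Lemma Cmod_Rpower_ek_small (p eta : R) (k : nat -> R) : 0 < p -> 0 < eta ->
  exists N : nat, forall n x, (N <= n)%nat ->
    Cmod (RtoC (Rpower (/ (INR n + 1)) p) * ek (k n) x) <= eta.
Proof.
  intros Hp He. destruct (Rpower_small p eta Hp He) as [d [Hd Hd']].
  destruct (inv_small d Hd) as [N HN]. exists N. intros n x Hn.
  rewrite Cmod_mult, Cmod_R, Cmod_ek, Rmult_1_r, Rabs_pos_eq by (left; apply Rpower_pos).
  apply Hd'. split; auto. apply Rinv_0_lt_compat. pose proof (pos_INR n). lra.
Qed.

Lemma Ccont_Rek (c : C) (k x : R) : Ccont (fun y => c * ek k y)%C x.
Proof. apply Ccont_scal, Ccont_ek. Qed.

(** The solution is be k^(-be) times the integral of m^(be - 1) [ek m] over 0 < m < k. The lower end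
    is first cut at k / (n + 1), which leaves an end term of size (n + 1)^(-be) as remainder. *)
Lemma atom_low (k : R) : 0 < k -> exists O, wball (omega s) (4 * omega s k) O /\
  scder be O (fun x => RtoC (-1) * O x + RtoC 1 * (ek k x - RtoC 0 * ek 1 x))%C.
Proof.
  intros Hk.
  set (a := fun n => k * / (INR n + 1)).
  assert (Ha : forall n, 0 < a n <= k).
  { intros n. unfold a. pose proof (pos_INR n).
    assert (0 < / (INR n + 1)) by (apply Rinv_0_lt_compat; lra).
    assert (/ (INR n + 1) <= 1) by (rewrite <- Rinv_1; apply Rinv_le_contravar; lra).
    nra. }
  set (c := be * Rpower k (- be)).
  assert (Hc : 0 <= c) by (unfold c; pose proof (Rpower_pos k (- be)); nra).
  assert (Hkb : Rpower k (- be) * Rpower k be = 1).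
  { rewrite <- Rpower_plus. replace (- be + be) with 0 by ring. apply Rpower_O; auto. }
  destruct (cluster_ode (omega s) s (4 * omega s k) be 1 (fun z => RtoC (-1) * z)%C
     (fun n x => RtoC c * pint be (a n) k x)%C
     (fun n x => ek k x - RtoC (Rpower (/ (INR n + 1)) be) * ek (a n) x)%C
     (ek k)) as [f [Hf1 [Hf2 _]]]; auto using omega_weight, omega_holder.
  - intros n. destruct (Ha n) as [Ha1 Ha2].
    eapply wball_mono; [|apply (wball_scal _ c); apply pint_wball; auto; lra].
    rewrite Rabs_pos_eq by auto. unfold c, omega.
    pose proof (Rpower_pos (a n) (be + s)). pose proof (Rpower_pos (a n) (be - s / 3)).
    pose proof (Rpower_pos k (- be)). pose proof (Rpower_pos k s). pose proof (Rpower_pos k (- (s / 3))).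
    assert (E1 : Rpower k (be + s) = Rpower k be * Rpower k s) by apply Rpower_plus.
    assert (E2 : Rpower k (be - s / 3) = Rpower k be * Rpower k (- (s / 3))) by apply Rpower_plus.
    apply Rle_trans with (be * Rpower k (- be) * (Rpower k (be + s) / (be + s) + Rpower k (be - s / 3) / (be - s / 3))).
    { apply Rmult_le_compat_l; [nra|]. apply Rplus_le_compat; apply Rmult_le_compat_r; try lra;
        left; apply Rinv_0_lt_compat; lra. }
    rewrite E1, E2.
    replace (be * Rpower k (- be) * (Rpower k be * Rpower k s / (be + s) + Rpower k be * Rpower k (- (s / 3)) / (be - s / 3)))
      with ((Rpower k (- be) * Rpower k be) * (be / (be + s) * Rpower k s + be / (be - s / 3) * Rpower k (- (s / 3))))
      by (field; lra).
    rewrite Hkb, Rmult_1_l.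
    assert (be / (be + s) <= 4) by (apply Rle_div_l; lra).
    assert (be / (be - s / 3) <= 4) by (apply Rle_div_l; lra).
    nra.
  - intros z z' _ _. replace (-1 * z - -1 * z')%C with (RtoC (-1) * (z - z'))%C by ring.
    rewrite Cmod_mult, Cmod_R, Rabs_left by lra. lra.
  - intros n. destruct (Ha n) as [Ha1 Ha2].
    eapply scder_ext; [intros; reflexivity| |apply (scder_pint c be (a n) k); lra].
    intros x Hx. cbv beta.
    assert (E : Rpower (/ (INR n + 1)) be = Rpower k (- be) * Rpower (a n) be).
    { unfold a. pose proof (pos_INR n). rewrite <- Rpower_mult_distr; [|lra|apply Rinv_0_lt_compat; lra].
      rewrite <- Rmult_assoc, Hkb. ring. }
    rewrite E.
    replace (c * Rpower k be / be) with 1.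
    2: { unfold c. rewrite <- Hkb. field. lra. }
    replace (c * Rpower (a n) be / be) with (Rpower k (- be) * Rpower (a n) be) by (unfold c; field; lra).
    replace (c * be / be) with c by (field; lra).
    apply injective_projections; simpl; ring.
  - intros x Hx. apply Ccont_ek.
  - intros x1 x2 eta Hx He.
    destruct (Cmod_Rpower_ek_small be eta a ltac:(lra) He) as [N HN]. exists N. intros n x Hn _.
    replace (ek k x - (ek k x - Rpower (/ (INR n + 1)) be * ek (a n) x))%C
      with (RtoC (Rpower (/ (INR n + 1)) be) * ek (a n) x)%C by ring.
    apply HN, Hn.
  - exists f. split; auto. eapply scder_ext; [intros; reflexivity| |exact Hf2].
    intros x _. cbv beta. ring.
Qed.

(** The solution is be k^be times the integral of m^(- be - 1) [ek m] over m > k; against the growth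
    m^s of the weight it converges because be > s. *)
Lemma atom_high (k : R) : 0 < k -> exists O, wball (omega s) (4 * omega s k) O /\
  scder be O (fun x => RtoC 1 * O x + RtoC (-1) * (ek k x - RtoC 0 * ek 1 x))%C.
Proof.
  intros Hk.
  set (a := fun n => k * (INR n + 1)).
  assert (Ha : forall n, 0 < k <= a n).
  { intros n. unfold a. pose proof (pos_INR n). nra. }
  set (c := be * Rpower k be).
  assert (Hc : 0 <= c) by (unfold c; pose proof (Rpower_pos k be); nra).
  assert (Hkb : Rpower k be * Rpower k (- be) = 1).
  { rewrite <- Rpower_plus. replace (be + - be) with 0 by ring. apply Rpower_O; auto. }
  destruct (cluster_ode (omega s) s (4 * omega s k) be 1 (fun z => RtoC 1 * z)%C
     (fun n x => RtoC c * pint (- be) k (a n) x)%C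
     (fun n x => RtoC (Rpower (/ (INR n + 1)) be) * ek (a n) x - ek k x)%C
     (fun x => RtoC (-1) * ek k x)%C) as [f [Hf1 [Hf2 _]]]; auto using omega_weight, omega_holder.
  - intros n. pose proof (Ha n) as Han.
    eapply wball_mono; [|apply (wball_scal _ c); apply pint_wball; auto; lra].
    rewrite Rabs_pos_eq by auto. unfold c, omega.
    pose proof (Rpower_pos (a n) (- be + s)). pose proof (Rpower_pos (a n) (- be - s / 3)).
    pose proof (Rpower_pos k be). pose proof (Rpower_pos k s). pose proof (Rpower_pos k (- (s / 3))).
    assert (E1 : Rpower k (- be + s) = Rpower k (- be) * Rpower k s) by apply Rpower_plus.
    assert (E2 : Rpower k (- be - s / 3) = Rpower k (- be) * Rpower k (- (s / 3))) by apply Rpower_plus.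
    apply Rle_trans with (be * Rpower k be * (Rpower k (- be + s) / (be - s) + Rpower k (- be - s / 3) / (be + s / 3))).
    { apply Rmult_le_compat_l; [nra|]. apply Rplus_le_compat.
      - replace ((Rpower (a n) (- be + s) - Rpower k (- be + s)) / (- be + s))
          with ((Rpower k (- be + s) - Rpower (a n) (- be + s)) / (be - s)) by (field; lra).
        apply Rmult_le_compat_r; [left; apply Rinv_0_lt_compat; lra | lra].
      - replace ((Rpower (a n) (- be - s / 3) - Rpower k (- be - s / 3)) / (- be - s / 3))
          with ((Rpower k (- be - s / 3) - Rpower (a n) (- be - s / 3)) / (be + s / 3)) by (field; lra).
        apply Rmult_le_compat_r; [left; apply Rinv_0_lt_compat; lra | lra]. }
    rewrite E1, E2.
    replace (be * Rpower k be * (Rpower k (- be) * Rpower k s / (be - s) + Rpower k (- be) * Rpower k (- (s / 3)) / (be + s / 3)))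
      with ((Rpower k be * Rpower k (- be)) * (be / (be - s) * Rpower k s + be / (be + s / 3) * Rpower k (- (s / 3))))
      by (field; lra).
    rewrite Hkb, Rmult_1_l.
    assert (be / (be - s) <= 4) by (apply Rle_div_l; lra).
    assert (be / (be + s / 3) <= 4) by (apply Rle_div_l; lra).
    nra.
  - intros z z' _ _. replace (1 * z - 1 * z')%C with (z - z')%C by ring. lra.
  - intros n. pose proof (Ha n) as Han.
    eapply scder_ext; [intros; reflexivity| |apply (scder_pint c (- be) k (a n)); lra].
    intros x Hx. cbv beta.
    assert (E : Rpower (/ (INR n + 1)) be = Rpower k be * Rpower (a n) (- be)).
    { unfold a. pose proof (pos_INR n). rewrite <- Rpower_mult_distr by lra.
      rewrite <- Rmult_assoc, Hkb, Rmult_1_l. rewrite Rpower_Ropp.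
      unfold Rpower. rewrite ln_Rinv by lra. rewrite <- exp_Ropp. f_equal. ring. }
    rewrite E.
    replace (c * Rpower k (- be) / be) with 1.
    2: { unfold c. rewrite <- Hkb. field. lra. }
    replace (c * Rpower (a n) (- be) / be) with (Rpower k be * Rpower (a n) (- be)) by (unfold c; field; lra).
    replace (c * - be / be) with (- c) by (field; lra).
    apply injective_projections; simpl; ring.
  - intros x Hx. apply Ccont_Rek.
  - intros x1 x2 eta Hx He.
    destruct (Cmod_Rpower_ek_small be eta a ltac:(lra) He) as [N HN]. exists N. intros n x Hn _.
    rewrite Cmod_minus_sym.
    replace (Rpower (/ (INR n + 1)) be * ek (a n) x - ek k x - -1 * ek k x)%C
      with (RtoC (Rpower (/ (INR n + 1)) be) * ek (a n) x)%C
      by (apply injective_projections; simpl; ring).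
    apply HN, Hn.
  - exists f. split; auto. eapply scder_ext; [intros; reflexivity| |exact Hf2].
    intros x _. cbv beta. ring.
Qed.

Lemma pint_swap (th a b x : R) : 0 < a -> 0 < b -> pint th b a x = (RtoC (-1) * pint th a b x)%C.
Proof.
  intros Ha Hb. rewrite RtoC_mult_pair. unfold pint, CRInt. cbn [fst snd].
  assert (H : forall f : R -> R, (forall u, 0 < u -> continuous f u) -> RInt f b a = -1 * RInt f a b).
  { intros f Hf. rewrite <- (opp_RInt_swap (V := R_CompleteNormedModule) f a b) by (apply ex_RInt_pos; auto).
    unfold opp; simpl. real_eq. ring. }
  rewrite !H; [reflexivity| |]; intros u Hu;
    [exact (proj2 (continuous_Cek _ x u (continuous_Rpower _ u Hu))) | exact (proj1 (continuous_Cek _ x u (continuous_Rpower _ u Hu)))].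
Qed.

(** The density be / m is integrable against the weight neither at 0 nor at infinity, so the
    integral runs between k and the fixed frequency 1, and [ek 1] enters the data. Integration costs
    1 / s, which the factor [be] compensates. *)
Lemma atom_mid (k : R) : 0 < k -> exists O, wball (omega s) (9 * omega s k) O /\
  scder be O (fun x => RtoC 0 * O x + RtoC (-1) * (ek k x - RtoC 1 * ek 1 x))%C.
Proof.
  intros Hk. exists (fun x => RtoC (- be) * pint 0 1 k x)%C. split.
  - pose proof (Rpower_pos k s). pose proof (Rpower_pos k (- (s / 3))).
    pose proof (omega_weight s Hs k Hk).
    assert (Hbs : be / s <= 3 / 2) by (apply Rle_div_l; lra).
    assert (Hbs0 : 0 <= be / s) by (apply Rdiv_le_0_compat; lra).
    destruct (Rle_dec 1 k) as [Hk1|Hk1].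
    + eapply wball_mono; [|apply (wball_scal _ (- be)); apply pint_wball; lra].
      rewrite Rabs_left by lra. rewrite !Rpower_1_l.
      replace (0 + s) with s by ring. replace (0 - s / 3) with (- (s / 3)) by ring.
      replace (- - be * ((Rpower k s - 1) / s + (Rpower k (- (s / 3)) - 1) / - (s / 3)))
        with (be / s * ((Rpower k s - 1) + 3 * (1 - Rpower k (- (s / 3))))) by (field; lra).
      unfold omega in *.
      pose proof (Rpower_neg_antimono 1 k (s / 3) ltac:(lra) ltac:(lra)) as H2. rewrite Rpower_1_l in H2.
      pose proof (Rpower_ge_1 k s ltac:(lra) ltac:(lra)).
      apply Rle_trans with (3 / 2 * ((Rpower k s - 1) + 3 * (1 - Rpower k (- (s / 3))))); [|lra].
      apply Rmult_le_compat_r; lra.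
    + apply wball_ext with (fun x => RtoC be * pint 0 k 1 x)%C.
      { intros x _. rewrite (pint_swap 0 k 1) by lra. apply injective_projections; simpl; ring. }
      eapply wball_mono; [|apply (wball_scal _ be); apply pint_wball; lra].
      rewrite Rabs_pos_eq by lra. rewrite !Rpower_1_l.
      replace (0 + s) with s by ring. replace (0 - s / 3) with (- (s / 3)) by ring.
      replace (be * ((1 - Rpower k s) / s + (1 - Rpower k (- (s / 3))) / - (s / 3)))
        with (be / s * ((1 - Rpower k s) + 3 * (Rpower k (- (s / 3)) - 1))) by (field; lra).
      unfold omega in *.
      pose proof (Rpower_neg_ge_1 k (s / 3) ltac:(lra) ltac:(lra)).
      pose proof (Rpower_le_1 k s ltac:(lra) ltac:(lra)).
      apply Rle_trans with (3 / 2 * ((1 - Rpower k s) + 3 * (Rpower k (- (s / 3)) - 1))); [|lra].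
      apply Rmult_le_compat_r; lra.
  - eapply scder_ext; [intros; reflexivity| |apply (scder_pint (- be) 0 1 k); lra].
    intros x Hx. cbv beta. rewrite !Rpower_O by lra.
    replace (- be * 1 / be) with (-1) by (field; lra). replace (- be * 0 / be) with 0 by (field; lra).
    apply injective_projections; simpl; ring.
Qed.


(** Combinations have real coefficients, and every exponential is 1 at the origin. *)
Lemma wball_real_0 (w : R -> R) (M : R) (f : R -> C) : wball w M f -> f 0 = RtoC (fst (f 0)).
Proof.
  intros Hf. apply injective_projections; simpl; [reflexivity|].
  apply cond_eq. intros eps He. rewrite Rminus_0_r.
  destruct (Hf 0 (eps / 2) ltac:(lra)) as [l [_ [_ H]]].
  specialize (H 0 ltac:(lra)).
  assert (E : snd (ev l 0) = 0).
  { clear. induction l as [|[c k] t IH]; simpl; [reflexivity|].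
    rewrite IH, Rmult_0_r, sin_0. ring. }
  pose proof (Rabs_snd_Cmod (f 0 - ev l 0)) as H1.
  change (snd (f 0 - ev l 0)%C) with (snd (f 0) - snd (ev l 0)) in H1.
  rewrite E, Rminus_0_r in H1. lra.
Qed.

(* With b, c, T solving D b = - b + h, D c = c - h, D T = - h for h = g - g(0) y^2, a solution is
   (1 - y)^2 b - 2 y (1 - y) T - y^2 c - g(0) y^2. *)
Lemma linear_inverse (y : R -> C) (Cy : R) :
  1 <= Cy -> wball (omega s) Cy y -> y 0 = RtoC 1 ->
  scder be y (fun x => - y x + y x * y x)%C ->
  forall M g, wball (omega s) M g ->
  exists f e, wball (omega s) (1000 * Cy ^ 4 * M) f /\ wball (omega s) (6000 * Cy ^ 5 * M) e /\
    scder be f e /\ forall x, 0 < x -> (f x + e x - 2 * y x * f x)%C = g x.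
Proof.
  intros HCy Hy Hy0 Hyd M g Hg.
  pose proof (omega_weight s Hs) as Hw. pose proof (omega_holder s Hs) as Hh.
  pose proof (wball_nonneg _ Hw _ _ Hg) as HM.
  pose proof (wball_omega_mult s _ _ _ _ Hs Hy Hy) as Hyy.
  set (g0 := fst (g 0)).
  assert (Hg0 : g 0 = RtoC g0) by (apply (wball_real_0 _ _ _ Hg)).
  assert (Hg0M : Rabs g0 <= M).
  { rewrite <- Cmod_R, <- Hg0. apply (wball_bound _ Hw _ _ Hg). lra. }
  (* The linearized operator sends - y^2 to y^2, and y(0) = 1. Taking out g(0) y^2 thus leaves data
     vanishing at 0, for which the term with [ek 1] in the equation of [T] disappears. *)
  set (gt := fun x => (g x - RtoC g0 * (y x * y x))%C).
  assert (Hgt : wball (omega s) (3 * Cy ^ 2 * M) gt).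
  { eapply wball_mono; [|apply (wball_minus _ M (Rabs g0 * (2 * Cy * Cy)) g); auto; apply wball_scal; exact Hyy].
    assert (H1 : 1 <= Cy * Cy) by nra.
    assert (Rabs g0 * (2 * Cy * Cy) <= M * (2 * Cy * Cy)) by (apply Rmult_le_compat_r; lra).
    assert (M * 1 <= M * (Cy * Cy)) by (apply Rmult_le_compat_l; auto). simpl. lra. }
  assert (Hgt0 : gt 0 = RtoC 0) by (unfold gt; rewrite Hg0, Hy0; ring).
  set (M' := 3 * Cy ^ 2 * M) in *.
  assert (HM' : 0 <= M') by (apply (wball_nonneg _ Hw _ _ Hgt)).
  destruct (lift_operator (omega s) s be 4 (-1) 1 0 Hw Hh ltac:(lra) atom_low M' gt Hgt) as [b [Hb Hbd]].
  destruct (lift_operator (omega s) s be 4 1 (-1) 0 Hw Hh ltac:(lra) atom_high M' gt Hgt) as [c [Hc Hcd]].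
  destruct (lift_operator (omega s) s be 9 0 (-1) 1 Hw Hh ltac:(lra) atom_mid M' gt Hgt) as [T [HT HTd]].
  set (yy := fun x => (y x * y x)%C) in *.
  set (dy := fun x => (- y x + y x * y x)%C) in *.
  set (db := fun x => (gt x - b x)%C).
  set (dc := fun x => (c x - gt x)%C).
  assert (Hb' : scder be b db).
  { eapply scder_ext; [intros; reflexivity| |exact Hbd]. intros x _. unfold db.
    apply injective_projections; simpl; ring. }
  assert (Hc' : scder be c dc).
  { eapply scder_ext; [intros; reflexivity| |exact Hcd]. intros x _. unfold dc.
    apply injective_projections; simpl; ring. }
  assert (HT' : scder be T (fun x => - gt x)%C).
  { eapply scder_ext; [intros; reflexivity| |exact HTd]. intros x _. cbv beta. rewrite Hgt0.
    apply injective_projections; simpl; ring. }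
  assert (Hyyd : scder be yy (fun x => dy x * y x + y x * dy x)%C) by (apply scder_mult; auto).
  (* The solution formula grouped by powers of [y]: f = b - 2 p + q. *)
  set (p := fun x => (y x * (b x + T x))%C).
  set (q := fun x => (yy x * (b x + (T x + T x) - c x - RtoC g0))%C).
  set (f := fun x => (b x - (p x + p x) + q x)%C).
  assert (Hpd : scder be p (fun x => dy x * (b x + T x) + y x * (db x + - gt x))%C).
  { apply scder_mult; auto. apply scder_plus; auto. }
  assert (Hqd : scder be q (fun x => (dy x * y x + y x * dy x) * (b x + (T x + T x) - c x - RtoC g0)
      + yy x * (db x + (- gt x + - gt x) - dc x - 0))%C).
  { apply scder_mult; auto. apply scder_minus; [|apply scder_const].
    apply scder_minus; auto. apply scder_plus; auto. apply scder_plus; auto. }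
  (* [e] is read off the equation, so its bound follows from those of [g] and [f] without
     differentiation; that it equals D f is verified at the end. *)
  set (e := fun x => (g x - f x + RtoC 2 * (y x * f x))%C).
  assert (HM2 : 0 <= Cy ^ 2) by (simpl; nra).
  assert (Hf : wball (omega s) (1000 * Cy ^ 4 * M) f).
  { assert (Hp : wball (omega s) (2 * Cy * (4 * M' + 9 * M')) p).
    { apply wball_omega_mult; auto. apply wball_add; auto. }
    assert (Hq : wball (omega s) (2 * (2 * Cy * Cy) * (4 * M' + (9 * M' + 9 * M') + 4 * M') + Rabs g0 * (2 * Cy * Cy)) q).
    { apply wball_ext with (fun x => (yy x * (b x + (T x + T x) - c x) - RtoC g0 * yy x))%C.
      { intros x _. unfold q. ring. }
      apply wball_minus; [|apply wball_scal; exact Hyy].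
      apply wball_omega_mult; auto. apply wball_minus; auto. apply wball_add; auto. apply wball_add; auto. }
    eapply wball_mono; [|apply (wball_add _ _ _ _ _ (wball_minus _ _ _ _ _ Hb (wball_add _ _ _ _ _ Hp Hp)) Hq)].
    assert (H1 : 1 <= Cy * Cy) by nra.
    assert (Rabs g0 * (2 * Cy * Cy) <= M * (2 * Cy * Cy)) by (apply Rmult_le_compat_r; lra).
    replace (4 * M' + (2 * Cy * (4 * M' + 9 * M') + 2 * Cy * (4 * M' + 9 * M')) +
      (2 * (2 * Cy * Cy) * (4 * M' + (9 * M' + 9 * M') + 4 * M') + Rabs g0 * (2 * Cy * Cy)))
      with (4 * M' + 52 * (Cy * M') + 104 * (Cy ^ 2 * M') + Rabs g0 * (2 * Cy * Cy)) by ring.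
    assert (E1 : M' <= Cy ^ 2 * M').
    { assert (1 * M' <= (Cy * Cy) * M') by (apply Rmult_le_compat_r; auto). simpl. lra. }
    assert (E2 : Cy * M' <= Cy ^ 2 * M').
    { assert (Cy * (1 * M') <= Cy * (Cy * M')); [|simpl; lra].
      apply Rmult_le_compat_l; [lra|]. apply Rmult_le_compat_r; auto. }
    assert (E3 : Cy ^ 2 * M' = 3 * Cy ^ 4 * M) by (unfold M'; ring).
    assert (E4 : M * (2 * Cy * Cy) <= Cy ^ 2 * M').
    { assert (0 <= M * (Cy * Cy)) by nra.
      assert (M * (Cy * Cy) * 1 <= M * (Cy * Cy) * (Cy * Cy)) by (apply Rmult_le_compat_l; auto).
      rewrite E3. simpl. lra. }
    assert (0 <= Cy ^ 4 * M) by (apply Rmult_le_pos; auto; apply pow_le; lra). lra. }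
  exists f, e. split; auto. split; [|split].
  - set (N := 1000 * Cy ^ 4 * M) in *.
    eapply wball_mono; [|apply (wball_add _ _ _ _ _ (wball_minus _ _ _ _ _ Hg Hf)
        (wball_scal _ 2 _ _ (wball_omega_mult s _ _ _ _ Hs Hy Hf)))].
    rewrite Rabs_pos_eq by lra.
    assert (1 <= Cy ^ 4) by (apply pow_R1_Rle; auto).
    assert (HN : 0 <= N) by (unfold N; nra).
    assert (M <= N) by (unfold N; nra).
    replace (6000 * Cy ^ 5 * M) with (6 * (Cy * N)) by (unfold N; ring).
    assert (1 * N <= Cy * N) by (apply Rmult_le_compat_r; auto). lra.
  - pose proof (scder_plus _ _ _ _ _ (scder_minus _ _ _ _ _ Hb' (scder_plus _ _ _ _ _ Hpd Hpd)) Hqd) as Hfd.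
    eapply scder_ext; [intros; reflexivity| |exact Hfd].
    intros x Hx. cbv beta. unfold e, f, p, q, db, dc, dy, yy.
    assert (Eg : g x = (gt x + RtoC g0 * (y x * y x))%C) by (unfold gt; ring).
    rewrite Eg. ring.
  - intros x _. unfold e. ring.
Qed.

End Atoms.

(** * The advection term *)

Lemma RInt_sin_scaled (x a b : R) : 0 < x ->
  RInt (fun m => sin (m * x)) a b = (cos (a * x) - cos (b * x)) / x.
Proof.
  intros Hx. apply is_RInt_unique.
  replace ((cos (a * x) - cos (b * x)) / x)
    with (minus (- cos (b * x) / x) (- cos (a * x) / x))
    by (unfold minus, plus, opp; simpl; field; lra).
  apply (is_RInt_derive (V := R_CompleteNormedModule) (fun m => - cos (m * x) / x)).
  - intros m _. auto_derive; [trivial | field; lra].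
  - intros m _. apply continuous_scale_arg, continuous_sin.
Qed.

Lemma RInt_cos_scaled (k x : R) : 0 < k -> RInt (fun m => cos (k * m)) 0 x = sin (k * x) / k.
Proof.
  intros Hk. apply is_RInt_unique.
  replace (sin (k * x) / k) with (minus (sin (k * x) / k) (sin (k * 0) / k))
    by (unfold minus, plus, opp; simpl; rewrite Rmult_0_r, sin_0; field; lra).
  apply (is_RInt_derive (V := R_CompleteNormedModule) (fun m => sin (k * m) / k)).
  - intros m _. auto_derive; [trivial | field; lra].
  - intros m _. apply (Ccont_ek k m).
Qed.

(** This is u / x for the velocity u with u' = Re f and u(0) = 0; the quotient is bounded on
    balls. *)
Definition ball_avg (f : R -> C) (x : R) : R := / x * RInt (fun t => fst (f t)) 0 x.

Lemma ex_RInt_ek (x a b : R) :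
  ex_RInt (fun u => fst (ek u x)) a b /\ ex_RInt (fun u => snd (ek u x)) a b.
Proof.
  split; apply (ex_RInt_continuous (V := R_CompleteNormedModule)); intros z _;
    apply continuous_scale_arg; [apply continuous_cos | apply continuous_sin].
Qed.

(* The product is the imaginary part of (1 / 2k) times the integral of exp (i m x) over
   |l - k| <= m <= l + k. *)
Lemma advect_atom (s k l : R) : 0 < s <= 1 -> 0 < k -> 0 < l ->
  exists h, wball (omega s) (4 * omega s k * omega s l) h /\
    forall x, 0 < x -> snd (h x) = sin (k * x) / (k * x) * sin (l * x).
Proof.
  intros Hs Hk Hl.
  pose proof (omega_weight s Hs) as Hw.
  (* The absolute value keeps frequencies nonnegative: for l < k the part of the range symmetric
     about 0 contributes nothing to the integral of the odd function sin (m x) in m. *)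
  set (a := Rabs (l - k)). set (b := l + k).
  assert (Ha : 0 <= a) by apply Rabs_pos.
  set (L := b - a).
  assert (HLm : L = 2 * Rmin k l).
  { unfold L, b, a, Rabs, Rmin. destruct (Rcase_abs (l - k)), (Rle_dec k l); lra. }
  assert (HL : 0 < L) by (rewrite HLm; pose proof (Rmin_pos k l Hk Hl); lra).
  assert (HLk : L <= 2 * k) by (rewrite HLm; pose proof (Rmin_l k l); lra).
  exists (fun x => RtoC (/ (2 * k)) * CRInt (fun m => ek m x) a b)%C. split.
  - assert (HJ : wball (omega s) (8 * k * omega s k * omega s l) (fun x => CRInt (fun m => ek m x) a b)).
    { apply wball_closed. intros X eta He.
      (* For k = l the range starts at m = 0, where the weight is singular. Its start is moved by
         [d], at the price of an error of at most 2 d. *)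
      set (d := Rmin (eta / 2) (L / 2)).
      assert (Hd : 0 < d) by (apply Rmin_pos; lra).
      assert (Hd1 : d <= eta / 2) by apply Rmin_l.
      assert (Hd2 : d <= L / 2) by apply Rmin_r.
      set (a' := a + d).
      exists (fun x => CRInt (fun m => RtoC 1 * ek m x)%C a' b). split.
      - set (m := fun u => plus (Rpower b s) (Rpower u (1 - s / 3 - 1))).
        eapply wball_mono; [|apply (wball_density (omega s) a' b (fun _ => 1) m)]; auto.
        + assert (E : is_RInt m a' b (plus (scal (b - a') (Rpower b s))
             ((Rpower b (1 - s / 3) - Rpower a' (1 - s / 3)) / (1 - s / 3)))).
          { apply (is_RInt_plus (V := R_NormedModule)).
            - apply (is_RInt_const (V := R_NormedModule)).
            - apply is_RInt_Rpower; unfold a', b; lra. }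
          rewrite (is_RInt_unique _ _ _ _ E). unfold plus, scal; simpl; unfold mult; simpl.
          pose proof (Rpower_subadd k l s Hk Hl Hs) as E1. replace (k + l) with b in E1 by (unfold b; ring).
          assert (Hba : 0 < b - a' <= L) by (unfold a', L in *; lra).
          (* Subadditivity of the power 1 - s / 3 bounds the integral of u^(-s/3) over the range by
             a multiple of L^(1 - s/3), wherever the range lies. *)
          pose proof (Rpower_subadd a' (b - a') (1 - s / 3) ltac:(unfold a'; lra) ltac:(lra) ltac:(lra)) as E2.
          replace (a' + (b - a')) with b in E2 by ring.
          assert (E3 : Rpower (b - a') (1 - s / 3) <= Rpower L (1 - s / 3)) by (apply Rle_Rpower_l; lra).
          assert (E4 : Rpower L (1 - s / 3) = L * Rpower L (- (s / 3))).
          { unfold Rminus. rewrite Rpower_plus, Rpower_1; auto. }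
          assert (E5 : Rpower L (- (s / 3)) <= Rpower k (- (s / 3)) + Rpower l (- (s / 3))).
          { pose proof (Rpower_pos k (- (s / 3))). pose proof (Rpower_pos l (- (s / 3))).
            eapply Rle_trans; [apply (Rpower_neg_antimono (Rmin k l)); [|lra]|].
            - rewrite HLm. pose proof (Rmin_pos k l Hk Hl). lra.
            - unfold Rmin. destruct (Rle_dec k l); lra. }
          assert (E6 : (Rpower b (1 - s / 3) - Rpower a' (1 - s / 3)) / (1 - s / 3)
                       <= 2 * (L * (Rpower k (- (s / 3)) + Rpower l (- (s / 3))))).
          { apply Rle_div_l; [lra|].
            assert (0 <= L * (Rpower k (- (s / 3)) + Rpower l (- (s / 3)))).
            { pose proof (Rpower_pos k (- (s / 3))). pose proof (Rpower_pos l (- (s / 3))). nra. }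
            assert (L * Rpower L (- (s / 3)) <= L * (Rpower k (- (s / 3)) + Rpower l (- (s / 3))))
              by (apply Rmult_le_compat_l; lra).
            nra. }
          assert (E7 : (b - a') * Rpower b s <= L * (Rpower k s + Rpower l s)).
          { pose proof (Rpower_pos b s). apply Rmult_le_compat; lra. }
          pose proof (Hw k Hk) as W1. pose proof (Hw l Hl) as W2.
          assert (E8 : omega s k + omega s l <= 2 * omega s k * omega s l) by nra.
          pose proof (Rpower_pos k s). pose proof (Rpower_pos l s).
          apply Rle_trans with (2 * L * (omega s k + omega s l)).
          { unfold omega. assert (0 <= L * (Rpower k s + Rpower l s)) by nra. lra. }
          apply Rle_trans with (2 * (2 * k) * (omega s k + omega s l)).
          { apply Rmult_le_compat_r; lra. }
          replace (8 * k * omega s k * omega s l) with (2 * (2 * k) * (2 * omega s k * omega s l)) by ring.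
          apply Rmult_le_compat_l; lra.
        + unfold a', L in *; lra.
        + intros u _. apply continuous_const.
        + intros u Hu. apply (continuous_plus (K := R_AbsRing) (V := R_NormedModule)).
          * apply continuous_const.
          * apply continuous_Rpower. unfold a' in Hu; lra.
        + intros u Hu. rewrite Rabs_R1, Rmult_1_l. unfold omega, m, plus; simpl.
          apply Rplus_le_compat.
          * apply Rle_Rpower_l; [lra|]. unfold a' in Hu; lra.
          * right. f_equal. ring.
      - intros x Hx.
        assert (E : (CRInt (fun m => ek m x) a b - CRInt (fun m => RtoC 1 * ek m x) a' b)%C
                    = CRInt (fun m => ek m x) a a').
        { assert (E0 : CRInt (fun m => (RtoC 1 * ek m x)%C) a' b = CRInt (fun m => ek m x) a' b).
          { unfold CRInt. f_equal; apply RInt_ext; intros; rewrite Cmult_1_l; reflexivity. }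
          rewrite E0.
          pose proof (RInt_Chasles (V := R_CompleteNormedModule) (fun u => fst (ek u x)) a a' b
            (proj1 (ex_RInt_ek x a a')) (proj1 (ex_RInt_ek x a' b))) as C1.
          pose proof (RInt_Chasles (V := R_CompleteNormedModule) (fun u => snd (ek u x)) a a' b
            (proj2 (ex_RInt_ek x a a')) (proj2 (ex_RInt_ek x a' b))) as C2.
          unfold CRInt. rewrite <- C1, <- C2. unfold Cminus, Cplus, Copp, plus; cbn [fst snd].
          assert (A : forall p q : R, p + q + - q = p) by (intros; ring).
          apply injective_projections; cbn [fst snd]; apply A. }
        rewrite E. eapply Rle_trans; [apply Cmod_le_sum|]. unfold CRInt; cbn [fst snd].
        assert (B1 : Rabs (RInt (fun u => fst (ek u x)) a a') <= (a' - a) * 1).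
        { apply abs_RInt_le_const; [unfold a'; lra | exact (proj1 (ex_RInt_ek x a a')) |].
          intros t _. eapply Rle_trans; [apply Rabs_fst_Cmod | rewrite Cmod_ek; lra]. }
        assert (B2 : Rabs (RInt (fun u => snd (ek u x)) a a') <= (a' - a) * 1).
        { apply abs_RInt_le_const; [unfold a'; lra | exact (proj2 (ex_RInt_ek x a a')) |].
          intros t _. eapply Rle_trans; [apply Rabs_snd_Cmod | rewrite Cmod_ek; lra]. }
        unfold a' in *. lra. }
    replace (4 * omega s k * omega s l) with (Rabs (/ (2 * k)) * (8 * k * omega s k * omega s l)).
    + apply wball_scal; auto.
    + rewrite Rabs_pos_eq by (left; apply Rinv_0_lt_compat; lra). field. lra.
  - intros x Hx. rewrite RtoC_mult_pair. unfold CRInt. cbn [fst snd].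
    change (fun u => snd (ek u x)) with (fun m => sin (m * x)).
    rewrite RInt_sin_scaled by auto.
    replace (cos (a * x)) with (cos ((l - k) * x)).
    + rewrite form2.
      replace (((l - k) * x - b * x) / 2) with (- (k * x)) by (unfold b; field).
      replace (((l - k) * x + b * x) / 2) with (l * x) by (unfold b; field).
      rewrite sin_neg. field. lra.
    + unfold a, Rabs. destruct (Rcase_abs (l - k)); [|reflexivity].
      rewrite <- cos_neg. f_equal. ring.
Qed.

(** Here sin (k x) / (k x) is the average of cos (k t) over [0, x]. *)
Fixpoint lavg (l : list (R * R)) (x : R) : R :=
  match l with
  | nil => 0
  | (c, k) :: t => c * (sin (k * x) / (k * x)) + lavg t x
  end.

Lemma ev_Ccont (l : list (R * R)) (x : R) : Ccont (ev l) x.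
Proof.
  induction l as [|[c k] t IH]; simpl.
  - split; apply continuous_const.
  - apply Ccont_plus; auto. apply Ccont_scal, Ccont_ek.
Qed.

Lemma ball_avg_ev (l : list (R * R)) (x : R) : posl l -> 0 < x -> ball_avg (ev l) x = lavg l x.
Proof.
  intros Hl Hx. unfold ball_avg. induction Hl as [|[c k] t H H' IH]; simpl.
  - rewrite RInt_const. unfold scal; simpl; unfold mult; simpl. ring.
  - simpl in H. rewrite <- IH.
    rewrite (RInt_ext _ (fun u => plus (scal c (cos (k * u))) (fst (ev t u)))).
    + rewrite (RInt_plus (V := R_CompleteNormedModule)).
      * rewrite (RInt_scal (V := R_CompleteNormedModule)).
        -- rewrite RInt_cos_scaled by auto. unfold plus, scal; simpl; unfold mult; simpl. field. lra.
        -- apply (ex_RInt_continuous (V := R_CompleteNormedModule)). intros z _. apply (Ccont_ek k z).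
      * apply (ex_RInt_continuous (V := R_CompleteNormedModule)). intros z _.
        apply (continuous_scal (K := R_AbsRing) (V := R_NormedModule)); [apply continuous_const|].
        apply (Ccont_ek k z).
      * apply (ex_RInt_continuous (V := R_CompleteNormedModule)). intros z _. apply (ev_Ccont t z).
    + intros u _. unfold plus, scal; simpl; unfold mult; simpl. real_eq. ring.
Qed.

(** The candidate for the Hilbert transform of the odd extension of - Im f. *)
Definition ext_even (f : R -> C) (x : R) : R := fst (f (Rabs x)).

Lemma ext_even_continuous (w : R -> R) (s M : R) (f : R -> C) (x : R) :
  holder_weight w s -> weight w -> wball w M f -> continuous (ext_even f) x.
Proof.
  intros Hs Hw Hf. apply continuity_pt_filterlim. intros eta He.
  destruct (wball_modulus w s M f (Rabs x) Hs Hw Hf (Rabs_pos x) (eta / 2)) as [d [Hd Hd']]; [lra|].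
  exists d. split; auto. intros y [_ Hy]. simpl in *. unfold R_dist in *.
  eapply Rle_lt_trans; [apply (Rabs_fst_Cmod (f (Rabs y) - f (Rabs x)))|].
  apply Rle_lt_trans with (eta / 2); [|lra]. apply Hd'; [apply Rabs_pos|].
  eapply Rle_lt_trans; [apply Rabs_triang_inv2 | exact Hy].
Qed.

Lemma ex_RInt_fst_wball (w : R -> R) (s M : R) (f : R -> C) (x : R) :
  holder_weight w s -> weight w -> wball w M f -> 0 <= x -> ex_RInt (fun t => fst (f t)) 0 x.
Proof.
  intros Hs Hw Hf Hx.
  apply (ex_RInt_ext (V := R_NormedModule) (ext_even f)).
  - intros t Ht. rewrite Rmin_left in Ht by auto. unfold ext_even. rewrite Rabs_pos_eq by lra. reflexivity.
  - apply (ex_RInt_continuous (V := R_CompleteNormedModule)). intros z _.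
    apply (ext_even_continuous w s M); auto.
Qed.

Lemma ball_avg_diff (w : R -> R) (s M eta : R) (f : R -> C) (l : list (R * R)) (x : R) :
  holder_weight w s -> weight w -> wball w M f -> 0 < x ->
  (forall t, 0 <= t <= x -> Cmod (f t - ev l t) <= eta) ->
  Rabs (ball_avg f x - ball_avg (ev l) x) <= eta.
Proof.
  intros Hs Hw Hf Hx H. unfold ball_avg. rewrite <- Rmult_minus_distr_l.
  assert (Hex : ex_RInt (fun t => fst (ev l t)) 0 x).
  { apply (ex_RInt_continuous (V := R_CompleteNormedModule)). intros z _. apply (ev_Ccont l z). }
  replace (RInt (fun t => fst (f t)) 0 x - RInt (fun t => fst (ev l t)) 0 x)
    with (RInt (fun t => minus (fst (f t)) (fst (ev l t))) 0 x).
  - rewrite Rabs_mult, Rabs_pos_eq by (left; apply Rinv_0_lt_compat; auto).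
    apply Rmult_le_reg_l with x; auto. rewrite <- Rmult_assoc, Rinv_r, Rmult_1_l by lra.
    replace (x * eta) with ((x - 0) * eta) by ring.
    apply abs_RInt_le_const; [lra| |].
    + apply (ex_RInt_minus (V := R_NormedModule)); auto.
      apply (ex_RInt_fst_wball w s M); auto; lra.
    + intros t Ht. eapply Rle_trans; [apply (Rabs_fst_Cmod (f t - ev l t)) | auto].
  - rewrite (RInt_minus (V := R_CompleteNormedModule)); auto.
    apply (ex_RInt_fst_wball w s M); auto; lra.
Qed.

Lemma ball_avg_bound (w : R -> R) (s M : R) (f : R -> C) (x : R) :
  holder_weight w s -> weight w -> wball w M f -> 0 < x -> Rabs (ball_avg f x) <= M.
Proof.
  intros Hs Hw Hf Hx. unfold ball_avg.
  rewrite Rabs_mult, Rabs_pos_eq by (left; apply Rinv_0_lt_compat; auto).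
  apply Rmult_le_reg_l with x; auto. rewrite <- Rmult_assoc, Rinv_r, Rmult_1_l by lra.
  replace (x * M) with ((x - 0) * M) by ring.
  apply abs_RInt_le_const; [lra | |].
  - apply (ex_RInt_fst_wball w s M); auto; lra.
  - intros t Ht. eapply Rle_trans; [apply Rabs_fst_Cmod | apply (wball_bound w Hw M f Hf); lra].
Qed.

(** Bilinear extension of [advect_atom]: the double sums over approximating lists have bounded cost
    and a known imaginary part, and a cluster point inherits both. The real part of [h] is left
    open, as the profile equation sees imaginary parts. *)
Theorem advection (s M1 M2 : R) (f g : R -> C) : 0 < s <= 1 ->
  wball (omega s) M1 f -> wball (omega s) M2 g ->
  exists h, wball (omega s) (4 * M1 * M2) h /\
    forall x, 0 < x -> snd (h x) = ball_avg f x * snd (g x).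
Proof.
  intros Hs Hf Hg.
  pose proof (omega_weight s Hs) as Hw. pose proof (omega_holder s Hs) as Hh.
  pose proof (wball_nonneg _ Hw _ _ Hf) as HM1. pose proof (wball_nonneg _ Hw _ _ Hg) as HM2.
  assert (Hh0 : forall kl : R * R, exists h, 0 < fst kl -> 0 < snd kl ->
     wball (omega s) (4 * omega s (fst kl) * omega s (snd kl)) h /\
     forall x, 0 < x -> snd (h x) = sin (fst kl * x) / (fst kl * x) * sin (snd kl * x)).
  { intros [k l]; simpl. destruct (Rlt_dec 0 k) as [Hk|Hk]; [destruct (Rlt_dec 0 l) as [Hl|Hl]|].
    - destruct (advect_atom s k l Hs Hk Hl) as [h H]. exists h; auto.
    - exists (fun _ => RtoC 0). intros; contradiction.
    - exists (fun _ => RtoC 0). intros; contradiction. }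
  set (h := fun k l => proj1_sig (constructive_indefinite_description _ (Hh0 (k, l)))).
  assert (HH : forall k l, 0 < k -> 0 < l -> wball (omega s) (4 * omega s k * omega s l) (h k l) /\
     forall x, 0 < x -> snd (h k l x) = sin (k * x) / (k * x) * sin (l * x)).
  { intros k l. unfold h. destruct (constructive_indefinite_description _ (Hh0 (k, l))); auto. }
  clearbody h. clear Hh0.
  destruct (lists_approx _ _ _ Hf) as [lf Hlf]. destruct (lists_approx _ _ _ Hg) as [lg Hlg].
  set (hn := fun n : nat => evO (fun k => evO (h k) (lg n)) (lf n)).
  destruct (wball_cluster (omega s) s (4 * M1 * M2) hn Hw Hh) as [H [HB HC]].
  { intros n. destruct (Hlf n) as [F1 [F2 _]]. destruct (Hlg n) as [G1 [G2 _]].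
    pose proof (cost_nonneg (omega s) _ (weight_nonneg _ Hw) F1).
    pose proof (cost_nonneg (omega s) _ (weight_nonneg _ Hw) G1).
    apply wball_mono with (4 * cost (omega s) (lg n) * cost (omega s) (lf n)).
    { rewrite !Rmult_assoc. apply Rmult_le_compat_l; [lra|]. rewrite Rmult_comm. apply Rmult_le_compat; auto. }
    apply evO_wball; auto. intros k Hk.
    apply wball_mono with (4 * omega s k * cost (omega s) (lg n)); [lra|].
    apply evO_wball; auto. intros l Hl. apply HH; auto. }
  exists H. split; auto. intros x Hx.
  assert (Himg : forall n, snd (hn n x) = lavg (lf n) x * snd (ev (lg n) x)).
  { intros n. unfold hn. destruct (Hlf n) as [F1 _]. destruct (Hlg n) as [G1 _].
    induction F1 as [|[c k] t Hk Ht IH]; simpl; [ring|].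
    simpl in Hk.
    rewrite IH.
    assert (E : snd (evO (h k) (lg n) x) = sin (k * x) / (k * x) * snd (ev (lg n) x)).
    { clear - G1 HH Hk Hx. induction G1 as [|[d l] t Hl Ht IH]; simpl; [ring|].
      simpl in Hl. rewrite IH. destruct (HH k l Hk Hl) as [_ H2]. rewrite H2 by auto. ring. }
    rewrite E. ring. }
  apply Rminus_diag_uniq. apply cond_eq. intros eps He.
  (* One unit pays for the cluster approximation, [M1] units for that of [g] and [M2] units for that
     of the average of [f]. *)
  set (eta := eps / (2 * (2 + M1 + M2))).
  assert (Heta : 0 < eta) by (apply Rdiv_lt_0_compat; lra).
  destruct (inv_small eta Heta) as [N HN]. destruct (nat_above x) as [N' HN'].
  destruct (HC x eta (Nat.max N N') Heta) as [n [Hn Hn']].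
  assert (Hxn : x <= INR n).
  { apply Rle_trans with (INR N'); auto. apply le_INR. lia. }
  specialize (HN n ltac:(lia)). specialize (Hn' x ltac:(lra)).
  destruct (Hlf n) as [F1 [F2 F3]]. destruct (Hlg n) as [G1 [G2 G3]].
  assert (A1 : Rabs (ball_avg f x - lavg (lf n) x) <= eta).
  { rewrite <- ball_avg_ev by auto.
    apply (ball_avg_diff (omega s) s M1); auto. intros t Ht.
    eapply Rle_trans; [apply F3; lra | auto]. }
  assert (A2 : Rabs (snd (g x) - snd (ev (lg n) x)) <= eta).
  { eapply Rle_trans; [apply (Rabs_snd_Cmod (g x - ev (lg n) x))|].
    eapply Rle_trans; [apply G3; lra | auto]. }
  assert (A3 : Rabs (snd (H x) - snd (hn n x)) <= eta).
  { eapply Rle_trans; [apply (Rabs_snd_Cmod (H x - hn n x)) | auto]. }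
  rewrite Himg in A3.
  assert (A4 : Rabs (snd (g x)) <= M2).
  { eapply Rle_trans; [apply Rabs_snd_Cmod | apply (wball_bound _ Hw _ _ Hg); lra]. }
  assert (A5 : Rabs (lavg (lf n) x) <= M1).
  { rewrite <- ball_avg_ev by auto. apply (ball_avg_bound (omega s) s M1); auto.
    apply wball_mono with (cost (omega s) (lf n)); auto. apply wball_ev; auto. }
  set (a := snd (H x) - lavg (lf n) x * snd (ev (lg n) x)) in *.
  set (b := lavg (lf n) x * (snd (g x) - snd (ev (lg n) x))).
  set (c := (ball_avg f x - lavg (lf n) x) * snd (g x)).
  assert (Hb : Rabs b <= M1 * eta).
  { unfold b. rewrite Rabs_mult. apply Rmult_le_compat; auto using Rabs_pos. }
  assert (Hc : Rabs c <= eta * M2).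
  { unfold c. rewrite Rabs_mult. apply Rmult_le_compat; auto using Rabs_pos. }
  replace (snd (H x) - ball_avg f x * snd (g x)) with (a - b - c) by (unfold a, b, c; ring).
  apply Rle_lt_trans with (eta + M1 * eta + eta * M2).
  - apply Rabs_le_between in A3, Hb, Hc. apply Rabs_le. lra.
  - apply Rle_lt_trans with (eta * (2 + M1 + M2)); [nra|].
    unfold eta. replace (eps / (2 * (2 + M1 + M2)) * (2 + M1 + M2)) with (eps / 2) by (field; lra). lra.
Qed.

(** * The formal power series in [a] *)

(** The range is i < n, so n = 0 gives the empty sum; convolutions without their end terms can then
    be written for every order. *)
Fixpoint rsum (a : nat -> R) (n : nat) : R :=
  match n with O => 0 | S k => rsum a k + a k end.

Fixpoint csum (a : nat -> C) (n : nat) : C :=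
  match n with O => RtoC 0 | S k => (csum a k + a k)%C end.

Lemma rsum_ext (a b : nat -> R) (n : nat) :
  (forall i, (i < n)%nat -> a i = b i) -> rsum a n = rsum b n.
Proof. induction n as [|n IH]; simpl; intros H; [reflexivity|]. rewrite IH, H; auto. Qed.

Lemma rsum_le (a b : nat -> R) (n : nat) :
  (forall i, (i < n)%nat -> a i <= b i) -> rsum a n <= rsum b n.
Proof. induction n as [|n IH]; simpl; intros H; [lra|]. apply Rplus_le_compat; auto. Qed.

Lemma rsum_scal (c : R) (a : nat -> R) (n : nat) : rsum (fun i => c * a i) n = c * rsum a n.
Proof. induction n as [|n IH]; simpl; [ring|]. rewrite IH; ring. Qed.

Lemma rsum_plus (a b : nat -> R) (n : nat) : rsum (fun i => a i + b i) n = rsum a n + rsum b n.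
Proof. induction n as [|n IH]; simpl; [ring|]. rewrite IH; ring. Qed.

Lemma rsum_head (a : nat -> R) (n : nat) : rsum a (S n) = a 0%nat + rsum (fun i => a (S i)) n.
Proof.
  induction n as [|n IH]; [simpl; ring|].
  change (rsum a (S (S n))) with (rsum a (S n) + a (S n)). rewrite IH. simpl. ring.
Qed.

Lemma sum_f_R0_rsum (a : nat -> R) (n : nat) : sum_f_R0 a n = rsum a (S n).
Proof. induction n as [|n IH]; simpl; [ring|]. rewrite IH. simpl. ring. Qed.

Lemma snd_csum (a : nat -> C) (n : nat) : snd (csum a n) = rsum (fun i => snd (a i)) n.
Proof. induction n as [|n IH]; simpl; [reflexivity|]. rewrite IH. reflexivity. Qed.

Lemma wball_csum (w : R -> R) (m : nat -> R) (f : nat -> R -> C) (n : nat) :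
  weight w -> (forall i, (i < n)%nat -> wball w (m i) (f i)) ->
  wball w (rsum m n) (fun x => csum (fun i => f i x) n).
Proof.
  intros Hw. induction n as [|n IH]; intros H; simpl.
  - apply wball_0; auto.
  - apply (wball_add w (rsum m n) (m n) (fun x => csum (fun i => f i x) n) (f n)); auto.
Qed.

(** The factor (i + 1)^(-2) is reproduced by convolution up to a constant, which a pure geometric
    sequence is not; with it the nonlinear recursion closes under a geometric bound. *)
Definition isq (i : nat) : R := / (INR i + 1) ^ 2.

Lemma isq_pos (i : nat) : 0 < isq i.
Proof. unfold isq. pose proof (pos_INR i). apply Rinv_0_lt_compat. nra. Qed.

Lemma isq_telescope (n : nat) : / (INR n + 1) + isq (S n) <= / (INR n + 1) + / (INR n + 1) - / (INR (S n) + 1).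
Proof.
  unfold isq. rewrite S_INR. pose proof (pos_INR n).
  set (t := INR n) in *.
  assert (E : / (t + 1) - / (t + 1 + 1) = / ((t + 1) * (t + 1 + 1))) by (field; lra).
  assert (/ (t + 1 + 1) ^ 2 <= / ((t + 1) * (t + 1 + 1))) by (apply Rinv_le_contravar; [apply Rmult_lt_0_compat; lra | simpl; nra]).
  lra.
Qed.

Lemma rsum_isq (n : nat) : rsum isq (S n) <= 2 - / (INR n + 1).
Proof.
  induction n as [|n IH].
  - simpl. unfold isq. simpl. lra.
  - change (rsum isq (S (S n))) with (rsum isq (S n) + isq (S n)).
    pose proof (isq_telescope n). lra.
Qed.

Lemma rsum_isq_rev (n : nat) : rsum (fun i => isq (n - i)) (S n) <= 2 - / (INR n + 1).
Proof.
  induction n as [|n IH].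
  - simpl. unfold isq. simpl. lra.
  - rewrite rsum_head. replace (S n - 0)%nat with (S n) by lia.
    rewrite (rsum_ext _ (fun i => isq (n - i))) by (intros; f_equal; lia).
    pose proof (isq_telescope n). lra.
Qed.

(** With p = 1 / (i + 1) and q = 1 / (n - i + 1) one has p q = (p + q) / (n + 2), hence p^2 q^2 <= 2
    (p^2 + q^2) / (n + 1)^2. The sums of p^2 and of q^2 are at most 2 each. *)
Lemma isq_conv (n : nat) : rsum (fun i => isq i * isq (n - i)) (S n) <= 8 * isq n.
Proof.
  apply Rle_trans with (rsum (fun i => 2 * isq n * (isq i + isq (n - i))) (S n)).
  - apply rsum_le. intros i Hi. unfold isq. rewrite minus_INR by lia.
    assert (Hle : INR i <= INR n) by (apply le_INR; lia).
    pose proof (pos_INR i). set (a := INR i) in *. set (b := INR n) in *.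
    set (p := / (a + 1)). set (q := / (b - a + 1)).
    assert (Hp : 0 < p) by (apply Rinv_0_lt_compat; lra).
    assert (Hq : 0 < q) by (apply Rinv_0_lt_compat; lra).
    assert (E1 : / (a + 1) ^ 2 = p ^ 2) by (unfold p; field; lra).
    assert (E2 : / (b - a + 1) ^ 2 = q ^ 2) by (unfold q; field; lra).
    rewrite E1, E2.
    assert (E3 : p * q = / (b + 2) * (p + q)) by (unfold p, q; field; lra).
    assert (E4 : / (b + 2) <= / (b + 1)) by (apply Rinv_le_contravar; lra).
    assert (Hb : 0 < / (b + 2)) by (apply Rinv_0_lt_compat; lra).
    assert (E5 : / (b + 1) ^ 2 = (/ (b + 1)) ^ 2) by (field; lra).
    rewrite E5. replace (p ^ 2 * q ^ 2) with ((p * q) ^ 2) by ring. rewrite E3.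
    set (r := / (b + 2)) in *. set (t := / (b + 1)) in *.
    assert (r ^ 2 <= t ^ 2) by (simpl; nra).
    assert ((p + q) ^ 2 <= 2 * (p ^ 2 + q ^ 2)) by (pose proof (pow2_ge_0 (p - q)); lra).
    replace ((r * (p + q)) ^ 2) with (r ^ 2 * (p + q) ^ 2) by ring.
    replace (2 * t ^ 2 * (p ^ 2 + q ^ 2)) with (t ^ 2 * (2 * (p ^ 2 + q ^ 2))) by ring.
    apply Rmult_le_compat; auto; apply pow2_ge_0.
  - rewrite rsum_scal, rsum_plus. pose proof (rsum_isq n). pose proof (rsum_isq_rev n).
    pose proof (isq_pos n). pose proof (pos_INR n).
    assert (0 < / (INR n + 1)) by (apply Rinv_0_lt_compat; lra).
    apply Rle_trans with (2 * isq n * 4); [|lra]. apply Rmult_le_compat_l; lra.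
Qed.

Lemma isq_half (n : nat) : isq n <= 4 * isq (S n).
Proof.
  unfold isq. rewrite S_INR. pose proof (pos_INR n).
  replace (4 * / (INR n + 1 + 1) ^ 2) with (/ ((INR n + 1 + 1) ^ 2 / 4)) by (field; lra).
  apply Rinv_le_contravar; nra.
Qed.

Lemma isq_le_1 (n : nat) : isq n <= 1.
Proof.
  unfold isq. rewrite <- Rinv_1. pose proof (pos_INR n). apply Rinv_le_contravar; nra.
Qed.

(** Recursion on the whole history, where a next value is guaranteed only for histories that satisfy
    the relation. The first hypothesis says that [P n] sees the values below n alone, so finite
    tables may be exchanged for the final sequence. *)
Lemma strong_choice {A : Type} (P : nat -> (nat -> A) -> A -> Prop) (d : A) :
  (forall n phi psi a, (forall i, (i < n)%nat -> phi i = psi i) -> P n phi a -> P n psi a) ->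
  (forall n phi, (forall i, (i < n)%nat -> P i phi (phi i)) -> exists a, P n phi a) ->
  exists phi, forall n, P n phi (phi n).
Proof.
  intros Hext Hstep.
  assert (Hstep' : forall n (phi : nat -> A), exists a, (forall i, (i < n)%nat -> P i phi (phi i)) -> P n phi a).
  { intros n phi. destruct (classic (forall i, (i < n)%nat -> P i phi (phi i))) as [H|H].
    - destruct (Hstep n phi H) as [a Ha]. exists a; auto.
    - exists d. intros H'; contradiction. }
  set (next := fun n phi => proj1_sig (constructive_indefinite_description _ (Hstep' n phi))).
  assert (Hnext : forall n phi, (forall i, (i < n)%nat -> P i phi (phi i)) -> P n phi (next n phi)).
  { intros n phi. unfold next. destruct (constructive_indefinite_description _ (Hstep' n phi)); auto. }
  clearbody next.
  (* [tab n] holds the first n values and the default [d] beyond them. *)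
  set (tab := fix tab (n : nat) : nat -> A := match n with
     | O => fun _ => d
     | S k => fun i => if Nat.eq_dec i k then next k (tab k) else tab k i end).
  assert (Htab : forall n i, (i < n)%nat -> tab n i = tab (S i) i).
  { induction n as [|n IH]; intros i Hi; [lia|]. simpl.
    destruct (Nat.eq_dec i n) as [->|Hne].
    - destruct (Nat.eq_dec n n); [reflexivity | lia].
    - rewrite IH by lia. reflexivity. }
  exists (fun n => tab (S n) n). intros n.
  induction n as [n IH] using lt_wf_ind.
  apply (Hext n (tab n)).
  - intros i Hi. apply Htab, Hi.
  - replace (tab (S n) n) with (next n (tab n)) by (simpl; destruct (Nat.eq_dec n n); [reflexivity | lia]).
    apply Hnext. intros i Hi. rewrite Htab by auto.
    apply (Hext i (fun k => tab (S k) k)); [|apply IH, Hi].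
    intros j Hj. symmetry. apply Htab. lia.
Qed.

(** Coefficient of order n in the parameter e of the profile equation. The product Re F Im F = Im
    (F^2) / 2 is symmetrized to match the Cauchy square of F; the advection term carries a factor e,
    so its indices add up to n - 1. *)
Definition profile_eq (f e : nat -> R -> C) (n : nat) (x : R) : Prop :=
  snd (f n x) + snd (e n x)
  - / 2 * (rsum (fun i => fst (f i x) * snd (f (n - i)%nat x)) (S n)
           + rsum (fun i => snd (f i x) * fst (f (n - i)%nat x)) (S n))
  + match n with
    | O => 0
    | S k => rsum (fun i => ball_avg (f i) x * snd (e (k - i)%nat x)) (S k)
    end = 0.

Theorem formal_solution (Cy : R) : 1 <= Cy -> exists A Rr, 1 <= A /\ 1 <= Rr /\
  forall s be y, 0 < s <= 1 -> 4 * s / 3 <= be <= 3 * s / 2 ->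
  wball (omega s) Cy y -> y 0 = RtoC 1 -> scder be y (fun x => - y x + y x * y x)%C ->
  exists f e : nat -> R -> C,
    f 0%nat 0 = RtoC 2 /\
    forall n, wball (omega s) (A * Rr ^ n) (f n) /\ wball (omega s) (A * Rr ^ n) (e n) /\
      scder be (f n) (e n) /\ forall x, 0 < x -> profile_eq f e n x.
Proof.
  intros HCy.
  (* [K] bounds the linear inverse and [Q] the terms of order 0. [th] is so small that the quadratic
     terms use half of the majorant (16 K th = 1), and then [Rr] so large that the advection terms
     use the other half (th Rr = 256 Q^2 K). *)
  set (K := 6000 * Cy ^ 5). set (Q := 6 * Cy ^ 2). set (th := / (16 * K)).
  set (Rr := 256 * Q ^ 2 * K / th).
  assert (HK : 6000 <= K) by (unfold K; pose proof (pow_R1_Rle Cy 5 HCy); lra).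
  assert (HQ : 6 <= Q) by (unfold Q; pose proof (pow_R1_Rle Cy 2 HCy); lra).
  assert (Hth : 0 < th) by (apply Rinv_0_lt_compat; lra).
  assert (Hth1 : th <= 1) by (unfold th; rewrite <- Rinv_1; apply Rinv_le_contravar; lra).
  assert (HKth : 16 * K * th = 1) by (unfold th; field; lra).
  assert (HR1 : 1 <= Rr).
  { unfold Rr. apply Rle_div_r; auto. assert (36 <= Q ^ 2) by nra. nra. }
  assert (HRth : th * Rr = 256 * Q ^ 2 * K) by (unfold Rr; field; lra).
  exists Q, Rr. split; [lra|]. split; auto.
  intros s be y Hs Hbe Hy Hy0 Hyd.
  pose proof (omega_weight s Hs) as Hw.
  (* The term of order 0 is given and not small; it is kept apart so that the small factor [th] can
     be put on all others, which are the ones that enter the remaining quadratic terms. *)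
  set (m := fun n : nat => match n with O => Q | S k => th * Rr ^ (S k) * isq (S k) end).
  assert (HRn : forall n, 1 <= Rr ^ n) by (intros n; apply pow_R1_Rle; auto).
  assert (Hm0 : forall n, 0 <= m n).
  { intros [|n]; simpl; [lra|]. pose proof (isq_pos (S n)). pose proof (HRn (S n)). simpl in *.
    apply Rmult_le_pos; [|lra]. apply Rmult_le_pos; lra. }
  assert (HmQ : forall n, m n <= Q * Rr ^ n * isq n).
  { intros [|n]; unfold m.
    - unfold isq. simpl. lra.
    - pose proof (isq_pos (S n)). pose proof (HRn (S n)).
      apply Rmult_le_compat_r; [lra|]. apply Rmult_le_compat_r; lra. }
  assert (Hconv1 : forall k, rsum (fun i => m (S i) * m (k - i)%nat) k <= 8 * th ^ 2 * Rr ^ (S k) * isq (S k)).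
  { intros k.
    apply Rle_trans with (rsum (fun i => th ^ 2 * Rr ^ (S k) * (isq (S i) * isq (k - i))) k).
    - apply rsum_le. intros i Hi. replace (k - i)%nat with (S (k - i - 1)) by lia.
      set (j := (k - i - 1)%nat). unfold m. replace (S k) with (S i + S j)%nat by (unfold j; lia).
      rewrite pow_add. right. ring.
    - rewrite rsum_scal. pose proof (isq_conv (S k)) as H. rewrite rsum_head in H.
      change (rsum (fun i => isq (S i) * isq (S k - S i)) (S k)) with
        (rsum (fun i => isq (S i) * isq (k - i)) k + isq (S k) * isq (k - k)) in H.
      pose proof (isq_pos 0). pose proof (isq_pos (S k - 0)). pose proof (isq_pos (S k)). pose proof (isq_pos (k - k)).
      pose proof (HRn (S k)).
      assert (Hs1 : rsum (fun i => isq (S i) * isq (k - i)) k <= 8 * isq (S k)) by nra.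
      apply Rle_trans with (th ^ 2 * Rr ^ S k * (8 * isq (S k))); [|right; ring].
      apply Rmult_le_compat_l; auto. apply Rmult_le_pos; [nra | lra]. }
  assert (Hconv2 : forall k, rsum (fun i => m i * m (k - i)%nat) (S k) <= 32 * Q ^ 2 * Rr ^ k * isq (S k)).
  { intros k.
    apply Rle_trans with (rsum (fun i => Q ^ 2 * Rr ^ k * (isq i * isq (k - i))) (S k)).
    - apply rsum_le. intros i Hi.
      apply Rle_trans with ((Q * Rr ^ i * isq i) * (Q * Rr ^ (k - i) * isq (k - i))).
      + apply Rmult_le_compat; auto.
      + replace (Rr ^ k) with (Rr ^ i * Rr ^ (k - i)) by (rewrite <- pow_add; f_equal; lia). right. ring.
    - rewrite rsum_scal. pose proof (isq_conv k). pose proof (isq_half k). pose proof (HRn k).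
      apply Rle_trans with (Q ^ 2 * Rr ^ k * (32 * isq (S k))); [|right; ring].
      apply Rmult_le_compat_l; [|lra]. apply Rmult_le_pos; [nra | lra]. }
  (* Inner part of the Cauchy square at order k + 1. Its two end terms, with f_0 = 2 y, make up the
     term 2 y f of the linearization. *)
  set (rhs1 := fun (phi : nat -> (R -> C) * (R -> C)) k x =>
     csum (fun i => fst (phi (S i)) x * fst (phi (k - i)%nat) x)%C k).
  set (P := fun (n : nat) (phi : nat -> (R -> C) * (R -> C)) (a : (R -> C) * (R -> C)) =>
     wball (omega s) (m n) (fst a) /\ wball (omega s) (m n) (snd a) /\ scder be (fst a) (snd a) /\
     match n with
     | O => a = (fun x => RtoC 2 * y x, fun x => RtoC 2 * (- y x + y x * y x))%C
     | S k => forall x, 0 < x -> snd (fst a x + snd a x - 2 * y x * fst a x)%C =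
          snd (RtoC (/ 2) * rhs1 phi k x)%C
          - rsum (fun i => ball_avg (fst (phi i)) x * snd (snd (phi (k - i)%nat) x)) (S k)
     end).
  destruct (strong_choice P ((fun _ => RtoC 0), (fun _ => RtoC 0))) as [phi Hphi].
  - intros n phi psi a Heq [H1 [H2 [H3 H4]]]. split; auto. split; auto. split; auto.
    destruct n as [|k]; auto. intros x Hx. rewrite H4 by auto. f_equal.
    + f_equal. f_equal. unfold rhs1.
      assert (E : forall j, (j <= k)%nat -> csum (fun i => fst (phi (S i)) x * fst (phi (k - i)%nat) x)%C j
        = csum (fun i => fst (psi (S i)) x * fst (psi (k - i)%nat) x)%C j).
      { induction j as [|j IH]; intros Hj; simpl; [reflexivity|].
        rewrite IH by lia. rewrite !Heq by lia. reflexivity. }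
      apply E; lia.
    + apply rsum_ext. intros i Hi. rewrite !Heq by lia. reflexivity.
  - intros n phi Hphi. destruct n as [|k].
    + exists (fun x => RtoC 2 * y x, fun x => RtoC 2 * (- y x + y x * y x))%C.
      split; [|split; [|split]]; cbn [fst snd]; auto.
      * eapply wball_mono; [|apply (wball_scal _ 2); exact Hy]. simpl. unfold Q.
        rewrite Rabs_pos_eq by lra. simpl. nra.
      * eapply wball_mono; [|apply (wball_scal _ 2); apply wball_add; auto;
          [apply wball_opp; auto; exact Hy | apply wball_omega_mult; eauto]].
        simpl. unfold Q. rewrite Rabs_pos_eq by lra. simpl. nra.
      * apply (scder_scal be (RtoC 2) y); auto.
    + assert (HN : forall i, exists h, (i <= k)%nat -> wball (omega s) (4 * m i * m (k - i)%nat) h /\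
         forall x, 0 < x -> snd (h x) = ball_avg (fst (phi i)) x * snd (snd (phi (k - i)%nat) x)).
      { intros i. destruct (le_lt_dec i k) as [Hi|Hi].
        - destruct (advection s (m i) (m (k - i)%nat) (fst (phi i)) (snd (phi (k - i)%nat)) Hs) as [h Hh].
          + apply Hphi. lia.
          + apply (Hphi (k - i)%nat). lia.
          + exists h. auto.
        - exists (fun _ => RtoC 0). intros; lia. }
      set (h := fun i => proj1_sig (constructive_indefinite_description _ (HN i))).
      assert (Hh : forall i, (i <= k)%nat -> wball (omega s) (4 * m i * m (k - i)%nat) (h i) /\
         forall x, 0 < x -> snd (h i x) = ball_avg (fst (phi i)) x * snd (snd (phi (k - i)%nat) x)).
      { intros i. unfold h. destruct (constructive_indefinite_description _ (HN i)); auto. }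
      clearbody h. clear HN.
      set (g := fun x => (RtoC (/ 2) * rhs1 phi k x - csum (fun i => h i x) (S k))%C).
      assert (Hg : wball (omega s) (m (S k) / K) g).
      { eapply wball_mono; [|apply (wball_minus (omega s)
            (Rabs (/ 2) * rsum (fun i => 2 * m (S i) * m (k - i)%nat) k)
            (rsum (fun i => 4 * m i * m (k - i)%nat) (S k))
            (fun x => RtoC (/ 2) * rhs1 phi k x)%C (fun x => csum (fun i => h i x) (S k)))]; auto.
        - rewrite Rabs_pos_eq by lra.
          rewrite (rsum_ext _ (fun i => 2 * (m (S i) * m (k - i)%nat))) by (intros; ring).
          rewrite rsum_scal.
          rewrite (rsum_ext _ (fun i => 4 * (m i * m (k - i)%nat)) (S k)) by (intros; ring).
          rewrite rsum_scal.
          pose proof (Hconv1 k). pose proof (Hconv2 k).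
          apply Rle_trans with (8 * th ^ 2 * Rr ^ S k * isq (S k) + 128 * Q ^ 2 * Rr ^ k * isq (S k)); [lra|].
          apply Rle_div_r; [lra|]. unfold m.
          replace (th * Rr ^ S k * isq (S k)) with
             ((th / 2) * Rr ^ S k * isq (S k) + (th * Rr / 2) * Rr ^ k * isq (S k)) by (simpl; field).
          rewrite HRth.
          replace ((8 * th ^ 2 * Rr ^ S k * isq (S k) + 128 * Q ^ 2 * Rr ^ k * isq (S k)) * K)
            with ((16 * K * th) * (th / 2) * Rr ^ S k * isq (S k) + 256 * Q ^ 2 * K / 2 * Rr ^ k * isq (S k)) by field.
          rewrite HKth. right. ring.
        - apply wball_scal. unfold rhs1. apply wball_csum; auto. intros i Hi.
          apply wball_omega_mult; auto.
          + apply (Hphi (S i)). lia.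
          + apply (Hphi (k - i)%nat). lia.
        - apply wball_csum; auto. intros i Hi. apply Hh. lia. }
      destruct (linear_inverse s be Hs Hbe y Cy HCy Hy Hy0 Hyd _ g Hg) as [f [e [Hf [He [Hfe Heq]]]]].
      exists (f, e). unfold P. cbn [fst snd].
      assert (HmK : 0 <= m (S k) / K) by (apply Rdiv_le_0_compat; [apply Hm0 | lra]).
      assert (Em : K * (m (S k) / K) = m (S k)) by (field; lra).
      split; [|split; [|split]]; auto.
      * apply wball_mono with (1000 * Cy ^ 4 * (m (S k) / K)); auto.
        rewrite <- Em at 2. apply Rmult_le_compat_r; auto. unfold K.
        assert (Cy ^ 4 <= Cy ^ 5) by (apply Rle_pow; [lra | lia]).
        assert (0 <= Cy ^ 4) by (apply pow_le; lra). lra.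
      * apply wball_mono with (6000 * Cy ^ 5 * (m (S k) / K)); auto.
        rewrite <- Em at 2. apply Rmult_le_compat_r; auto. unfold K. lra.
      * intros x Hx. rewrite Heq by auto. unfold g.
        assert (Esub : forall u v : C, snd (u - v)%C = snd u - snd v) by (intros; reflexivity).
        rewrite Esub. f_equal. rewrite snd_csum. apply rsum_ext. intros i Hi.
        apply Hh; auto. lia.
  - exists (fun n => fst (phi n)), (fun n => snd (phi n)). split.
    { destruct (Hphi 0%nat) as [_ [_ [_ H]]]. rewrite H. cbn [fst]. rewrite Hy0. ring. }
    intros n. destruct (Hphi n) as [H1 [H2 [H3 H4]]].
    assert (Hmn : m n <= Q * Rr ^ n).
    { eapply Rle_trans; [apply HmQ|]. pose proof (isq_le_1 n). pose proof (HRn n).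
      assert (0 <= Q * Rr ^ n) by nra. nra. }
    split; [|split; [|split]]; eauto using wball_mono.
    intros x Hx. unfold profile_eq.
    destruct n as [|k].
    + rewrite H4. cbn [fst snd]. unfold rsum. replace (0 - 0)%nat with 0%nat by lia. rewrite H4. cbn [fst snd].
      simpl. field.
    + assert (H0 : fst (phi 0%nat) = fun x => (RtoC 2 * y x)%C).
      { destruct (Hphi 0%nat) as [_ [_ [_ H]]]. rewrite H. reflexivity. }
      specialize (H4 x Hx).
      assert (Ec : forall a b : nat -> R, rsum (fun i => a i * b (S k - i)%nat) (S (S k))
         = a 0%nat * b (S k) + rsum (fun i => a (S i) * b (k - i)%nat) k + a (S k) * b 0%nat).
      { intros a b. rewrite rsum_head.
        change (rsum (fun i => a (S i) * b (S k - S i)%nat) (S k)) with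
          (rsum (fun i => a (S i) * b (k - i)%nat) k + a (S k) * b (k - k)%nat).
        replace (k - k)%nat with 0%nat by lia. replace (S k - 0)%nat with (S k) by lia. ring. }
      rewrite (Ec (fun i => fst (fst (phi i) x)) (fun i => snd (fst (phi i) x))).
      rewrite (Ec (fun i => snd (fst (phi i) x)) (fun i => fst (fst (phi i) x))).
      rewrite H0.
      assert (E2 : snd (RtoC (/ 2) * rhs1 phi k x)%C = / 2 *
         (rsum (fun i => fst (fst (phi (S i)) x) * snd (fst (phi (k - i)%nat) x)) k
          + rsum (fun i => snd (fst (phi (S i)) x) * fst (fst (phi (k - i)%nat) x)) k)).
      { rewrite RtoC_mult_pair. cbn [snd]. f_equal. unfold rhs1. rewrite snd_csum, <- rsum_plus.
        apply rsum_ext. intros i Hi. simpl. ring. }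
      rewrite E2 in H4. cbv beta.
      set (S1 := rsum (fun i => fst (fst (phi (S i)) x) * snd (fst (phi (k - i)%nat) x)) k) in *.
      set (S2 := rsum (fun i => snd (fst (phi (S i)) x) * fst (fst (phi (k - i)%nat) x)) k) in *.
      set (S3 := rsum (fun i => ball_avg (fst (phi i)) x * snd (snd (phi (k - i)%nat) x)) (S k)) in *.
      clearbody S1 S2 S3.
      set (F := fst (phi (S k)) x) in *. set (E := snd (phi (S k)) x) in *. set (Y := y x) in *.
      clearbody F E Y. clear - H4. destruct F as [F1 F2], E as [E1 E2], Y as [Y1 Y2].
      simpl in *. lra.
Qed.

(** * The inverse 1 / (1 + p ^ be) for small exponents *)

(** A constant is the limit of multiples of [ek k] as k tends to 0, at cost tending to |c| when the
    weight comes close to 1 there; [omega] is unbounded at 0 instead. *)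
Lemma wball_const (w : R -> R) (c : R) : weight w ->
  (forall d eta, 0 < d -> 0 < eta -> exists k, 0 < k < d /\ w k <= 1 + eta) ->
  wball w (Rabs c) (fun _ => RtoC c).
Proof.
  intros Hw H. replace (Rabs c) with (Rabs c * 1) by ring.
  apply wball_ext with (fun _ => RtoC c * RtoC 1)%C; [intros; ring|].
  apply (wball_scal w c 1 (fun _ => RtoC 1)).
  apply wball_slack; auto; [lra|]. intros eta He. apply wball_closed. intros X e He'.
  pose proof (Rabs_pos X) as HX.
  destruct (H (e / (Rabs X + 1)) eta) as [k [Hk1 Hk2]]; auto.
  { apply Rdiv_lt_0_compat; lra. }
  exists (ek k). split.
  - apply wball_mono with (w k); auto. apply wball_ek; auto. lra.
  - intros x Hx. rewrite <- (ek_0 k). eapply Rle_trans; [apply Cmod_ek_diff|].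
    rewrite Rabs_mult, Rabs_pos_eq by lra.
    assert (Rabs (0 - x) <= Rabs X + 1).
    { rewrite Rabs_minus_sym, Rminus_0_r, Rabs_pos_eq by lra. pose proof (Rle_abs X). lra. }
    apply Rle_trans with (e / (Rabs X + 1) * (Rabs X + 1)); [|right; field; lra].
    apply Rmult_le_compat; try lra. apply Rabs_pos.
Qed.

(* The geometric series is built by the affine iteration p -> 1/D + (f/D) p, whose cost keeps the bound 1/(D - N). *)
Lemma wball_resolvent (w : R -> R) (D N : R) (f : R -> C) : weight w ->
  (forall d eta, 0 < d -> 0 < eta -> exists k, 0 < k < d /\ w k <= 1 + eta) ->
  (forall k l, 0 < k -> 0 < l -> w (k + l) <= 1 * w k * w l) ->
  N < D -> wball w N f -> wball w (/ (D - N)) (fun x => / (RtoC D - f x))%C.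
Proof.
  intros Hw Hc Hm HND Hf.
  pose proof (wball_nonneg w Hw _ _ Hf) as HN.
  set (p := fix p (n : nat) : R -> C := match n with
    | O => fun _ => RtoC 0
    | S k => fun x => (RtoC (/ D) + RtoC (/ D) * (f x * p k x))%C end).
  assert (Hp : forall n, wball w (/ (D - N)) (p n)).
  { induction n as [|n IH].
    - apply wball_mono with 0; [left; apply Rinv_0_lt_compat; lra | apply wball_0; auto].
    - apply wball_mono with (Rabs (/ D) + Rabs (/ D) * (1 * N * / (D - N))).
      + rewrite Rabs_pos_eq by (left; apply Rinv_0_lt_compat; lra). right. field. lra.
      + apply (wball_add w _ _ (fun _ => RtoC (/ D)) (fun x => RtoC (/ D) * (f x * p n x))%C).
        * apply wball_const; auto.
        * apply wball_scal. apply (wball_mult w w w 1); auto. lra. }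
  assert (Hden : forall x, 0 <= x -> D - N <= Cmod (RtoC D - f x)).
  { intros x Hx. pose proof (wball_bound w Hw N f Hf x Hx).
    pose proof (Cmod_triangle (RtoC D - f x) (f x)) as H1.
    replace (RtoC D - f x + f x)%C with (RtoC D) in H1 by ring.
    rewrite Cmod_R, Rabs_pos_eq in H1 by lra. lra. }
  assert (Hne : forall x, 0 <= x -> (RtoC D - f x)%C <> RtoC 0).
  { intros x Hx E. specialize (Hden x Hx). rewrite E, Cmod_0 in Hden. lra. }
  assert (Hinv : forall x, 0 <= x -> Cmod (/ (RtoC D - f x)) <= / (D - N)).
  { intros x Hx. rewrite Cmod_inv by auto. apply Rinv_le_contravar; [lra | auto]. }
  assert (HD0 : RtoC D <> RtoC 0) by (intros E; apply RtoC_inj in E; lra).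
  assert (Herr : forall n x, 0 <= x -> Cmod (/ (RtoC D - f x) - p n x) <= (N / D) ^ n * / (D - N)).
  { induction n as [|n IH]; intros x Hx; simpl.
    - replace (/ (RtoC D - f x) - 0)%C with (/ (RtoC D - f x))%C by ring. rewrite Rmult_1_l. auto.
    - replace (/ (RtoC D - f x) - (RtoC (/ D) + RtoC (/ D) * (f x * p n x)))%C
        with (RtoC (/ D) * f x * (/ (RtoC D - f x) - p n x))%C.
      + rewrite !Cmod_mult, Cmod_R, Rabs_pos_eq by (left; apply Rinv_0_lt_compat; lra).
        replace (N / D * (N / D) ^ n * / (D - N)) with (/ D * N * ((N / D) ^ n * / (D - N))) by (field; lra).
        assert (0 < / D) by (apply Rinv_0_lt_compat; lra).
        apply Rmult_le_compat; auto using Cmod_ge_0.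
        * apply Rmult_le_pos; [lra | apply Cmod_ge_0].
        * apply Rmult_le_compat_l; [lra|]. apply (wball_bound w Hw N f Hf); auto.
      + rewrite RtoC_inv by lra. field. split; auto. }
  apply wball_closed. intros X eta He.
  assert (Hq : 0 <= N / D < 1).
  { split; [apply Rdiv_le_0_compat; lra | apply Rlt_div_l; lra]. }
  destruct (pow_lt_1_zero (N / D) ltac:(rewrite Rabs_pos_eq; lra) (eta * (D - N))) as [n Hn]; [nra|].
  exists (p n). split; auto. intros x Hx. eapply Rle_trans; [apply Herr; lra|].
  specialize (Hn n (Nat.le_refl n)). apply Rabs_def2 in Hn.
  apply Rmult_le_reg_r with (D - N); [lra|]. rewrite Rmult_assoc, Rinv_l by lra. lra.
Qed.

Lemma scder_inv (be : R) (f e : R -> C) : (forall x, 0 < x -> f x <> RtoC 0) ->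
  scder be f e -> scder be (fun x => / f x)%C (fun x => - (e x * / f x * / f x))%C.
Proof.
  intros Hf0 H x Hx. destruct (H x Hx) as [H1 H2].
  assert (Hpos : fst (f x) ^ 2 + snd (f x) ^ 2 <> 0).
  { intros E. apply (Hf0 x Hx). apply injective_projections; simpl; nra. }
  set (u := fun y => fst (f y)) in *. set (v := fun y => snd (f y)) in *.
  set (du := fst (RtoC (be / x) * e x)%C) in *. set (dv := snd (RtoC (be / x) * e x)%C) in *.
  assert (Hd : is_derive (fun y => u y ^ 2 + v y ^ 2) x (2 * u x * du + 2 * v x * dv)).
  { evar_last.
    - apply (is_derive_plus (K := R_AbsRing) (V := R_NormedModule));
      [apply (is_derive_pow u 2 x du); exact H1 | apply (is_derive_pow v 2 x dv); exact H2].
    - unfold plus; simpl. ring. }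
  assert (E1 : fst (RtoC (be / x) * - (e x * / f x * / f x))%C =
     (du * (u x ^ 2 + v x ^ 2) - u x * (2 * u x * du + 2 * v x * dv)) / (u x ^ 2 + v x ^ 2) ^ 2).
  { unfold du, dv, u, v. destruct (f x) as [p q]. destruct (e x) as [r t]. simpl in *. field; repeat split; lra. }
  assert (E2 : snd (RtoC (be / x) * - (e x * / f x * / f x))%C =
     ((- dv) * (u x ^ 2 + v x ^ 2) - (- v x) * (2 * u x * du + 2 * v x * dv)) / (u x ^ 2 + v x ^ 2) ^ 2).
  { unfold du, dv, u, v. destruct (f x) as [p q]. destruct (e x) as [r t]. simpl in *. field; repeat split; lra. }
  split.
  - rewrite E1. apply (is_derive_ext (fun y => u y / (u y ^ 2 + v y ^ 2))).
    + intros y. reflexivity.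
    + apply (is_derive_div u (fun y => u y ^ 2 + v y ^ 2)); auto.
  - rewrite E2. apply (is_derive_ext (fun y => (- v y) / (u y ^ 2 + v y ^ 2))).
    + intros y. reflexivity.
    + apply (is_derive_div (fun y => - v y) (fun y => u y ^ 2 + v y ^ 2)); auto.
      apply (is_derive_opp v). exact H2.
Qed.

Section SmallExponent.
Variable s : R.
Hypothesis Hs : 0 < s <= / 4.
Let be := 4 * s / 3.

(* As [de -> 0] and [ka -> oo], [1 + de ^ (- be) - jump de ka] tends to a dilation of
   [1 + p ^ be], p = - i x. *)
Definition jump (de ka x : R) : C := (RtoC be * pint (- be) de ka x)%C.
Definition resolv (de ka x : R) : C := (/ (RtoC (1 + Rpower de (- be)) - jump de ka x))%C.
(** An auxiliary weight that is submultiplicative with constant 1 and close to 1 at low frequencies,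
    as geometric series with constant terms require. *)
Definition wrel (ka k : R) : R := 1 + k / ka.
(** [omega] with its growth frozen below [ka]. A jump measured in this weight, times factors
    measured in [wrel ka], is controlled in [omega]; the resolvents themselves are never measured in
    [omega]. *)
Definition wmax (ka m : R) : R := Rpower (Rmax m ka) s + Rpower m (- (s / 3)).

Lemma be_range : 0 < be <= / 3.
Proof. unfold be. lra. Qed.

Lemma jump_density (de ka x : R) : 0 < de -> 0 < ka ->
  jump de ka x = CRInt (fun u => RtoC (be * Rpower u (- be - 1)) * ek u x)%C de ka.
Proof.
  intros Hd Hk. unfold jump, pint. rewrite RtoC_mult_pair. unfold CRInt. cbn [fst snd].
  assert (H : forall f g : R -> R, (forall u, 0 < u -> continuous f u) ->
    (forall u, 0 < u -> g u = be * f u) -> be * RInt f de ka = RInt g de ka).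
  { intros f g Hf Hg. rewrite (RInt_ext g (fun u => scal be (f u))).
    - rewrite (RInt_scal (V := R_CompleteNormedModule)); [reflexivity|]. apply ex_RInt_pos; auto.
    - intros u Hu. apply Hg. pose proof (Rmin_pos de ka Hd Hk). lra. }
  apply injective_projections; cbn [fst snd]; apply H.
  - intros u Hu. exact (proj1 (continuous_Cek (fun v => Rpower v (- be - 1)) x u (continuous_Rpower _ _ Hu))).
  - intros u Hu. simpl. ring.
  - intros u Hu. exact (proj2 (continuous_Cek (fun v => Rpower v (- be - 1)) x u (continuous_Rpower _ _ Hu))).
  - intros u Hu. simpl. ring.
Qed.

Lemma RInt_jump (c a b : R) : 0 < a -> 0 < b ->
  is_RInt (fun u => c * (be * Rpower u (- be - 1))) a b (c * (Rpower a (- be) - Rpower b (- be))).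
Proof.
  intros Ha Hb. pose proof be_range.
  replace (c * (Rpower a (- be) - Rpower b (- be)))
    with (scal (c * be) ((Rpower b (- be) - Rpower a (- be)) / (- be)))
    by (unfold scal; simpl; unfold mult; simpl; field; lra).
  apply (is_RInt_ext (fun u => scal (c * be) (Rpower u (- be - 1)))).
  - intros u _. unfold scal; simpl; unfold mult; simpl. ring.
  - apply (is_RInt_scal (V := R_NormedModule)). apply is_RInt_Rpower; lra.
Qed.

Lemma wball_jump (w : R -> R) (c de ka : R) : weight w -> 0 < de <= ka ->
  (forall u, de <= u <= ka -> w u <= c) ->
  wball w (c * (Rpower de (- be) - Rpower ka (- be))) (jump de ka).
Proof.
  intros Hw Hd Hc. pose proof be_range.
  apply wball_ext with (fun x => CRInt (fun u => RtoC (be * Rpower u (- be - 1)) * ek u x)%C de ka).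
  { intros x _. symmetry. apply jump_density; lra. }
  rewrite <- (is_RInt_unique _ _ _ _ (RInt_jump c de ka ltac:(lra) ltac:(lra))).
  apply wball_density; auto.
  - intros u Hu. apply (continuous_mult (K := R_AbsRing)); [apply continuous_const | apply continuous_Rpower; lra].
  - intros u Hu. apply (continuous_mult (K := R_AbsRing)); [apply continuous_const |].
    apply (continuous_mult (K := R_AbsRing)); [apply continuous_const | apply continuous_Rpower; lra].
  - intros u Hu. pose proof (Rpower_pos u (- be - 1)).
    rewrite Rabs_pos_eq by nra. rewrite Rmult_comm. apply Rmult_le_compat_r; [nra | auto].
Qed.

Lemma wrel_weight (ka : R) : 0 < ka -> weight (wrel ka).
Proof.
  intros Hk k Hk'. unfold wrel. assert (0 < k / ka) by (apply Rdiv_lt_0_compat; auto). lra.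
Qed.

Lemma wrel_const (ka : R) : 0 < ka ->
  forall d eta, 0 < d -> 0 < eta -> exists k, 0 < k < d /\ wrel ka k <= 1 + eta.
Proof.
  intros Hk d eta Hd He. assert (Hm : 0 < Rmin d (eta * ka)) by (apply Rmin_pos; nra).
  pose proof (Rmin_l d (eta * ka)). pose proof (Rmin_r d (eta * ka)).
  exists (Rmin d (eta * ka) / 2). split; [lra|]. unfold wrel.
  apply Rplus_le_compat_l. apply Rle_div_l; lra.
Qed.

Lemma wrel_submult (ka k l : R) : 0 < ka -> 0 < k -> 0 < l ->
  wrel ka (k + l) <= 1 * wrel ka k * wrel ka l.
Proof.
  intros Hka Hk Hl. unfold wrel.
  assert (0 < k / ka) by (apply Rdiv_lt_0_compat; auto).
  assert (0 < l / ka) by (apply Rdiv_lt_0_compat; auto).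
  replace ((k + l) / ka) with (k / ka + l / ka) by (field; lra). nra.
Qed.

(** The density has mass de^(-be) - ka^(-be), and the part k / ka of the weight adds at most be / (1
    - be) times ka^(-be), hence half of ka^(-be) as be <= 1 / 3. The remaining gap to 1 + de^(-be)
    does not depend on [de]. *)
Lemma jump_wrel (de ka : R) : 0 < de <= ka ->
  wball (wrel ka) (Rpower de (- be) - Rpower ka (- be) / 2) (jump de ka).
Proof.
  intros Hd. pose proof be_range as Hb.
  apply wball_ext with (fun x => CRInt (fun u => RtoC (be * Rpower u (- be - 1)) * ek u x)%C de ka).
  { intros x _. symmetry. apply jump_density; lra. }
  set (m := fun u => plus (1 * (be * Rpower u (- be - 1))) (scal (be / ka) (Rpower u (1 - be - 1)))).
  assert (E : is_RInt m de ka (plus (1 * (Rpower de (- be) - Rpower ka (- be)))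
      (scal (be / ka) ((Rpower ka (1 - be) - Rpower de (1 - be)) / (1 - be))))).
  { apply (is_RInt_plus (V := R_NormedModule)).
    - apply RInt_jump; lra.
    - apply (is_RInt_scal (V := R_NormedModule)). apply is_RInt_Rpower; lra. }
  eapply wball_mono; [|apply (wball_density (wrel ka) de ka _ m); auto].
  - rewrite (is_RInt_unique _ _ _ _ E). unfold plus, scal; simpl; unfold mult; simpl.
    pose proof (Rpower_pos de (1 - be)). pose proof (Rpower_pos ka (- be)).
    assert (Ek : Rpower ka (1 - be) = ka * Rpower ka (- be)).
    { unfold Rminus. rewrite Rpower_plus, Rpower_1; lra. }
    assert (Hq : be / ka * ((Rpower ka (1 - be) - Rpower de (1 - be)) / (1 - be)) <= Rpower ka (- be) / 2).
    { apply Rle_trans with (be / ka * (Rpower ka (1 - be) / (1 - be))).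
      - apply Rmult_le_compat_l; [apply Rdiv_le_0_compat; lra|].
        apply Rmult_le_compat_r; [left; apply Rinv_0_lt_compat; lra | lra].
      - rewrite Ek. replace (be / ka * (ka * Rpower ka (- be) / (1 - be)))
          with (be / (1 - be) * Rpower ka (- be)) by (field; lra).
        assert (be / (1 - be) <= / 2) by (apply Rle_div_l; lra). nra. }
    lra.
  - apply wrel_weight; lra.
  - intros u Hu. apply (continuous_mult (K := R_AbsRing)); [apply continuous_const | apply continuous_Rpower; lra].
  - intros u Hu. apply (continuous_plus (K := R_AbsRing) (V := R_NormedModule)).
    + apply (continuous_mult (K := R_AbsRing)); [apply continuous_const |].
      apply (continuous_mult (K := R_AbsRing)); [apply continuous_const | apply continuous_Rpower; lra].
    + apply (continuous_mult (K := R_AbsRing)); [apply continuous_const | apply continuous_Rpower; lra].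
  - intros u Hu. pose proof (Rpower_pos u (- be - 1)).
    rewrite Rabs_pos_eq by nra. unfold m, wrel, plus, scal; simpl; unfold mult; simpl.
    replace (Rpower u (1 - be - 1)) with (u * Rpower u (- be - 1)).
    + right. field. lra.
    + rewrite <- (Rpower_1 u) at 1 by lra. rewrite <- Rpower_plus. f_equal. ring.
Qed.

Lemma resolv_wrel (de ka : R) : 0 < de <= ka ->
  wball (wrel ka) (2 / (1 + Rpower ka (- be))) (resolv de ka).
Proof.
  intros Hd. pose proof (Rpower_pos ka (- be)).
  apply wball_mono with (/ (1 + Rpower de (- be) - (Rpower de (- be) - Rpower ka (- be) / 2))).
  - replace (2 / (1 + Rpower ka (- be))) with (/ ((1 + Rpower ka (- be)) / 2)) by (field; lra).
    apply Rinv_le_contravar; lra.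
  - apply wball_resolvent.
    + apply wrel_weight; lra.
    + apply wrel_const; lra.
    + intros k l Hk Hl. apply wrel_submult; lra.
    + lra.
    + apply jump_wrel; auto.
Qed.

Lemma jump_bound (de ka x : R) : 0 < de <= ka -> 0 <= x ->
  Cmod (jump de ka x) <= Rpower de (- be) - Rpower ka (- be).
Proof.
  intros Hd Hx. rewrite <- (Rmult_1_l (Rpower de (- be) - Rpower ka (- be))).
  apply (wball_bound (fun _ => 1)); auto.
  - intros k Hk. lra.
  - apply wball_jump; auto; [intros k Hk; lra | intros; lra].
Qed.

Lemma resolv_den (de ka x : R) : 0 < de <= ka -> 0 <= x ->
  1 <= Cmod (RtoC (1 + Rpower de (- be)) - jump de ka x).
Proof.
  intros Hd Hx. pose proof (jump_bound de ka x Hd Hx) as H.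
  pose proof (Rpower_pos ka (- be)). pose proof (Rpower_pos de (- be)).
  pose proof (Cmod_triangle (RtoC (1 + Rpower de (- be)) - jump de ka x) (jump de ka x)) as Htri.
  replace (RtoC (1 + Rpower de (- be)) - jump de ka x + jump de ka x)%C
    with (RtoC (1 + Rpower de (- be))) in Htri by ring.
  rewrite Cmod_R, Rabs_pos_eq in Htri by lra. lra.
Qed.

Lemma resolv_den_neq (de ka x : R) : 0 < de <= ka -> 0 <= x ->
  (RtoC (1 + Rpower de (- be)) - jump de ka x)%C <> RtoC 0.
Proof.
  intros Hd Hx E. pose proof (resolv_den de ka x Hd Hx) as H. rewrite E, Cmod_0 in H. lra.
Qed.

Lemma resolv_bound (de ka x : R) : 0 < de <= ka -> 0 <= x -> Cmod (resolv de ka x) <= 1.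
Proof.
  intros Hd Hx. unfold resolv. rewrite Cmod_inv by (apply resolv_den_neq; auto).
  apply Rle_trans with (/ 1); [|lra].
  apply Rinv_le_contravar; [lra | apply resolv_den; auto].
Qed.

Lemma wmax_weight (ka : R) : 0 < ka -> weight (wmax ka).
Proof.
  intros Hk m Hm. unfold wmax.
  pose proof (Rpower_pos (Rmax m ka) s). pose proof (Rpower_pos m (- (s / 3))).
  destruct (Rle_dec 1 m) as [Hm1|Hm1].
  - pose proof (Rmax_l m ka). pose proof (Rpower_ge_1 (Rmax m ka) s ltac:(lra) ltac:(lra)). lra.
  - pose proof (Rpower_neg_ge_1 m (s / 3) ltac:(lra) ltac:(lra)). lra.
Qed.

(** One has m + k <= max (m, ka) (1 + k / ka), and the exponent s <= 1 may be dropped on the second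
    factor. *)
Lemma omega_wmax (ka m k : R) : 0 < ka -> 0 < m -> 0 < k ->
  omega s (m + k) <= 1 * wmax ka m * wrel ka k.
Proof.
  intros Hka Hm Hk. unfold omega, wmax, wrel.
  assert (Hq : 0 < k / ka) by (apply Rdiv_lt_0_compat; auto).
  pose proof (Rmax_l m ka) as M1. pose proof (Rmax_r m ka) as M2.
  assert (H1 : Rpower (m + k) s <= Rpower (Rmax m ka) s * (1 + k / ka)).
  { apply Rle_trans with (Rpower (Rmax m ka * (1 + k / ka)) s).
    - apply Rle_Rpower_l; [lra|]. split; [lra|].
      assert (ka * (k / ka) = k) by (field; lra). nra.
    - rewrite <- Rpower_mult_distr by lra.
      apply Rmult_le_compat_l; [left; apply Rpower_pos|].
      rewrite <- (Rpower_1 (1 + k / ka)) at 2 by lra. apply Rle_Rpower; lra. }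
  assert (H2 : Rpower (m + k) (- (s / 3)) <= Rpower m (- (s / 3)) * 1).
  { rewrite Rmult_1_r. apply Rpower_neg_antimono; lra. }
  pose proof (Rpower_pos m (- (s / 3))). nra.
Qed.

Lemma ex_RInt_density (a b x : R) : 0 < a -> 0 < b ->
  ex_RInt (fun u => fst (RtoC (be * Rpower u (- be - 1)) * ek u x)%C) a b /\
  ex_RInt (fun u => snd (RtoC (be * Rpower u (- be - 1)) * ek u x)%C) a b.
Proof.
  intros Ha Hb.
  assert (H : forall u, 0 < u -> continuous (fun v => be * Rpower v (- be - 1)) u).
  { intros u Hu. apply (continuous_mult (K := R_AbsRing) (fun _ => be) (fun v => Rpower v (- be - 1)));
      [apply continuous_const | apply continuous_Rpower, Hu]. }
  split; apply ex_RInt_pos; auto; intros u Hu.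
  - exact (proj1 (continuous_Cek (fun v => be * Rpower v (- be - 1)) x u (H u Hu))).
  - exact (proj2 (continuous_Cek (fun v => be * Rpower v (- be - 1)) x u (H u Hu))).
Qed.

Lemma jump_split (de ka ka' x : R) : 0 < de <= ka -> ka <= ka' ->
  jump de ka' x = (jump de ka x + jump ka ka' x)%C.
Proof.
  intros Hd Hk. rewrite !jump_density by lra. unfold CRInt. apply injective_projections; cbn [fst snd].
  - symmetry. apply (RInt_Chasles (V := R_CompleteNormedModule) (fun u => fst (RtoC (be * Rpower u (- be - 1)) * ek u x)%C));
      [exact (proj1 (ex_RInt_density de ka x ltac:(lra) ltac:(lra)))
      | exact (proj1 (ex_RInt_density ka ka' x ltac:(lra) ltac:(lra)))].
  - symmetry. apply (RInt_Chasles (V := R_CompleteNormedModule) (fun u => snd (RtoC (be * Rpower u (- be - 1)) * ek u x)%C));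
      [exact (proj2 (ex_RInt_density de ka x ltac:(lra) ltac:(lra)))
      | exact (proj2 (ex_RInt_density ka ka' x ltac:(lra) ltac:(lra)))].
Qed.

(** Its decrements dominate the cost of one dyadic step in the upper cutoff, so the costs of all
    steps telescope to a bounded total. *)
Definition psi (ka : R) : R := Rpower ka (- (s / 3)) / (1 + Rpower ka (- (s / 3))).

(* [resolv de ka' - resolv de ka = resolv de ka * resolv de ka' * jump ka ka'], where the
   resolvents are bounded in the weight [1 + k / ka] and only the jump sees [omega]. *)
Lemma resolv_step (de ka ka' : R) : 0 < de <= ka -> ka <= ka' <= 2 * ka ->
  wball (omega s) (512 * (psi ka - psi ka')) (fun x => resolv de ka' x - resolv de ka x)%C.
Proof.
  intros Hd Hk.
  assert (Hw : weight (wrel ka)) by (apply wrel_weight; lra).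
  assert (H1 : wball (wrel ka) (2 / (1 + Rpower ka (- be))) (resolv de ka)) by (apply resolv_wrel; lra).
  assert (H2 : wball (wrel ka) (2 * (2 / (1 + Rpower ka' (- be)))) (resolv de ka')).
  { apply (wball_weight (wrel ka')); [lra| |apply resolv_wrel; lra].
    intros k Hk'. unfold wrel.
    assert (k / ka <= 2 * (k / ka')); [|lra].
    apply Rle_div_l; [lra|]. replace (2 * (k / ka') * ka) with (k / ka' * (2 * ka)) by ring.
    apply Rle_trans with (k / ka' * ka'); [right; field; lra|].
    apply Rmult_le_compat_l; [apply Rdiv_le_0_compat; lra | lra]. }
  assert (H3 : wball (wmax ka) (2 * omega s ka * (Rpower ka (- be) - Rpower ka' (- be))) (jump ka ka')).
  { apply wball_jump; [apply wmax_weight; lra | lra |].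
    intros u Hu. unfold wmax, omega. rewrite Rmax_left by lra.
    pose proof (Rpower_neg_antimono ka u (s / 3) ltac:(lra) ltac:(lra)).
    assert (Rpower u s <= 2 * Rpower ka s).
    { apply Rle_trans with (Rpower (2 * ka) s); [apply Rle_Rpower_l; lra|].
      rewrite <- Rpower_mult_distr by lra. apply Rmult_le_compat_r; [left; apply Rpower_pos|].
      rewrite <- (Rpower_1 2) at 2 by lra. apply Rle_Rpower; lra. }
    pose proof (Rpower_pos ka (- (s / 3))). lra. }
  assert (H4 := wball_mult _ _ _ 1 _ _ _ _ Hw Hw ltac:(lra) (fun k l Hk1 Hl => wrel_submult ka k l ltac:(lra) Hk1 Hl) H1 H2).
  assert (H5 := wball_mult _ _ (omega s) 1 _ _ _ _ (wmax_weight ka ltac:(lra)) Hw ltac:(lra)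
    (fun k l Hk1 Hl => omega_wmax ka k l ltac:(lra) Hk1 Hl) H3 H4).
  eapply wball_ext; [|eapply wball_mono; [|exact H5]].
  - intros x Hx. cbv beta.
    pose proof (resolv_den_neq de ka x Hd Hx) as N1.
    pose proof (resolv_den_neq de ka' x ltac:(lra) Hx) as N2.
    unfold resolv. rewrite (jump_split de ka ka' x) in * by lra. field. split; auto.
  (* With t = ka^(-s/3) one has ka^(-be) = t^4 and ka^s = t^(-3). The claim becomes an inequality
     between rational functions of t and t', where t' <= t <= 2 t' because ka' <= 2 ka. *)
  - set (t := Rpower ka (- (s / 3))). set (t' := Rpower ka' (- (s / 3))).
    assert (Ht' : 0 < t') by apply Rpower_pos.
    assert (Htt : t' <= t) by (apply Rpower_neg_antimono; lra).
    assert (Ht2 : t <= 2 * t').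
    { apply Rle_trans with (Rpower (ka' / 2) (- (s / 3))).
      - apply Rpower_neg_antimono; lra.
      - unfold Rdiv at 1. rewrite <- Rpower_mult_distr by lra. rewrite Rmult_comm.
        apply Rmult_le_compat_r; [lra|].
        rewrite Rpower_Ropp. unfold Rpower. rewrite ln_Rinv by lra. rewrite <- exp_Ropp.
        replace (- (s / 3 * - ln 2)) with (s / 3 * ln 2) by ring. change (Rpower 2 (s / 3) <= 2).
        rewrite <- (Rpower_1 2) at 2 by lra. apply Rle_Rpower; lra. }
    assert (P4 : forall k, Rpower k (- be) = Rpower k (- (s / 3)) ^ 4).
    { intros k. rewrite <- Rpower_pow by apply Rpower_pos. rewrite Rpower_mult. f_equal. unfold be. simpl. field. }
    assert (P3 : Rpower ka s * t ^ 3 = 1).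
    { unfold t. rewrite <- Rpower_pow by apply Rpower_pos. rewrite Rpower_mult, <- Rpower_plus.
      replace (s + - (s / 3) * INR 3) with 0 by (simpl; field). apply Rpower_O. lra. }
    unfold psi, omega. rewrite !P4. fold t t'.
    set (r := Rpower ka s) in *.
    assert (Hr : 0 < r) by apply Rpower_pos. clearbody r.
    clearbody t t'. clear H1 H2 H3 H4 H5 P4.
    assert (Ht : 0 < t) by lra.
    assert (B1 : (r + t) * (t ^ 4 - t' ^ 4) <= 4 * (1 + t ^ 4) * (t - t')).
    { assert (C1 : t ^ 4 - t' ^ 4 <= 4 * t ^ 3 * (t - t')).
      { replace (t ^ 4 - t' ^ 4) with ((t ^ 3 + t ^ 2 * t' + t * t' ^ 2 + t' ^ 3) * (t - t')) by ring.
        apply Rmult_le_compat_r; [lra|].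
        assert (t' ^ 2 <= t ^ 2) by (apply pow_incr; lra).
        assert (t' ^ 3 <= t ^ 3) by (apply pow_incr; lra).
        assert (t ^ 2 * t' <= t ^ 2 * t) by (apply Rmult_le_compat_l; [apply pow2_ge_0 | lra]).
        assert (t * t' ^ 2 <= t * t ^ 2) by (apply Rmult_le_compat_l; lra).
        simpl in *. lra. }
      apply Rle_trans with ((r + t) * (4 * t ^ 3 * (t - t'))).
      - apply Rmult_le_compat_l; lra.
      - right. replace ((r + t) * (4 * t ^ 3 * (t - t'))) with (4 * (r * t ^ 3 + t ^ 4) * (t - t')) by ring.
        rewrite P3. ring. }
    assert (B2 : (1 + t) * (1 + t') <= 8 * (1 + t' ^ 4)).
    { assert (t' ^ 2 <= 1 + t' ^ 4) by (pose proof (pow2_ge_0 (t' ^ 2 - / 2)); lra).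
      assert ((1 + t) * (1 + t') <= (1 + 2 * t') * (1 + t')) by (apply Rmult_le_compat_r; lra).
      assert ((1 + 2 * t') * (1 + t') <= 2 * (1 + t') ^ 2) by lra.
      assert ((1 + t') ^ 2 <= 2 * (1 + t' ^ 2)) by (pose proof (pow2_ge_0 (1 - t')); lra).
      assert (0 <= t' ^ 4) by (apply pow_le; lra). lra. }
    assert (T4 : 0 < t ^ 4) by (apply pow_lt; auto). assert (T4' : 0 < t' ^ 4) by (apply pow_lt; auto).
    replace (512 * (t / (1 + t) - t' / (1 + t'))) with (512 * (t - t') / ((1 + t) * (1 + t'))) by (field; lra).
    rewrite <- Rle_div_r by (apply Rmult_lt_0_compat; lra).
    replace (1 * (2 * (r + t) * (t ^ 4 - t' ^ 4)) * (1 * (2 / (1 + t ^ 4)) * (2 * (2 / (1 + t' ^ 4)))) * ((1 + t) * (1 + t')))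
      with (16 * ((r + t) * (t ^ 4 - t' ^ 4) / (1 + t ^ 4)) * (((1 + t) * (1 + t')) / (1 + t' ^ 4))) by (field; lra).
    assert (B3 : (r + t) * (t ^ 4 - t' ^ 4) / (1 + t ^ 4) <= 4 * (t - t')).
    { apply Rle_div_l; [lra|]. lra. }
    assert (B4 : (1 + t) * (1 + t') / (1 + t' ^ 4) <= 8) by (apply Rle_div_l; lra).
    assert (B5 : 0 <= (1 + t) * (1 + t') / (1 + t' ^ 4)) by (apply Rdiv_le_0_compat; [apply Rmult_le_pos|]; lra).
    apply Rle_trans with (16 * (4 * (t - t')) * 8); [|lra].
    apply Rmult_le_compat; auto; try lra.
    assert (0 <= (r + t) * (t ^ 4 - t' ^ 4) / (1 + t ^ 4)); [|lra].
    apply Rdiv_le_0_compat; [|lra]. apply Rmult_le_pos; [lra|].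
    assert (t' ^ 4 <= t ^ 4) by (apply pow_incr; lra). lra.
Qed.

Lemma psi_range (ka : R) : 0 <= psi ka <= 1.
Proof.
  unfold psi. pose proof (Rpower_pos ka (- (s / 3))).
  split; [apply Rdiv_le_0_compat; lra | apply Rle_div_l; lra].
Qed.

Lemma jump_diag (de x : R) : jump de de x = RtoC 0.
Proof.
  unfold jump, pint, CRInt. rewrite !RInt_point. apply injective_projections; simpl; unfold zero; simpl; ring.
Qed.

(** Sum of the dyadic steps. The start [resolv de de] is the constant 1 / (1 + de^(-be)); it is
    subtracted because the weight [omega] does not admit constants, and it tends to 0 with [de]. *)
Lemma resolv_ball (de : R) (n : nat) : 0 < de ->
  wball (omega s) (512 * (psi de - psi (2 ^ n * de))) (fun x => resolv de (2 ^ n * de) x - resolv de de x)%C.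
Proof.
  intros Hd. induction n as [|n IH].
  - rewrite pow_O, Rmult_1_l. replace (512 * (psi de - psi de)) with 0 by ring.
    apply wball_ext with (fun _ => RtoC 0); [intros; ring|]. apply wball_0; exact (omega_weight s ltac:(lra)).
  - assert (H1 : 1 <= 2 ^ n) by (apply pow_R1_Rle; lra).
    pose proof (resolv_step de (2 ^ n * de) (2 ^ S n * de) ltac:(nra) ltac:(simpl; nra)) as H.
    eapply wball_ext; [|eapply wball_mono; [|apply (wball_add _ _ _ _ _ IH H)]].
    + intros x _. cbv beta. ring.
    + right. ring.
Qed.

Lemma jump_at_0 (de ka : R) : 0 < de -> 0 < ka ->
  jump de ka 0 = RtoC (Rpower de (- be) - Rpower ka (- be)).
Proof.
  intros Hd Hk. rewrite jump_density by auto. unfold CRInt.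
  apply injective_projections; cbn [fst snd].
  - rewrite (RInt_ext _ (fun u => 1 * (be * Rpower u (- be - 1)))).
    + rewrite (is_RInt_unique _ _ _ _ (RInt_jump 1 de ka Hd Hk)). simpl. ring.
    + intros u _. rewrite ek_0. simpl. real_eq. ring.
  - rewrite (RInt_ext _ (fun u => 0)).
    + rewrite RInt_const. unfold scal; simpl; unfold mult; simpl. ring.
    + intros u _. rewrite ek_0. simpl. real_eq. ring.
Qed.

(** The denominator A satisfies D A = A - 1 up to two end terms: de^(-be) (1 - [ek de]), small since
    [ek de] is close to 1 on bounded sets, and ka^(-be) [ek ka]. The equation for 1 / A follows. *)
Lemma resolv_ode (de ka : R) : 0 < de <= ka -> scder be (resolv de ka)
  (fun x => - resolv de ka x + resolv de ka x * resolv de ka x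
   + (RtoC (Rpower de (- be)) * (1 - ek de x) + RtoC (Rpower ka (- be)) * ek ka x) * (resolv de ka x * resolv de ka x))%C.
Proof.
  intros Hd. pose proof be_range as Hb.
  assert (Hbs : 4 * s / 3 <= be <= 3 * s / 2) by (unfold be; lra).
  assert (Hs1 : 0 < s <= 1) by lra.
  pose proof (scder_pint s be Hs1 Hbs be (- be) de ka ltac:(lra) ltac:(lra)) as H.
  set (A := fun x => (RtoC (1 + Rpower de (- be)) - jump de ka x)%C).
  pose proof (scder_minus be _ _ _ _ (scder_const be (RtoC (1 + Rpower de (- be)))) H) as HA.
  set (dA := fun x => (RtoC (Rpower de (- be)) * ek de x - RtoC (Rpower ka (- be)) * ek ka x - jump de ka x)%C).
  assert (HA' : scder be A dA).
  { eapply scder_ext; [| |exact HA].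
    - intros x _. reflexivity.
    - intros x _. cbv beta. unfold dA, jump.
      replace (be * Rpower ka (- be) / be) with (Rpower ka (- be)) by (field; lra).
      replace (be * Rpower de (- be) / be) with (Rpower de (- be)) by (field; lra).
      replace (be * - be / be) with (- be) by (field; lra).
      rewrite RtoC_opp. ring. }
  assert (HA0 : forall x, 0 < x -> A x <> RtoC 0) by (intros x Hx; apply resolv_den_neq; lra).
  pose proof (scder_inv be A dA HA0 HA') as Hinv.
  eapply scder_ext; [intros; reflexivity| |exact Hinv].
  intros x Hx. cbv beta. change (resolv de ka x) with (/ A x)%C.
  assert (E : jump de ka x = (RtoC (1 + Rpower de (- be)) - A x)%C) by (unfold A; ring).
  unfold dA. rewrite E, RtoC_plus. field. auto.
Qed.

(** Limit of the resolvents as both cutoffs are removed. It is 1 / (1 + p^be) up to a dilation,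
    under which the equation and the value at 0 are invariant. *)
Lemma bernstein_inverse : exists y, wball (omega s) 512 y /\ y 0 = RtoC 1 /\
  scder be y (fun x => - y x + y x * y x)%C.
Proof.
  pose proof be_range as Hb.
  assert (Hs1 : 0 < s <= 1) by lra.
  set (de := fun n : nat => / (INR n + 1)).
  assert (Hde : forall n, 0 < de n).
  { intros n. unfold de. pose proof (pos_INR n). apply Rinv_0_lt_compat. lra. }
  (* A power of 2 times [de n], as the dyadic steps require, and at least n + 1, so that both
     cutoffs disappear in the limit. *)
  set (ka := fun n : nat => 2 ^ (2 * n) * de n).
  assert (Hka : forall n, INR n + 1 <= ka n).
  { intros n. unfold ka. rewrite pow_mult. replace (2 ^ 2) with (2 * 2) by ring. rewrite Rpow_mult_distr.
    assert (H : INR n + 1 <= 2 ^ n).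
    { clear. induction n as [|n IH]; [simpl; lra|]. rewrite S_INR. simpl.
      assert (1 <= 2 ^ n) by (apply pow_R1_Rle; lra). lra. }
    pose proof (pos_INR n). unfold de. apply Rle_div_r; nra. }
  assert (Hdk : forall n, 0 < de n <= ka n).
  { intros n. split; auto. unfold ka. assert (1 <= 2 ^ (2 * n)) by (apply pow_R1_Rle; lra).
    specialize (Hde n). nra. }
  set (d := fun n => / (1 + Rpower (de n) (- be))).
  assert (Hd0 : forall n, 0 < d n <= 1).
  { intros n. unfold d. pose proof (Rpower_pos (de n) (- be)). split; [apply Rinv_0_lt_compat; lra|].
    apply Rle_trans with (/ 1); [apply Rinv_le_contravar; lra | lra]. }
  set (fn := fun n x => (resolv (de n) (ka n) x - resolv (de n) (de n) x)%C).
  assert (Hdiag : forall n x, resolv (de n) (de n) x = RtoC (d n)).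
  { intros n x. unfold resolv, d. rewrite jump_diag. pose proof (Rpower_pos (de n) (- be)).
    rewrite RtoC_inv by lra. f_equal. ring. }
  assert (Hfn : forall n, wball (omega s) 512 (fn n)).
  { intros n. eapply wball_mono; [|apply resolv_ball; auto].
    pose proof (psi_range (de n)). pose proof (psi_range (2 ^ (2 * n) * de n)). lra. }
  assert (Hsmall : forall p eta, 0 < p -> 0 < eta -> exists N : nat, forall n, (N <= n)%nat ->
     Rpower (de n) p <= eta /\ Rpower (ka n) (- p) <= eta).
  { intros p eta Hp He. destruct (Rpower_small p eta Hp He) as [h [Hh Hh']].
    destruct (inv_small h Hh) as [N HN]. exists N. intros n Hn.
    assert (H1 : Rpower (de n) p <= eta) by (apply Hh'; split; auto; apply HN; auto).
    split; auto. eapply Rle_trans; [|exact H1].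
    eapply Rle_trans; [apply (Rpower_neg_antimono (INR n + 1)); [|lra]|].
    - pose proof (pos_INR n). split; [lra | auto].
    - right. unfold de. rewrite Rpower_Ropp. pose proof (pos_INR n).
      unfold Rpower. rewrite ln_Rinv by lra. rewrite <- exp_Ropp. f_equal. ring. }
  assert (Hdp : forall n, d n <= Rpower (de n) be).
  { intros n. unfold d. rewrite Rpower_Ropp. pose proof (Rpower_pos (de n) be).
    rewrite <- (Rinv_inv (Rpower (de n) be)) at 2. apply Rinv_le_contravar; [|lra].
    apply Rinv_0_lt_compat; auto. }
  (* Defect of [fn n] in the limit equation: the shift by the constant [d n] and the two end
     terms. *)
  set (rn := fun n x => (RtoC (d n) * (- RtoC 1 + RtoC 2 * fn n x + RtoC (d n))
     + (RtoC (Rpower (de n) (- be)) * (1 - ek (de n) x) + RtoC (Rpower (ka n) (- be)) * ek (ka n) x)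
       * (resolv (de n) (ka n) x * resolv (de n) (ka n) x))%C).
  (* 1025 = 2 * 512 + 1 is a Lipschitz constant of - z + z^2 on the disc of radius 512. *)
  destruct (cluster_ode (omega s) s 512 be 1025 (fun z => - z + z * z)%C fn rn (fun _ => RtoC 0))
    as [y [Hy1 [Hy2 Hy3]]]; auto.
  - apply omega_weight; lra.
  - apply omega_holder; lra.
  - intros z z' Hz Hz'. replace (- z + z * z - (- z' + z' * z'))%C with ((z - z') * (z + z' - 1))%C by ring.
    rewrite Cmod_mult, Rmult_comm. apply Rmult_le_compat_r; [apply Cmod_ge_0|].
    pose proof (Cmod_triangle (z + z') (- RtoC 1)%C) as T1. pose proof (Cmod_triangle z z') as T2.
    rewrite Cmod_opp, Cmod_1 in T1. unfold Cminus. lra.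
  - intros n. eapply scder_ext; [| |apply (scder_minus be _ _ _ _ (resolv_ode (de n) (ka n) (Hdk n)) (scder_const be (RtoC (d n))))].
    + intros x _. unfold fn. rewrite Hdiag. reflexivity.
    + intros x _. cbv beta. unfold rn, fn. rewrite Hdiag. ring.
  - intros x Hx. split; apply continuous_const.
  - intros x1 x2 eta Hx He.
    (* Six units pay for the shift, [x2] units for the end term at [de] and one for the end term at
       [ka]. *)
    set (e := eta / (7 + x2)).
    assert (He0 : 0 < e) by (apply Rdiv_lt_0_compat; lra).
    destruct (Hsmall be e ltac:(lra) He0) as [N1 HN1].
    destruct (Hsmall (1 - be) e ltac:(lra) He0) as [N2 HN2].
    exists (Nat.max N1 N2). intros n x Hn Hxx.
    destruct (HN1 n ltac:(lia)) as [A1 A2]. destruct (HN2 n ltac:(lia)) as [A3 _].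
    replace (RtoC 0 - rn n x)%C with (- rn n x)%C by ring. rewrite Cmod_opp.
    unfold rn. eapply Rle_trans; [apply Cmod_triangle|]. rewrite !Cmod_mult, Cmod_R.
    pose proof (resolv_bound (de n) (ka n) x (Hdk n) ltac:(lra)) as Hr.
    pose proof (Cmod_ge_0 (resolv (de n) (ka n) x)) as Hr0.
    assert (B1 : Cmod (- RtoC 1 + RtoC 2 * fn n x + RtoC (d n)) <= 6).
    { unfold fn. rewrite Hdiag.
      replace (- RtoC 1 + RtoC 2 * (resolv (de n) (ka n) x - RtoC (d n)) + RtoC (d n))%C
        with ((RtoC 2 * resolv (de n) (ka n) x) + - (1 + RtoC (d n)))%C by ring.
      eapply Rle_trans; [apply Cmod_triangle|].
      rewrite Cmod_opp, Cmod_mult, Cmod_R, Rabs_pos_eq by lra.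
      replace (1 + RtoC (d n))%C with (RtoC (1 + d n)) by (rewrite RtoC_plus; reflexivity).
      rewrite Cmod_R, Rabs_pos_eq; specialize (Hd0 n); lra. }
    assert (B2 : Cmod (RtoC (Rpower (de n) (- be)) * (1 - ek (de n) x) + RtoC (Rpower (ka n) (- be)) * ek (ka n) x)
                 <= x2 * e + e).
    { eapply Rle_trans; [apply Cmod_triangle|]. rewrite !Cmod_mult, !Cmod_R, Cmod_ek, Rmult_1_r.
      rewrite !Rabs_pos_eq by (left; apply Rpower_pos). apply Rplus_le_compat; auto.
      rewrite <- (ek_0 (de n)).
      apply Rle_trans with (Rpower (de n) (- be) * (de n * x)).
      - apply Rmult_le_compat_l; [left; apply Rpower_pos|].
        eapply Rle_trans; [apply Cmod_ek_diff|]. rewrite Rabs_mult, (Rabs_pos_eq (de n)) by (left; auto).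
        rewrite Rabs_minus_sym, Rminus_0_r, Rabs_pos_eq by lra. lra.
      - replace (Rpower (de n) (- be) * (de n * x)) with (Rpower (de n) (1 - be) * x).
        + rewrite Rmult_comm. pose proof (Rpower_pos (de n) (1 - be)). apply Rmult_le_compat; lra.
        + replace (1 - be) with (- be + 1) by ring. rewrite Rpower_plus, Rpower_1 by auto. ring. }
    rewrite Rabs_pos_eq by (left; apply Hd0).
    specialize (Hdp n). destruct (Hd0 n) as [Hdn _].
    apply Rle_trans with (e * 6 + (x2 * e + e) * 1); [|].
    + apply Rplus_le_compat; apply Rmult_le_compat; auto using Cmod_ge_0; try lra; nra.
    + unfold e. right. field. lra.
  - exists y. split; auto. split.
    + apply Ceq_minus. apply Cmod_eq_0. apply Rle_antisym; [|apply Cmod_ge_0].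
      apply Rle_plus_epsilon. intros eta He. rewrite Rplus_0_l.
      destruct (Hsmall be (eta / 3) ltac:(lra) ltac:(lra)) as [N HN].
      destruct (Hy3 0 (eta / 3) N ltac:(lra)) as [n [Hn Hn']].
      destruct (HN n Hn) as [A1 A2]. specialize (Hn' 0 ltac:(lra)).
      eapply Rle_trans; [apply (Cmod_dist_triangle _ (fn n 0))|].
      assert (B : Cmod (fn n 0 - 1) <= Rpower (ka n) (- be) + d n).
      { unfold fn. rewrite Hdiag. unfold resolv.
        rewrite jump_at_0 by (destruct (Hdk n); lra).
        rewrite <- RtoC_minus.
        replace (1 + Rpower (de n) (- be) - (Rpower (de n) (- be) - Rpower (ka n) (- be)))
          with (1 + Rpower (ka n) (- be)) by ring.
        pose proof (Rpower_pos (ka n) (- be)) as Hp. set (c := Rpower (ka n) (- be)) in *.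
        rewrite <- RtoC_inv, <- !RtoC_minus, Cmod_R by lra.
        assert (0 < / (1 + c) <= 1).
        { split; [apply Rinv_0_lt_compat; lra|]. apply Rle_trans with (/ 1); [apply Rinv_le_contravar; lra | lra]. }
        assert (1 - / (1 + c) <= c).
        { replace (1 - / (1 + c)) with (c * / (1 + c)) by (field; lra). nra. }
        specialize (Hd0 n). apply Rabs_le. lra. }
      specialize (Hdp n). lra.
    + eapply scder_ext; [intros; reflexivity| |exact Hy2]. intros x _. cbv beta. ring.
Qed.

End SmallExponent.

(** * Rational profiles *)

Lemma sqrt_le_1_plus (u : R) : 0 <= u -> sqrt u <= 1 + u.
Proof.
  intros Hu. pose proof (sqrt_sqrt u Hu). pose proof (sqrt_pos u). nra.
Qed.

Lemma Rpower_third_le (u : R) : 0 < u -> Rpower u (- (1 / 3)) * sqrt u <= 2 + u.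
Proof.
  intros Hu. rewrite <- Rpower_sqrt by auto. rewrite <- Rpower_plus.
  replace (- (1 / 3) + / 2) with (/ 6) by field.
  destruct (Rle_dec u 1) as [H|H].
  - pose proof (Rpower_le_1 u (/ 6) ltac:(lra) ltac:(lra)). lra.
  - apply Rle_trans with (Rpower u 1); [apply Rle_Rpower; lra | rewrite Rpower_1; lra].
Qed.

(** exp (u / 2) is the cube of exp (u / 6), and each of the three linear factors on the left is at
    most 6 exp (u / 6). *)
Lemma exp_poly_bound (u : R) : 0 <= u -> (1 + u) * (u + 2) ^ 2 <= 216 * exp (u / 2).
Proof.
  intros Hu.
  assert (H : 1 + u / 6 <= exp (u / 6)) by (destruct (Req_dec u 0) as [->|]; [replace (0 / 6) with 0 by field; rewrite exp_0; lra | left; apply exp_ineq1; lra]).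
  replace (u / 2) with (u / 6 + u / 6 + u / 6) by field. rewrite !exp_plus.
  set (E := exp (u / 6)) in *.
  assert (H1 : 1 + u <= 6 * E) by lra. assert (H2 : u + 2 <= 6 * E) by lra.
  assert (H3 : (u + 2) ^ 2 <= (6 * E) ^ 2) by (apply pow_incr; lra).
  apply Rle_trans with (6 * E * (6 * E) ^ 2); [|right; ring].
  apply Rmult_le_compat; auto; [lra | apply pow2_ge_0].
Qed.

(** 648 is 3 times 216. The shape is chosen for its bounded primitive 1296 atan (sqrt u): the total
    mass is finite although the weight is singular at 0. *)
Definition decay (u : R) : R := 648 / (sqrt u * (1 + u)).

Lemma decay_bound (u : R) : 0 < u -> 3 * exp (- (u / 2)) * omega 1 u <= decay u.
Proof.
  intros Hu. unfold decay, omega. rewrite Rpower_1 by auto.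
  pose proof (sqrt_lt_R0 u Hu) as Hs.
  rewrite <- Rle_div_r by nra.
  replace (3 * exp (- (u / 2)) * (u + Rpower u (- (1 / 3))) * (sqrt u * (1 + u)))
    with (3 * exp (- (u / 2)) * ((1 + u) * (u * sqrt u + Rpower u (- (1 / 3)) * sqrt u))) by ring.
  pose proof (sqrt_le_1_plus u ltac:(lra)). pose proof (Rpower_third_le u Hu).
  pose proof (exp_poly_bound u ltac:(lra)) as He.
  assert (H1 : u * sqrt u + Rpower u (- (1 / 3)) * sqrt u <= (u + 2) ^ 2) by nra.
  apply Rle_trans with (3 * exp (- (u / 2)) * (216 * exp (u / 2))).
  - apply Rmult_le_compat_l; [pose proof (exp_pos (- (u / 2))); lra|].
    eapply Rle_trans; [|exact He]. apply Rmult_le_compat_l; lra.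
  - right. rewrite exp_Ropp. pose proof (exp_pos (u / 2)). field. lra.
Qed.

Lemma is_RInt_decay (a b : R) : 0 < a -> 0 < b ->
  is_RInt decay a b (1296 * atan (sqrt b) - 1296 * atan (sqrt a)).
Proof.
  intros Ha Hb. apply (is_RInt_derive (V := R_CompleteNormedModule) (fun u => 1296 * atan (sqrt u))).
  - intros x Hx. pose proof (Rmin_pos a b Ha Hb). pose proof (sqrt_lt_R0 x ltac:(lra)).
    unfold decay. auto_derive; [lra|].
    pose proof (sqrt_sqrt x ltac:(lra)) as E.
    remember (sqrt x) as q eqn:Hq. clear Hq. rewrite <- E. unfold Rsqr.
    field. repeat split; nra.
  - intros x Hx. pose proof (Rmin_pos a b Ha Hb). pose proof (sqrt_lt_R0 x ltac:(lra)).
    apply (ex_derive_continuous (K := R_AbsRing) (V := R_NormedModule)).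
    unfold decay. auto_derive. repeat split; nra.
Qed.

Lemma RInt_decay_le (a b : R) : 0 < a -> 0 < b -> RInt decay a b <= 1296 * PI.
Proof.
  intros Ha Hb. rewrite (is_RInt_unique _ _ _ _ (is_RInt_decay a b Ha Hb)).
  pose proof (atan_bound (sqrt b)). pose proof (atan_bound (sqrt a)). lra.
Qed.

(** The bound is independent of the range of integration, so the cutoffs can be removed within one
    ball. *)
Lemma wball_decay (psi : R -> R) (a b : R) : 0 < a <= b ->
  (forall u, 0 < u -> continuous psi u) -> (forall u, 0 < u -> Rabs (psi u) <= 3 * exp (- (u / 2))) ->
  wball (omega 1) (1296 * PI) (fun x => CRInt (fun u => RtoC (psi u) * ek u x)%C a b).
Proof.
  intros Hab Hc Hb. eapply wball_mono; [apply (RInt_decay_le a b); lra|].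
  apply wball_density; auto.
  - apply omega_weight; lra.
  - intros u Hu. apply Hc; lra.
  - intros u Hu. pose proof (sqrt_lt_R0 u ltac:(lra)).
    apply (ex_derive_continuous (K := R_AbsRing) (V := R_NormedModule)).
    unfold decay. auto_derive. repeat split; nra.
  - intros u Hu. eapply Rle_trans; [|apply decay_bound; lra].
    apply Rmult_le_compat_r; [|apply Hb; lra].
    pose proof (omega_weight 1 ltac:(lra) u ltac:(lra)). lra.
Qed.

Lemma exp_neg_le (u : R) : 0 <= u -> exp (- u) <= / (1 + u).
Proof.
  intros Hu. rewrite exp_Ropp. apply Rinv_le_contravar; [lra|].
  destruct (Req_dec u 0) as [->|]; [rewrite exp_0; lra | left; apply exp_ineq1; lra].
Qed.

Lemma exp_integral (a b x : R) :
  ((RtoC 1 - Ci * RtoC x) * CRInt (fun u => RtoC (exp (- u)) * ek u x) a b)%C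
  = (RtoC (exp (- a)) * ek a x - RtoC (exp (- b)) * ek b x)%C.
Proof.
  assert (H1 : is_RInt (fun u => exp (- u) * (cos (u * x) + x * sin (u * x))) a b
      (- exp (- b) * cos (b * x) - - exp (- a) * cos (a * x))).
  { apply (is_RInt_derive (V := R_CompleteNormedModule) (fun u => - exp (- u) * cos (u * x))).
    - intros u _. auto_derive; [trivial | ring].
    - intros u _. apply (ex_derive_continuous (K := R_AbsRing) (V := R_NormedModule)). auto_derive. trivial. }
  assert (H2 : is_RInt (fun u => exp (- u) * (sin (u * x) - x * cos (u * x))) a b
      (- exp (- b) * sin (b * x) - - exp (- a) * sin (a * x))).
  { apply (is_RInt_derive (V := R_CompleteNormedModule) (fun u => - exp (- u) * sin (u * x))).
    - intros u _. auto_derive; [trivial | ring].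
    - intros u _. apply (ex_derive_continuous (K := R_AbsRing) (V := R_NormedModule)). auto_derive. trivial. }
  assert (X1 : ex_RInt (fun u => exp (- u) * cos (u * x)) a b).
  { apply (ex_RInt_continuous (V := R_CompleteNormedModule)). intros u _.
    apply (ex_derive_continuous (K := R_AbsRing) (V := R_NormedModule)). auto_derive. trivial. }
  assert (X2 : ex_RInt (fun u => exp (- u) * sin (u * x)) a b).
  { apply (ex_RInt_continuous (V := R_CompleteNormedModule)). intros u _.
    apply (ex_derive_continuous (K := R_AbsRing) (V := R_NormedModule)). auto_derive. trivial. }
  set (P := RInt (fun u => exp (- u) * cos (u * x)) a b) in *.
  set (S := RInt (fun u => exp (- u) * sin (u * x)) a b) in *.
  assert (E1 : P + x * S = - exp (- b) * cos (b * x) - - exp (- a) * cos (a * x)).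
  { rewrite <- (is_RInt_unique (V := R_CompleteNormedModule) _ _ _ _ H1). symmetry.
    apply (is_RInt_unique (V := R_CompleteNormedModule)).
    apply (is_RInt_ext (fun u => plus (exp (- u) * cos (u * x)) (scal x (exp (- u) * sin (u * x))))).
    - intros u _. unfold plus, scal; simpl; unfold mult; simpl. ring.
    - apply (is_RInt_plus (V := R_NormedModule)); [|apply (is_RInt_scal (V := R_NormedModule))];
        apply (RInt_correct (V := R_CompleteNormedModule)); auto. }
  assert (E2 : S - x * P = - exp (- b) * sin (b * x) - - exp (- a) * sin (a * x)).
  { rewrite <- (is_RInt_unique (V := R_CompleteNormedModule) _ _ _ _ H2). symmetry.
    apply (is_RInt_unique (V := R_CompleteNormedModule)).
    apply (is_RInt_ext (fun u => minus (exp (- u) * sin (u * x)) (scal x (exp (- u) * cos (u * x))))).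
    - intros u _. unfold minus, plus, opp, scal; simpl; unfold mult; simpl. ring.
    - apply (is_RInt_minus (V := R_NormedModule)); [|apply (is_RInt_scal (V := R_NormedModule))];
        apply (RInt_correct (V := R_CompleteNormedModule)); auto. }
  assert (E : CRInt (fun u => (RtoC (exp (- u)) * ek u x)%C) a b = (P, S)).
  { unfold CRInt, P, S. apply injective_projections; cbn [fst snd]; apply RInt_ext;
      intros u _; simpl; real_eq; ring. }
  rewrite E. apply injective_projections; simpl; lra.
Qed.

Lemma Cmod_1_mix (x : R) : 1 <= Cmod (RtoC 1 - Ci * RtoC x).
Proof.
  eapply Rle_trans; [|apply Rabs_fst_Cmod]. simpl. rewrite Rabs_pos_eq; lra.
Qed.

Lemma neq_1_mix (x : R) : (RtoC 1 - Ci * RtoC x)%C <> RtoC 0.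
Proof. intros E. pose proof (Cmod_1_mix x) as H. rewrite E, Cmod_0 in H. lra. Qed.

(** 1 / (1 + p) is the Laplace transform of exp (- u), here at p = - i x. The range [a, b] exhausts
    the half line, and the end terms of [exp_integral] measure the error. *)
Lemma wball_cauchy : wball (omega 1) (1296 * PI) (fun x => / (RtoC 1 - Ci * RtoC x))%C.
Proof.
  apply wball_closed. intros X eta He.
  pose proof (Rabs_pos X) as HX.
  set (c := eta / (3 * (1 + Rabs X))).
  assert (Hc : 0 < c) by (apply Rdiv_lt_0_compat; lra).
  set (a := Rmin 1 c). assert (Ha : 0 < a) by (apply Rmin_pos; lra).
  set (b := Rmax 1 (3 / eta)).
  assert (Hb : 1 <= b) by apply Rmax_l.
  exists (fun x => CRInt (fun u => RtoC (exp (- u)) * ek u x)%C a b). split.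
  - apply wball_decay.
    + split; auto. unfold a. pose proof (Rmin_l 1 c). lra.
    + intros u _. apply (ex_derive_continuous (K := R_AbsRing) (V := R_NormedModule)). auto_derive. trivial.
    + intros u Hu. rewrite Rabs_pos_eq by (left; apply exp_pos).
      assert (exp (- u) <= exp (- (u / 2))) by (left; apply exp_increasing; lra).
      pose proof (exp_pos (- (u / 2))). lra.
  - intros x Hx.
    pose proof (exp_integral a b x) as E.
    set (J := CRInt (fun u => (RtoC (exp (- u)) * ek u x)%C) a b) in *.
    replace (/ (RtoC 1 - Ci * RtoC x) - J)%C with
      (/ (RtoC 1 - Ci * RtoC x) * (RtoC 1 - (RtoC (exp (- a)) * ek a x - RtoC (exp (- b)) * ek b x)))%C.
    2: { rewrite <- E. field. apply neq_1_mix. }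
    rewrite Cmod_mult, Cmod_inv by apply neq_1_mix.
    pose proof (Cmod_1_mix x) as H1.
    apply Rle_trans with (1 * (c * Rabs X + c + eta / 3)).
    + apply Rmult_le_compat; auto using Cmod_ge_0.
      * left. apply Rinv_0_lt_compat. lra.
      * apply Rle_trans with (/ 1); [apply Rinv_le_contravar; lra | lra].
      * replace (RtoC 1 - (RtoC (exp (- a)) * ek a x - RtoC (exp (- b)) * ek b x))%C
          with ((RtoC 1 - ek a x) + (RtoC (1 - exp (- a)) * ek a x + RtoC (exp (- b)) * ek b x))%C
          by (rewrite RtoC_minus; ring).
        eapply Rle_trans; [apply Cmod_triangle|].
        rewrite Rplus_assoc. apply Rplus_le_compat.
        -- rewrite <- (ek_0 a). eapply Rle_trans; [apply Cmod_ek_diff|].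
           rewrite Rabs_mult, (Rabs_pos_eq a) by lra. rewrite Rabs_minus_sym, Rminus_0_r, Rabs_pos_eq by lra.
           pose proof (Rmin_r 1 c). pose proof (Rle_abs X). unfold a in *. apply Rmult_le_compat; lra.
        -- eapply Rle_trans; [apply Cmod_triangle|]. rewrite !Cmod_mult, !Cmod_R, !Cmod_ek, !Rmult_1_r.
           apply Rplus_le_compat.
           ++ pose proof (exp_ineq1_le (- a)). pose proof (Rmin_r 1 c).
              assert (exp (- a) <= 1) by (rewrite <- exp_0; left; apply exp_increasing; lra).
              rewrite Rabs_pos_eq by lra. unfold a in *. lra.
           ++ rewrite Rabs_pos_eq by (left; apply exp_pos).
              eapply Rle_trans; [apply exp_neg_le; lra|].
              replace (eta / 3) with (/ (3 / eta)) by (field; lra).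
              pose proof (Rmax_r 1 (3 / eta)).
              apply Rinv_le_contravar; [apply Rdiv_lt_0_compat; lra | unfold b; lra].
    + assert (c * (1 + Rabs X) = eta / 3) by (unfold c; field; lra). lra.
Qed.

(* The inverse Laplace transform of (p + 2) / (1 + p + p^2). *)
Definition psi3 (k : R) : R := exp (- (k / 2)) * (cos (sqrt 3 / 2 * k) + sqrt 3 * sin (sqrt 3 / 2 * k)).
Definition dpsi3 (k : R) : R := exp (- (k / 2)) * (cos (sqrt 3 / 2 * k) - sqrt 3 * sin (sqrt 3 / 2 * k)).

Lemma psi3_derive (k : R) : is_derive psi3 k (dpsi3 k).
Proof.
  unfold psi3, dpsi3. auto_derive; [trivial|].
  pose proof (sqrt_sqrt 3 ltac:(lra)) as E.
  change (k / 2) with (k * / 2).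
  set (e := exp (- (k * / 2))). set (c := cos (sqrt 3 / 2 * k)). set (z := sin (sqrt 3 / 2 * k)).
  clearbody e c z. set (r := sqrt 3) in *. clearbody r.
  transitivity (e * (- / 2 * (c + r * z) - r / 2 * z + (r * r) / 2 * c)); [field | rewrite E; field].
Qed.

Lemma dpsi3_derive (k : R) : is_derive dpsi3 k (- psi3 k - dpsi3 k).
Proof.
  unfold psi3, dpsi3. auto_derive; [trivial|].
  pose proof (sqrt_sqrt 3 ltac:(lra)) as E.
  change (k / 2) with (k * / 2).
  set (e := exp (- (k * / 2))). set (c := cos (sqrt 3 / 2 * k)). set (z := sin (sqrt 3 / 2 * k)).
  clearbody e c z. set (r := sqrt 3) in *. clearbody r.
  transitivity (e * (- / 2 * (c - r * z) - r / 2 * z - (r * r) / 2 * c)); [field | rewrite E; field].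
Qed.

Lemma sqrt3_bound : 1 <= sqrt 3 <= 2.
Proof.
  split.
  - rewrite <- sqrt_1 at 1. apply sqrt_le_1; lra.
  - replace 2 with (sqrt (2 * 2)) by (rewrite sqrt_square; lra). apply sqrt_le_1; lra.
Qed.

Lemma psi3_bound (k : R) : Rabs (psi3 k) <= 3 * exp (- (k / 2)) /\ Rabs (dpsi3 k) <= 3 * exp (- (k / 2)).
Proof.
  unfold psi3, dpsi3. pose proof (exp_pos (- (k / 2))) as He. pose proof sqrt3_bound as Hr.
  pose proof (COS_bound (sqrt 3 / 2 * k)). pose proof (SIN_bound (sqrt 3 / 2 * k)).
  rewrite !Rabs_mult, !(Rabs_pos_eq (exp _)) by lra.
  split; rewrite Rmult_comm; (apply Rmult_le_compat_r; [lra|]); apply Rabs_le; nra.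
Qed.

(** 1 + p + p^2 at p = - i x; likewise [num3] below is p + 2. *)
Definition den3 (x : R) : C := (1 - x ^ 2, - x).

Lemma Cmod_den3 (x : R) : / 2 <= Cmod (den3 x).
Proof.
  unfold den3. destruct (Rle_dec (/ 2) (Rabs x)) as [H|H].
  - eapply Rle_trans; [|apply Rabs_snd_Cmod]. simpl. rewrite Rabs_Ropp. lra.
  - eapply Rle_trans; [|apply Rabs_fst_Cmod]. simpl. apply Rnot_le_lt in H. apply Rabs_def2 in H.
    rewrite Rabs_pos_eq; nra.
Qed.

Definition num3 (x : R) : C := (2, - x).

(** The number psi + psi' - i x psi for [p] = psi and [d] = psi'. Times [ek u x] it is, up to sign,
    a primitive in u of [den3 x] times psi3(u) [ek u x], because psi'' = - psi - psi'. *)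
Definition gvec (p d x : R) : C := (p + d, - x * p).

Definition gden (k x : R) : C := (ek k x * gvec (psi3 k) (dpsi3 k) x)%C.

Lemma psi3_integral (a b x : R) :
  (den3 x * CRInt (fun u => RtoC (psi3 u) * ek u x) a b)%C = (gden a x - gden b x)%C.
Proof.
  assert (Cp : forall u, continuous psi3 u).
  { intros u. apply (ex_derive_continuous (K := R_AbsRing) (V := R_NormedModule)). eexists. apply psi3_derive. }
  assert (X1 : ex_RInt (fun u => psi3 u * cos (u * x)) a b).
  { apply (ex_RInt_continuous (V := R_CompleteNormedModule)). intros u _.
    apply (continuous_mult (K := R_AbsRing) psi3 (fun u => cos (u * x))); auto.
    apply continuous_scale_arg, continuous_cos. }
  assert (X2 : ex_RInt (fun u => psi3 u * sin (u * x)) a b).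
  { apply (ex_RInt_continuous (V := R_CompleteNormedModule)). intros u _.
    apply (continuous_mult (K := R_AbsRing) psi3 (fun u => sin (u * x))); auto.
    apply continuous_scale_arg, continuous_sin. }
  set (P := RInt (fun u => psi3 u * cos (u * x)) a b) in *.
  set (S := RInt (fun u => psi3 u * sin (u * x)) a b) in *.
  assert (Dm : forall f g df dg u, is_derive f u df -> is_derive g u dg ->
            is_derive (fun y : R => f y * g y : R) u (df * g u + f u * dg : R)).
  { intros f g df dg u Hf Hg. apply (is_derive_mult f g u df dg Hf Hg). intros; apply Rmult_comm. }
  assert (Dp : forall f g df dg u, is_derive f u df -> is_derive g u dg ->
            is_derive (fun y : R => f y + g y : R) u (df + dg : R)).
  { intros f g df dg u Hf Hg. apply (is_derive_plus (K := R_AbsRing) (V := R_NormedModule)); auto. }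
  assert (Dc : forall u, is_derive (fun u => cos (u * x)) u (- x * sin (u * x))).
  { intros u. auto_derive; [trivial | ring]. }
  assert (Ds : forall u, is_derive (fun u => sin (u * x)) u (x * cos (u * x))).
  { intros u. auto_derive; [trivial | ring]. }
  assert (Dw : forall u, is_derive (fun u => psi3 u + dpsi3 u) u (- psi3 u)).
  { intros u. evar_last; [apply Dp; [apply psi3_derive | apply dpsi3_derive] | ring]. }
  assert (H1 : is_RInt (fun u => psi3 u * ((1 - x ^ 2) * cos (u * x) + x * sin (u * x))) a b
      (- fst (gden b x) - - fst (gden a x))).
  { apply (is_RInt_derive (V := R_CompleteNormedModule) (fun u => - fst (gden u x))).
    - intros u _. apply (is_derive_ext (fun u => - (cos (u * x) * (psi3 u + dpsi3 u) + x * (sin (u * x) * psi3 u)))).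
      + intros t. unfold gden; simpl. real_eq. ring.
      + evar_last.
        * apply (is_derive_opp (K := R_AbsRing) (V := R_NormedModule)). apply Dp; [apply Dm; [apply Dc | apply Dw]|].
          apply (is_derive_scal (fun u => sin (u * x) * psi3 u) u x). apply Dm; [apply Ds | apply psi3_derive].
        * unfold opp; simpl. ring.
    - intros u _. apply (continuous_mult (K := R_AbsRing) psi3 (fun u => (1 - x ^ 2) * cos (u * x) + x * sin (u * x))); auto.
      apply (ex_derive_continuous (K := R_AbsRing) (V := R_NormedModule)). auto_derive. trivial. }
  assert (H2 : is_RInt (fun u => psi3 u * ((1 - x ^ 2) * sin (u * x) - x * cos (u * x))) a b
      (- snd (gden b x) - - snd (gden a x))).
  { apply (is_RInt_derive (V := R_CompleteNormedModule) (fun u => - snd (gden u x))).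
    - intros u _. apply (is_derive_ext (fun u => - (sin (u * x) * (psi3 u + dpsi3 u) + (- x) * (cos (u * x) * psi3 u)))).
      + intros t. unfold gden; simpl. real_eq. ring.
      + evar_last.
        * apply (is_derive_opp (K := R_AbsRing) (V := R_NormedModule)). apply Dp; [apply Dm; [apply Ds | apply Dw]|].
          apply (is_derive_scal (fun u => cos (u * x) * psi3 u) u (- x)). apply Dm; [apply Dc | apply psi3_derive].
        * unfold opp; simpl. ring.
    - intros u _. apply (continuous_mult (K := R_AbsRing) psi3 (fun u => (1 - x ^ 2) * sin (u * x) - x * cos (u * x))); auto.
      apply (ex_derive_continuous (K := R_AbsRing) (V := R_NormedModule)). auto_derive. trivial. }
  assert (E1 : (1 - x ^ 2) * P + x * S = - fst (gden b x) - - fst (gden a x)).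
  { rewrite <- (is_RInt_unique (V := R_CompleteNormedModule) _ _ _ _ H1). symmetry.
    apply (is_RInt_unique (V := R_CompleteNormedModule)).
    apply (is_RInt_ext (fun u => plus (scal (1 - x ^ 2) (psi3 u * cos (u * x))) (scal x (psi3 u * sin (u * x))))).
    - intros u _. unfold plus, scal; simpl; unfold mult; simpl. ring.
    - apply (is_RInt_plus (V := R_NormedModule)); apply (is_RInt_scal (V := R_NormedModule));
        apply (RInt_correct (V := R_CompleteNormedModule)); auto. }
  assert (E2 : (1 - x ^ 2) * S - x * P = - snd (gden b x) - - snd (gden a x)).
  { rewrite <- (is_RInt_unique (V := R_CompleteNormedModule) _ _ _ _ H2). symmetry.
    apply (is_RInt_unique (V := R_CompleteNormedModule)).
    apply (is_RInt_ext (fun u => minus (scal (1 - x ^ 2) (psi3 u * sin (u * x))) (scal x (psi3 u * cos (u * x))))).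
    - intros u _. unfold minus, plus, opp, scal; simpl; unfold mult; simpl. ring.
    - apply (is_RInt_minus (V := R_NormedModule)); apply (is_RInt_scal (V := R_NormedModule));
        apply (RInt_correct (V := R_CompleteNormedModule)); auto. }
  assert (E : CRInt (fun u => (RtoC (psi3 u) * ek u x)%C) a b = (P, S)).
  { unfold CRInt, P, S. apply injective_projections; cbn [fst snd]; apply RInt_ext;
      intros u _; simpl; real_eq; ring. }
  rewrite E. unfold den3. revert E1 E2. generalize (gden a x) (gden b x). intros [p q] [r t]. cbn [fst snd].
  intros E1 E2. apply injective_projections; cbn [fst snd Cmult Cminus Cplus Copp]; lra.
Qed.

Lemma wball_rational3 : exists M, wball (omega 1) M (fun x => (num3 x / den3 x)%C).
Proof.
  exists (1296 * PI). apply wball_closed. intros X eta He.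
  pose proof (Rabs_pos X) as HX.
  set (T := 1 + Rabs X).
  (* The constants 100 and 80 leave eta / 4 for each end of the range; division by [den3], of
     modulus at least 1 / 2, doubles the sum. *)
  set (c := eta / (100 * T * T)).
  assert (HT : 1 <= T) by (unfold T; lra).
  assert (HTT : T <= T * T) by nra.
  assert (Hc : 0 < c) by (apply Rdiv_lt_0_compat; nra).
  set (a := Rmin 1 c). assert (Ha : 0 < a) by (apply Rmin_pos; lra).
  assert (Ha1 : a <= 1) by apply Rmin_l. assert (Hac : a <= c) by apply Rmin_r.
  set (b := Rmax 1 (80 * T / eta)).
  assert (Hb : 1 <= b) by apply Rmax_l. assert (Hb2 : 80 * T / eta <= b) by apply Rmax_r.
  exists (fun x => CRInt (fun u => RtoC (psi3 u) * ek u x)%C a b). split.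
  - apply wball_decay; [lra | | intros; apply psi3_bound].
    intros u _. apply (ex_derive_continuous (K := R_AbsRing) (V := R_NormedModule)). eexists. apply psi3_derive.
  - intros x Hx.
    assert (HxT : 0 <= x <= T) by (unfold T; pose proof (Rle_abs X); lra).
    pose proof (psi3_integral a b x) as E. pose proof (Cmod_den3 x) as Hd.
    assert (Hd0 : den3 x <> RtoC 0) by (intros H0; rewrite H0, Cmod_0 in Hd; lra).
    set (J := CRInt (fun u => (RtoC (psi3 u) * ek u x)%C) a b) in *.
    replace (num3 x / den3 x - J)%C with (/ den3 x * ((num3 x) - (gden a x - gden b x)))%C.
    2: { rewrite <- E. field. auto. }
    rewrite Cmod_mult, Cmod_inv by auto.
    assert (Hbb : forall k, Rabs (psi3 k) <= 3 * exp (- (k / 2)) /\ Rabs (dpsi3 k) <= 3 * exp (- (k / 2))) by apply psi3_bound.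
    assert (B2 : Cmod (gden b x) <= eta / 4).
    { unfold gden. rewrite Cmod_mult, Cmod_ek, Rmult_1_l.
      eapply Rle_trans; [apply Cmod_le_sum|]. unfold gvec; cbn [fst snd].
      destruct (Hbb b) as [b1 b2].
      assert (He2 : exp (- (b / 2)) <= 2 * (eta / (80 * T))).
      { eapply Rle_trans; [apply exp_neg_le; lra|].
        apply Rle_trans with (/ (b / 2)); [apply Rinv_le_contravar; lra|].
        replace (2 * (eta / (80 * T))) with (/ (80 * T / eta / 2)) by (field; lra).
        assert (0 < 80 * T / eta) by (apply Rdiv_lt_0_compat; lra).
        apply Rinv_le_contravar; lra. }
      rewrite Rabs_mult, Rabs_Ropp, (Rabs_pos_eq x) by lra.
      pose proof (Rabs_triang (psi3 b) (dpsi3 b)). pose proof (exp_pos (- (b / 2))).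
      assert (x * Rabs (psi3 b) <= T * (3 * exp (- (b / 2)))) by (apply Rmult_le_compat; auto using Rabs_pos; lra).
      assert (1 * exp (- (b / 2)) <= T * exp (- (b / 2))) by (apply Rmult_le_compat_r; lra).
      apply Rle_trans with (9 * T * exp (- (b / 2))); [lra|].
      apply Rle_trans with (9 * T * (2 * (eta / (80 * T)))); [apply Rmult_le_compat_l; lra|].
      replace (9 * T * (2 * (eta / (80 * T)))) with (18 / 80 * eta) by (field; lra). lra. }
    assert (B1 : Cmod ((num3 x) - gden a x) <= eta / 4).
    { assert (G : forall (f : R -> R) df v, (forall t, is_derive f t (df t)) -> f 0 = v ->
           (forall t, 0 <= t -> Rabs (df t) <= 6) -> Rabs (v - f a) <= 6 * a).
      { intros f df v Hf <- Hdf. rewrite Rabs_minus_sym.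
        destruct (MVT_gen f 0 a df) as [z [Hz Hz']].
        - intros; apply Hf.
        - intros t _. apply (is_derive_continuity_pt _ _ _ (Hf t)).
        - rewrite Hz', Rabs_mult, (Rabs_pos_eq (a - 0)) by lra. rewrite Rmin_left in Hz by lra.
          apply Rmult_le_compat; try lra; [apply Rabs_pos | apply Hdf; lra]. }
      assert (P0 : psi3 0 = 1).
      { unfold psi3. replace (- (0 / 2)) with 0 by field. rewrite exp_0, !Rmult_0_r, cos_0, sin_0. ring. }
      assert (D0 : dpsi3 0 = 1).
      { unfold dpsi3. replace (- (0 / 2)) with 0 by field. rewrite exp_0, !Rmult_0_r, cos_0, sin_0. ring. }
      assert (Hexp1 : forall t, 0 <= t -> exp (- (t / 2)) <= 1).
      { intros t Ht. rewrite <- exp_0. destruct (Req_dec t 0) as [->|].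
        - right. f_equal. field.
        - left. apply exp_increasing. lra. }
      assert (C1 : Rabs (1 - psi3 a) <= 6 * a).
      { apply (G psi3 dpsi3); auto using psi3_derive. intros t Ht. destruct (Hbb t). specialize (Hexp1 t Ht). lra. }
      assert (C2 : Rabs (1 - dpsi3 a) <= 6 * a).
      { apply (G dpsi3 (fun t => - psi3 t - dpsi3 t)); auto using dpsi3_derive. intros t Ht.
        destruct (Hbb t). specialize (Hexp1 t Ht).
        pose proof (Rabs_triang (- psi3 t) (- dpsi3 t)) as T1. rewrite !Rabs_Ropp in T1. unfold Rminus. lra. }
      replace ((num3 x) - gden a x)%C with
        ((num3 x) * (RtoC 1 - ek a x) + ek a x * gvec (1 - psi3 a) (1 - dpsi3 a) x)%C.
      2: { unfold gden, gvec, num3. apply injective_projections; simpl; ring. }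
      eapply Rle_trans; [apply Cmod_triangle|]. rewrite !Cmod_mult, Cmod_ek, Rmult_1_l.
      assert (F1 : Cmod (num3 x) <= 3 * T).
      { eapply Rle_trans; [apply Cmod_le_sum|]. unfold num3; cbn [fst snd]. rewrite Rabs_Ropp, !Rabs_pos_eq by lra. lra. }
      assert (F2 : Cmod (RtoC 1 - ek a x) <= a * T).
      { rewrite <- (ek_0 a). eapply Rle_trans; [apply Cmod_ek_diff|].
        rewrite Rabs_mult, (Rabs_pos_eq a) by lra. rewrite Rabs_minus_sym, Rminus_0_r, Rabs_pos_eq by lra.
        apply Rmult_le_compat; lra. }
      assert (F3 : Cmod (gvec (1 - psi3 a) (1 - dpsi3 a) x) <= 18 * a * T).
      { eapply Rle_trans; [apply Cmod_le_sum|]. unfold gvec; cbn [fst snd].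
        rewrite Rabs_mult, Rabs_Ropp, (Rabs_pos_eq x) by lra.
        pose proof (Rabs_triang (1 - psi3 a) (1 - dpsi3 a)).
        assert (x * Rabs (1 - psi3 a) <= T * (6 * a)) by (apply Rmult_le_compat; auto using Rabs_pos; lra).
        assert (1 * a <= T * a) by (apply Rmult_le_compat_r; lra). lra. }
      assert (Cmod (num3 x) * Cmod (RtoC 1 - ek a x) <= 3 * T * (a * T)) by (apply Rmult_le_compat; auto using Cmod_ge_0).
      assert (H80 : c * (T * T) = eta / 100) by (unfold c; field; lra).
      assert (a * (T * T) <= c * (T * T)) by (apply Rmult_le_compat_r; nra).
      assert (a * T <= a * (T * T)) by (apply Rmult_le_compat_l; lra). lra. }
    apply Rle_trans with (2 * (eta / 4 + eta / 4)); [|lra].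
    apply Rmult_le_compat; auto using Cmod_ge_0.
    + left. apply Rinv_0_lt_compat. lra.
    + replace 2 with (/ / 2) by field. apply Rinv_le_contravar; lra.
    + replace ((num3 x) - (gden a x - gden b x))%C with (((num3 x) - gden a x) + gden b x)%C by ring.
      eapply Rle_trans; [apply Cmod_triangle|]. lra.
Qed.

(** * Two improper integrals *)

Lemma atan_le (y : R) : 0 <= y -> 0 <= atan y <= y.
Proof.
  intros Hy. destruct (MVT_gen atan 0 y (fun t => / (1 + t ^ 2))) as [c [Hc Hc']].
  - intros t _. auto_derive; [trivial|]. field. nra.
  - intros t _. apply derivable_continuous_pt, derivable_pt_atan.
  - rewrite atan_0, !Rminus_0_r in Hc'. rewrite Hc'.
    assert (0 < / (1 + c ^ 2)) by (apply Rinv_0_lt_compat; nra).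
    assert (/ (1 + c ^ 2) <= / 1) by (apply Rinv_le_contravar; nra).
    split; nra.
Qed.

Lemma atan_lim (u : nat -> R) : is_lim_seq u p_infty -> is_lim_seq (fun n => atan (u n)) (PI / 2).
Proof.
  intros Hu. apply is_lim_seq_spec. intros eps.
  apply is_lim_seq_spec in Hu. destruct (Hu (/ eps)) as [N HN].
  exists N. intros n Hn. specialize (HN n Hn). pose proof (cond_pos eps) as He.
  assert (H0 : 0 < / eps) by (apply Rinv_0_lt_compat; auto).
  assert (Hun : 0 < u n) by lra.
  pose proof (atan_inv (u n) Hun) as E.
  assert (H1 : 0 < / u n) by (apply Rinv_0_lt_compat; auto).
  pose proof (atan_le (/ u n) ltac:(lra)) as H2.
  assert (H3 : / u n < eps).
  { rewrite <- (Rinv_inv eps). apply Rinv_lt_contravar; auto. nra. }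
  simpl. apply Rabs_def1; lra.
Qed.

Lemma atan_lim_m (u : nat -> R) : is_lim_seq u m_infty -> is_lim_seq (fun n => atan (u n)) (- (PI / 2)).
Proof.
  intros Hu. apply (is_lim_seq_ext (fun n => - atan (- u n))).
  - intros n. rewrite atan_opp. ring.
  - apply (is_lim_seq_opp _ (Finite (PI / 2))). apply atan_lim.
    apply (is_lim_seq_opp _ m_infty) in Hu. exact Hu.
Qed.

(** The cutoffs 1 / [top n] and [top n] are exchanged by t -> 1 / t, so that primitives invariant
    under this map give exactly 0. *)
Definition top (n : nat) : R := INR n + 1.

Lemma top_ge (n : nat) : 1 <= top n.
Proof. unfold top. pose proof (pos_INR n). lra. Qed.

Lemma top_inv (n : nat) : 0 < / top n <= 1.
Proof.
  pose proof (top_ge n). split; [apply Rinv_0_lt_compat; lra|].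
  apply Rle_trans with (/ 1); [apply Rinv_le_contravar; lra | lra].
Qed.

Lemma top_lim : is_lim_seq top p_infty.
Proof.
  apply (is_lim_seq_plus INR (fun _ => 1) p_infty 1 p_infty); [apply is_lim_seq_INR | apply is_lim_seq_const | reflexivity].
Qed.

Lemma top_inv_lim : is_lim_seq (fun n => / top n) 0.
Proof. apply (is_lim_seq_inv top p_infty); [apply top_lim | discriminate]. Qed.

Lemma lin_lim (a b : R) : 0 < a -> is_lim_seq (fun n => a * top n - b * / top n) p_infty.
Proof.
  intros Ha.
  apply (is_lim_seq_minus (fun n => a * top n) (fun n => b * / top n) p_infty 0 p_infty).
  - replace p_infty with (Rbar_mult a p_infty).
    + apply is_lim_seq_scal_l, top_lim.
    + unfold Rbar_mult, Rbar_mult'. destruct (Rle_dec 0 a) as [H|H]; [|lra].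
      destruct (Rle_lt_or_eq_dec 0 a H); [reflexivity | lra].
  - replace (Finite 0) with (Rbar_mult b 0) by (simpl; f_equal; ring).
    apply is_lim_seq_scal_l, top_inv_lim.
  - reflexivity.
Qed.

Lemma lin_lim_m (a b : R) : 0 < a -> is_lim_seq (fun n => b * / top n - a * top n) m_infty.
Proof.
  intros Ha. apply (is_lim_seq_ext (fun n => - (a * top n - b * / top n))); [intros; ring|].
  apply (is_lim_seq_opp _ p_infty), lin_lim, Ha.
Qed.

(** Both quotients are 1 minus a nonnegative term of order 1 / [top n]. *)
Lemma ln_ratio_lim (b x : R) : 0 < b -> 0 < x -> b * b < 4 * x ->
  is_lim_seq (fun n => ln ((top n ^ 2 - b * top n + x) / (top n ^ 2 + b * top n + x))) 0 /\
  is_lim_seq (fun n => ln (((/ top n) ^ 2 - b * / top n + x) / ((/ top n) ^ 2 + b * / top n + x))) 0.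
Proof.
  intros Hb Hx Hd.
  assert (Hln : forall u : nat -> R, is_lim_seq u 1 -> is_lim_seq (fun n => ln (u n)) 0).
  { intros u Hu. rewrite <- ln_1. apply (is_lim_seq_continuous ln u 1); auto.
    apply derivable_continuous_pt. exists (/ 1). apply derivable_pt_lim_ln. lra. }
  assert (Hsq : forall (u c : nat -> R), (forall n, 0 < c n) -> is_lim_seq c 0 ->
            (forall n, 1 - c n <= u n <= 1) -> is_lim_seq u 1).
  { intros u c _ Hc Hu. apply (is_lim_seq_le_le (fun n => 1 - c n) u (fun _ => 1)); auto.
    - replace (Finite 1) with (Finite (1 - 0)) by (f_equal; ring).
      apply is_lim_seq_minus'; [apply is_lim_seq_const | auto].
    - apply is_lim_seq_const. }
  assert (Hcl : forall k : R, is_lim_seq (fun n => k * / top n) 0).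
  { intros k. replace (Finite 0) with (Rbar_mult k 0) by (simpl; f_equal; ring).
    apply is_lim_seq_scal_l, top_inv_lim. }
  split; apply Hln.
  - apply (Hsq _ (fun n => 2 * b * / top n)); auto.
    + intros n. pose proof (top_inv n). nra.
    + intros n. pose proof (top_ge n) as Ht. set (t := top n) in *.
      assert (H1 : 0 < t ^ 2 + b * t + x) by nra.
      replace ((t ^ 2 - b * t + x) / (t ^ 2 + b * t + x)) with (1 - 2 * b * t / (t ^ 2 + b * t + x)) by (field; lra).
      assert (H2 : 0 <= 2 * b * t / (t ^ 2 + b * t + x)) by (apply Rdiv_le_0_compat; nra).
      assert (H3 : 2 * b * t / (t ^ 2 + b * t + x) <= 2 * b * / t).
      { apply Rle_div_l; auto. replace (2 * b * / t * (t ^ 2 + b * t + x)) with (2 * b * t + 2 * b * b + 2 * b * x * / t) by (field; lra).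
        assert (0 < / t) by (apply Rinv_0_lt_compat; lra). assert (0 < b * x) by nra. nra. }
      lra.
  - apply (Hsq _ (fun n => 2 * b / x * / top n)); auto.
    + intros n. pose proof (top_inv n). assert (0 < 2 * b / x) by (apply Rdiv_lt_0_compat; lra). nra.
    + intros n. pose proof (top_inv n) as Ht. set (t := / top n) in *.
      assert (H1 : 0 < t ^ 2 + b * t + x) by nra.
      replace ((t ^ 2 - b * t + x) / (t ^ 2 + b * t + x)) with (1 - 2 * b * t / (t ^ 2 + b * t + x)) by (field; lra).
      assert (H2 : 0 <= 2 * b * t / (t ^ 2 + b * t + x)) by (apply Rdiv_le_0_compat; nra).
      assert (H3 : 2 * b * t / (t ^ 2 + b * t + x) <= 2 * b / x * t).
      { apply Rle_div_l; auto. replace (2 * b / x * t * (t ^ 2 + b * t + x)) with (2 * b * t + 2 * b * t * (t ^ 2 + b * t) / x) by (field; lra).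
        assert (0 <= 2 * b * t * (t ^ 2 + b * t) / x) by (apply Rdiv_le_0_compat; nra). lra. }
      lra.
Qed.

Lemma is_RInt_unique_R (f : R -> R) (a b l : R) : is_RInt f a b l -> RInt f a b = l.
Proof. apply (is_RInt_unique (V := R_CompleteNormedModule)). Qed.

Lemma is_RInt_cont_R (f : R -> R) (a b : R) : (forall t, continuous f t) -> is_RInt f a b (RInt f a b).
Proof.
  intros Hf. apply (RInt_correct (V := R_CompleteNormedModule)).
  apply (ex_RInt_continuous (V := R_CompleteNormedModule)). auto.
Qed.

Lemma RInt_plus_R (f g : R -> R) (a b : R) : (forall t, continuous f t) -> (forall t, continuous g t) ->
  RInt (fun t => f t + g t) a b = RInt f a b + RInt g a b.
Proof.
  intros Hf Hg. apply is_RInt_unique_R.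
  apply (is_RInt_plus (V := R_NormedModule)); apply is_RInt_cont_R; auto.
Qed.

Lemma RInt_minus_R (f g : R -> R) (a b : R) : (forall t, continuous f t) -> (forall t, continuous g t) ->
  RInt (fun t => f t - g t) a b = RInt f a b - RInt g a b.
Proof.
  intros Hf Hg. apply is_RInt_unique_R.
  apply (is_RInt_minus (V := R_NormedModule)); apply is_RInt_cont_R; auto.
Qed.

Lemma is_RInt_antideriv (F f : R -> R) (a b : R) : 0 < a -> 0 < b ->
  (forall t, 0 < t -> is_derive F t (f t)) -> (forall t, 0 < t -> continuous f t) ->
  is_RInt f a b (F b - F a).
Proof.
  intros Ha Hb HF Hf. apply (is_RInt_derive (V := R_CompleteNormedModule) F f);
    intros t Ht; pose proof (Rmin_pos a b Ha Hb); [apply HF | apply Hf]; lra.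
Qed.

Lemma int_t2_t6 : is_lim_seq (fun n => RInt (fun t => t ^ 2 / (1 + t ^ 6)) (/ top n) (top n)) (PI / 6).
Proof.
  apply (is_lim_seq_ext (fun n => / 3 * atan (top n ^ 3) - / 3 * atan ((/ top n) ^ 3))).
  - intros n. pose proof (top_ge n). pose proof (top_inv n). symmetry. apply is_RInt_unique_R.
    apply (is_RInt_antideriv (fun t => / 3 * atan (t ^ 3))); try lra.
    + intros t Ht. assert (0 < t ^ 6) by (apply pow_lt; auto). auto_derive; [trivial|].
      replace (1 + t ^ 3 * (t ^ 3 * 1)) with (1 + t ^ 6) by ring. unfold Rsqr. field. repeat split; simpl in *; nra.
    + intros t Ht. assert (0 < t ^ 6) by (apply pow_lt; auto).
      apply (ex_derive_continuous (K := R_AbsRing) (V := R_NormedModule)). auto_derive. simpl in *; lra.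
  - replace (Finite (PI / 6)) with (Finite (/ 3 * (PI / 2) - / 3 * 0)) by (f_equal; field).
    apply is_lim_seq_minus'.
    + apply (is_lim_seq_scal_l _ (/ 3) (PI / 2)). apply atan_lim.
      apply (is_lim_seq_le_p_loc top); [|apply top_lim]. exists 0%nat. intros n _.
      pose proof (top_ge n). assert (1 <= top n ^ 2) by (apply pow_R1_Rle; auto). simpl in *. nra.
    + apply (is_lim_seq_scal_l _ (/ 3) 0).
      apply (is_lim_seq_le_le (fun _ => 0) _ (fun n => / top n)).
      * intros n. pose proof (top_inv n) as Hi. assert (0 <= (/ top n) ^ 2 <= 1) by (simpl; nra).
        assert (H3 : 0 <= (/ top n) ^ 3) by (apply pow_le; lra). pose proof (atan_le _ H3).
        assert ((/ top n) ^ 3 <= / top n) by (simpl in *; nra). lra.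
      * apply is_lim_seq_const.
      * apply top_inv_lim.
Qed.

Lemma atan_top_lim : is_lim_seq (fun n => atan (top n) - atan (/ top n)) (PI / 2).
Proof.
  replace (Finite (PI / 2)) with (Finite (PI / 2 - 0)) by (f_equal; ring).
  apply is_lim_seq_minus'; [apply atan_lim, top_lim|].
  apply (is_lim_seq_le_le (fun _ => 0) _ (fun n => / top n)).
  - intros n. pose proof (top_inv n). apply atan_le. lra.
  - apply is_lim_seq_const.
  - apply top_inv_lim.
Qed.

Lemma t6_pos (t : R) : 0 < 1 + t ^ 6.
Proof. assert (0 <= (t ^ 3) ^ 2) by apply pow2_ge_0. replace (t ^ 6) with ((t ^ 3) ^ 2) by ring. lra. Qed.

Lemma cont_t6 (p : R -> R) (t : R) : ex_derive p t -> continuous (fun t => p t / (1 + t ^ 6)) t.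
Proof.
  intros Hp. apply (ex_derive_continuous (K := R_AbsRing) (V := R_NormedModule)).
  apply (ex_derive_div p (fun t => 1 + t ^ 6)); auto.
  - auto_derive. trivial.
  - pose proof (t6_pos t). lra.
Qed.

Lemma int_1_t6 :
  is_lim_seq (fun n => RInt (fun t => 1 / (1 + t ^ 6)) (/ top n) (top n)) (PI / 3) /\
  is_lim_seq (fun n => RInt (fun t => t ^ 4 / (1 + t ^ 6)) (/ top n) (top n)) (PI / 3).
Proof.
  set (f0 := fun t => 1 / (1 + t ^ 6)). set (f2 := fun t => t ^ 4 / (1 + t ^ 6)).
  set (f1 := fun t => t ^ 2 / (1 + t ^ 6)).
  assert (C0 : forall t, continuous f0 t) by (intros t; apply (cont_t6 (fun _ => 1)); auto_derive; trivial).
  assert (C1 : forall t, continuous f1 t) by (intros t; apply (cont_t6 (fun t => t ^ 2)); auto_derive; trivial).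
  assert (C2 : forall t, continuous f2 t) by (intros t; apply (cont_t6 (fun t => t ^ 4)); auto_derive; trivial).
  (* sum and difference of the two integrals have elementary primitives; the second takes equal values at t and 1/t *)
  assert (S : forall n, RInt f0 (/ top n) (top n) + RInt f2 (/ top n) (top n)
     = (atan (top n) - atan (/ top n)) + RInt f1 (/ top n) (top n)).
  { intros n. pose proof (top_ge n). pose proof (top_inv n).
    assert (E : is_RInt (fun t => plus (f0 t) (f2 t)) (/ top n) (top n)
       ((atan (top n) - atan (/ top n)) + RInt f1 (/ top n) (top n))).
    { apply (is_RInt_ext (fun t => plus (/ (1 + t ^ 2)) (f1 t))).
      - intros t _. unfold f0, f1, f2, plus; simpl. pose proof (t6_pos t) as Ht6. simpl in Ht6.
        field. split; nra.
      - apply (is_RInt_plus (V := R_NormedModule)); [|apply is_RInt_cont_R, C1].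
        apply is_RInt_antideriv; try lra.
        + intros t Ht. auto_derive; [trivial|]. field. nra.
        + intros t Ht. apply (ex_derive_continuous (K := R_AbsRing) (V := R_NormedModule)). auto_derive. nra. }
    rewrite <- RInt_plus_R by auto. apply is_RInt_unique_R. exact E. }
  assert (D : forall n, RInt f2 (/ top n) (top n) - RInt f0 (/ top n) (top n) = 0).
  { intros n. pose proof (top_ge n) as Ht. pose proof (top_inv n) as Hti.
    pose proof (sqrt_sqrt 3 ltac:(lra)) as Q. pose proof sqrt3_bound as Q'.
    assert (Hp : forall t, 0 < t ^ 2 - sqrt 3 * t + 1).
    { intros t. pose proof (pow2_ge_0 (t - sqrt 3 / 2)). nra. }
    assert (Hp' : forall t, 0 < t ^ 2 + sqrt 3 * t + 1).
    { intros t. pose proof (pow2_ge_0 (t + sqrt 3 / 2)). nra. }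
    set (F := fun t => / (2 * sqrt 3) * (ln (t ^ 2 - sqrt 3 * t + 1) - ln (t ^ 2 + sqrt 3 * t + 1))).
    assert (E : is_RInt (fun t => minus (f2 t) (f0 t)) (/ top n) (top n) (F (top n) - F (/ top n))).
    { apply is_RInt_antideriv; try lra.
      - intros t Ht0. unfold F. specialize (Hp t). specialize (Hp' t). pose proof (t6_pos t) as Ht6.
        auto_derive; [split; [simpl in Hp; lra | split; [simpl in Hp'; lra | trivial]]|].
        unfold f0, f2, minus, plus, opp; simpl.
        assert (E6 : 1 + t ^ 6 = (1 + t ^ 2) * ((t ^ 2 - sqrt 3 * t + 1) * (t ^ 2 + sqrt 3 * t + 1))).
        { replace ((t ^ 2 - sqrt 3 * t + 1) * (t ^ 2 + sqrt 3 * t + 1))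
            with (t ^ 4 + 2 * t ^ 2 + 1 - (sqrt 3 * sqrt 3) * t ^ 2) by ring. rewrite Q. ring. }
        simpl in E6. simpl in Hp, Hp'. set (r := sqrt 3) in *. clearbody r.
        rewrite E6. simpl in *.
        assert (Hr : r <> 0) by lra.
        assert (N1 : 1 + t * (t * 1) <> 0) by nra.
        assert (N2 : t * (t * 1) + - (r * t) + 1 <> 0) by lra.
        assert (N3 : t * (t * 1) + r * t + 1 <> 0) by lra.
        field. repeat split; lra.
      - intros t Ht0. apply (continuous_minus (K := R_AbsRing) (V := R_NormedModule)); auto. }
    assert (EF : F (top n) - F (/ top n) = 0).
    { unfold F.
      assert (G : forall c, 0 < top n ^ 2 + c * top n + 1 -> ln ((/ top n) ^ 2 + c * / top n + 1) = ln (top n ^ 2 + c * top n + 1) - 2 * ln (top n)).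
      { intros c Hc. replace ((/ top n) ^ 2 + c * / top n + 1) with ((top n ^ 2 + c * top n + 1) * (/ top n * / top n)) by (field; lra).
        rewrite !ln_mult; try lra; [|apply Rmult_lt_0_compat; lra]. rewrite ln_Rinv by lra. ring. }
      replace ((/ top n) ^ 2 - sqrt 3 * / top n + 1) with ((/ top n) ^ 2 + (- sqrt 3) * / top n + 1) by ring.
      rewrite !G by (specialize (Hp (top n)); specialize (Hp' (top n)); lra).
      replace (top n ^ 2 + - sqrt 3 * top n + 1) with (top n ^ 2 - sqrt 3 * top n + 1) by ring. ring. }
    rewrite EF in E. rewrite <- RInt_minus_R by auto. apply is_RInt_unique_R. exact E. }
  assert (L : is_lim_seq (fun n => / 2 * ((atan (top n) - atan (/ top n)) + RInt f1 (/ top n) (top n))) (PI / 3)).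
  { replace (Finite (PI / 3)) with (Rbar_mult (/ 2) (PI / 2 + PI / 6)) by (simpl; f_equal; field).
    apply is_lim_seq_scal_l. apply is_lim_seq_plus'; [apply atan_top_lim | apply int_t2_t6]. }
  split; (eapply is_lim_seq_ext; [|exact L]); intros n; specialize (S n); specialize (D n); lra.
Qed.

(** The sum of the two integrands has an arctangent as primitive; their difference has a logarithm
    that tends to 0 at both ends. Here b = sqrt (2 x) comes from factoring t^4 + x^2 into two
    quadratics. *)
Lemma quartic_limits (x : R) : 0 < x ->
  is_lim_seq (fun n => RInt (fun t => t ^ 2 / (t ^ 4 + x ^ 2)) (/ top n) (top n)) (PI / (2 * sqrt (2 * x))) /\
  is_lim_seq (fun n => RInt (fun t => x / (t ^ 4 + x ^ 2)) (/ top n) (top n)) (PI / (2 * sqrt (2 * x))).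
Proof.
  intros Hx.
  set (b := sqrt (2 * x)).
  assert (Hb : 0 < b) by (apply sqrt_lt_R0; lra).
  assert (Hbb : b * b = 2 * x) by (apply sqrt_sqrt; lra).
  set (f := fun t => t ^ 2 / (t ^ 4 + x ^ 2)). set (g := fun t => x / (t ^ 4 + x ^ 2)).
  assert (Hden : forall t, 0 < t ^ 4 + x ^ 2).
  { intros t. assert (0 <= (t ^ 2) ^ 2) by apply pow2_ge_0. replace (t ^ 4) with ((t ^ 2) ^ 2) by ring.
    assert (0 < x ^ 2) by (apply pow_lt; auto). lra. }
  assert (Cf : forall t, continuous f t).
  { intros t. apply (ex_derive_continuous (K := R_AbsRing) (V := R_NormedModule)). unfold f.
    specialize (Hden t). auto_derive. simpl in Hden; lra. }
  assert (Cg : forall t, continuous g t).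
  { intros t. apply (ex_derive_continuous (K := R_AbsRing) (V := R_NormedModule)). unfold g.
    specialize (Hden t). auto_derive. simpl in Hden; lra. }
  set (P := fun t => / b * atan ((t ^ 2 - x) / (b * t))).
  set (M := fun t => / (2 * b) * ln ((t ^ 2 - b * t + x) / (t ^ 2 + b * t + x))).
  assert (Hm : forall t, 0 < t ^ 2 - b * t + x) by (intros t; pose proof (pow2_ge_0 (t - b / 2)); nra).
  assert (Hp : forall t, 0 < t ^ 2 + b * t + x) by (intros t; pose proof (pow2_ge_0 (t + b / 2)); nra).
  assert (E4 : forall t, t ^ 4 + x ^ 2 = (t ^ 2 - b * t + x) * (t ^ 2 + b * t + x)).
  { intros t. replace ((t ^ 2 - b * t + x) * (t ^ 2 + b * t + x)) with (t ^ 4 + 2 * x * t ^ 2 + x ^ 2 - (b * b) * t ^ 2) by ring.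
    rewrite Hbb. ring. }
  assert (S : forall n, RInt f (/ top n) (top n) + RInt g (/ top n) (top n) = P (top n) - P (/ top n)).
  { intros n. pose proof (top_ge n). pose proof (top_inv n).
    assert (E : is_RInt (fun t => plus (f t) (g t)) (/ top n) (top n) (P (top n) - P (/ top n))).
    { apply is_RInt_antideriv; try lra.
      - intros t Ht. unfold P. specialize (Hden t).
        assert (N : 0 < b * t) by nra.
        auto_derive; [lra|]. unfold f, g, plus, Rsqr; simpl.
        assert (Eq : t ^ 4 + x ^ 2 = (t ^ 2 - x) ^ 2 + (b * b) * t ^ 2) by (rewrite Hbb; ring).
        simpl in Eq, Hden. rewrite Eq in *. clear Eq.
        replace x with (b * b / 2) in * by lra.
        field. simpl in *. repeat split; try lra.
      - intros t Ht. apply (continuous_plus (K := R_AbsRing) (V := R_NormedModule)); auto. }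
    rewrite <- RInt_plus_R by auto. apply is_RInt_unique_R. exact E. }
  assert (D : forall n, RInt f (/ top n) (top n) - RInt g (/ top n) (top n) = M (top n) - M (/ top n)).
  { intros n. pose proof (top_ge n). pose proof (top_inv n).
    assert (E : is_RInt (fun t => minus (f t) (g t)) (/ top n) (top n) (M (top n) - M (/ top n))).
    { apply is_RInt_antideriv; try lra.
      - intros t Ht. unfold M. specialize (Hden t). specialize (Hm t). specialize (Hp t). specialize (E4 t).
        auto_derive.
        + simpl in *. split; [lra|]. split; [apply Rdiv_lt_0_compat; lra | trivial].
        + unfold f, g, minus, plus, opp; simpl in *. rewrite E4. field. repeat split; lra.
      - intros t Ht. apply (continuous_minus (K := R_AbsRing) (V := R_NormedModule)); auto. }
    rewrite <- RInt_minus_R by auto. apply is_RInt_unique_R. exact E. }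
  assert (LP : is_lim_seq (fun n => P (top n) - P (/ top n)) (PI / b)).
  { replace (Finite (PI / b)) with (Finite (/ b * (PI / 2) - / b * (- (PI / 2)))) by (f_equal; field; lra).
    apply is_lim_seq_minus'.
    - apply (is_lim_seq_scal_l _ (/ b) (PI / 2)). apply atan_lim.
      apply (is_lim_seq_ext (fun n => / b * top n - x / b * / top n)); [|apply lin_lim, Rinv_0_lt_compat, Hb].
      intros n. pose proof (top_ge n). field. lra.
    - apply (is_lim_seq_scal_l _ (/ b) (- (PI / 2))). apply atan_lim_m.
      apply (is_lim_seq_ext (fun n => / b * / top n - x / b * top n)); [|apply lin_lim_m, Rdiv_lt_0_compat; auto].
      intros n. pose proof (top_ge n). field. lra. }
  assert (LM : is_lim_seq (fun n => M (top n) - M (/ top n)) 0).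
  { destruct (ln_ratio_lim b x Hb Hx ltac:(lra)) as [L1 L2].
    replace (Finite 0) with (Finite (/ (2 * b) * 0 - / (2 * b) * 0)) by (f_equal; ring).
    apply is_lim_seq_minus'; [apply (is_lim_seq_scal_l _ (/ (2 * b)) 0), L1 | apply (is_lim_seq_scal_l _ (/ (2 * b)) 0), L2]. }
  split.
  - apply (is_lim_seq_ext (fun n => / 2 * ((P (top n) - P (/ top n)) + (M (top n) - M (/ top n))))).
    + intros n. specialize (S n). specialize (D n). lra.
    + replace (Finite (PI / (2 * b))) with (Rbar_mult (/ 2) (PI / b + 0)) by (simpl; f_equal; field; lra).
      apply is_lim_seq_scal_l. apply is_lim_seq_plus'; auto.
  - apply (is_lim_seq_ext (fun n => / 2 * ((P (top n) - P (/ top n)) - (M (top n) - M (/ top n))))).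
    + intros n. specialize (S n). specialize (D n). lra.
    + replace (Finite (PI / (2 * b))) with (Rbar_mult (/ 2) (PI / b - 0)) by (simpl; f_equal; field; lra).
      apply is_lim_seq_scal_l. apply is_lim_seq_minus'; auto.
Qed.

(** * The inverse 1 / (1 + p ^ (3/2)) *)

Lemma RInt_scal_R (c : R) (f : R -> R) (a b : R) : (forall t, continuous f t) ->
  RInt (fun t => c * f t) a b = c * RInt f a b.
Proof.
  intros Hf. apply is_RInt_unique_R.
  apply (is_RInt_scal (V := R_NormedModule) f). apply is_RInt_cont_R; auto.
Qed.

(* 1 / (1 + p^(3/2)) = (2/3) (p + 2) / (1 + p + p^2) - (2/PI) times the integral over t > 0 of
   t^4 / ((1 + t^6) (p + t^2)), the contributions of the poles and of the branch cut; p = - i x. *)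
Definition kern (t x : R) : C :=
  (t ^ 4 / (1 + t ^ 6) * (t ^ 2 / (t ^ 4 + x ^ 2)), t ^ 4 / (1 + t ^ 6) * (x / (t ^ 4 + x ^ 2))).

(** As a function of x the kernel is a dilated Cauchy kernel, so its ball bound follows from
    [wball_cauchy]. *)
Lemma kern_cauchy (t x : R) : 0 < t ->
  kern t x = (RtoC (t ^ 2 / (1 + t ^ 6)) * / (RtoC 1 - Ci * RtoC (/ t ^ 2 * x)))%C.
Proof.
  intros Ht. assert (H2 : 0 < t ^ 2) by (apply pow_lt; auto). pose proof (t6_pos t) as H6.
  assert (H4 : 0 < t ^ 4 + x ^ 2) by (pose proof (pow2_ge_0 x); assert (0 < t ^ 4) by (apply pow_lt; auto); lra).
  unfold kern. apply injective_projections; simpl; simpl in H2, H6, H4; field; repeat split; nra.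
Qed.

Lemma Rpower_inv_sq (t : R) : 0 < t -> Rpower (/ t ^ 2) (- (1 / 3)) <= 1 + t ^ 2.
Proof.
  intros Ht. assert (H2 : 0 < t ^ 2) by (apply pow_lt; auto).
  rewrite Rpower_Ropp. unfold Rpower. rewrite ln_Rinv by auto. rewrite <- exp_Ropp.
  replace (- (1 / 3 * - ln (t ^ 2))) with (1 / 3 * ln (t ^ 2)) by ring.
  change (Rpower (t ^ 2) (1 / 3) <= 1 + t ^ 2).
  destruct (Rle_dec (t ^ 2) 1) as [H|H].
  - pose proof (Rpower_le_1 (t ^ 2) (1 / 3) ltac:(lra) ltac:(lra)). lra.
  - apply Rle_trans with (Rpower (t ^ 2) 1); [apply Rle_Rpower; lra | rewrite Rpower_1; lra].
Qed.

(** Dilation by r = 1 / t^2 multiplies the weight by at most r + r^(-1/3). The factor t^2 / (1 +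
    t^6) brings this down to a bound in t with an arctangent as primitive. *)
Lemma wball_kern (t : R) : 0 < t -> wball (omega 1) (3888 * PI / (1 + t ^ 2)) (kern t).
Proof.
  intros Ht. assert (H2 : 0 < t ^ 2) by (apply pow_lt; auto). pose proof (t6_pos t) as H6.
  pose proof PI_RGT_0 as Hpi.
  set (r := / t ^ 2). assert (Hr : 0 < r) by (apply Rinv_0_lt_compat; auto).
  pose proof (Rpower_pos r (- (1 / 3))) as Hrp.
  apply wball_ext with (fun x => RtoC (t ^ 2 / (1 + t ^ 6)) * / (RtoC 1 - Ci * RtoC (r * x)))%C.
  { intros x _. symmetry. apply kern_cauchy; auto. }
  eapply wball_mono; [|apply (wball_scal (omega 1) (t ^ 2 / (1 + t ^ 6)));
     apply (wball_dil (omega 1) r (r + Rpower r (- (1 / 3))) (1296 * PI) (fun x => / (RtoC 1 - Ci * RtoC x))%C Hr ltac:(lra)); [|apply wball_cauchy]].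
  - rewrite Rabs_pos_eq by (apply Rdiv_le_0_compat; lra).
    pose proof (Rpower_inv_sq t Ht) as E. fold r in E.
    apply Rle_trans with (t ^ 2 / (1 + t ^ 6) * ((r + (1 + t ^ 2)) * (1296 * PI))).
    + apply Rmult_le_compat_l; [apply Rdiv_le_0_compat; lra|]. apply Rmult_le_compat_r; lra.
    + replace (t ^ 2 / (1 + t ^ 6) * ((r + (1 + t ^ 2)) * (1296 * PI)))
        with (1296 * PI * ((1 + t ^ 2 + t ^ 4) / (1 + t ^ 6))) by (unfold r; field; lra).
      replace (3888 * PI / (1 + t ^ 2)) with (1296 * PI * (3 / (1 + t ^ 2))) by (field; lra).
      apply Rmult_le_compat_l; [lra|].
      rewrite <- Rle_div_r by lra.
      replace ((1 + t ^ 2 + t ^ 4) / (1 + t ^ 6) * (1 + t ^ 2)) with ((1 + 2 * t ^ 2 + 2 * t ^ 4 + t ^ 6) / (1 + t ^ 6)) by (field; lra).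
      rewrite Rle_div_l by lra.
      assert (0 <= (1 - t ^ 2) ^ 2 * (1 + t ^ 2)) by (apply Rmult_le_pos; [apply pow2_ge_0 | lra]). nra.
  - intros k Hk. unfold omega. rewrite Rpower_1, Rpower_1 by nra.
    rewrite <- Rpower_mult_distr by auto. pose proof (Rpower_pos k (- (1 / 3))). nra.
Qed.

Lemma kern_den_pos (t x : R) : 0 < t \/ 0 < x -> 0 < t ^ 4 + x ^ 2.
Proof.
  intros H. assert (0 <= (t ^ 2) ^ 2) by apply pow2_ge_0. replace (t ^ 4) with ((t ^ 2) ^ 2) by ring.
  pose proof (pow2_ge_0 x). destruct H as [H|H].
  - assert (0 < (t ^ 2) ^ 2) by (apply pow_lt, pow_lt, H). lra.
  - assert (0 < x ^ 2) by (apply pow_lt, H). lra.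
Qed.

Lemma kern_continuous (t x : R) : 0 < t \/ 0 < x ->
  continuous (fun t => fst (kern t x)) t /\ continuous (fun t => snd (kern t x)) t.
Proof.
  intros H. pose proof (kern_den_pos t x H) as H4. pose proof (t6_pos t) as H6.
  split; apply (ex_derive_continuous (K := R_AbsRing) (V := R_NormedModule)); unfold kern; simpl;
    auto_derive; simpl in H4, H6; repeat split; lra.
Qed.

Lemma wball_kern_int (a b : R) : 0 < a <= b ->
  wball (omega 1) (3888 * PI * PI) (fun x => CRInt (fun t => kern t x) a b).
Proof.
  intros Hab. pose proof PI_RGT_0 as Hpi.
  set (m := fun t => 3888 * PI / (1 + t ^ 2)).
  assert (Hint : is_RInt m a b (3888 * PI * atan b - 3888 * PI * atan a)).
  { apply (is_RInt_antideriv (fun t => 3888 * PI * atan t)); try lra.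
    - intros t Ht. unfold m. auto_derive; [trivial|]. field. nra.
    - intros t Ht. apply (ex_derive_continuous (K := R_AbsRing) (V := R_NormedModule)).
      unfold m. auto_derive. nra. }
  eapply wball_mono; [|apply (wball_int (omega 1) a b kern m)].
  - rewrite (is_RInt_unique_R _ _ _ _ Hint). pose proof (atan_bound a). pose proof (atan_bound b).
    assert (3888 * PI * (atan b - atan a) <= 3888 * PI * PI) by (apply Rmult_le_compat_l; lra). lra.
  - apply omega_weight; lra.
  - lra.
  - intros t Ht. apply (ex_derive_continuous (K := R_AbsRing) (V := R_NormedModule)).
    unfold m. auto_derive. nra.
  - intros t Ht. apply wball_kern. lra.
  - intros x Hx. apply ex_RInt_pos; [lra | lra |]. intros t Ht.
    exact (proj1 (kern_continuous t x (or_introl Ht))).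
  - intros x Hx. apply ex_RInt_pos; [lra | lra |]. intros t Ht.
    exact (proj2 (kern_continuous t x (or_introl Ht))).
  - intros X eta He. pose proof (Rabs_pos X) as HX.
    destruct (unifcont_normed_1d (fun t => t ^ 2 / (1 + t ^ 6)) a b) with (eps := mkposreal (eta / 2) ltac:(lra)) as [d1 Hd1].
    { intros t Ht. apply (cont_t6 (fun t => t ^ 2)). auto_derive. trivial. }
    assert (He2 : 0 < eta / (2 * (1 + Rabs X))) by (apply Rdiv_lt_0_compat; lra).
    destruct (unifcont_normed_1d (fun t => / t ^ 2) a b) with (eps := mkposreal _ He2) as [d2 Hd2].
    { intros t Ht. apply (ex_derive_continuous (K := R_AbsRing) (V := R_NormedModule)). auto_derive.
      assert (0 < t ^ 2) by (apply pow_lt; lra). simpl in *; lra. }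
    set (d := Rmin (d1 / 2) (d2 / 2)).
    pose proof (cond_pos d1). pose proof (cond_pos d2).
    assert (Hd1' : d <= d1 / 2) by apply Rmin_l. assert (Hd2' : d <= d2 / 2) by apply Rmin_r.
    exists d. split; [apply Rmin_pos; lra|]. intros u v x Hu Hv Huv Hx.
    assert (A1 : Rabs (u ^ 2 / (1 + u ^ 6) - v ^ 2 / (1 + v ^ 6)) < eta / 2).
    { apply (Hd1 v u Hv Hu). change (Rabs (u - v) < d1). lra. }
    assert (A2 : Rabs (/ u ^ 2 - / v ^ 2) < eta / (2 * (1 + Rabs X))).
    { apply (Hd2 v u Hv Hu). change (Rabs (u - v) < d2). lra. }
    rewrite !kern_cauchy by lra.
    set (s := / u ^ 2) in *. set (s' := / v ^ 2) in *.
    set (E := (/ (RtoC 1 - Ci * RtoC (s * x)))%C). set (E' := (/ (RtoC 1 - Ci * RtoC (s' * x)))%C).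
    set (p := u ^ 2 / (1 + u ^ 6)) in *. set (p' := v ^ 2 / (1 + v ^ 6)) in *.
    replace (p * E - p' * E')%C with (RtoC (p - p') * E + RtoC p' * (E - E'))%C by (rewrite RtoC_minus; ring).
    assert (B : forall q, Cmod (/ (RtoC 1 - Ci * RtoC q)) <= 1).
    { intros q. rewrite Cmod_inv by apply neq_1_mix. apply Rle_trans with (/ 1); [|lra].
      apply Rinv_le_contravar; [lra | apply Cmod_1_mix]. }
    assert (Hp' : Rabs p' <= 1).
    { unfold p'. pose proof (t6_pos v). pose proof (pow2_ge_0 v). rewrite Rabs_pos_eq by (apply Rdiv_le_0_compat; lra).
      rewrite Rle_div_l by lra. destruct (Rle_dec (v ^ 2) 1) as [Hv1|Hv1].
      - assert (0 <= (v ^ 3) ^ 2) by apply pow2_ge_0. replace (v ^ 6) with ((v ^ 3) ^ 2) by ring. lra.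
      - replace (v ^ 6) with (v ^ 2 * (v ^ 2 * v ^ 2)) by ring. assert (1 <= v ^ 2 * v ^ 2) by nra. nra. }
    assert (HE : Cmod (E - E') <= eta / 2).
    { replace (E - E')%C with (Ci * RtoC ((s - s') * x) * E * E')%C.
      - rewrite !Cmod_mult, Cmod_R. pose proof (B (s * x)) as B1. pose proof (B (s' * x)) as B2.
        fold E in B1. fold E' in B2.
        assert (HCi : Cmod Ci = 1).
        { unfold Cmod, Ci; simpl. replace (0 * (0 * 1) + 1 * (1 * 1)) with 1 by ring. apply sqrt_1. }
        rewrite HCi, Rmult_1_l, Rabs_mult.
        assert (H3 : Rabs (s - s') * Rabs x <= eta / 2).
        { rewrite (Rabs_pos_eq x) by lra.
          apply Rle_trans with (eta / (2 * (1 + Rabs X)) * (1 + Rabs X)); [|right; field; lra].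
          pose proof (Rle_abs X). apply Rmult_le_compat; try lra; apply Rabs_pos. }
        pose proof (Cmod_ge_0 E). pose proof (Cmod_ge_0 E').
        assert (0 <= Rabs (s - s') * Rabs x) by (apply Rmult_le_pos; apply Rabs_pos).
        apply Rle_trans with (eta / 2 * 1 * 1); [|lra].
        apply Rmult_le_compat; auto; [apply Rmult_le_pos; auto|]. apply Rmult_le_compat; auto.
      - unfold E, E'. rewrite !RtoC_mult, RtoC_minus. field.
        split; rewrite <- RtoC_mult; apply neq_1_mix. }
    eapply Rle_trans; [apply Cmod_triangle|]. rewrite !Cmod_mult, !Cmod_R.
    pose proof (B (s * x)) as B1. fold E in B1.
    assert (Rabs (p - p') * Cmod E <= eta / 2 * 1) by (apply Rmult_le_compat; auto using Rabs_pos, Cmod_ge_0; lra).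
    assert (Rabs p' * Cmod (E - E') <= 1 * (eta / 2)) by (apply Rmult_le_compat; auto using Rabs_pos, Cmod_ge_0).
    lra.
Qed.

(** These are the real and imaginary parts of (1 - p^3) times the kernel integral, p = - i x. The
    factor 1 - p^3 separates the denominators: the integrand splits into terms over 1 + t^6 and
    terms over t^4 + x^2, whose integrals are known. *)
Lemma kern_int_limit (x : R) : 0 < x ->
  let A := fun n => RInt (fun t => fst (kern t x)) (/ top n) (top n) in
  let B := fun n => RInt (fun t => snd (kern t x)) (/ top n) (top n) in
  let j := PI / (2 * sqrt (2 * x)) in
  is_lim_seq (fun n => A n + x ^ 3 * B n) (- x ^ 2 * j + PI / 6 + x ^ 2 * (PI / 3)) /\
  is_lim_seq (fun n => B n - x ^ 3 * A n) (- x ^ 2 * j + x * (PI / 3)).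
Proof.
  intros Hx A B j.
  set (f0 := fun t => 1 / (1 + t ^ 6)). set (f2 := fun t => t ^ 4 / (1 + t ^ 6)).
  set (f1 := fun t => t ^ 2 / (1 + t ^ 6)).
  set (j1 := fun t => t ^ 2 / (t ^ 4 + x ^ 2)). set (j2 := fun t => x / (t ^ 4 + x ^ 2)).
  set (fA := fun t => fst (kern t x)). set (fB := fun t => snd (kern t x)).
  assert (C0 : forall t, continuous f0 t) by (intros t; apply (cont_t6 (fun _ => 1)); auto_derive; trivial).
  assert (C1 : forall t, continuous f1 t) by (intros t; apply (cont_t6 (fun t => t ^ 2)); auto_derive; trivial).
  assert (C2 : forall t, continuous f2 t) by (intros t; apply (cont_t6 (fun t => t ^ 4)); auto_derive; trivial).
  assert (Cj1 : forall t, continuous j1 t).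
  { intros t. apply (ex_derive_continuous (K := R_AbsRing) (V := R_NormedModule)). unfold j1.
    pose proof (kern_den_pos t x (or_intror Hx)) as H. auto_derive. simpl in H; lra. }
  assert (Cj2 : forall t, continuous j2 t).
  { intros t. apply (ex_derive_continuous (K := R_AbsRing) (V := R_NormedModule)). unfold j2.
    pose proof (kern_den_pos t x (or_intror Hx)) as H. auto_derive. simpl in H; lra. }
  assert (CA : forall t, continuous fA t) by (intros t; exact (proj1 (kern_continuous t x (or_intror Hx)))).
  assert (CB : forall t, continuous fB t) by (intros t; exact (proj2 (kern_continuous t x (or_intror Hx)))).
  assert (Cs : forall (c : R) (f : R -> R), (forall t, continuous f t) -> forall t, continuous (fun t => c * f t) t).
  { intros c f Hf t. apply (continuous_mult (K := R_AbsRing) (fun _ => c) f); auto. apply continuous_const. }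
  assert (Cp : forall f g : R -> R, (forall t, continuous f t) -> (forall t, continuous g t) -> forall t, continuous (fun t => f t + g t) t).
  { intros f g Hf Hg t. apply (continuous_plus (K := R_AbsRing) (V := R_NormedModule) f g); auto. }
  assert (P1 : forall t, fA t + x ^ 3 * fB t = (- x ^ 2 * j1 t + f1 t) + x ^ 2 * f2 t).
  { intros t. pose proof (kern_den_pos t x (or_intror Hx)) as H. pose proof (t6_pos t).
    unfold fA, fB, kern, j1, f1, f2; cbn [fst snd]. field. lra. }
  assert (P2 : forall t, fB t - x ^ 3 * fA t = - x ^ 2 * j2 t + x * f0 t).
  { intros t. pose proof (kern_den_pos t x (or_intror Hx)) as H. pose proof (t6_pos t).
    unfold fA, fB, kern, j2, f0; cbn [fst snd]. field. lra. }
  destruct (quartic_limits x Hx) as [L1 L2]. destruct int_1_t6 as [L3 L4]. pose proof int_t2_t6 as L5.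
  split.
  - apply (is_lim_seq_ext (fun n => (- x ^ 2 * RInt j1 (/ top n) (top n) + RInt f1 (/ top n) (top n)) + x ^ 2 * RInt f2 (/ top n) (top n))).
    + intros n. unfold A, B. fold fA fB.
      rewrite <- (RInt_scal_R (x ^ 3) fB), <- (RInt_plus_R fA (fun t => x ^ 3 * fB t)) by auto.
      rewrite <- (RInt_scal_R (- x ^ 2) j1), <- (RInt_scal_R (x ^ 2) f2), <- (RInt_plus_R (fun t => - x ^ 2 * j1 t) f1) by auto.
      rewrite <- (RInt_plus_R (fun t => - x ^ 2 * j1 t + f1 t) (fun t => x ^ 2 * f2 t)) by auto.
      apply RInt_ext. intros t _. symmetry. apply P1.
    + apply is_lim_seq_plus'; [apply is_lim_seq_plus'|]; auto.
      * apply (is_lim_seq_scal_l _ (- x ^ 2) j), L1.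
      * apply (is_lim_seq_scal_l _ (x ^ 2) (PI / 3)), L4.
  - apply (is_lim_seq_ext (fun n => - x ^ 2 * RInt j2 (/ top n) (top n) + x * RInt f0 (/ top n) (top n))).
    + intros n. unfold A, B. fold fA fB.
      rewrite <- (RInt_scal_R (x ^ 3) fA), <- (RInt_minus_R fB (fun t => x ^ 3 * fA t)) by auto.
      rewrite <- (RInt_scal_R (- x ^ 2) j2), <- (RInt_scal_R x f0), <- (RInt_plus_R (fun t => - x ^ 2 * j2 t) (fun t => x * f0 t)) by auto.
      apply RInt_ext. intros t _. symmetry. apply P2.
    + apply is_lim_seq_plus'.
      * apply (is_lim_seq_scal_l _ (- x ^ 2) j), L2.
      * apply (is_lim_seq_scal_l _ x (PI / 3)), L3.
Qed.

(* p ^ (3/2) = - (1 + i) zfun x for p = - i x. *)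
Definition zfun (x : R) : R := x ^ 2 / sqrt (2 * x).

(** 1 + p^(3/2) at p = - i x. *)
Definition zden (x : R) : C := (1 - zfun x, - zfun x).

Lemma zden_neq (x : R) : zden x <> RtoC 0.
Proof. intros E. inversion E. lra. Qed.

Lemma zfun_derive (x : R) : 0 < x -> is_derive zfun x (3 / 2 / x * zfun x).
Proof.
  intros Hx. unfold zfun. pose proof (sqrt_lt_R0 (2 * x) ltac:(lra)) as Hq.
  auto_derive; [split; [lra | split; [lra | trivial]]|].
  pose proof (sqrt_sqrt (2 * x) ltac:(lra)) as E.
  set (q := sqrt (2 * x)) in *. clearbody q. replace x with (q * q / 2) by lra.
  field. lra.
Qed.

(** For be = 3 / 2, D reproduces p^be, so D [zden] = [zden] - 1; the claim is the quotient rule. *)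
Lemma zden_ode : scder (3 / 2) (fun x => / zden x)%C
  (fun x => - / zden x + / zden x * / zden x)%C.
Proof.
  assert (H : scder (3 / 2) zden (fun x => zden x - 1)%C).
  { intros x Hx. pose proof (zfun_derive x Hx) as Hz. split.
    - apply (is_derive_ext (fun x => minus 1 (zfun x))); [reflexivity|].
      evar_last; [apply (is_derive_minus (K := R_AbsRing) (V := R_NormedModule) (fun _ => 1) zfun);
        [apply is_derive_const | exact Hz]|].
      unfold minus, plus, opp, zero, zden; simpl. ring.
    - apply (is_derive_ext (fun x => opp (zfun x))); [reflexivity|].
      evar_last; [apply (is_derive_opp (K := R_AbsRing) (V := R_NormedModule) zfun); exact Hz|].
      unfold opp, zden; simpl. ring. }
  pose proof (scder_inv (3 / 2) zden _ (fun x _ => zden_neq x) H) as H1.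
  eapply scder_ext; [intros; reflexivity| |exact H1].
  intros x _. cbv beta. field. apply zden_neq.
Qed.

(** The resolvent construction covers s <= 1 / 4; for s = 1 an explicit representation is used
    instead. The ball bound comes from the contributions of poles and branch cut, the identification
    with 1 / [zden] from the exact values of the integrals. *)
Lemma three_halves_inverse : exists M y, wball (omega 1) M y /\ y 0 = RtoC 1 /\
  scder (3 / 2) y (fun x => - y x + y x * y x)%C.
Proof.
  destruct wball_rational3 as [M0 HM0].
  pose proof (omega_weight 1 ltac:(lra)) as Hw. pose proof (omega_holder 1 ltac:(lra)) as Hh.
  set (M := Rabs (2 / 3) * M0 + Rabs (2 / PI) * (3888 * PI * PI)).
  set (Y := fun n x => (RtoC (2 / 3) * (num3 x / den3 x)
      - RtoC (2 / PI) * CRInt (fun t => kern t x) (/ top n) (top n))%C).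
  assert (HY : forall n, wball (omega 1) M (Y n)).
  { intros n. pose proof (top_ge n). pose proof (top_inv n).
    apply wball_minus; apply wball_scal; auto. apply wball_kern_int. lra. }
  destruct (wball_cluster (omega 1) 1 M Y Hw Hh HY) as [y [Hy Hc]].
  assert (Hyz : forall x, 0 < x -> y x = (/ zden x)%C).
  { intros x Hx. pose proof PI_RGT_0 as Hpi.
    (* [D] is 1 - p^3 = (1 - p^(3/2)) (1 + p^(3/2)); the two sides are compared after multiplication
       by it, when the integrals are explicit. The number [u] below is 1 - p^(3/2). *)
    set (D := (RtoC 1 - Ci * RtoC (x ^ 3))%C).
    assert (HD : D <> RtoC 0) by apply neq_1_mix.
    pose proof (sqrt_lt_R0 (2 * x) ltac:(lra)) as Hq.
    pose proof (sqrt_sqrt (2 * x) ltac:(lra)) as Eq.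
    assert (Hz2 : zfun x * zfun x = x ^ 3 / 2).
    { unfold zfun. replace (x ^ 2 / sqrt (2 * x) * (x ^ 2 / sqrt (2 * x))) with (x ^ 4 / (sqrt (2 * x) * sqrt (2 * x))) by (field; lra).
      rewrite Eq. field. lra. }
    assert (Hd3 : den3 x <> RtoC 0).
    { intros E. pose proof (Cmod_den3 x) as H. rewrite E, Cmod_0 in H. lra. }
    set (A := fun n => RInt (fun t => fst (kern t x)) (/ top n) (top n)).
    set (B := fun n => RInt (fun t => snd (kern t x)) (/ top n) (top n)).
    assert (HDY : forall n, (D * Y n x)%C =
      (2 / 3 * (2 + x ^ 2) - 2 / PI * (A n + x ^ 3 * B n), 2 / 3 * x - 2 / PI * (B n - x ^ 3 * A n))).
    { intros n. unfold Y.
      change (CRInt (fun t => kern t x) (/ top n) (top n)) with (A n, B n).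
      assert (E1 : (D * (num3 x / den3 x))%C = ((RtoC 1 + Ci * RtoC x) * num3 x)%C).
      { assert (E2 : D = ((RtoC 1 + Ci * RtoC x) * den3 x)%C).
        { unfold D, den3. apply injective_projections; simpl; ring. }
        rewrite E2. field. auto. }
      replace (D * (RtoC (2 / 3) * (num3 x / den3 x) - RtoC (2 / PI) * (A n, B n)))%C
        with (RtoC (2 / 3) * (D * (num3 x / den3 x)) - RtoC (2 / PI) * (D * (A n, B n)))%C by ring.
      rewrite E1. unfold D, num3. apply injective_projections; cbn [fst snd Cmult Cminus Cplus Copp RtoC Ci]; field; lra. }
    set (u := (1 + zfun x, zfun x) : C).
    assert (HDz : (D * / zden x)%C = u).
    { assert (E2 : D = (u * zden x)%C).
      { unfold D, u, zden. apply injective_projections; cbn [fst snd Cmult Cminus Cplus Copp RtoC Ci]; lra. }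
      rewrite E2. field. apply zden_neq. }
    destruct (kern_int_limit x Hx) as [LA LB]. fold A B in LA, LB.
    assert (L1 : is_lim_seq (fun n => 2 / 3 * (2 + x ^ 2) - 2 / PI * (A n + x ^ 3 * B n)) (1 + zfun x)).
    { replace (Finite (1 + zfun x)) with (Finite (2 / 3 * (2 + x ^ 2) - 2 / PI * (- x ^ 2 * (PI / (2 * sqrt (2 * x))) + PI / 6 + x ^ 2 * (PI / 3))))
        by (f_equal; unfold zfun; field; lra).
      apply is_lim_seq_minus'; [apply is_lim_seq_const|].
      apply (is_lim_seq_scal_l _ (2 / PI) (Finite _) LA). }
    assert (L2 : is_lim_seq (fun n => 2 / 3 * x - 2 / PI * (B n - x ^ 3 * A n)) (zfun x)).
    { replace (Finite (zfun x)) with (Finite (2 / 3 * x - 2 / PI * (- x ^ 2 * (PI / (2 * sqrt (2 * x))) + x * (PI / 3))))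
        by (f_equal; unfold zfun; field; lra).
      apply is_lim_seq_minus'; [apply is_lim_seq_const|].
      apply (is_lim_seq_scal_l _ (2 / PI) (Finite _) LB). }
    assert (HE : (D * y x)%C = (D * / zden x)%C).
    { apply Ceq_minus. apply Cmod_eq_0. apply Rle_antisym; [|apply Cmod_ge_0].
      apply Rle_plus_epsilon. intros eta He. rewrite Rplus_0_l.
      pose proof (Cmod_ge_0 D) as HD0.
      apply is_lim_seq_spec in L1. apply is_lim_seq_spec in L2.
      destruct (L1 (mkposreal (eta / 4) ltac:(lra))) as [N1 HN1].
      destruct (L2 (mkposreal (eta / 4) ltac:(lra))) as [N2 HN2].
      assert (He2 : 0 < eta / (2 * (1 + Cmod D))) by (apply Rdiv_lt_0_compat; lra).
      destruct (Hc x _ (Nat.max N1 N2) He2) as [n [Hn Hn']].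
      specialize (HN1 n ltac:(lia)). specialize (HN2 n ltac:(lia)). specialize (Hn' x ltac:(lra)). simpl in HN1, HN2.
      eapply Rle_trans; [apply (Cmod_dist_triangle _ (D * Y n x)%C)|].
      replace eta with (eta / 2 + (eta / 4 + eta / 4)) by field.
      apply Rplus_le_compat.
      - replace (D * y x - D * Y n x)%C with (D * (y x - Y n x))%C by ring. rewrite Cmod_mult.
        apply Rle_trans with ((1 + Cmod D) * (eta / (2 * (1 + Cmod D)))); [|right; field; lra].
        apply Rmult_le_compat; auto using Cmod_ge_0; lra.
      - rewrite HDz, HDY. eapply Rle_trans; [apply Cmod_le_sum|]. unfold u; cbn [fst snd Cminus Cplus Copp].
        apply Rplus_le_compat; left; [exact HN1 | exact HN2]. }
    assert (E3 : y x = (/ D * (D * y x))%C) by (field; auto). rewrite E3, HE. field. split; [apply zden_neq | auto]. }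
  exists M, y. split; auto. split.
  - apply Ceq_minus. apply Cmod_eq_0. apply Rle_antisym; [|apply Cmod_ge_0].
    apply Rle_plus_epsilon. intros eta He. rewrite Rplus_0_l.
    destruct (wball_modulus (omega 1) 1 M y 0 Hh Hw Hy ltac:(lra) (eta / 2) ltac:(lra)) as [d [Hd Hd']].
    (* The value at 0 is reached by continuity from a small [x]: there [zfun x] <= x, and 1 /
       [zden x] differs from 1 by at most 4 [zfun x]. *)
    set (x := Rmin (d / 2) (Rmin 1 (eta / 8))).
    assert (Hx : 0 < x) by (repeat apply Rmin_pos; lra).
    assert (Hx1 : x <= d / 2) by apply Rmin_l.
    assert (Hx2 : x <= Rmin 1 (eta / 8)) by apply Rmin_r.
    pose proof (Rmin_l 1 (eta / 8)). pose proof (Rmin_r 1 (eta / 8)).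
    specialize (Hd' x ltac:(lra) ltac:(rewrite Rminus_0_r, Rabs_pos_eq; lra)).
    eapply Rle_trans; [apply (Cmod_dist_triangle _ (y x))|]. rewrite Cmod_minus_sym.
    replace eta with (eta / 2 + eta / 2) at 1 by field. apply Rplus_le_compat; auto.
    rewrite Hyz by auto.
    set (o := (1, 1) : C).
    replace (/ zden x - 1)%C with (/ zden x * (RtoC (zfun x) * o))%C.
    2: { assert (E : (RtoC (zfun x) * o)%C = (RtoC 1 - zden x)%C) by (unfold o, zden; apply injective_projections; simpl; ring).
         rewrite E. field. apply zden_neq. }
    rewrite !Cmod_mult, Cmod_inv, Cmod_R by apply zden_neq.
    pose proof (sqrt_lt_R0 (2 * x) ltac:(lra)) as Hq.
    pose proof (sqrt_sqrt (2 * x) ltac:(lra)) as Eq.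
    assert (Hz : 0 <= zfun x <= x).
    { unfold zfun. split; [apply Rdiv_le_0_compat; nra|]. rewrite Rle_div_l by auto.
      assert (x <= sqrt (2 * x)); [|simpl; nra].
      apply Rnot_lt_le. intros Hlt. nra. }
    assert (Hm : / 2 <= Cmod (zden x)).
    { destruct (Rle_dec (zfun x) (/ 2)) as [Hz2|Hz2].
      - eapply Rle_trans; [|apply Rabs_fst_Cmod]. simpl. rewrite Rabs_pos_eq; lra.
      - eapply Rle_trans; [|apply Rabs_snd_Cmod]. simpl. rewrite Rabs_Ropp, Rabs_pos_eq; lra. }
    assert (H11 : Cmod o <= 2).
    { eapply Rle_trans; [apply Cmod_le_sum|]. simpl. rewrite Rabs_R1. lra. }
    rewrite Rabs_pos_eq by lra.
    apply Rle_trans with (2 * (eta / 8 * 2)); [|lra].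
    apply Rmult_le_compat.
    + left. apply Rinv_0_lt_compat. lra.
    + apply Rmult_le_pos; [lra | apply Cmod_ge_0].
    + apply Rle_trans with (/ / 2); [apply Rinv_le_contravar; lra | lra].
    + apply Rmult_le_compat; try lra. apply Cmod_ge_0.
  - eapply scder_ext; [| |exact zden_ode]; intros x Hx; cbv beta; rewrite Hyz; auto.
Qed.

(** * The Hilbert transform of the odd extension *)

(* Real part of the integral of [exp (i z) / (i z)] over a quarter circle of radius [T]. *)
Definition quarter (T : R) : R := RInt (fun a => exp (- (T * sin a)) * cos (T * cos a)) 0 (PI / 2).

Lemma quarter_cont (T a : R) : continuous (fun a => exp (- (T * sin a)) * cos (T * cos a)) a.
Proof. apply (ex_derive_continuous (K := R_AbsRing) (V := R_NormedModule)). auto_derive. trivial. Qed.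

Lemma continuity_2d_fst_comp (g h : R -> R) (x y : R) :
  continuity_pt g (x * h y) -> continuity_pt h y ->
  continuity_2d_pt (fun u v => g (u * h v)) x y.
Proof.
  intros Hg Hh. apply (continuity_1d_2d_pt_comp g (fun u v => u * h v)); auto.
  apply continuity_2d_pt_mult; [apply continuity_2d_pt_id1|].
  apply (continuity_1d_2d_pt_comp h (fun u v => v)); auto. apply continuity_2d_pt_id2.
Qed.

(** After differentiation under the integral sign the integrand is the derivative in a of exp (- T
    sin a) sin (T cos a) / T. So [quarter] is a primitive of - sin T / T, near PI / 2 at 0 and
    decaying at infinity: it evaluates truncated Dirichlet integrals with rates at both ends. *)
Lemma quarter_derive (T : R) : 0 < T -> is_derive quarter T (- (sin T / T)).
Proof.
  intros HT.
  set (f := fun T a => exp (- (T * sin a)) * cos (T * cos a)).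
  set (df := fun T a => exp (- (T * sin a)) * (- sin a * cos (T * cos a) - cos a * sin (T * cos a))).
  assert (Hf : forall T a, is_derive (fun u => f u a) T (df T a)).
  { intros u a. unfold f, df. auto_derive; [trivial | ring]. }
  assert (HI : RInt (fun a => Derive (fun u => f u a) T) 0 (PI / 2) = - (sin T / T)).
  { rewrite (RInt_ext _ (df T)) by (intros a _; apply is_derive_unique, Hf).
    apply is_RInt_unique_R.
    replace (- (sin T / T)) with (minus (exp (- (T * sin (PI / 2))) * sin (T * cos (PI / 2)) / T)
      (exp (- (T * sin 0)) * sin (T * cos 0) / T)).
    - apply (is_RInt_derive (V := R_CompleteNormedModule) (fun a => exp (- (T * sin a)) * sin (T * cos a) / T)).
      + intros a _. unfold df. auto_derive; [trivial | field; lra].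
      + intros a _. apply (ex_derive_continuous (K := R_AbsRing) (V := R_NormedModule)). unfold df. auto_derive. trivial.
    - rewrite cos_PI2, sin_0, cos_0, !Rmult_0_r, sin_0, Ropp_0, exp_0, Rmult_1_r.
      unfold minus, plus, opp; simpl. field. lra. }
  rewrite <- HI. apply (is_derive_RInt_param f 0 (PI / 2) T).
  - exists (mkposreal 1 Rlt_0_1). intros u _ a _. eexists. apply Hf.
  - intros a _. apply (continuity_2d_pt_ext df).
    { intros u v. symmetry. apply is_derive_unique, Hf. }
    unfold df. apply continuity_2d_pt_mult.
    + apply (continuity_2d_fst_comp (fun z => exp (- z)) sin); [|apply continuity_sin].
      apply (is_derive_continuity_pt _ _ (- exp (- (T * sin a)))). auto_derive; [trivial | ring].
    + apply continuity_2d_pt_minus; apply continuity_2d_pt_mult.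
      * apply (continuity_1d_2d_pt_comp (fun v => - sin v) (fun u v => v)); [|apply continuity_2d_pt_id2].
        apply (is_derive_continuity_pt _ _ (- cos a)). auto_derive; [trivial | ring].
      * apply (continuity_2d_fst_comp cos cos); apply continuity_cos.
      * apply (continuity_1d_2d_pt_comp cos (fun u v => v)); [apply continuity_cos | apply continuity_2d_pt_id2].
      * apply (continuity_2d_fst_comp sin cos); [apply continuity_sin | apply continuity_cos].
  - exists (mkposreal 1 Rlt_0_1). intros u _. eexists. apply is_RInt_cont_R. intros a. apply quarter_cont.
Qed.

(** Up to PI / 3 the cosine is at least 1 / 2; beyond, sin a >= sqrt 3 / 2 >= 0.85 >= PI / 4 >= a /
    2. *)
Lemma sin_lower (a : R) : 0 <= a <= PI / 2 -> a / 2 <= sin a.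
Proof.
  intros Ha. pose proof PI_RGT_0 as Hpi. pose proof PI_4 as H4.
  destruct (Rle_dec a (PI / 3)) as [H|H].
  - destruct (MVT_gen sin 0 a cos) as [c [Hc Hc']].
    + intros t _. auto_derive; [trivial | ring].
    + intros t _. apply continuity_sin.
    + rewrite sin_0, !Rminus_0_r in Hc'. rewrite Hc'.
      rewrite Rmin_left, Rmax_right in Hc by lra.
      assert (/ 2 <= cos c); [|nra].
      replace (/ 2) with (cos (PI / 3)) by (rewrite cos_PI3; field).
      apply cos_decr_1; lra.
  - assert (sin (PI / 3) <= sin a) by (apply sin_incr_1; lra).
    rewrite sin_PI3 in H0.
    assert (Hs : 1.7 <= sqrt 3).
    { rewrite <- (sqrt_square 1.7) by lra. apply sqrt_le_1; lra. }
    assert (PI / 4 <= 0.85); [|lra].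
    pose proof PI2_3_2. pose proof PI_ineq 2 as [_ Hup]. simpl in Hup. unfold tg_alt, PI_tg in Hup. simpl in Hup. lra.
Qed.

Lemma quarter_near_0 (T : R) : 0 <= T -> Rabs (quarter T - PI / 2) <= 4 * T.
Proof.
  intros HT. pose proof PI_RGT_0 as Hpi. pose proof PI_4 as H4.
  replace (quarter T - PI / 2) with (RInt (fun a => exp (- (T * sin a)) * cos (T * cos a)) 0 (PI / 2) - (PI / 2 - 0) * 1)
    by (unfold quarter; ring).
  eapply Rle_trans; [apply (RInt_near_const _ 0 (PI / 2) 1 (2 * T))|].
  - lra.
  - eexists. apply is_RInt_cont_R. apply quarter_cont.
  - intros a Ha.
    assert (Hs : 0 <= sin a) by (pose proof (sin_lower a Ha); lra).
    assert (Hs1 : sin a <= 1) by apply SIN_bound.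
    assert (Hts : 0 <= T * sin a <= T) by nra.
    set (E := exp (- (T * sin a))).
    assert (HE : 1 - T <= E <= 1).
    { unfold E. split.
      - pose proof (exp_ineq1_le (- (T * sin a))). lra.
      - rewrite <- exp_0. destruct (Req_dec (T * sin a) 0) as [E0|E0]; [rewrite E0, Ropp_0; lra|].
        left. apply exp_increasing. lra. }
    assert (HE0 : 0 < E) by apply exp_pos.
    assert (Hc : Rabs (cos (T * cos a) - 1) <= T).
    { pose proof (Cmod_ek_diff 1 (T * cos a) 0) as H. pose proof (Rabs_fst_Cmod (ek 1 (T * cos a) - ek 1 0)) as H'.
      rewrite ek_0 in H'. change (fst (ek 1 (T * cos a) - 1)%C) with (cos (1 * (T * cos a)) - 1) in H'.
      rewrite ek_0 in H. rewrite Rmult_1_l in H'. rewrite Rminus_0_r, Rmult_1_l, Rabs_mult, (Rabs_pos_eq T) in H by lra.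
      assert (Rabs (cos a) <= 1) by (apply Rabs_le; pose proof (COS_bound a); lra). nra. }
    apply Rabs_le_between in Hc. pose proof (COS_bound (T * cos a)). apply Rabs_le. nra.
  - nra.
Qed.

Lemma quarter_decay (T : R) : 0 < T -> Rabs (quarter T) <= 2 / T.
Proof.
  intros HT. pose proof PI_RGT_0 as Hpi.
  assert (Hi : is_RInt (fun a => exp (- (T * (a / 2)))) 0 (PI / 2) (2 / T * (1 - exp (- (T * (PI / 4)))))).
  { replace (2 / T * (1 - exp (- (T * (PI / 4)))))
      with (minus (- (2 / T) * exp (- (T * (PI / 2 / 2)))) (- (2 / T) * exp (- (T * (0 / 2))))).
    - apply (is_RInt_derive (V := R_CompleteNormedModule) (fun a => - (2 / T) * exp (- (T * (a / 2))))).
      + intros a _. auto_derive; [trivial|]. replace (a * / 2) with (a / 2) by field. field. lra.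
      + intros a _. apply (ex_derive_continuous (K := R_AbsRing) (V := R_NormedModule)). auto_derive. trivial.
    - unfold minus, plus, opp; simpl. replace (T * (0 / 2)) with 0 by field. rewrite Ropp_0, exp_0.
      replace (PI / 2 / 2) with (PI / 4) by field. ring. }
  apply Rle_trans with (2 / T * (1 - exp (- (T * (PI / 4))))).
  - apply (norm_RInt_le (V := R_NormedModule) (fun a => exp (- (T * sin a)) * cos (T * cos a)) (fun a => exp (- (T * (a / 2)))) 0 (PI / 2)).
    + lra.
    + intros a Ha. change (Rabs (exp (- (T * sin a)) * cos (T * cos a)) <= exp (- (T * (a / 2)))).
      rewrite Rabs_mult, Rabs_pos_eq by (left; apply exp_pos).
      pose proof (sin_lower a Ha) as Hs.
      assert (exp (- (T * sin a)) <= exp (- (T * (a / 2)))).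
      { destruct (Req_dec (sin a) (a / 2)) as [->|Hne]; [lra|]. left. apply exp_increasing. nra. }
      assert (Rabs (cos (T * cos a)) <= 1) by (apply Rabs_le; pose proof (COS_bound (T * cos a)); lra).
      pose proof (exp_pos (- (T * sin a))). pose proof (Rabs_pos (cos (T * cos a))). nra.
    + apply is_RInt_cont_R, quarter_cont.
    + exact Hi.
  - pose proof (exp_pos (- (T * (PI / 4)))). assert (0 < 2 / T) by (apply Rdiv_lt_0_compat; lra). nra.
Qed.

Lemma quarter_bound (T : R) : 0 <= T -> Rabs (quarter T) <= 2.
Proof.
  intros HT. pose proof PI_RGT_0 as Hpi. pose proof PI_4 as H4.
  replace 2 with (4 / 2) by field.
  apply Rle_trans with ((PI / 2 - 0) * 1); [|lra].
  apply abs_RInt_le_const; [lra | eexists; apply is_RInt_cont_R, quarter_cont |].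
  intros a Ha. rewrite Rabs_mult, Rabs_pos_eq by (left; apply exp_pos).
  pose proof (sin_lower a Ha) as Hs.
  assert (exp (- (T * sin a)) <= 1).
  { rewrite <- exp_0. destruct (Req_dec (T * sin a) 0) as [E0|E0]; [rewrite E0, Ropp_0; lra|].
    left. apply exp_increasing. assert (0 <= T * sin a) by (apply Rmult_le_pos; lra). lra. }
  assert (Rabs (cos (T * cos a)) <= 1) by (apply Rabs_le; pose proof (COS_bound (T * cos a)); lra).
  pose proof (exp_pos (- (T * sin a))). pose proof (Rabs_pos (cos (T * cos a))). nra.
Qed.

Lemma sinc_integral (k e Rr : R) : 0 < k -> 0 < e <= Rr ->
  is_RInt (fun r => sin (k * r) / r) e Rr (quarter (k * e) - quarter (k * Rr)).
Proof.
  intros Hk He.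
  replace (quarter (k * e) - quarter (k * Rr)) with (- quarter (k * Rr) - - quarter (k * e)) by ring.
  apply (is_RInt_antideriv (fun r => - quarter (k * r))); try lra.
  - intros r Hr. evar_last.
    + apply (is_derive_opp (K := R_AbsRing) (V := R_NormedModule) (fun r => quarter (k * r))).
      apply (is_derive_comp quarter (fun r => k * r)); [apply quarter_derive; nra | auto_derive; trivial].
    + unfold opp, scal; simpl; unfold mult; simpl. field. lra.
  - intros r Hr. apply (ex_derive_continuous (K := R_AbsRing) (V := R_NormedModule)). auto_derive. lra.
Qed.

(** The errors at the two ends are of order min (1, k e) and min (1, 1 / (k Rr)). They are
    interpolated to (k e)^s and (k Rr)^(-s/3), whose powers of k are the two parts of the weight;
    principal values therefore converge uniformly over a ball. *)
Lemma sinc_error (k e Rr s : R) : 0 < k -> 0 < e <= Rr -> 0 < s <= 1 ->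
  Rabs (/ PI * (2 * (quarter (k * e) - quarter (k * Rr))) - 1)
  <= 4 * omega s k * (Rpower e s + Rpower Rr (- (s / 3))).
Proof.
  intros Hk He Hs. pose proof PI_RGT_0 as Hpi. pose proof PI2_3_2 as H3.
  replace (/ PI * (2 * (quarter (k * e) - quarter (k * Rr))) - 1)
    with (2 / PI * ((quarter (k * e) - PI / 2) - quarter (k * Rr))) by (field; lra).
  rewrite Rabs_mult, Rabs_pos_eq by (apply Rdiv_le_0_compat; lra).
  assert (Hp : 2 / PI <= 1) by (rewrite Rle_div_l; lra).
  pose proof (Rpower_pos e s). pose proof (Rpower_pos Rr (- (s / 3))).
  pose proof (Rpower_pos k s). pose proof (Rpower_pos k (- (s / 3))).
  assert (B1 : Rabs (quarter (k * e) - PI / 2) <= 4 * (Rpower k s * Rpower e s)).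
  { rewrite Rpower_mult_distr by lra.
    pose proof (min_le_Rpower (k * e) s ltac:(nra) Hs) as Hm.
    apply Rle_trans with (4 * Rmin 1 (k * e)); [|lra].
    unfold Rmin. destruct (Rle_dec 1 (k * e)).
    - pose proof (quarter_bound (k * e) ltac:(nra)) as Hq. pose proof PI_4.
      apply Rabs_le_between in Hq. apply Rabs_le. lra.
    - apply quarter_near_0. nra. }
  assert (B2 : Rabs (quarter (k * Rr)) <= 2 * (Rpower k (- (s / 3)) * Rpower Rr (- (s / 3)))).
  { rewrite Rpower_mult_distr by lra. assert (HkR : 0 < k * Rr) by nra.
    destruct (Rle_dec 1 (k * Rr)) as [Hk1|Hk1].
    - eapply Rle_trans; [apply quarter_decay; auto|]. unfold Rdiv. apply Rmult_le_compat_l; [lra|].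
      rewrite Rpower_Ropp. apply Rinv_le_contravar; [apply Rpower_pos|].
      rewrite <- (Rpower_1 (k * Rr)) at 2 by auto. apply Rle_Rpower; lra.
    - pose proof (quarter_bound (k * Rr) ltac:(lra)).
      pose proof (Rpower_neg_ge_1 (k * Rr) (s / 3) ltac:(lra) ltac:(lra)). lra. }
  unfold omega.
  assert (B3 : Rabs (quarter (k * e) - PI / 2 - quarter (k * Rr))
     <= 4 * (Rpower k s * Rpower e s) + 2 * (Rpower k (- (s / 3)) * Rpower Rr (- (s / 3)))).
  { apply Rabs_le_between in B1, B2. apply Rabs_le. lra. }
  pose proof (Rabs_pos (quarter (k * e) - PI / 2 - quarter (k * Rr))).
  apply Rle_trans with (1 * Rabs (quarter (k * e) - PI / 2 - quarter (k * Rr))).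
  - apply Rmult_le_compat_r; lra.
  - assert (0 < Rpower k s * Rpower Rr (- (s / 3))) by nra.
    assert (0 < Rpower k (- (s / 3)) * Rpower e s) by nra.
    assert (0 < Rpower k (- (s / 3)) * Rpower Rr (- (s / 3))) by nra. lra.
Qed.

(** W = - Im F, extended oddly. Negative arguments of [f] are avoided because the balls control the
    half line only. *)
Definition Wof (f : R -> C) (x : R) : R := if Rle_dec 0 x then - snd (f x) else snd (f (- x)).

Lemma ev_conj (l : list (R * R)) (x : R) : snd (ev l (- x)) = - snd (ev l x) /\ fst (ev l (- x)) = fst (ev l x).
Proof.
  induction l as [|[c k] t [I1 I2]]; simpl; [split; ring|].
  rewrite I1, I2. replace (k * - x) with (- (k * x)) by ring. rewrite cos_neg, sin_neg. split; ring.
Qed.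

(** Finite combinations have odd imaginary part on the whole line, as their coefficients are real;
    one list thus serves both signs of x. *)
Lemma Wof_approx (f : R -> C) (l : list (R * R)) (X eta : R) :
  (forall x, 0 <= x <= X -> Cmod (f x - ev l x) <= eta) ->
  forall x, Rabs x <= X -> Rabs (Wof f x - - snd (ev l x)) <= eta.
Proof.
  intros H x Hx. unfold Wof. apply Rabs_le_between in Hx. destruct (Rle_dec 0 x) as [H0|H0].
  - specialize (H x ltac:(lra)). pose proof (Rabs_snd_Cmod (f x - ev l x)) as H1.
    change (snd (f x - ev l x)%C) with (snd (f x) - snd (ev l x)) in H1.
    replace (- snd (f x) - - snd (ev l x)) with (- (snd (f x) - snd (ev l x))) by ring.
    rewrite Rabs_Ropp. lra.
  - specialize (H (- x) ltac:(lra)). pose proof (Rabs_snd_Cmod (f (- x)%R - ev l (- x)%R)) as H1.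
    change (snd (f (- x)%R - ev l (- x)%R)%C) with (snd (f (- x)) - snd (ev l (- x))) in H1.
    rewrite (proj1 (ev_conj l x)) in H1. lra.
Qed.

Lemma Wof_bound (w : R -> R) (M : R) (f : R -> C) (x : R) : weight w -> wball w M f -> Rabs (Wof f x) <= M.
Proof.
  intros Hw Hf. unfold Wof. destruct (Rle_dec 0 x) as [H|H]; rewrite ?Rabs_Ropp;
    (eapply Rle_trans; [apply Rabs_snd_Cmod | apply (wball_bound w Hw M f Hf); lra]).
Qed.

Lemma Wof_holder (w : R -> R) (s M : R) (f : R -> C) (x y : R) :
  holder_weight w s -> wball w M f -> x <> y ->
  Rabs (Wof f x - Wof f y) <= 2 * M * Rpower (Rabs (x - y)) s.
Proof.
  intros Hs Hf Hxy. apply Rle_plus_epsilon. intros eta He.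
  destruct (Hf (Rmax (Rabs x) (Rabs y)) (eta / 2) ltac:(lra)) as [l [H1 [H2 H3]]].
  pose proof (Wof_approx f l _ _ H3 x (Rmax_l _ _)) as A1.
  pose proof (Wof_approx f l _ _ H3 y (Rmax_r _ _)) as A2.
  pose proof (ev_holder w s l x y Hs H1 Hxy) as A3.
  pose proof (Rabs_snd_Cmod (ev l x - ev l y)) as A4.
  change (snd (ev l x - ev l y)%C) with (snd (ev l x) - snd (ev l y)) in A4.
  pose proof (Rpower_pos (Rabs (x - y)) s) as Hp.
  assert (A5 : Rabs (snd (ev l x) - snd (ev l y)) <= 2 * M * Rpower (Rabs (x - y)) s) by nra.
  apply Rabs_le_between in A1, A2, A5. apply Rabs_le. lra.
Qed.

Lemma Wof_continuous (w : R -> R) (s M : R) (f : R -> C) (x : R) :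
  holder_weight w s -> weight w -> wball w M f -> continuous (Wof f) x.
Proof.
  intros Hs Hw Hf. pose proof (wball_nonneg w Hw M f Hf) as HM.
  apply continuity_pt_filterlim. intros eta He.
  destruct (Rpower_small s (eta / (4 * (M + 1)))) as [d [Hd Hd']]; [apply Hs | apply Rdiv_lt_0_compat; lra |].
  exists d. split; auto. intros y [[_ Hyx] Hy]. simpl in *. unfold R_dist in *.
  eapply Rle_lt_trans; [apply (Wof_holder w s M f y x Hs Hf); auto|].
  specialize (Hd' (Rabs (y - x)) ltac:(split; [apply Rabs_pos_lt; lra | lra])).
  apply Rle_lt_trans with (2 * (M + 1) * (eta / (4 * (M + 1)))).
  - pose proof (Rpower_pos (Rabs (y - x)) s). apply Rmult_le_compat; lra.
  - replace (2 * (M + 1) * (eta / (4 * (M + 1)))) with (eta / 2) by (field; lra). lra.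
Qed.

Lemma continuous_quot (f : R -> R) (a s y : R) : (forall t, continuous f t) -> y <> a ->
  continuous (fun y => f y / (a - y)) y.
Proof.
  intros Hf Hy. apply (continuous_mult (K := R_AbsRing) f (fun y => / (a - y))); auto.
  apply (ex_derive_continuous (K := R_AbsRing) (V := R_NormedModule)). auto_derive. lra.
Qed.

Definition pv_sum (f : R -> R) (x e Rr : R) : R :=
  RInt (fun y => f y / (x - y)) (x - Rr) (x - e) + RInt (fun y => f y / (x - y)) (x + e) (x + Rr).

Lemma pv_sum_ex (f : R -> R) (x e Rr : R) : (forall t, continuous f t) -> 0 < e -> e < Rr ->
  ex_RInt (fun y => f y / (x - y)) (x - Rr) (x - e) /\ ex_RInt (fun y => f y / (x - y)) (x + e) (x + Rr).
Proof.
  intros Hf He HR. split; apply (ex_RInt_continuous (V := R_CompleteNormedModule)); intros z;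
    rewrite Rmin_left, Rmax_right by lra; intros Hz; apply continuous_quot; auto; lra.
Qed.

(** Both ranges are folded onto r = |x - y|. For a sine, the difference of the values at x - r and x
    + r is a multiple of sin (k r), and the truncated Dirichlet integral appears. *)
Lemma pv_sum_fold (f : R -> R) (x e Rr : R) : (forall t, continuous f t) -> 0 < e -> e < Rr ->
  pv_sum f x e Rr = RInt (fun r => (f (x - r) - f (x + r)) / r) e Rr.
Proof.
  intros Hf He HR. unfold pv_sum. destruct (pv_sum_ex f x e Rr Hf He HR) as [X1 X2].
  set (g := fun y => f y / (x - y)) in *.
  assert (C1 : forall r, 0 < r -> continuous (fun r => f (x - r) / r) r).
  { intros r Hr. apply (continuous_mult (K := R_AbsRing) (fun r => f (x - r)) (fun r => / r)).
    - apply (continuous_comp (fun r => x - r) f); auto.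
      apply (ex_derive_continuous (K := R_AbsRing) (V := R_NormedModule)). auto_derive. trivial.
    - apply (ex_derive_continuous (K := R_AbsRing) (V := R_NormedModule)). auto_derive. lra. }
  assert (C2 : forall r, 0 < r -> continuous (fun r => - f (x + r) / r) r).
  { intros r Hr. apply (continuous_mult (K := R_AbsRing) (fun r => - f (x + r)) (fun r => / r)).
    - apply (continuous_opp (K := R_AbsRing) (V := R_NormedModule) (fun r => f (x + r))).
      apply (continuous_comp (fun r => x + r) f); auto.
      apply (ex_derive_continuous (K := R_AbsRing) (V := R_NormedModule)). auto_derive. trivial.
    - apply (ex_derive_continuous (K := R_AbsRing) (V := R_NormedModule)). auto_derive. lra. }
  assert (E2 : RInt g (x + e) (x + Rr) = RInt (fun r => - f (x + r) / r) e Rr).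
  { pose proof (RInt_comp_lin (V := R_CompleteNormedModule) g 1 x e Rr) as H.
    replace (1 * e + x) with (x + e) in H by ring. replace (1 * Rr + x) with (x + Rr) in H by ring.
    rewrite <- (H X2). apply RInt_ext. intros r. rewrite Rmin_left, Rmax_right by lra. intros Hr.
    unfold g, scal; simpl; unfold mult; simpl. real_eq. replace (1 * r + x) with (x + r) by ring. field. lra. }
  assert (E1 : RInt g (x - Rr) (x - e) = RInt (fun r => f (x - r) / r) e Rr).
  { pose proof (RInt_comp_lin (V := R_CompleteNormedModule) g (-1) x Rr e) as H.
    replace (-1 * Rr + x) with (x - Rr) in H by ring. replace (-1 * e + x) with (x - e) in H by ring.
    rewrite <- (H X1).
    rewrite <- (opp_RInt_swap (V := R_CompleteNormedModule) _ e Rr).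
    - rewrite <- (RInt_opp (V := R_CompleteNormedModule)).
      + apply RInt_ext. intros r. rewrite Rmin_left, Rmax_right by lra. intros Hr.
        unfold g, opp, scal; simpl; unfold mult; simpl. real_eq. replace (-1 * r + x) with (x - r) by ring. field. lra.
      + apply (ex_RInt_ext (V := R_NormedModule) (fun r => - (f (x - r) / r))).
        * intros r. rewrite Rmin_left, Rmax_right by lra. intros Hr.
          unfold g, scal; simpl; unfold mult; simpl. replace (-1 * r + x) with (x - r) by ring. field. lra.
        * apply (ex_RInt_opp (V := R_NormedModule)). apply ex_RInt_pos; auto; lra.
    - apply (ex_RInt_ext (V := R_NormedModule) (fun r => - (f (x - r) / r))).
      * intros r. rewrite Rmin_left, Rmax_right by lra. intros Hr.
        unfold g, scal; simpl; unfold mult; simpl. replace (-1 * r + x) with (x - r) by ring. field. lra.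
      * apply (ex_RInt_opp (V := R_NormedModule)). apply ex_RInt_pos; auto; lra. }
  rewrite E1, E2.
  change (plus (RInt (fun r => f (x - r) / r) e Rr) (RInt (fun r => - f (x + r) / r) e Rr)
     = RInt (fun r => (f (x - r) - f (x + r)) / r) e Rr).
  rewrite <- (RInt_plus (V := R_CompleteNormedModule)); [|apply ex_RInt_pos; auto; lra | apply ex_RInt_pos; auto; lra].
  apply RInt_ext. intros r. rewrite Rmin_left, Rmax_right by lra. intros Hr. unfold plus; simpl. real_eq. field. lra.
Qed.

Lemma pv_sum_ev (l : list (R * R)) (x e Rr s : R) : posl l -> 0 < e -> e < Rr -> 0 < s <= 1 ->
  Rabs (/ PI * pv_sum (fun y => - snd (ev l y)) x e Rr - fst (ev l x))
  <= cost (omega s) l * (4 * (Rpower e s + Rpower Rr (- (s / 3)))).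
Proof.
  intros Hl He HR Hs.
  assert (Cev : forall l t, continuous (fun y => - snd (ev l y)) t).
  { intros l' t. apply (continuous_opp (K := R_AbsRing) (V := R_NormedModule) (fun y => snd (ev l' y))). apply ev_Ccont. }
  rewrite pv_sum_fold by auto.
  assert (Hval : exists v, is_RInt (fun r => (- snd (ev l (x - r)) - - snd (ev l (x + r))) / r) e Rr v /\
     Rabs (/ PI * v - fst (ev l x)) <= cost (omega s) l * (4 * (Rpower e s + Rpower Rr (- (s / 3))))).
  { induction Hl as [|[c k] t H H' IH].
    - exists 0. split.
      + apply (is_RInt_ext (fun _ => 0)); [intros; simpl; unfold Rdiv; ring|].
        evar_last; [apply (is_RInt_const (V := R_NormedModule))|]. unfold scal; simpl; unfold mult; simpl. ring.
      + simpl. rewrite Rmult_0_r, Rminus_0_r, Rabs_R0. lra.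
    - simpl in H. destruct IH as [v [Hv1 Hv2]].
      exists (c * (2 * cos (k * x)) * (quarter (k * e) - quarter (k * Rr)) + v). split.
      + apply (is_RInt_ext (fun r => plus (scal (c * (2 * cos (k * x))) (sin (k * r) / r))
           ((- snd (ev t (x - r)) - - snd (ev t (x + r))) / r))).
        * intros r. rewrite Rmin_left, Rmax_right by lra. intros Hr. unfold plus, scal; simpl; unfold mult; simpl.
          replace (k * (x - r)) with (k * x - k * r) by ring. replace (k * (x + r)) with (k * x + k * r) by ring.
          rewrite sin_plus, sin_minus. field. lra.
        * apply (is_RInt_plus (V := R_NormedModule)); auto.
          apply (is_RInt_scal (V := R_NormedModule)). apply sinc_integral; auto. lra.
      + pose proof (sinc_error k e Rr s H ltac:(lra) Hs) as E. simpl.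
        set (q := quarter (k * e) - quarter (k * Rr)) in *.
        set (b := Rpower e s + Rpower Rr (- (s / 3))) in *.
        replace (/ PI * (c * (2 * cos (k * x)) * q + v) - (c * cos (k * x) - 0 * sin (k * x) + fst (ev t x)))
          with (c * cos (k * x) * (/ PI * (2 * q) - 1) + (/ PI * v - fst (ev t x))) by ring.
        eapply Rle_trans; [apply Rabs_triang|]. rewrite !Rabs_mult.
        assert (Hc : Rabs (cos (k * x)) <= 1) by (apply Rabs_le; pose proof (COS_bound (k * x)); lra).
        assert (Rabs c * Rabs (cos (k * x)) * Rabs (/ PI * (2 * q) - 1) <= Rabs c * 1 * (4 * omega s k * b)).
        { apply Rmult_le_compat; auto using Rabs_pos; [apply Rmult_le_pos; apply Rabs_pos|].
          apply Rmult_le_compat_l; auto using Rabs_pos. }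
        lra. }
  destruct Hval as [v [Hv1 Hv2]]. rewrite (is_RInt_unique_R _ _ _ _ Hv1). exact Hv2.
Qed.

Lemma pv_sum_wball (s M : R) (f : R -> C) (x e Rr : R) : 0 < s <= 1 -> wball (omega s) M f ->
  0 < e -> e < Rr ->
  Rabs (/ PI * pv_sum (Wof f) x e Rr - ext_even f x) <= M * (4 * (Rpower e s + Rpower Rr (- (s / 3)))).
Proof.
  intros Hs Hf He HR. pose proof (omega_weight s Hs) as Hw. pose proof (omega_holder s Hs) as Hh.
  pose proof PI_RGT_0 as Hpi. pose proof PI2_3_2 as H3.
  assert (CW : forall t, continuous (Wof f) t) by (intros t; apply (Wof_continuous (omega s) s M); auto).
  apply Rle_plus_epsilon. intros eta Heta.
  (* The truncation is fixed before the approximation: an error delta in [f] changes the truncated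
     integral by at most 2 delta Rr / e and the value at x by delta, so delta = eta / K suffices. *)
  set (K := 1 + 2 * (Rr / e)).
  assert (HK : 0 < K) by (unfold K; assert (0 < Rr / e) by (apply Rdiv_lt_0_compat; lra); lra).
  destruct (Hf (Rabs x + Rr) (eta / K)) as [l [H1 [H2 H4]]]; [apply Rdiv_lt_0_compat; lra|].
  pose proof (pv_sum_ev l x e Rr s H1 He HR Hs) as Hev.
  pose proof (Wof_approx f l _ _ H4) as HW.
  assert (Cev : forall t, continuous (fun y => - snd (ev l y)) t).
  { intros t. apply (continuous_opp (K := R_AbsRing) (V := R_NormedModule) (fun y => snd (ev l y))). apply ev_Ccont. }
  assert (Cd : forall g : R -> R, (forall t, continuous g t) -> forall r, 0 < r -> continuous (fun r => (g (x - r) - g (x + r)) / r) r).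
  { intros g Hg r Hr. apply (continuous_mult (K := R_AbsRing) (fun r => g (x - r) - g (x + r)) (fun r => / r)).
    - apply (continuous_minus (K := R_AbsRing) (V := R_NormedModule) (fun r => g (x - r)) (fun r => g (x + r))).
      + apply (continuous_comp (fun r => x - r) g); auto.
        apply (ex_derive_continuous (K := R_AbsRing) (V := R_NormedModule)). auto_derive. trivial.
      + apply (continuous_comp (fun r => x + r) g); auto.
        apply (ex_derive_continuous (K := R_AbsRing) (V := R_NormedModule)). auto_derive. trivial.
    - apply (ex_derive_continuous (K := R_AbsRing) (V := R_NormedModule)). auto_derive. lra. }
  assert (Hdiff : Rabs (pv_sum (Wof f) x e Rr - pv_sum (fun y => - snd (ev l y)) x e Rr) <= 2 * (eta / K) * (Rr / e)).
  { rewrite !pv_sum_fold by auto.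
    change (Rabs (minus (RInt (fun r => (Wof f (x - r) - Wof f (x + r)) / r) e Rr)
       (RInt (fun r => (- snd (ev l (x - r)) - - snd (ev l (x + r))) / r) e Rr)) <= 2 * (eta / K) * (Rr / e)).
    rewrite <- (RInt_minus (V := R_CompleteNormedModule)).
    2: apply ex_RInt_pos; try lra; apply Cd; auto.
    2: apply ex_RInt_pos; try lra; apply (Cd (fun y => - snd (ev l y))); auto.
    assert (HeK : 0 < eta / K) by (apply Rdiv_lt_0_compat; lra).
    apply Rle_trans with ((Rr - e) * (2 * (eta / K) / e)).
    - apply abs_RInt_le_const; [lra | |].
      + apply (ex_RInt_minus (V := R_NormedModule)); apply ex_RInt_pos; try lra; [apply Cd; auto | apply (Cd (fun y => - snd (ev l y))); auto].
      + intros r Hr. unfold minus, plus, opp; simpl.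
        assert (Hxr : Rabs (x - r) <= Rabs x + Rr /\ Rabs (x + r) <= Rabs x + Rr).
        { pose proof (Rle_abs x). pose proof (Rle_abs (- x)). rewrite Rabs_Ropp in *. split; apply Rabs_le; lra. }
        pose proof (HW (x - r) (proj1 Hxr)) as W1. pose proof (HW (x + r) (proj2 Hxr)) as W2.
        replace ((Wof f (x - r) - Wof f (x + r)) / r + - ((- snd (ev l (x - r)) - - snd (ev l (x + r))) / r))
          with (((Wof f (x - r) - - snd (ev l (x - r))) - (Wof f (x + r) - - snd (ev l (x + r)))) / r) by (field; lra).
        unfold Rdiv at 1. rewrite Rabs_mult, (Rabs_pos_eq (/ r)) by (left; apply Rinv_0_lt_compat; lra).
        unfold Rdiv at 1. apply Rmult_le_compat; auto using Rabs_pos.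
        * left. apply Rinv_0_lt_compat. lra.
        * apply Rabs_le_between in W1, W2. apply Rabs_le. lra.
        * apply Rinv_le_contravar; lra.
    - replace (2 * (eta / K) * (Rr / e)) with (Rr * (2 * (eta / K) / e)) by (field; lra).
      apply Rmult_le_compat_r; [apply Rdiv_le_0_compat; lra | lra]. }
  assert (Hfst : Rabs (ext_even f x - fst (ev l x)) <= eta / K).
  { unfold ext_even. replace (fst (ev l x)) with (fst (ev l (Rabs x))).
    - eapply Rle_trans; [apply (Rabs_fst_Cmod (f (Rabs x) - ev l (Rabs x)))|]. apply H4. pose proof (Rabs_pos x). lra.
    - unfold Rabs. destruct (Rcase_abs x); [apply ev_conj | reflexivity]. }
  set (b := 4 * (Rpower e s + Rpower Rr (- (s / 3)))) in *.
  assert (Hb : 0 <= b) by (unfold b; pose proof (Rpower_pos e s); pose proof (Rpower_pos Rr (- (s / 3))); lra).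
  assert (Hcb : cost (omega s) l * b <= M * b) by (apply Rmult_le_compat_r; auto).
  assert (Hipi : 0 < / PI <= 1).
  { split; [apply Rinv_0_lt_compat; auto|]. apply Rle_trans with (/ 1); [apply Rinv_le_contravar; lra | lra]. }
  set (p := pv_sum (Wof f) x e Rr) in *. set (q := pv_sum (fun y => - snd (ev l y)) x e Rr) in *.
  assert (Hpq : Rabs (/ PI * p - / PI * q) <= 2 * (eta / K) * (Rr / e)).
  { rewrite <- Rmult_minus_distr_l, Rabs_mult, Rabs_pos_eq by lra. pose proof (Rabs_pos (p - q)). nra. }
  assert (HKeta : 2 * (eta / K) * (Rr / e) + eta / K = eta).
  { unfold K. field. split; lra. }
  apply Rabs_le_between in Hev, Hpq, Hfst. apply Rabs_le. lra.
Qed.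

Lemma hilbert_Wof (s M : R) (f : R -> C) (x : R) : 0 < s <= 1 -> wball (omega s) M f ->
  hilbert_pv (Wof f) x (ext_even f x).
Proof.
  intros Hs Hf. pose proof (omega_weight s Hs) as Hw. pose proof (omega_holder s Hs) as Hh.
  pose proof (wball_nonneg _ Hw _ _ Hf) as HM.
  split.
  - intros e Rr He HR. apply pv_sum_ex; auto. intros t. apply (Wof_continuous (omega s) s M); auto.
  - intros d Hd. set (c := d / (16 * (M + 1))).
    assert (Hc : 0 < c) by (apply Rdiv_lt_0_compat; lra).
    destruct (Rpower_small s c ltac:(lra) Hc) as [e0 [He0 He0']].
    destruct (Rpower_small (s / 3) c ltac:(lra) Hc) as [r0 [Hr0 Hr0']].
    exists e0, (/ r0). split; auto. intros e Rr He Hee HR HeR.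
    assert (H0 : 0 < / r0) by (apply Rinv_0_lt_compat; auto).
    eapply Rle_lt_trans; [apply (pv_sum_wball s M f x e Rr Hs Hf He HeR)|].
    assert (B1 : Rpower e s <= c) by (apply He0'; lra).
    assert (B2 : Rpower Rr (- (s / 3)) <= c).
    { replace (Rpower Rr (- (s / 3))) with (Rpower (/ Rr) (s / 3)).
      - apply Hr0'. split; [apply Rinv_0_lt_compat; lra|].
        rewrite <- (Rinv_inv r0). apply Rinv_le_contravar; lra.
      - unfold Rpower. rewrite ln_Rinv by lra. f_equal. ring. }
    pose proof (Rpower_pos e s). pose proof (Rpower_pos Rr (- (s / 3))).
    apply Rle_lt_trans with ((M + 1) * (4 * (c + c))).
    + apply Rmult_le_compat; lra.
    + replace ((M + 1) * (4 * (c + c))) with (d / 2) by (unfold c; field; lra). lra.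
Qed.

(** * Summing the series *)

Lemma fst_sum_n (u : nat -> C) (n : nat) : fst (sum_n u n) = sum_n (fun i => fst (u i)) n.
Proof. induction n as [|n IH]; [rewrite !sum_O; reflexivity|]. rewrite !sum_Sn, <- IH. reflexivity. Qed.

Lemma snd_sum_n (u : nat -> C) (n : nat) : snd (sum_n u n) = sum_n (fun i => snd (u i)) n.
Proof. induction n as [|n IH]; [rewrite !sum_O; reflexivity|]. rewrite !sum_Sn, <- IH. reflexivity. Qed.

Lemma is_series_tail_small (a : nat -> R) (M eta : R) : is_series a M -> 0 < eta ->
  exists N : nat, forall n, (N <= n)%nat -> Rabs (M - sum_n a n) <= eta.
Proof.
  intros H He. change (is_lim_seq (sum_n a) M) in H. apply is_lim_seq_spec in H. destruct (H (mkposreal eta He)) as [N HN].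
  exists N. intros n Hn. specialize (HN n Hn). simpl in HN.
  rewrite Rabs_minus_sym. lra.
Qed.

Lemma is_series_tail_nonneg (a : nat -> R) (M : R) (n : nat) : (forall i, 0 <= a i) -> is_series a M ->
  sum_n a n <= M.
Proof.
  intros Ha H.
  apply (is_lim_seq_incr_compare (sum_n a) M H).
  intros k. rewrite sum_Sn. change (sum_n a k <= sum_n a k + a (S k)). specialize (Ha (S k)). lra.
Qed.

Lemma is_series_0 : is_series (fun _ : nat => 0) 0.
Proof.
  apply (filterlim_ext (fun _ => 0)).
  - intros n. rewrite sum_n_const. ring.
  - apply filterlim_const.
Qed.

Lemma series_C (u : nat -> C) (a : nat -> R) (M : R) :
  (forall n, Cmod (u n) <= a n) -> is_series a M ->
  is_series (fun n => fst (u n)) (Series (fun n => fst (u n))) /\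
  is_series (fun n => snd (u n)) (Series (fun n => snd (u n))) /\
  forall n, Cmod ((Series (fun n => fst (u n)), Series (fun n => snd (u n))) - sum_n u n) <= M - sum_n a n.
Proof.
  intros Hu Ha.
  assert (S1 : is_series (fun n => fst (u n)) (Series (fun n => fst (u n)))).
  { apply Series_correct. apply (ex_series_le (K := R_AbsRing) (V := R_CompleteNormedModule) _ a); [|exists M; auto].
    intros n. eapply Rle_trans; [apply Rabs_fst_Cmod | apply Hu]. }
  assert (S2 : is_series (fun n => snd (u n)) (Series (fun n => snd (u n)))).
  { apply Series_correct. apply (ex_series_le (K := R_AbsRing) (V := R_CompleteNormedModule) _ a); [|exists M; auto].
    intros n. eapply Rle_trans; [apply Rabs_snd_Cmod | apply Hu]. }
  split; auto. split; auto. intros n. apply Rle_plus_epsilon. intros eta He.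
  destruct (is_series_tail_small _ _ (eta / 2) S1 ltac:(lra)) as [N1 H1].
  destruct (is_series_tail_small _ _ (eta / 2) S2 ltac:(lra)) as [N2 H2].
  set (N := (N1 + N2)%nat).
  set (F := (Series (fun n => fst (u n)), Series (fun n => snd (u n)))) in *.
  eapply Rle_trans; [apply (Cmod_dist_triangle F (sum_n u (n + N)))|].
  assert (B1 : Cmod (F - sum_n u (n + N)) <= eta).
  { eapply Rle_trans; [apply Cmod_le_sum|].
    change (fst (F - sum_n u (n + N))%C) with (fst F - fst (sum_n u (n + N))).
    change (snd (F - sum_n u (n + N))%C) with (snd F - snd (sum_n u (n + N))).
    rewrite fst_sum_n, snd_sum_n. unfold F. cbn [fst snd].
    specialize (H1 (n + N)%nat ltac:(lia)). specialize (H2 (n + N)%nat ltac:(lia)). lra. }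
  assert (B2 : forall j, Cmod (sum_n u (n + j) - sum_n u n) <= sum_n a (n + j) - sum_n a n).
  { induction j as [|j IH].
    - rewrite Nat.add_0_r. replace (sum_n u n - sum_n u n)%C with (RtoC 0) by ring. rewrite Cmod_0. lra.
    - rewrite Nat.add_succ_r, !sum_Sn.
      change (Cmod (sum_n u (n + j) + u (S (n + j)) - sum_n u n)%C <= sum_n a (n + j) + a (S (n + j)) - sum_n a n).
      replace (sum_n u (n + j) + u (S (n + j)) - sum_n u n)%C
        with ((sum_n u (n + j) - sum_n u n) + u (S (n + j)))%C by ring.
      eapply Rle_trans; [apply Cmod_triangle|]. specialize (Hu (S (n + j))). lra. }
  specialize (B2 N).
  assert (sum_n a (n + N) <= M).
  { apply is_series_tail_nonneg; auto. intros i. eapply Rle_trans; [apply Cmod_ge_0 | apply Hu]. }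
  lra.
Qed.

(** The sum of c n f n, taken componentwise. General coefficients are allowed: powers give the
    solution, while Taylor coefficients and Taylor remainders of powers give its expansion in the
    parameter. *)
Definition comb (c : nat -> R) (f : nat -> R -> C) (x : R) : C :=
  (Series (fun n => fst (RtoC (c n) * f n x)%C), Series (fun n => snd (RtoC (c n) * f n x)%C)).

Section Comb.
Variables (w : R -> R) (c m : nat -> R) (f : nat -> R -> C) (M : R).
Hypothesis Hw : weight w.
Hypothesis Hf : forall n, wball w (m n) (f n).
Hypothesis HM : is_series (fun n => Rabs (c n) * m n) M.

Lemma comb_spec (x : R) : 0 <= x ->
  is_series (fun n => fst (RtoC (c n) * f n x)%C) (fst (comb c f x)) /\
  is_series (fun n => snd (RtoC (c n) * f n x)%C) (snd (comb c f x)) /\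
  forall n, Cmod (comb c f x - sum_n (fun n => RtoC (c n) * f n x)%C n)
    <= M - sum_n (fun n => Rabs (c n) * m n) n.
Proof.
  intros Hx. apply series_C; auto. intros n. rewrite Cmod_mult, Cmod_R.
  apply Rmult_le_compat_l; [apply Rabs_pos | apply (wball_bound w Hw _ _ (Hf n)); auto].
Qed.

Lemma comb_wball : wball w M (comb c f).
Proof.
  apply (wball_series w Hw (fun n => Rabs (c n) * m n) M (fun n x => RtoC (c n) * f n x)%C); auto.
  - intros n. apply wball_scal; auto.
  - intros x n Hx. apply comb_spec; auto.
Qed.

Lemma comb_part_wball (n : nat) :
  wball w (sum_n (fun n => Rabs (c n) * m n) n) (fun x => sum_n (fun i => RtoC (c i) * f i x)%C n).
Proof. apply (wball_sum w (fun n => Rabs (c n) * m n) (fun n x => RtoC (c n) * f n x)%C). intros i _. apply wball_scal; auto. Qed.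

Lemma comb_tail_small (eta : R) : 0 < eta -> exists N : nat, forall n x, (N <= n)%nat -> 0 <= x ->
  Cmod (comb c f x - sum_n (fun n => RtoC (c n) * f n x)%C n) <= eta.
Proof.
  intros He. destruct (is_series_tail_small _ _ eta HM He) as [N HN]. exists N. intros n x Hn Hx.
  eapply Rle_trans; [apply comb_spec; auto|]. specialize (HN n Hn). apply Rabs_le_between in HN. lra.
Qed.

Lemma comb_ball_avg (s x : R) : holder_weight w s -> 0 < x ->
  is_series (fun n => c n * ball_avg (f n) x) (ball_avg (comb c f) x).
Proof.
  intros Hs Hx.
  assert (Hex : forall g M, wball w M g -> ex_RInt (fun t => fst (g t)) 0 x).
  { intros g K Hg. apply (ex_RInt_fst_wball w s K); auto. lra. }
  assert (Hsum : forall n, ball_avg (fun x => sum_n (fun i => RtoC (c i) * f i x)%C n) x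
                           = sum_n (fun n => c n * ball_avg (f n) x) n).
  { induction n as [|n IH].
    - rewrite sum_O. unfold ball_avg.
      rewrite (RInt_ext _ (fun t => scal (c 0%nat) (fst (f 0%nat t)))).
      + rewrite (RInt_scal (V := R_CompleteNormedModule)) by (apply (Hex (f 0%nat) (m 0%nat)); auto).
        unfold scal; simpl; unfold mult; simpl. ring.
      + intros t _. rewrite sum_O, RtoC_mult_pair. reflexivity.
    - rewrite sum_Sn, <- IH. unfold ball_avg.
      rewrite (RInt_ext _ (fun t => plus (fst (sum_n (fun i => RtoC (c i) * f i t)%C n)) (scal (c (S n)) (fst (f (S n) t))))).
      + rewrite (RInt_plus (V := R_CompleteNormedModule)), (RInt_scal (V := R_CompleteNormedModule)).
        * unfold plus, scal; simpl; unfold mult; simpl. ring.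
        * apply (Hex (f (S n)) (m (S n))); auto.
        * apply (Hex _ _ (comb_part_wball n)).
        * apply (ex_RInt_scal (V := R_NormedModule)). apply (Hex (f (S n)) (m (S n))); auto.
      + intros t _. rewrite sum_Sn, RtoC_mult_pair. reflexivity. }
  change (is_lim_seq (sum_n (fun n => c n * ball_avg (f n) x)) (ball_avg (comb c f) x)).
  apply is_lim_seq_spec. intros [eta He]. simpl.
  destruct (comb_tail_small (eta / 2) ltac:(lra)) as [N HN]. exists N. intros n Hn.
  rewrite <- Hsum. unfold ball_avg. rewrite <- Rmult_minus_distr_l.
  rewrite Rabs_mult, Rabs_pos_eq by (left; apply Rinv_0_lt_compat; auto).
  pose proof (Hex _ _ (comb_part_wball n)) as X1. pose proof (Hex _ _ comb_wball) as X2.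
  apply Rle_lt_trans with (/ x * ((x - 0) * (eta / 2))).
  - apply Rmult_le_compat_l; [left; apply Rinv_0_lt_compat; auto|].
    match goal with |- Rabs (?p - ?q) <= _ => change (Rabs (minus p q) <= (x - 0) * (eta / 2)) end.
    rewrite <- (RInt_minus (V := R_CompleteNormedModule) _ _ 0 x X1 X2).
    apply abs_RInt_le_const; [lra | apply (ex_RInt_minus (V := R_NormedModule)); auto |].
    intros t Ht. rewrite Rabs_minus_sym.
    eapply Rle_trans; [apply (Rabs_fst_Cmod (comb c f t - sum_n (fun i => RtoC (c i) * f i t)%C n))|].
    apply HN; [auto | lra].
  - replace (/ x * ((x - 0) * (eta / 2))) with (eta / 2) by (field; lra). lra.
Qed.

Lemma comb_abs_series (x : R) : 0 <= x ->
  ex_series (fun n => Rabs (fst (RtoC (c n) * f n x)%C)) /\ ex_series (fun n => Rabs (snd (RtoC (c n) * f n x)%C)).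
Proof.
  intros Hx.
  assert (H : forall n, Cmod (RtoC (c n) * f n x)%C <= Rabs (c n) * m n).
  { intros n. rewrite Cmod_mult, Cmod_R.
    apply Rmult_le_compat_l; [apply Rabs_pos | apply (wball_bound w Hw _ _ (Hf n)); auto]. }
  split; apply (ex_series_le (K := R_AbsRing) (V := R_CompleteNormedModule) _ (fun n => Rabs (c n) * m n)); try (exists M; auto);
    intros n; change (norm ?z) with (Rabs z); rewrite Rabs_Rabsolu; (eapply Rle_trans; [|apply H]);
    [apply Rabs_fst_Cmod | apply Rabs_snd_Cmod].
Qed.
End Comb.

(** The partial sums of both series converge uniformly on the half line, so [scder_limit]
    applies. *)
Lemma comb_scder (w : R -> R) (s be : R) (c m : nat -> R) (f e : nat -> R -> C) (M : R) :
  weight w -> holder_weight w s ->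
  (forall n, wball w (m n) (f n)) -> (forall n, wball w (m n) (e n)) ->
  is_series (fun n => Rabs (c n) * m n) M ->
  (forall n, scder be (f n) (e n)) -> scder be (comb c f) (comb c e).
Proof.
  intros Hw Hs Hf He HM Hd. apply scder_limit.
  - intros x Hx. apply (wball_Ccont w s M); auto. apply (comb_wball w c m e M); auto.
  - intros x1 x2 eta Hx Heta.
    destruct (comb_tail_small w c m f M Hw Hf HM eta Heta) as [N1 H1].
    destruct (comb_tail_small w c m e M Hw He HM eta Heta) as [N2 H2].
    set (N := (N1 + N2)%nat).
    exists (fun x => sum_n (fun i => RtoC (c i) * f i x)%C N), (fun x => sum_n (fun i => RtoC (c i) * e i x)%C N).
    split.
    + induction N as [|N IH].
      * apply (scder_ext be (fun x => RtoC (c 0%nat) * f 0%nat x)%C _ (fun x => RtoC (c 0%nat) * e 0%nat x)%C).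
        -- intros x _. rewrite sum_O. reflexivity.
        -- intros x _. rewrite sum_O. reflexivity.
        -- apply scder_scal. auto.
      * apply (scder_ext be (fun x => sum_n (fun i => RtoC (c i) * f i x)%C N + RtoC (c (S N)) * f (S N) x)%C _
                            (fun x => sum_n (fun i => RtoC (c i) * e i x)%C N + RtoC (c (S N)) * e (S N) x)%C).
        -- intros x _. rewrite sum_Sn. reflexivity.
        -- intros x _. rewrite sum_Sn. reflexivity.
        -- apply scder_plus; [exact IH | apply scder_scal; auto].
    + intros x Hx'. split; [apply H1 | apply H2]; try lra; unfold N; lia.
Qed.

(** Cauchy products of absolutely convergent series: the coefficients of the resulting power series
    in [ep] are those of [profile_eq], and each of them vanishes. *)
Lemma comb_profile_eq (s ep M : R) (m : nat -> R) (f e : nat -> R -> C) :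
  0 < s <= 1 -> (forall n, wball (omega s) (m n) (f n)) -> (forall n, wball (omega s) (m n) (e n)) ->
  is_series (fun n => Rabs (ep ^ n) * m n) M ->
  (forall n x, 0 < x -> profile_eq f e n x) ->
  let F := comb (pow ep) f in let E := comb (pow ep) e in
  forall x, 0 < x -> snd (F x) + snd (E x) - fst (F x) * snd (F x) + ep * (ball_avg F x * snd (E x)) = 0.
Proof.
  intros Hs Hf He HM Hp F E x Hx.
  pose proof (omega_weight s Hs) as Hw. pose proof (omega_holder s Hs) as Hh.
  destruct (comb_spec (omega s) (pow ep) m f M Hw Hf HM x ltac:(lra)) as [F1 [F2 _]].
  destruct (comb_spec (omega s) (pow ep) m e M Hw He HM x ltac:(lra)) as [_ [E2 _]].
  destruct (comb_abs_series (omega s) (pow ep) m f M Hw Hf HM x ltac:(lra)) as [AF1 AF2].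
  destruct (comb_abs_series (omega s) (pow ep) m e M Hw He HM x ltac:(lra)) as [_ AE2].
  pose proof (comb_ball_avg (omega s) (pow ep) m f M Hw Hf HM s x Hh Hx) as B.
  assert (AB : ex_series (fun n => Rabs (ep ^ n * ball_avg (f n) x))).
  { apply (ex_series_le (K := R_AbsRing) (V := R_CompleteNormedModule) _ (fun n => Rabs (ep ^ n) * m n)); [|exists M; auto].
    intros n. change (norm ?z) with (Rabs z). rewrite Rabs_Rabsolu, Rabs_mult.
    apply Rmult_le_compat_l; [apply Rabs_pos | apply (ball_avg_bound (omega s) s); auto]. }
  fold F E in F1, F2, E2, B.
  pose proof (is_series_mult _ _ _ _ F1 F2 AF1 AF2) as P1.
  pose proof (is_series_mult _ _ _ _ F2 F1 AF2 AF1) as P2.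
  pose proof (is_series_mult _ _ _ _ B E2 AB AE2) as P3.
  apply (is_series_scal (K := R_AbsRing) (V := R_NormedModule) ep) in P3.
  (* The factor [ep] shifts the advection series by one order; the coefficient of order 0 becomes
     0. *)
  assert (P3' : is_series (fun n => match n with O => 0 | S k =>
       ep * sum_f_R0 (fun i => ep ^ i * ball_avg (f i) x * snd (RtoC (ep ^ (k - i)) * e (k - i)%nat x)%C) k end)
     (ep * (ball_avg F x * snd (E x)))).
  { apply (is_series_decr_1 (K := R_AbsRing) (V := R_NormedModule)).
    match goal with |- is_series _ ?l => replace l with (scal ep (ball_avg F x * snd (E x)))
      by (unfold plus, opp, scal; simpl; unfold mult; simpl; ring) end.
    exact P3. }
  pose proof (is_series_plus _ _ _ _ P1 P2) as P12.
  apply (is_series_scal (K := R_AbsRing) (V := R_NormedModule) (- / 2)) in P12.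
  pose proof (is_series_plus _ _ _ _ (is_series_plus _ _ _ _ F2 E2) (is_series_plus _ _ _ _ P12 P3')) as H.
  apply (is_series_ext _ (fun _ => 0)) in H.
  - apply is_series_unique in H. rewrite (is_series_unique _ _ is_series_0) in H.
    change (0 = snd (F x) + snd (E x) + (- / 2 * (fst (F x) * snd (F x) + snd (F x) * fst (F x))
      + ep * (ball_avg F x * snd (E x)))) in H. lra.
  - intros n. symmetry. specialize (Hp n x Hx). unfold profile_eq in Hp.
    apply (f_equal (fun z => ep ^ n * z)) in Hp. rewrite Rmult_0_r in Hp. refine (eq_trans (eq_sym Hp) _).
    match goal with |- _ = plus (plus ?a ?b) (plus (scal ?c (plus ?p ?q)) ?r) =>
      change (plus (plus a b) (plus (scal c (plus p q)) r)) with (a + b + (c * (p + q) + r)) end.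
    cbv beta. rewrite !sum_f_R0_rsum.
    rewrite !Rmult_plus_distr_l.
    assert (Hpow : forall i, (i < S n)%nat -> ep ^ i * ep ^ (n - i) = ep ^ n).
    { intros i Hi. rewrite <- pow_add. f_equal. lia. }
    rewrite (rsum_ext (fun k => fst (RtoC (ep ^ k) * f k x)%C * snd (RtoC (ep ^ (n - k)) * f (n - k)%nat x)%C)
       (fun i => ep ^ n * (fst (f i x) * snd (f (n - i)%nat x))) (S n)).
    2: { intros i Hi. rewrite !RtoC_mult_pair. cbn [fst snd]. rewrite <- (Hpow i Hi). ring. }
    rewrite (rsum_ext (fun k => snd (RtoC (ep ^ k) * f k x)%C * fst (RtoC (ep ^ (n - k)) * f (n - k)%nat x)%C)
       (fun i => ep ^ n * (snd (f i x) * fst (f (n - i)%nat x))) (S n)).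
    2: { intros i Hi. rewrite !RtoC_mult_pair. cbn [fst snd]. rewrite <- (Hpow i Hi). ring. }
    rewrite !rsum_scal, !RtoC_mult_pair. cbn [fst snd].
    real_eq. destruct n as [|k]; [cbv iota beta; ring|].
    rewrite sum_f_R0_rsum.
    rewrite (rsum_ext (fun i => ep ^ i * ball_avg (f i) x * snd (RtoC (ep ^ (k - i)) * e (k - i)%nat x)%C)
       (fun i => ep ^ k * (ball_avg (f i) x * snd (e (k - i)%nat x))) (S k)).
    2: { intros i Hi. rewrite !RtoC_mult_pair. cbn [fst snd].
         replace (ep ^ k) with (ep ^ i * ep ^ (k - i)) by (rewrite <- pow_add; f_equal; lia). ring. }
    rewrite rsum_scal. rewrite <- (tech_pow_Rmult ep k). ring.
Qed.

(** * The weak formulation *)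

Definition jcont (g : R -> R -> R) (t x : R) : Prop := continuous (fun p : R * R => g (fst p) (snd p)) (t, x).

Lemma jcont_slice_2 (g : R -> R -> R) (t x : R) : jcont g t x -> continuous (g t) x.
Proof.
  intros H. apply (continuous_comp_2 (fun _ : R => t) (fun x : R => x) g x).
  - apply continuous_const.
  - apply continuous_id.
  - exact H.
Qed.

Lemma jcont_slice_1 (g : R -> R -> R) (t x : R) : jcont g t x -> continuous (fun s => g s x) t.
Proof.
  intros H. apply (continuous_comp_2 (fun s : R => s) (fun _ : R => x) g t).
  - apply continuous_id.
  - apply continuous_const.
  - exact H.
Qed.

Lemma jcont_mult (f g : R -> R -> R) (t x : R) : jcont f t x -> jcont g t x -> jcont (fun t x => f t x * g t x) t x.
Proof. intros Hf Hg. exact (continuous_mult (K := R_AbsRing) (fun p : R * R => f (fst p) (snd p)) (fun p => g (fst p) (snd p)) (t, x) Hf Hg). Qed.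

Lemma jcont_plus (f g : R -> R -> R) (t x : R) : jcont f t x -> jcont g t x -> jcont (fun t x => f t x + g t x) t x.
Proof. intros Hf Hg. exact (continuous_plus (V := R_NormedModule) (fun p : R * R => f (fst p) (snd p)) (fun p => g (fst p) (snd p)) (t, x) Hf Hg). Qed.

Lemma jcont_2d (g : R -> R -> R) (t x : R) : jcont g t x -> continuity_2d_pt g t x.
Proof. intros H. apply continuity_2d_pt_filterlim. exact H. Qed.

Lemma continuity_2d_pt_swap (g : R -> R -> R) (t x : R) :
  continuity_2d_pt g t x -> continuity_2d_pt (fun x t => g t x) x t.
Proof.
  intros H eps. destruct (H eps) as [d Hd]. exists d. intros u v Hu Hv. apply Hd; auto.
Qed.

Lemma continuous_RInt_param (g : R -> R -> R) (a b t : R) : a <= b ->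
  (forall x, a <= x <= b -> jcont g t x) ->
  locally t (fun s => ex_RInt (g s) a b) ->
  continuous (fun s => RInt (g s) a b) t.
Proof.
  intros Hab Hc [d0 Hex].
  apply continuity_pt_filterlim. intros eta He.
  assert (Hd : 0 < eta / (2 * (b - a + 1))) by (apply Rdiv_lt_0_compat; lra).
  destruct (uniform_continuity_2d_1d (fun x t => g t x) a b t
    (fun x Hx => continuity_2d_pt_swap g t x (jcont_2d g t x (Hc x Hx))) (mkposreal _ Hd)) as [d1 H1].
  simpl in H1.
  exists (Rmin d0 d1). split; [apply Rmin_case; apply cond_pos|].
  intros s [_ Hs]. simpl in *. unfold R_dist in *.
  assert (Hs0 : Rabs (s - t) < d0) by (eapply Rlt_le_trans; [exact Hs | apply Rmin_l]).
  assert (Hs1 : Rabs (s - t) < d1) by (eapply Rlt_le_trans; [exact Hs | apply Rmin_r]).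
  assert (X1 : ex_RInt (g s) a b) by (apply Hex; exact Hs0).
  assert (X2 : ex_RInt (g t) a b) by (apply Hex, ball_center).
  match goal with |- Rabs (?p - ?q) < _ => change (Rabs (minus p q) < eta) end.
  rewrite <- (RInt_minus (V := R_CompleteNormedModule) _ _ a b X1 X2).
  apply Rle_lt_trans with ((b - a) * (eta / (2 * (b - a + 1)))).
  - apply abs_RInt_le_const; auto; [apply (ex_RInt_minus (V := R_NormedModule)); auto|].
    intros x Hx. left. apply Rabs_def2 in Hs1.
    apply (H1 x t x s); auto; try (pose proof (cond_pos d1); lra).
    rewrite Rminus_diag, Rabs_R0. apply cond_pos.
  - apply Rle_lt_trans with ((b - a + 1) * (eta / (2 * (b - a + 1)))).
    + apply Rmult_le_compat_r; lra.
    + replace ((b - a + 1) * (eta / (2 * (b - a + 1)))) with (eta / 2) by (field; lra). lra.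
Qed.

(** A test function is given to vanish strictly outside its box; continuity extends this to the
    boundary, where the integrations by parts evaluate it. *)
Lemma vanish_right (g : R -> R) (x0 : R) : continuous g x0 -> (forall x, x0 < x -> g x = 0) -> g x0 = 0.
Proof.
  intros Hc Hz. apply cond_eq. intros e He. rewrite Rminus_0_r.
  apply continuity_pt_filterlim in Hc. destruct (Hc e He) as [d [Hd Hd']].
  specialize (Hd' (x0 + d / 2)). simpl in Hd'. unfold R_dist in Hd'.
  rewrite (Hz (x0 + d / 2)), Rminus_0_l, Rabs_Ropp in Hd' by lra. apply Hd'. split.
  - split; [exact I | lra].
  - replace (x0 + d / 2 - x0) with (d / 2) by ring. rewrite Rabs_pos_eq; lra.
Qed.

Lemma vanish_left (g : R -> R) (x0 : R) : continuous g x0 -> (forall x, x < x0 -> g x = 0) -> g x0 = 0.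
Proof.
  intros Hc Hz. rewrite <- (Ropp_involutive x0). apply (vanish_right (fun x => g (- x)) (- x0)).
  - apply (continuous_comp (fun x => - x) g).
    + apply (ex_derive_continuous (K := R_AbsRing) (V := R_NormedModule)). auto_derive. trivial.
    + rewrite Ropp_involutive. exact Hc.
  - intros x Hx. apply Hz. lra.
Qed.

(** With [q] as flux, the integrand is the sum of the t-derivative of w phi and the x-derivative of
    q phi. The former is moved out of the x-integral and integrated in t, the latter is integrated
    in x at fixed t; the boundary terms contain phi. *)
Lemma weak_form (w wt q qx phi phit phix : R -> R -> R) (T0 T1 X : R) :
  (forall t x, t < 1 -> is_derive (fun s => w s x) t (wt t x)) ->
  (forall t x, t < 1 -> is_derive (q t) x (qx t x)) ->
  (forall t x, t < 1 -> jcont w t x /\ jcont wt t x /\ continuous (qx t) x) ->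
  T1 < 1 ->
  (forall t x, (t < T0 \/ T1 < t \/ X < Rabs x) -> phi t x = 0) ->
  (forall t x, is_derive (fun s => phi s x) t (phit t x)) ->
  (forall t x, is_derive (fun y => phi t y) x (phix t x)) ->
  (forall t x, jcont phi t x /\ jcont phit t x /\ jcont phix t x) ->
  RInt (fun t => RInt (fun x =>
    w t x * phit t x + q t x * phix t x + (wt t x + qx t x) * phi t x) (- X) X) T0 T1 = 0.
Proof.
  intros Dw Dq Hc HT Hz Dt Dx Cp.
  (* If the box is empty, phi vanishes identically with its derivatives; the main argument uses T0
     <= T1 and 0 <= X. *)
  destruct (classic (T0 <= T1 /\ 0 <= X)) as [[HT0 HX]|Hdeg].
  2: { assert (Z : forall t x, phi t x = 0).
       { intros t x. apply Hz. destruct (Rle_dec T0 T1) as [A|A]; [|lra].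
         right; right. pose proof (Rabs_pos x). destruct (Rle_dec 0 X); [tauto | lra]. }
       assert (Zt : forall t x, phit t x = 0).
       { intros t x. rewrite <- (is_derive_unique _ _ _ (Dt t x)).
         rewrite (Derive_ext _ (fun _ => 0)) by (intros; apply Z). apply Derive_const. }
       assert (Zx : forall t x, phix t x = 0).
       { intros t x. rewrite <- (is_derive_unique _ _ _ (Dx t x)).
         rewrite (Derive_ext _ (fun _ => 0)) by (intros; apply Z). apply Derive_const. }
       rewrite (RInt_ext _ (fun _ => 0)).
       - rewrite (RInt_const (V := R_CompleteNormedModule)). unfold scal; simpl; unfold mult; simpl. ring.
       - intros t _. rewrite (RInt_ext _ (fun _ => 0)).
         + rewrite (RInt_const (V := R_CompleteNormedModule)). unfold scal; simpl; unfold mult; simpl. ring.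
         + intros x _. rewrite Z, Zt, Zx. real_eq. ring. }
  assert (BX : forall t, phi t X = 0 /\ phi t (- X) = 0).
  { intros t. split.
    - apply (vanish_right (phi t) X); [exact (jcont_slice_2 phi t _ (proj1 (Cp t _)))|].
      intros x Hx. apply Hz. right; right. rewrite Rabs_pos_eq; lra.
    - apply (vanish_left (phi t) (- X)); [exact (jcont_slice_2 phi t _ (proj1 (Cp t _)))|].
      intros x Hx. apply Hz. right; right. rewrite Rabs_left; lra. }
  assert (BT : forall x, phi T0 x = 0 /\ phi T1 x = 0).
  { intros x. split.
    - apply (vanish_left (fun s => phi s x) T0); [exact (jcont_slice_1 phi _ x (proj1 (Cp _ x)))|]. intros s Hs. apply Hz. auto.
    - apply (vanish_right (fun s => phi s x) T1); [exact (jcont_slice_1 phi _ x (proj1 (Cp _ x)))|]. intros s Hs. apply Hz. auto. }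
  set (d := fun t x => wt t x * phi t x + w t x * phit t x).
  set (dq := fun t x => qx t x * phi t x + q t x * phix t x).
  assert (Hd : forall t x, t < 1 -> jcont d t x).
  { intros t x Ht. destruct (Hc t x Ht) as [C1 [C2 _]]. destruct (Cp t x) as [C4 [C5 C6]].
    apply jcont_plus; apply jcont_mult; auto. }
  assert (Hdq : forall t x, t < 1 -> continuous (dq t) x).
  { intros t x Ht. destruct (Hc t x Ht) as [C1 [C2 C3]]. destruct (Cp t x) as [C4 [C5 C6]].
    apply (continuous_plus (V := R_NormedModule) (fun x => qx t x * phi t x) (fun x => q t x * phix t x)).
    - apply (continuous_mult (K := R_AbsRing) (qx t) (phi t)); auto. apply jcont_slice_2; auto.
    - apply (continuous_mult (K := R_AbsRing) (q t) (phix t)).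
      + apply (ex_derive_continuous (K := R_AbsRing) (V := R_NormedModule)). eexists. apply Dq; auto.
      + apply jcont_slice_2; auto. }
  assert (Hexd : forall t, t < 1 -> ex_RInt (d t) (- X) X).
  { intros t Ht. apply (ex_RInt_continuous (V := R_CompleteNormedModule)). intros x _. apply jcont_slice_2, Hd; auto. }
  assert (Hdder : forall t x, t < 1 -> is_derive (fun s => w s x * phi s x) t (d t x)).
  { intros t x Ht. apply (is_derive_mult (K := R_AbsRing) (fun s => w s x) (fun s => phi s x)); auto.
    intros n m. apply Rmult_comm. }
  assert (Hloc : forall t, t < 1 -> locally t (fun s => s < 1)).
  { intros t Ht. apply (open_lt 1). exact Ht. }
  set (J := fun t => RInt (fun x => w t x * phi t x) (- X) X).
  assert (HJ : forall t, t < 1 -> is_derive J t (RInt (d t) (- X) X)).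
  { intros t Ht.
    rewrite (RInt_ext (d t) (fun x => Derive (fun s => w s x * phi s x) t))
      by (intros x _; symmetry; apply is_derive_unique, Hdder; auto).
    apply (is_derive_RInt_param (fun s x => w s x * phi s x) (- X) X t).
    - apply (filter_imp (fun s => s < 1)); [|apply Hloc; auto].
      intros s Hs x _. eexists. apply Hdder; auto.
    - intros x _. apply (continuity_2d_pt_ext_loc d).
      + destruct (Hloc t Ht) as [r Hr]. exists r. intros s y Hs _. symmetry. apply is_derive_unique, Hdder.
        apply Hr. exact Hs.
      + apply jcont_2d, Hd; auto.
    - apply (filter_imp (fun s => s < 1)); [|apply Hloc; auto].
      intros s Hs. apply (ex_RInt_continuous (V := R_CompleteNormedModule)). intros x _.
      apply (jcont_slice_2 (fun s x => w s x * phi s x)). apply jcont_mult; [exact (proj1 (Hc s x Hs)) | exact (proj1 (Cp s x))]. }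
  rewrite (RInt_ext _ (fun t => RInt (d t) (- X) X)).
  - rewrite (is_RInt_unique_R (fun t => RInt (d t) (- X) X) T0 T1 (minus (J T1) (J T0))).
    + assert (J0 : forall t, (forall x, phi t x = 0) -> J t = 0).
      { intros t H0. unfold J. rewrite (RInt_ext _ (fun _ => 0)).
        - rewrite (RInt_const (V := R_CompleteNormedModule)). unfold scal; simpl; unfold mult; simpl. ring.
        - intros x _. rewrite H0. real_eq. ring. }
      rewrite !J0; [change (0 - 0 = 0); ring | intros x; apply BT | intros x; apply BT].
    + apply (is_RInt_derive (V := R_CompleteNormedModule) J).
      * intros t. rewrite Rmin_left, Rmax_right by lra. intros Ht. apply HJ. lra.
      * intros t. rewrite Rmin_left, Rmax_right by lra. intros Ht.
        apply continuous_RInt_param; [lra | intros x _; apply Hd; lra |].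
        apply (filter_imp (fun s => s < 1)); [auto | apply Hloc; lra].
  - intros t. rewrite Rmin_left, Rmax_right by lra. intros Ht.
    assert (Ht1 : t < 1) by lra.
    assert (E : RInt (dq t) (- X) X = 0).
    { apply is_RInt_unique_R.
      replace 0 with (minus (q t X * phi t X) (q t (- X) * phi t (- X)))
        by (rewrite !(proj1 (BX t)), !(proj2 (BX t)); unfold minus, plus, opp; simpl; ring).
      apply (is_RInt_derive (V := R_CompleteNormedModule) (fun x => q t x * phi t x)).
      - intros x _. apply (is_derive_mult (K := R_AbsRing) (q t) (phi t)); auto. intros n m. apply Rmult_comm.
      - intros x _. apply Hdq; auto. }
    rewrite (RInt_ext _ (fun x => plus (d t x) (dq t x))).
    + rewrite (RInt_plus (V := R_CompleteNormedModule)).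
      * rewrite E. apply Rplus_0_r.
      * apply Hexd; auto.
      * apply (ex_RInt_continuous (V := R_CompleteNormedModule)). intros x _. apply Hdq; auto.
    + intros x _. unfold d, dq, plus; simpl. real_eq. ring.
Qed.

(** The substitution y -> k y turns the truncation parameters e and Rr into k e and k Rr and
    preserves the kernel dy / (x - y). *)
Lemma hilbert_pv_scale (f : R -> R) (c k x v : R) : 0 < k -> hilbert_pv f (k * x) v ->
  hilbert_pv (fun y => c * f (k * y)) x (c * v).
Proof.
  intros Hk [H1 H2].
  assert (L : forall a b, (x < a /\ x < b) \/ (a < x /\ b < x) ->
     ex_RInt (fun y => f y / (k * x - y)) (k * a) (k * b) ->
     is_RInt (fun y => c * f (k * y) / (x - y)) a b (c * RInt (fun y => f y / (k * x - y)) (k * a) (k * b))).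
  { intros a b Hab Hex.
    replace (k * a) with (k * a + 0) in * by ring. replace (k * b) with (k * b + 0) in * by ring.
    pose proof (is_RInt_comp_lin _ k 0 a b _ (RInt_correct (V := R_CompleteNormedModule) _ _ _ Hex)) as H.
    apply (is_RInt_scal (V := R_NormedModule) _ _ _ c) in H.
    apply (is_RInt_ext (V := R_NormedModule) (fun y => scal c (scal k (f (k * y + 0) / (k * x - (k * y + 0)))))); [|exact H].
    intros y Hy. unfold scal; simpl; unfold mult; simpl. rewrite Rplus_0_r. field.
    assert (x <> y) by (unfold Rmin, Rmax in Hy; destruct (Rle_dec a b); lra).
    replace (k * x - k * y) with (k * (x - y)) by ring.
    split; [lra | apply Rmult_integral_contrapositive_currified; lra]. }
  assert (M : forall e Rr, 0 < e -> e < Rr ->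
     is_RInt (fun y => c * f (k * y) / (x - y)) (x - Rr) (x - e)
       (c * RInt (fun y => f y / (k * x - y)) (k * x - k * Rr) (k * x - k * e)) /\
     is_RInt (fun y => c * f (k * y) / (x - y)) (x + e) (x + Rr)
       (c * RInt (fun y => f y / (k * x - y)) (k * x + k * e) (k * x + k * Rr))).
  { intros e Rr He HR. destruct (H1 (k * e) (k * Rr)) as [A B]; [nra | nra |].
    rewrite <- !Rmult_minus_distr_l, <- !Rmult_plus_distr_l in *. split; apply L; auto; lra. }
  split.
  - intros e Rr He HR. destruct (M e Rr He HR) as [A B]. split; eexists; eauto.
  - intros d Hd. destruct (H2 (d / (Rabs c + 1))) as [e0 [R0 [He0 Hpv]]].
    { apply Rdiv_lt_0_compat; auto. pose proof (Rabs_pos c). lra. }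
    exists (e0 / k), (R0 / k). split; [apply Rdiv_lt_0_compat; auto|].
    intros e Rr He Hee HR HeR. destruct (M e Rr He HeR) as [A B].
    rewrite (is_RInt_unique_R _ _ _ _ A), (is_RInt_unique_R _ _ _ _ B).
    assert (Q1 : k * e < e0) by (rewrite <- Rlt_div_r in Hee by lra; lra).
    assert (Q2 : R0 < k * Rr) by (rewrite Rlt_div_l in HR by lra; lra).
    specialize (Hpv (k * e) (k * Rr) ltac:(nra) Q1 Q2 ltac:(nra)).
    match goal with |- Rabs (/ PI * (c * ?p + c * ?q) - c * v) < d =>
      replace (/ PI * (c * p + c * q) - c * v) with (c * (/ PI * (p + q) - v)) by ring end.
    rewrite Rabs_mult. pose proof (Rabs_pos c).
    apply Rle_lt_trans with (Rabs c * (d / (Rabs c + 1))).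
    + apply Rmult_le_compat_l; lra.
    + apply Rlt_le_trans with ((Rabs c + 1) * (d / (Rabs c + 1))).
      * apply Rmult_lt_compat_r; [apply Rdiv_lt_0_compat; lra | lra].
      * right. field. lra.
Qed.

(** * From the profile equation to the self-similar solution *)

Section SelfSimilar.
Variables (s be a M : R) (F E : R -> C).
Hypothesis Hs : 0 < s <= 1.
Hypothesis Hbe : 0 < be.
Hypothesis HF : wball (omega s) M F.
Hypothesis HE : wball (omega s) M E.
Hypothesis HFE : scder be F E.
Hypothesis Heq : forall x, 0 < x ->
  snd (F x) + snd (E x) - fst (F x) * snd (F x) + a * be * (ball_avg F x * snd (E x)) = 0.

Let W := Wof F.
Let G := Wof E.
Let h := ext_even F.
Let U x := RInt h 0 x.
(* By the profile equation this is a (U W)', also at the origin. *)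
Let P x := (1 + a) * h x * W x - W x - G x.

Lemma W_cont (x : R) : continuous W x.
Proof. apply (Wof_continuous (omega s) s M); auto using omega_weight, omega_holder. Qed.

Lemma G_cont (x : R) : continuous G x.
Proof. apply (Wof_continuous (omega s) s M); auto using omega_weight, omega_holder. Qed.

Lemma h_cont (x : R) : continuous h x.
Proof. apply (ext_even_continuous (omega s) s M); auto using omega_weight, omega_holder. Qed.

Lemma P_cont (x : R) : continuous P x.
Proof.
  unfold P.
  apply (continuous_minus (V := R_NormedModule) (fun x => (1 + a) * h x * W x - W x) G); [|apply G_cont].
  apply (continuous_minus (V := R_NormedModule) (fun x => (1 + a) * h x * W x) W); [|apply W_cont].
  apply (continuous_mult (K := R_AbsRing) (fun x => (1 + a) * h x) W); [|apply W_cont].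
  apply (continuous_mult (K := R_AbsRing) (fun _ => 1 + a) h); [apply continuous_const | apply h_cont].
Qed.

Lemma Wof_0 (w : R -> R) (K : R) (f : R -> C) : wball w K f -> Wof f 0 = 0.
Proof.
  intros Hf. unfold Wof. destruct (Rle_dec 0 0) as [_|H]; [|lra].
  rewrite (wball_real_0 w K f Hf). simpl. ring.
Qed.

(** The origin is excluded because the profile is in general only Hölder there; for x < 0 the
    derivative is reflected. *)
Lemma W_derive (x : R) : x <> 0 -> is_derive W x (be / x * G x).
Proof.
  intros Hx. unfold W, G, Wof. destruct (Rlt_dec 0 x) as [H|H].
  - destruct (HFE x H) as [_ D]. rewrite RtoC_mult_pair in D. cbn [snd] in D.
    destruct (Rle_dec 0 x) as [_|H']; [|lra].
    apply (is_derive_ext_loc (fun y => - snd (F y))).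
    + exists (mkposreal x H). intros y Hy. change (Rabs (y - x) < x) in Hy. apply Rabs_def2 in Hy.
      destruct (Rle_dec 0 y); [reflexivity | lra].
    + replace (be / x * - snd (E x)) with (opp (be / x * snd (E x))) by (unfold opp; simpl; ring).
      apply (is_derive_opp (K := R_AbsRing) (V := R_NormedModule) (fun y => snd (F y))). exact D.
  - destruct (HFE (- x) ltac:(lra)) as [_ D]. rewrite RtoC_mult_pair in D. cbn [snd] in D.
    destruct (Rle_dec 0 x) as [H'|_]; [lra|].
    assert (Hx' : 0 < - x) by lra.
    apply (is_derive_ext_loc (fun y => snd (F (- y)))).
    + exists (mkposreal (- x) Hx'). intros y Hy. change (Rabs (y - x) < - x) in Hy. apply Rabs_def2 in Hy.
      destruct (Rle_dec 0 y); [lra | reflexivity].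
    + replace (be / x * snd (E (- x))) with (scal (-1) (be / - x * snd (E (- x))))
        by (unfold scal; simpl; unfold mult; simpl; field; lra).
      apply (is_derive_comp (fun y => snd (F y)) (fun y => - y)); [exact D|].
      auto_derive; [trivial | ring].
Qed.

Lemma U_derive (x : R) : is_derive U x (h x).
Proof.
  apply (is_derive_RInt (V := R_NormedModule) h U 0 x).
  - apply filter_forall. intros y. apply is_RInt_cont_R, h_cont.
  - apply h_cont.
Qed.

Lemma U_odd (x : R) : U (- x) = - U x.
Proof.
  unfold U. apply is_RInt_unique_R.
  pose proof (is_RInt_cont_R h 0 x h_cont) as H.
  replace x with (- - x) in H at 1 by ring. replace 0 with (- 0) in H by ring.
  apply (is_RInt_comp_opp (V := R_NormedModule)) in H.
  apply (is_RInt_opp (V := R_NormedModule)) in H. rewrite Ropp_0 in H.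
  apply (is_RInt_ext (V := R_NormedModule) (fun y => opp (opp (h (- y))))); [|exact H].
  intros y _. rewrite opp_opp. unfold h, ext_even. rewrite Rabs_Ropp. reflexivity.
Qed.

Lemma U_avg (x : R) : 0 < x -> U x = x * ball_avg F x.
Proof.
  intros Hx. unfold U, ball_avg.
  rewrite (RInt_ext h (fun t => fst (F t))).
  - rewrite <- Rmult_assoc, Rinv_r, Rmult_1_l by lra. reflexivity.
  - intros t. rewrite Rmin_left, Rmax_right by lra. intros Ht. unfold h, ext_even. rewrite Rabs_pos_eq by lra. reflexivity.
Qed.

(** For x > 0 this is the profile equation with U(x) = x v(x), where v is the average; both sides
    are odd. *)
Lemma stationary_eq (x : R) : x <> 0 -> h x * W x = W x + G x + a * U x * (be / x * G x).
Proof.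
  intros Hx.
  assert (H : forall y, 0 < y -> h y * W y = W y + G y + a * U y * (be / y * G y)).
  { intros y Hy. rewrite (U_avg y Hy). specialize (Heq y Hy). unfold h, W, G, Wof, ext_even.
    rewrite Rabs_pos_eq by lra. destruct (Rle_dec 0 y) as [_|H]; [|lra].
    replace (a * (y * ball_avg F y) * (be / y * - snd (E y))) with (- (a * be * (ball_avg F y * snd (E y)))) by (field; lra).
    lra. }
  destruct (Rlt_dec 0 x) as [H0|H0]; [auto|].
  specialize (H (- x) ltac:(lra)). rewrite U_odd in H.
  assert (Odd : forall f : R -> C, Wof f (- x) = - Wof f x).
  { intros f. unfold Wof. destruct (Rle_dec 0 (- x)); [|lra]. destruct (Rle_dec 0 x); [lra|]. reflexivity. }
  unfold W, G in *. rewrite !Odd in H.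
  assert (Eh : h (- x) = h x) by (unfold h, ext_even; rewrite Rabs_Ropp; reflexivity).
  rewrite Eh in H.
  replace (a * - U x * (be / - x * - Wof E x)) with (- (a * U x * (be / x * Wof E x))) in H by (field; lra).
  lra.
Qed.

(** Away from 0 the product rule and [stationary_eq] apply. At 0 the profile W need not be
    differentiable, but U is O(x) and W tends to 0, so the product has derivative 0; for this reason
    the flux is differentiated as a whole. *)
Lemma aUW_derive (x : R) : is_derive (fun x => a * U x * W x) x (P x).
Proof.
  pose proof (Wof_0 _ _ _ HF) as W0. pose proof (Wof_0 _ _ _ HE) as G0.
  destruct (Req_dec x 0) as [->|Hx].
  - replace (P 0) with 0 by (unfold P, W, G; rewrite W0, G0; ring).
    pose proof (U_derive 0) as DU.
    assert (U0 : U 0 = 0) by (unfold U; apply (RInt_point (V := R_CompleteNormedModule))).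
    apply is_derive_Reals. intros e He.
    apply is_derive_Reals in DU. destruct (DU 1 Rlt_0_1) as [d1 Hd1].
    set (c := Rabs a * (Rabs (h 0) + 1) + 1).
    assert (Hc : 0 < c).
    { unfold c. pose proof (Rabs_pos a). pose proof (Rabs_pos (h 0)). nra. }
    pose proof (W_cont 0) as CW. apply continuity_pt_filterlim in CW.
    destruct (CW (e / c)) as [d2 [Hd2 Hd2']]; [apply Rdiv_lt_0_compat; auto|].
    assert (Hm : 0 < Rmin d1 d2) by (apply Rmin_case; [apply cond_pos | exact Hd2]).
    exists (mkposreal _ Hm). intros y Hy0 Hy. simpl in Hy.
    assert (Hy1 : Rabs y < d1) by (eapply Rlt_le_trans; [exact Hy | apply Rmin_l]).
    assert (Hy2 : Rabs y < d2) by (eapply Rlt_le_trans; [exact Hy | apply Rmin_r]).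
    specialize (Hd1 y Hy0 Hy1).
    assert (HW : Rabs (W y) < e / c).
    { specialize (Hd2' y). simpl in Hd2'. unfold R_dist in Hd2'. unfold W at 2 in Hd2'.
      rewrite W0, !Rminus_0_r in Hd2'. apply Hd2'. split; [split; [exact I | auto] | exact Hy2]. }
    rewrite Rplus_0_l in *. rewrite U0 in *. rewrite Rminus_0_r in *.
    replace ((a * U y * W y - a * 0 * W 0) / y) with (a * (U y / y) * W y) by (field; auto).
    rewrite Rabs_mult, Rabs_mult.
    assert (HU : Rabs (U y / y) <= Rabs (h 0) + 1).
    { replace (U y / y) with ((U y / y - h 0) + h 0) by ring.
      eapply Rle_trans; [apply Rabs_triang|]. lra. }
    apply Rle_lt_trans with ((c - 1) * Rabs (W y)).
    + apply Rmult_le_compat_r; [apply Rabs_pos|]. unfold c.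
      replace (Rabs a * (Rabs (h 0) + 1) + 1 - 1) with (Rabs a * (Rabs (h 0) + 1)) by ring.
      apply Rmult_le_compat_l; [apply Rabs_pos | exact HU].
    + apply Rle_lt_trans with (c * Rabs (W y)); [apply Rmult_le_compat_r; [apply Rabs_pos | lra]|].
      apply Rlt_le_trans with (c * (e / c)); [apply Rmult_lt_compat_l; auto | right; field; lra].
  - evar_last.
    + apply (is_derive_mult (K := R_AbsRing) (fun x => a * U x) W); [|apply W_derive; auto | intros n m; apply Rmult_comm].
      apply (is_derive_scal U x a). apply U_derive.
    + unfold plus, scal; simpl; unfold mult; simpl. unfold P. pose proof (stationary_eq x Hx). lra.
Qed.

(** Reciprocal of the length scale (1 - t)^(1 + lam), as 1 + lam = 1 / be. *)
Let kap t := / Rpower (1 - t) (/ be).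

Lemma kap_pos (t : R) : 0 < kap t.
Proof. apply Rinv_0_lt_compat, Rpower_pos. Qed.

Lemma kap_derive (t : R) : t < 1 -> is_derive kap t (/ be * kap t / (1 - t)).
Proof.
  intros Ht. unfold kap, Rpower. auto_derive.
  - split; [lra|]. split; [apply Rgt_not_eq, exp_pos | trivial].
  - change (1 - t) with (1 + - t). field. repeat split; try lra; apply Rgt_not_eq, exp_pos.
Qed.

Lemma jcont_profile (g : R -> R) (t x : R) : t < 1 -> (forall y, continuous g y) ->
  jcont (fun t x => g (x * kap t)) t x.
Proof.
  intros Ht Hg. apply (continuous_comp (fun p : R * R => snd p * kap (fst p)) g); [|apply Hg].
  apply (continuous_mult (K := R_AbsRing) (fun p : R * R => snd p) (fun p => kap (fst p))).
  - apply continuous_snd.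
  - apply (continuous_comp (fun p : R * R => fst p) kap); [apply continuous_fst|].
    apply (ex_derive_continuous (K := R_AbsRing) (V := R_NormedModule)). eexists. apply kap_derive. exact Ht.
Qed.

Lemma jcont_time (g : R -> R) (t x : R) : continuous g t -> jcont (fun t _ => g t) t x.
Proof. intros Hg. apply (continuous_comp (fun p : R * R => fst p) g); [apply continuous_fst | exact Hg]. Qed.

(** Since G(z) = (1 / be) z W'(z), the moving scale contributes exactly G. At x = 0 the function of
    time is constantly 0. *)
Lemma profile_time_derive (t x : R) : t < 1 ->
  is_derive (fun s => / (1 - s) * W (x * kap s)) t (/ (1 - t) ^ 2 * (W (x * kap t) + G (x * kap t))).
Proof.
  intros Ht. pose proof (Wof_0 _ _ _ HF) as W0. pose proof (Wof_0 _ _ _ HE) as G0.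
  destruct (Req_dec x 0) as [->|Hx].
  - apply (is_derive_ext (fun _ => 0)).
    + intros u. rewrite Rmult_0_l. unfold W. rewrite W0. real_eq. ring.
    + rewrite Rmult_0_l. unfold W, G. rewrite W0, G0.
      replace (/ (1 - t) ^ 2 * (0 + 0)) with 0 by ring. apply (is_derive_const (K := R_AbsRing) (V := R_NormedModule)).
  - pose proof (kap_pos t) as Hk. pose proof (kap_derive t Ht) as Dk.
    assert (Hxk : x * kap t <> 0) by (apply Rmult_integral_contrapositive_currified; lra).
    evar_last.
    + apply (is_derive_mult (K := R_AbsRing) (fun s => / (1 - s)) (fun s => W (x * kap s))); [| |intros n m; apply Rmult_comm].
      * instantiate (1 := / (1 - t) ^ 2). auto_derive; [lra | field; lra].
      * apply (is_derive_comp W (fun s => x * kap s)); [apply W_derive; auto | apply (is_derive_scal kap t x); exact Dk].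
    + unfold plus, scal; simpl; unfold mult; simpl. field. split; [lra | split; lra].
Qed.

Theorem self_similar_solution : dg_solution a (ss_w W (/ be - 1)).
Proof.
  assert (Ew : forall t x, ss_w W (/ be - 1) t x = / (1 - t) * W (x * kap t)).
  { intros t x. unfold ss_w, kap. replace (1 + (/ be - 1)) with (/ be) by ring. reflexivity. }
  set (H := fun t x => / (1 - t) * h (x * kap t)).
  exists H. split; [|split].
  - intros t x Ht. unfold H. pose proof (kap_pos t) as Hk.
    assert (Ef : ss_w W (/ be - 1) t = fun y => / (1 - t) * W (kap t * y)).
    { apply functional_extensionality. intros y. rewrite Ew, (Rmult_comm y). reflexivity. }
    rewrite Ef, (Rmult_comm x). apply hilbert_pv_scale; auto.
    apply (hilbert_Wof s M); auto.
  - intros t x Ht. apply (jcont_mult (fun t _ => / (1 - t)) (fun t x => h (x * kap t))).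
    + apply (jcont_time (fun t => / (1 - t))).
      apply (ex_derive_continuous (K := R_AbsRing) (V := R_NormedModule)). auto_derive. lra.
    + apply jcont_profile; auto. apply h_cont.
  - intros u phi phit phix T0 T1 X HT Hz Dt Dx Cp.
    assert (Eu : forall t x, t < 1 -> u t x = / (1 - t) * (/ kap t * U (x * kap t))).
    { intros t x Ht. unfold u, H, U. pose proof (kap_pos t) as Hk.
      apply is_RInt_unique_R.
      pose proof (is_RInt_comp_lin (V := R_NormedModule) h (kap t) 0 0 x (RInt h 0 (x * kap t))) as HI.
      rewrite Rmult_0_r, !Rplus_0_r, (Rmult_comm (kap t) x) in HI.
      specialize (HI (is_RInt_cont_R h 0 (x * kap t) h_cont)).
      apply (is_RInt_scal (V := R_NormedModule) _ _ _ (/ (1 - t) * / kap t)) in HI.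
      replace (/ (1 - t) * (/ kap t * RInt h 0 (x * kap t)))
        with (scal (/ (1 - t) * / kap t) (RInt h 0 (x * kap t))) by (unfold scal; simpl; unfold mult; simpl; ring).
      refine (is_RInt_ext (V := R_NormedModule) _ _ _ _ _ _ HI).
      intros y _. unfold scal; simpl; unfold mult; simpl. rewrite Rplus_0_r, (Rmult_comm y). real_eq. field. lra. }
    set (w := fun t x => / (1 - t) * W (x * kap t)).
    set (wt := fun t x => / (1 - t) ^ 2 * (W (x * kap t) + G (x * kap t))).
    set (q := fun t x => / (1 - t) ^ 2 * / kap t * (a * U (x * kap t) * W (x * kap t))).
    set (qx := fun t x => / (1 - t) ^ 2 * P (x * kap t)).
    assert (Hlin : forall t x, is_derive (fun x => x * kap t) x (kap t)).
    { intros t x. auto_derive; [trivial | ring]. }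
    rewrite <- (weak_form w wt q qx phi phit phix T0 T1 X); auto.
    + destruct (Rle_dec T0 T1) as [HT0|HT0].
      * apply RInt_ext. intros t. rewrite Rmin_left, Rmax_right by lra. intros Ht.
        apply RInt_ext. intros x _. rewrite Ew, (Eu t x) by lra. unfold w, wt, q, qx, H, P.
        pose proof (kap_pos t). real_eq. field. split; lra.
      * assert (Z : forall t x, phi t x = 0) by (intros t x; apply Hz; lra).
        assert (Zt : forall t x, phit t x = 0).
        { intros t x. rewrite <- (is_derive_unique _ _ _ (Dt t x)).
          rewrite (Derive_ext _ (fun _ => 0)) by (intros; apply Z). apply Derive_const. }
        assert (Zx : forall t x, phix t x = 0).
        { intros t x. rewrite <- (is_derive_unique _ _ _ (Dx t x)).
          rewrite (Derive_ext _ (fun _ => 0)) by (intros; apply Z). apply Derive_const. }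
        apply RInt_ext. intros t _. apply RInt_ext. intros x _. rewrite Z, Zt, Zx. real_eq. ring.
    + intros t x Ht. apply profile_time_derive. exact Ht.
    + intros t x Ht. pose proof (kap_pos t) as Hk. unfold q, qx. evar_last.
      * apply is_derive_scal. apply (is_derive_comp (fun y => a * U y * W y) (fun x => x * kap t)); [apply aUW_derive | apply Hlin].
      * unfold scal; simpl; unfold mult; simpl. field. split; lra.
    + intros t x Ht. split; [|split].
      * apply (jcont_mult (fun t _ => / (1 - t)) (fun t x => W (x * kap t))).
        -- apply (jcont_time (fun t => / (1 - t))).
           apply (ex_derive_continuous (K := R_AbsRing) (V := R_NormedModule)). auto_derive. lra.
        -- apply jcont_profile; auto. apply W_cont.
      * apply (jcont_mult (fun t _ => / (1 - t) ^ 2) (fun t x => W (x * kap t) + G (x * kap t))).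
        -- apply (jcont_time (fun t => / (1 - t) ^ 2)).
           apply (ex_derive_continuous (K := R_AbsRing) (V := R_NormedModule)). auto_derive. nra.
        -- apply (jcont_profile (fun y => W y + G y)); auto. intros y.
           apply (continuous_plus (V := R_NormedModule) W G); [apply W_cont | apply G_cont].
      * unfold qx. apply (continuous_mult (K := R_AbsRing) (fun _ => / (1 - t) ^ 2) (fun x => P (x * kap t))); [apply continuous_const|].
        apply (continuous_comp (fun x => x * kap t) P); [|apply P_cont].
        apply (ex_derive_continuous (K := R_AbsRing) (V := R_NormedModule)). eexists. apply Hlin.
Qed.

End SelfSimilar.

(** * Analyticity in [a] *)

(** For alpha <= 1 / 4 the exponent is s = alpha, beyond it the single profile with s = 1 and be = 3
    / 2 is used. In both cases be <= 6 alpha, so that |a alpha| controls the expansion parameter a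
    be, and [Cy] is independent of alpha. *)
Lemma base_profile : exists Cy, 1 <= Cy /\ forall alpha, 0 < alpha < 1 -> exists s be y,
  0 < s <= 1 /\ alpha <= s /\ 4 * s / 3 <= be <= 3 * s / 2 /\ be <= 6 * alpha /\
  wball (omega s) Cy y /\ y 0 = RtoC 1 /\ scder be y (fun x => - y x + y x * y x)%C.
Proof.
  destruct three_halves_inverse as [M [y1 [A1 [A2 A3]]]].
  exists (Rmax 512 M). split; [eapply Rle_trans; [|apply Rmax_l]; lra|].
  intros alpha Ha. destruct (Rle_dec alpha (/ 4)) as [H|H].
  - destruct (bernstein_inverse alpha ltac:(lra)) as [y [B1 [B2 B3]]].
    exists alpha, (4 * alpha / 3), y. do 4 (split; [lra|]). split; [|split; auto].
    apply (wball_mono (omega alpha) 512); [apply Rmax_l | auto].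
  - exists 1, (3 / 2), y1. do 4 (split; [lra|]). split; [|split; auto].
    apply (wball_mono (omega 1) M); [apply Rmax_r | auto].
Qed.

Lemma Rpower_le_smaller (h s alpha : R) : 0 < h <= 1 -> 0 < alpha <= s -> Rpower h s <= Rpower h alpha.
Proof.
  intros Hh Hs. replace s with (alpha + (s - alpha)) by ring. rewrite Rpower_plus.
  pose proof (Rpower_le_1 h (s - alpha) Hh ltac:(lra)). pose proof (Rpower_pos h alpha). nra.
Qed.

(** At distance at most 1 the power with exponent [s] is below the one with [alpha]; at larger
    distance the sup bound suffices. *)
Lemma Wof_calpha (s alpha M : R) (f : R -> C) : 0 < alpha <= s -> s <= 1 -> wball (omega s) M f ->
  (forall x, Rabs (Wof f x) <= M) /\
  (forall x y, x <> y -> Rabs (Wof f x - Wof f y) <= 2 * M * Rpower (Rabs (x - y)) alpha).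
Proof.
  intros Ha Hs Hf. assert (Hs' : 0 < s <= 1) by lra.
  pose proof (omega_weight s Hs') as Hw. pose proof (omega_holder s Hs') as Hh.
  pose proof (wball_nonneg _ Hw _ _ Hf) as HM.
  assert (B : forall x, Rabs (Wof f x) <= M) by (intros x; apply (Wof_bound (omega s)); auto).
  split; auto. intros x y Hxy. assert (Hd : 0 < Rabs (x - y)) by (apply Rabs_pos_lt; lra).
  destruct (Rle_dec (Rabs (x - y)) 1) as [H|H].
  - eapply Rle_trans; [apply (Wof_holder (omega s) s M f x y); auto|].
    apply Rmult_le_compat_l; [lra|]. apply Rpower_le_smaller; lra.
  - pose proof (Rpower_ge_1 (Rabs (x - y)) alpha ltac:(lra) ltac:(lra)).
    pose proof (B x) as B1. pose proof (B y) as B2. apply Rabs_le_between in B1, B2.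
    apply Rle_trans with (2 * M); [apply Rabs_le; lra | nra].
Qed.

(* Coefficient of [h ^ n] in [(z + h) ^ j]. *)
Fixpoint bcoef (z : R) (j n : nat) : R :=
  match j with
  | O => match n with O => 1 | S _ => 0 end
  | S i => z * bcoef z i n + match n with O => 0 | S m => bcoef z i m end
  end.

Lemma bcoef_bound (z r : R) (j n : nat) : 0 < r -> Rabs (bcoef z j n) * r ^ n <= (Rabs z + r) ^ j.
Proof.
  intros Hr. revert n. induction j as [|j IH]; intros n; simpl.
  - destruct n; simpl; [rewrite Rabs_R1 | rewrite Rabs_R0]; lra.
  - pose proof (Rabs_pos z) as Hz.
    eapply Rle_trans; [apply Rmult_le_compat_r; [apply pow_le; lra | apply Rabs_triang]|].
    rewrite Rmult_plus_distr_r, Rmult_plus_distr_r, Rabs_mult.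
    apply Rplus_le_compat.
    + rewrite Rmult_assoc. apply Rmult_le_compat_l; auto.
    + destruct n as [|n]; simpl.
      * rewrite Rabs_R0, Rmult_0_l. apply Rmult_le_pos; [lra | apply pow_le; lra].
      * specialize (IH n). replace (Rabs (bcoef z j n) * (r * r ^ n)) with (r * (Rabs (bcoef z j n) * r ^ n)) by ring.
        apply Rmult_le_compat_l; lra.
Qed.

(** Taylor remainder after order N, in [h], of (z + h)^j. *)
Definition brem (z h : R) (N j : nat) : R := (z + h) ^ j - rsum (fun n => bcoef z j n * h ^ n) (S N).

Lemma brem_succ (z h : R) (N j : nat) :
  brem z h N (S j) = (z + h) * brem z h N j + h ^ S N * bcoef z j N.
Proof.
  unfold brem. rewrite (rsum_head (fun n => bcoef z (S j) n * h ^ n)).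
  rewrite (rsum_ext (fun i => bcoef z (S j) (S i) * h ^ S i)
    (fun i => z * (bcoef z j (S i) * h ^ S i) + h * (bcoef z j i * h ^ i)) N) by (intros i _; simpl; ring).
  rewrite rsum_plus, !rsum_scal.
  assert (E : rsum (fun n => bcoef z j n * h ^ n) (S N)
            = bcoef z j 0 * h ^ 0 + rsum (fun i => bcoef z j (S i) * h ^ S i) N) by apply rsum_head.
  assert (E' : rsum (fun n => bcoef z j n * h ^ n) (S N)
            = rsum (fun n => bcoef z j n * h ^ n) N + bcoef z j N * h ^ N) by reflexivity.
  assert (E1 : rsum (fun i => bcoef z j (S i) * h ^ S i) N
    = rsum (fun n => bcoef z j n * h ^ n) (S N) - bcoef z j 0 * h ^ 0) by lra.
  assert (E2 : rsum (fun i => bcoef z j i * h ^ i) N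
    = rsum (fun n => bcoef z j n * h ^ n) (S N) - bcoef z j N * h ^ N) by lra.
  rewrite E1, E2. cbn [bcoef pow]. ring.
Qed.

(** Induction on j: one more factor multiplies the old remainder by at most |z| + r and adds a term
    of at most r times the bound, hence the base |z| + 2 r. Being geometric in j, the bound can be
    summed against the members f_j of the balls. *)
Lemma brem_bound (z h r : R) (N j : nat) : 0 < r -> Rabs h <= r ->
  Rabs (brem z h N j) <= (Rabs h / r) ^ S N * (Rabs z + 2 * r) ^ j.
Proof.
  intros Hr Hh. pose proof (Rabs_pos h) as Hh0. pose proof (Rabs_pos z) as Hz0.
  assert (Hq : 0 <= (Rabs h / r) ^ S N) by (apply pow_le, Rdiv_le_0_compat; lra).
  induction j as [|j IH].
  - replace (brem z h N 0) with 0; [rewrite Rabs_R0, pow_O; lra|].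
    unfold brem. rewrite rsum_head. rewrite (rsum_ext _ (fun _ => 0 * 0)) by (intros i _; simpl; ring).
    rewrite rsum_scal. simpl. ring.
  - rewrite brem_succ. eapply Rle_trans; [apply Rabs_triang|]. rewrite !Rabs_mult, <- RPow_abs.
    pose proof (bcoef_bound z r j N Hr) as Hb.
    assert (Hb' : Rabs h ^ S N * Rabs (bcoef z j N) <= (Rabs h / r) ^ S N * (r * (Rabs z + 2 * r) ^ j)).
    { unfold Rdiv. rewrite Rpow_mult_distr, pow_inv.
      replace (Rabs h ^ S N * / r ^ S N * (r * (Rabs z + 2 * r) ^ j))
        with (Rabs h ^ S N * ((Rabs z + 2 * r) ^ j / r ^ N)).
      2: { simpl. field. split; [apply pow_nonzero|]; lra. }
      apply Rmult_le_compat_l; [apply pow_le; auto|].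
      rewrite <- Rle_div_r by (apply pow_lt; auto). eapply Rle_trans; [exact Hb|]. apply pow_incr. lra. }
    assert (Ha : Rabs (z + h) * Rabs (brem z h N j)
              <= (Rabs z + r) * ((Rabs h / r) ^ S N * (Rabs z + 2 * r) ^ j)).
    { apply Rmult_le_compat; auto using Rabs_pos. eapply Rle_trans; [apply Rabs_triang|]. lra. }
    cbn [pow] in *. lra.
Qed.

Lemma is_series_geom_scaled (A q : R) : 0 <= q < 1 -> is_series (fun n => A * q ^ n) (A / (1 - q)).
Proof.
  intros Hq. apply (is_series_scal (K := R_AbsRing) (V := R_NormedModule) A (fun n => q ^ n) (/ (1 - q))).
  apply is_series_geom. rewrite Rabs_pos_eq; lra.
Qed.

Section Family.
Variables (s alpha be A Rr : R) (f e : nat -> R -> C).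
Hypothesis Hs : 0 < s <= 1.
Hypothesis Hal : 0 < alpha <= s.
Hypothesis Hbe : 0 < be.
Hypothesis HA : 1 <= A.
Hypothesis HR : 1 <= Rr.
Hypothesis Hf : forall n, wball (omega s) (A * Rr ^ n) (f n).
Hypothesis He : forall n, wball (omega s) (A * Rr ^ n) (e n).

Lemma comb_geom (c : nat -> R) (K z : R) (g : nat -> R -> C) : 0 <= z -> z * Rr < 1 ->
  (forall j, Rabs (c j) <= K * z ^ j) ->
  exists L, L <= K * A / (1 - z * Rr) /\ is_series (fun n => Rabs (c n) * (A * Rr ^ n)) L.
Proof.
  intros Hz HzR Hc.
  assert (Hq : 0 <= z * Rr < 1) by (split; [apply Rmult_le_pos; lra | lra]).
  pose proof (is_series_geom_scaled (K * A) (z * Rr) Hq) as HG.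
  assert (Hle : forall n, 0 <= Rabs (c n) * (A * Rr ^ n) <= K * A * (z * Rr) ^ n).
  { intros n. assert (0 < A * Rr ^ n) by (apply Rmult_lt_0_compat; [lra | apply pow_lt; lra]).
    split; [apply Rmult_le_pos; [apply Rabs_pos | lra]|].
    apply Rle_trans with (K * z ^ n * (A * Rr ^ n)); [apply Rmult_le_compat_r; [lra | auto]|].
    rewrite Rpow_mult_distr. right. ring. }
  exists (Series (fun n => Rabs (c n) * (A * Rr ^ n))). split.
  - rewrite <- (is_series_unique _ _ HG). apply Series_le; [exact Hle | eexists; exact HG].
  - apply Series_correct. apply (ex_series_le (K := R_AbsRing) (V := R_CompleteNormedModule) _ (fun n => K * A * (z * Rr) ^ n));
      [|eexists; exact HG].
    intros n. change (norm ?u) with (Rabs u). rewrite Rabs_pos_eq; apply Hle.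
Qed.

(** With q = |ep| Rr the terms of positive order sum to at most A q / (1 - q) <= 1, while f_0(0) =
    2. This keeps Re F(0) >= 1, which later excludes the zero profile. *)
Lemma family_member (ep : R) : f 0%nat 0 = RtoC 2 -> Rabs ep * Rr <= / (2 * A) ->
  exists M, is_series (fun n => Rabs (ep ^ n) * (A * Rr ^ n)) M /\
    wball (omega s) M (comb (pow ep) f) /\ wball (omega s) M (comb (pow ep) e) /\
    1 <= fst (comb (pow ep) f 0).
Proof.
  intros Hf0 Hep. pose proof (omega_weight s Hs) as Hw. pose proof (Rabs_pos ep) as He0.
  assert (HA2 : 0 < / (2 * A) <= / 2).
  { split; [apply Rinv_0_lt_compat; lra | apply Rinv_le_contravar; lra]. }
  set (q := Rabs ep * Rr) in *. assert (Hq0 : 0 <= q) by (apply Rmult_le_pos; lra).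
  destruct (comb_geom (pow ep) 1 (Rabs ep) f He0 ltac:(fold q; lra)) as [M [HM1 HM2]].
  { intros j. rewrite RPow_abs. lra. }
  fold q in HM1. rewrite Rmult_1_l in HM1.
  exists M. split; auto. split; [|split].
  - apply (comb_wball (omega s) (pow ep) (fun n => A * Rr ^ n) f M); auto.
  - apply (comb_wball (omega s) (pow ep) (fun n => A * Rr ^ n) e M); auto.
  - destruct (comb_spec (omega s) (pow ep) (fun n => A * Rr ^ n) f M Hw Hf HM2 0 ltac:(lra)) as [_ [_ H]].
    specialize (H 0%nat). rewrite !sum_O, Hf0 in H. cbn [pow] in H. rewrite Rabs_R1, Rmult_1_r, Rmult_1_l in H.
    assert (HMA : M - A <= 1).
    { assert (A / (1 - q) - A <= 1); [|lra].
      replace (A / (1 - q) - A) with (A * q / (1 - q)) by (field; lra).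
      rewrite Rle_div_l by lra.
      assert (A * q <= / 2); [|lra].
      apply Rle_trans with (A * / (2 * A)); [apply Rmult_le_compat_l; lra | right; field; lra]. }
    pose proof (Rabs_fst_Cmod (comb (pow ep) f 0 - RtoC 1 * RtoC 2)) as H1.
    change (fst (comb (pow ep) f 0 - RtoC 1 * RtoC 2)%C) with (fst (comb (pow ep) f 0) - (1 * 2 - 0 * 0)) in H1.
    assert (H2 : Rabs (fst (comb (pow ep) f 0) - (1 * 2 - 0 * 0)) <= 1) by lra.
    apply Rabs_le_between in H2. lra.
Qed.

Lemma Wof_abs (g : R -> C) (x : R) : Wof g x = (if Rle_dec 0 x then -1 else 1) * snd (g (Rabs x)).
Proof.
  unfold Wof. destruct (Rle_dec 0 x); [rewrite Rabs_pos_eq by lra | rewrite Rabs_left by lra]; ring.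
Qed.

(** The power series in a be is re-expanded about [a0]. The remainder of order N is again a
    combination of the f_j, with Taylor remainders of powers as coefficients; it lies in a ball
    whose radius controls the sup norm and the Hölder seminorm at once. *)
Lemma family_analytic : calpha_analytic_on alpha (fun a => Rabs (a * be) * Rr <= / 2) (fun a => Wof (comb (pow (a * be)) f)).
Proof.
  intros a0 Ha0. pose proof (omega_weight s Hs) as Hw.
  (* With |z| Rr <= 1 / 2 this choice gives (|z| + 2 r) Rr <= 3 / 4, so all rearranged series
     converge. *)
  set (z := a0 * be) in *. set (r := / (8 * Rr)).
  assert (Hr : 0 < r) by (apply Rinv_0_lt_compat; lra).
  assert (HrR : r * Rr = / 8) by (unfold r; field; lra).
  pose proof (Rabs_pos z) as Hz0.
  set (coef := fun n j => bcoef z j n * be ^ n).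
  assert (Hcoef : forall n, exists L, is_series (fun j => Rabs (coef n j) * (A * Rr ^ j)) L).
  { intros n. destruct (comb_geom (coef n) (be ^ n / r ^ n) (Rabs z + r) f) as [L [_ HL]]; [lra | nra | |exists L; auto].
    intros j. unfold coef. rewrite Rabs_mult, (Rabs_pos_eq (be ^ n)) by (apply pow_le; lra).
    assert (0 < r ^ n) by (apply pow_lt; auto). assert (0 < be ^ n) by (apply pow_lt; auto).
    replace (Rabs (bcoef z j n) * be ^ n) with (be ^ n / r ^ n * (Rabs (bcoef z j n) * r ^ n)) by (field; lra).
    apply Rmult_le_compat_l; [left; apply Rdiv_lt_0_compat; auto | apply bcoef_bound; auto]. }
  (* This radius gives |h| <= r / 2, and the remainders decay like 2^(-N-1). *)
  exists (r / (2 * be)). split; [apply Rdiv_lt_0_compat; lra|].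
  exists (fun n => Wof (comb (coef n) f)). split.
  - intros n. destruct (Hcoef n) as [L HL].
    assert (HB : wball (omega s) L (comb (coef n) f)) by (apply (comb_wball (omega s) (coef n) (fun n => A * Rr ^ n) f L); auto).
    destruct (Wof_calpha s alpha L _ Hal ltac:(lra) HB) as [B1 B2]. split; eexists; eauto.
  - intros a Ha eps Heps. set (h := (a - a0) * be).
    assert (Hh : Rabs h <= r / 2).
    { unfold h. rewrite Rabs_mult, (Rabs_pos_eq be) by lra.
      apply Rle_trans with (r / (2 * be) * be); [apply Rmult_le_compat_r; lra | right; field; lra]. }
    assert (Hzh : a * be = z + h) by (unfold z, h; ring).
    (* The Hölder constant is 2 L with L <= 4 A 2^(-N-1), whence the tolerance eps / (8 A). *)
    destruct (pow_lt_1_zero (/ 2) ltac:(rewrite Rabs_pos_eq; lra) (eps / (8 * A))) as [N0 HN0];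
      [apply Rdiv_lt_0_compat; lra|].
    exists N0. intros N HN Rm.
    destruct (comb_geom (brem z h N) ((Rabs h / r) ^ S N) (Rabs z + 2 * r) f) as [L [HL1 HL2]];
      [lra | nra | intros j; apply brem_bound; lra |].
    assert (HL : 2 * L <= eps).
    { assert (Hq : (Rabs h / r) ^ S N <= eps / (8 * A)).
      { apply Rle_trans with ((/ 2) ^ S N).
        - apply pow_incr. split; [apply Rdiv_le_0_compat; [apply Rabs_pos | auto]|]. rewrite Rle_div_l by lra. lra.
        - specialize (HN0 (S N) ltac:(lia)). rewrite Rabs_pos_eq in HN0 by (apply pow_le; lra). lra. }
      assert (Hd : / 4 <= 1 - (Rabs z + 2 * r) * Rr) by nra.
      apply Rle_trans with (2 * (eps / (8 * A) * A / (/ 4))); [|right; field; lra].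
      apply Rmult_le_compat_l; [lra|]. eapply Rle_trans; [exact HL1|].
      assert (0 <= (Rabs h / r) ^ S N) by (apply pow_le, Rdiv_le_0_compat; [apply Rabs_pos | auto]).
      unfold Rdiv at 1 3. apply Rmult_le_compat.
      - apply Rmult_le_pos; lra.
      - left. apply Rinv_0_lt_compat. lra.
      - apply Rmult_le_compat_r; lra.
      - apply Rinv_le_contravar; lra. }
    assert (HB : wball (omega s) L (comb (brem z h N) f)) by (apply (comb_wball (omega s) (brem z h N) (fun n => A * Rr ^ n) f L); auto).
    assert (HRm : forall x, Rm x = Wof (comb (brem z h N) f) x).
    { intros x. unfold Rm. rewrite !Wof_abs. set (sg := if Rle_dec 0 x then -1 else 1).
      set (y := Rabs x). assert (Hy : 0 <= y) by apply Rabs_pos.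
      (* The Taylor terms are subtracted one at a time, so that only differences of two convergent
         series occur and no double series is rearranged. *)
      assert (HS : forall k, is_series
          (fun j => ((z + h) ^ j - rsum (fun n => bcoef z j n * h ^ n) k) * snd (f j y))
          (snd (comb (pow (a * be)) f y) - rsum (fun n => snd (comb (coef n) f y) * (a - a0) ^ n) k)).
      { induction k as [|k IH].
        - destruct (comb_geom (pow (a * be)) 1 (Rabs z + r) f) as [L0 [_ HL0]]; [lra | nra | |].
          + intros j. rewrite <- RPow_abs, Rmult_1_l. apply pow_incr. split; [apply Rabs_pos|].
            rewrite Hzh. eapply Rle_trans; [apply Rabs_triang|]. lra.
          + destruct (comb_spec (omega s) (pow (a * be)) (fun n => A * Rr ^ n) f L0 Hw Hf HL0 y Hy) as [_ [H _]].
            cbn [rsum]. rewrite Rminus_0_r. refine (is_series_ext _ _ _ _ H). intros j. rewrite RtoC_mult_pair, <- Hzh. cbn [snd]. real_eq. ring.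
        - destruct (Hcoef k) as [Lk HLk].
          destruct (comb_spec (omega s) (coef k) (fun n => A * Rr ^ n) f Lk Hw Hf HLk y Hy) as [_ [H _]].
          apply (is_series_scal (K := R_AbsRing) (V := R_NormedModule) ((a - a0) ^ k)) in H.
          pose proof (is_series_minus _ _ _ _ IH H) as H'. cbn [rsum].
          match type of H' with is_series _ ?l => replace (snd (comb (pow (a * be)) f y)
             - (rsum (fun n => snd (comb (coef n) f y) * (a - a0) ^ n) k + snd (comb (coef k) f y) * (a - a0) ^ k)) with l end.
          + refine (is_series_ext _ _ _ _ H'). intros j. rewrite RtoC_mult_pair. unfold coef, h. cbn [snd]. unfold minus, plus, opp, scal; simpl; unfold mult; simpl. rewrite Rpow_mult_distr. real_eq. ring.
          + unfold minus, plus, opp, scal; simpl; unfold mult; simpl. ring. }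
      specialize (HS (S N)).
      replace (snd (comb (brem z h N) f y)) with
        (snd (comb (pow (a * be)) f y) - rsum (fun n => snd (comb (coef n) f y) * (a - a0) ^ n) (S N)).
      - rewrite sum_n_Reals, sum_f_R0_rsum, Rmult_minus_distr_l, <- rsum_scal. f_equal. apply rsum_ext. intros n _.
        rewrite Wof_abs. fold sg y. ring.
      - rewrite <- (is_series_unique _ _ HS). apply Series_ext. intros j. unfold brem. rewrite RtoC_mult_pair. reflexivity. }
    destruct (Wof_calpha s alpha L _ Hal ltac:(lra) HB) as [B1 B2].
    pose proof (wball_nonneg _ Hw _ _ HB) as HL0.
    split.
    + intros x. rewrite HRm. specialize (B1 x). lra.
    + intros x y Hxy. rewrite !HRm. eapply Rle_trans; [apply B2; auto|].
      apply Rmult_le_compat_r; [left; apply Rpower_pos | lra].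
Qed.

End Family.

(** If the profile vanished, so would all its truncated principal values, and with them their limit
    Re F(0). *)
Lemma Wof_nontrivial (s M : R) (F : R -> C) : 0 < s <= 1 -> wball (omega s) M F -> fst (F 0) <> 0 ->
  exists x, Wof F x <> 0.
Proof.
  intros Hs HF H0. apply not_all_not_ex. intros Hall. apply H0.
  assert (HZ : forall x, Wof F x = 0) by (intros x; apply NNPP; apply Hall).
  destruct (hilbert_Wof s M F 0 Hs HF) as [_ H].
  apply cond_eq. intros d Hd. destruct (H d Hd) as [e0 [R0 [He0 Hpv]]].
  set (Rr := Rmax R0 e0 + 1).
  assert (HR : R0 < Rr /\ e0 < Rr) by (unfold Rr; pose proof (Rmax_l R0 e0); pose proof (Rmax_r R0 e0); lra).
  specialize (Hpv (e0 / 2) Rr ltac:(lra) ltac:(lra) (proj1 HR) ltac:(lra)).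
  assert (HI : forall a b, RInt (fun y => Wof F y / (0 - y)) a b = 0).
  { intros a b. rewrite (RInt_ext _ (fun _ => 0)).
    - rewrite (RInt_const (V := R_CompleteNormedModule)). unfold scal; simpl; unfold mult; simpl. ring.
    - intros y _. rewrite HZ. unfold Rdiv. apply Rmult_0_l. }
  rewrite !HI in Hpv. unfold ext_even in Hpv. rewrite Rabs_R0 in Hpv.
  replace (/ PI * (0 + 0) - fst (F 0)) with (- (fst (F 0) - 0)) in Hpv by ring.
  rewrite Rabs_Ropp in Hpv. exact Hpv.
Qed.

Theorem theorem1p1 :
  exists c : R, 0 < c /\
  forall alpha : R, 0 < alpha < 1 ->
  exists (W : R -> R -> R) (lam : R -> R),
    (forall a : R, Rabs (a * alpha) < c ->
       Calpha alpha (W a) /\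
       (exists x, W a x <> 0) /\
       dg_solution a (ss_w (W a) (lam a))) /\
    real_analytic_on (fun a => Rabs (a * alpha) < c) lam /\
    calpha_analytic_on alpha (fun a => Rabs (a * alpha) < c) W.
Proof.
  destruct base_profile as [Cy [HCy Hbase]].
  destruct (formal_solution Cy HCy) as [A [Rr [HA [HR Hformal]]]].
  assert (HAR : 0 < 12 * A * Rr) by (apply Rmult_lt_0_compat; lra).
  (* As be <= 6 alpha, the condition |a alpha| < 1 / (12 A Rr) gives |a be| Rr <= 1 / (2 A), the
     smallness that [family_member] asks for. *)
  exists (/ (12 * A * Rr)). split; [apply Rinv_0_lt_compat; auto|].
  intros alpha Hal.
  destruct (Hbase alpha Hal) as [s [be [y [Hs [Has [Hbe [Hbe6 [Hy1 [Hy2 Hy3]]]]]]]]].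
  destruct (Hformal s be y Hs Hbe Hy1 Hy2 Hy3) as [f [e [Hf0 Hfe]]].
  assert (Hbe0 : 0 < be) by lra.
  assert (Hf : forall n, wball (omega s) (A * Rr ^ n) (f n)) by (intros n; apply Hfe).
  assert (He : forall n, wball (omega s) (A * Rr ^ n) (e n)) by (intros n; apply Hfe).
  assert (Hsmall : forall a, Rabs (a * alpha) < / (12 * A * Rr) -> Rabs (a * be) * Rr <= / (2 * A)).
  { intros a Ha. rewrite Rabs_mult, (Rabs_pos_eq alpha) in Ha by lra. rewrite Rabs_mult, (Rabs_pos_eq be) by lra.
    pose proof (Rabs_pos a).
    apply Rle_trans with (6 * / (12 * A * Rr) * Rr); [|right; field; lra].
    apply Rmult_le_compat_r; [lra|]. apply Rle_trans with (Rabs a * (6 * alpha)); [apply Rmult_le_compat_l; lra | lra]. }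
  exists (fun a => Wof (comb (pow (a * be)) f)), (fun _ => / be - 1). split; [|split].
  - intros a Ha. destruct (family_member s A Rr f e Hs HA HR Hf He (a * be) Hf0 (Hsmall a Ha)) as [M [HM [B1 [B2 B3]]]].
    split; [|split].
    + destruct (Wof_calpha s alpha M _ ltac:(lra) ltac:(lra) B1) as [C1 C2]. split; eexists; eauto.
    + apply (Wof_nontrivial s M); auto. lra.
    + apply (self_similar_solution s be a M (comb (pow (a * be)) f) (comb (pow (a * be)) e)); auto.
      * apply (comb_scder (omega s) s be (pow (a * be)) (fun n => A * Rr ^ n) f e M); auto using omega_weight, omega_holder.
        intros n. apply Hfe.
      * apply (comb_profile_eq s (a * be) M (fun n => A * Rr ^ n) f e); auto. intros n x Hx. apply Hfe. exact Hx.
  (* The exponent is independent of [a]: a power series with its constant term only. *)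
  - intros a0 _. exists 1. split; [lra|]. exists (fun n => match n with O => / be - 1 | S _ => 0 end).
    intros a _. apply (is_series_decr_1 (K := R_AbsRing) (V := R_NormedModule)).
    apply (is_series_ext (fun _ => 0)); [intros n; real_eq; ring|].
    match goal with |- is_series _ ?l => replace l with 0 by (unfold plus, opp; simpl; ring) end. exact is_series_0.
  - intros a0 Ha0.
    destruct (family_analytic s alpha be A Rr f Hs ltac:(lra) Hbe0 HA HR Hf a0) as [r Hr]; [|exists r; exact Hr].
    eapply Rle_trans; [apply Hsmall; exact Ha0|]. apply Rinv_le_contravar; lra.
Qed.
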